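(* Let $A$ be a dilation and $X$ a ball quasi-Banach function space with an absolutely continuous quasi-norm satisfying Assumption (FS) with $p_-\in(0,\infty)$ and Assumption (A) with $\theta_0\in(0,\min\{p_-,1\})$ and $p_0\in(\theta_0,\infty)$. Let $d\in\mathbb Z_+$ with $d\ge\lfloor(1/\theta_0-1)\ln b/\ln\lambda_-\rfloor$, let $q\in[1,\infty)$ if $p_0\in(0,1)$ or $q\in[1,p_0')$ if $p_0\in[1,\infty)$, and let $\varepsilon\in\left(\frac{\ln b}{\ln\lambda_-}\left[\frac2s+d\frac{\ln\lambda_+}{\ln b}\right],\infty\right)$ for some $s\in(0,\theta_0)$. Write $\beta:=\varepsilon\ln\lambda_-/\ln b$ and, for $f\in L^q_{\mathrm{loc}}(\mathbb R^n)$, $$\|f\|_{*}:=\sup\left\|\left\{\sum_{i\in\mathbb N}\left(\frac{\lambda_i}{\|\mathbf 1_{x_i+B_{l_i}}\|_X}\right)^{\theta_0}\mathbf 1_{x_i+B_{l_i}}\right\}^{1/\theta_0}\right\|_X^{-1}\sum_{j\in\mathbb N}\frac{\lambda_j|x_j+B_{l_j}|}{\|\mathbf 1_{x_j+B_{l_j}}\|_X}\int_{\mathbb R^n}\frac{b^{\beta l_j}|f(x)-P^d_{x_j+B_{l_j}}f(x)|}{b^{l_j(1+\beta)}+[\rho(x-x_j)]^{1+\beta}}\,dx,$$ the supremum taken over all $\{x_j\}_{j\in\mathbb N}\subset\mathbb R^n$, $\{l_j\}_{j\in\mathbb N}\subset\mathbb Z$ and $\{\lambda_j\}_{j\in\mathbb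 N}\subset[0,\infty)$ with $\sum_j\lambda_j\ne0$ such that $\left\|\left\{\sum_{j\in\mathbb N}\left(\frac{\lambda_j}{\|\mathbf 1_{x_j+B_{l_j}}\|_X}\right)^{\theta_0}\mathbf 1_{x_j+B_{l_j}}\right\}^{1/\theta_0}\right\|_X\in(0,\infty)$. Then, for $f\in L^q_{\mathrm{loc}}(\mathbb R^n)$, $f\in\mathcal L^A_{X,q,d,\theta_0}(\mathbb R^n)$ if and only if $\|f\|_*<\infty$, and $\|f\|_{\mathcal L^A_{X,q,d,\theta_0}(\mathbb R^n)}\sim\|f\|_*$ with positive equivalence constants independent of $f$.
   Context: A real $n\times n$ matrix $A$ is a dilation if all its eigenvalues have modulus $>1$; $b:=|\det A|$; fix $\lambda_-,\lambda_+$ with $1<\lambda_-<\min|\lambda|\le\max|\lambda|<\lambda_+$, over eigenvalues $\lambda$ of $A$. Fix an open ellipsoid $\Delta$ symmetric about $0$ with $|\Delta|=1$ and $r>1$ with $\Delta\subset r\Delta\subset A\Delta$; $B_k:=A^k\Delta$ (so $|B_k|=b^k$), $\mathcal B:=\{x+B_k:x\in\mathbb R^n,k\in\mathbb Z\}$; $\rho(x):=b^k$ if $x\in B_{k+1}\setminus B_k$, $\rho(0):=0$. $\mathcal M(f)(x):=\sup_{x\in B\in\mathcal B}|B|^{-1}\int_B|f|$, $\mathcal M^{(\alpha)}(f):=[\mathcal M(|f|^\alpha)]^{1/\alpha}$. Ball quasi-Banach function space: a quasi-normed space $X$ of measurable functions with quasi-norm defined on all measurable functions such that (i) $\|f\|_X=0\Rightarrow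 f=0$ a.e.; (ii) $|g|\le|f|$ a.e. $\Rightarrow\|g\|_X\le\|f\|_X$; (iii) $0\le f_m\uparrow f$ a.e. $\Rightarrow\|f_m\|_X\uparrow\|f\|_X$; (iv) $\mathbf 1_B\in X$ for $B\in\mathcal B$. Ball Banach function space: additionally the triangle inequality and $\int_B|f|\le C_B\|f\|_X$ for each $B\in\mathcal B$. $X^p:=\{f:|f|^p\in X\}$, $\|f\|_{X^p}:=\||f|^p\|_X^{1/p}$; for ball Banach $Y$, $\|f\|_{Y'}:=\sup\{\|fg\|_{L^1}:\|g\|_Y=1\}$, $Y'$ its finiteness set. Absolutely continuous quasi-norm: $\|f\mathbf 1_{E_j}\|_X\downarrow0$ for all $f\in X$ and measurable $E_j\downarrow\emptyset$. Assumption (FS) with $p_-$: for all $p\in(0,p_-)$, $u\in(1,\infty)$, $\|(\sum_k[\mathcal M(f_k)]^u)^{1/u}\|_{X^{1/p}}\le C\|(\sum_k|f_k|^u)^{1/u}\|_{X^{1/p}}$. Assumption (A) with $\theta_0,p_0$: $X^{1/\theta_0}$ is a ball Banach function space and $\mathcal M^{((p_0/\theta_0)')}$ is bounded on $(X^{1/\theta_0})'$. $P^d_Bg$ is the unique polynomial $P$ of degree $\le d$ with $\int_B(g-P)h=0$ for all polynomials $h$ of degree $\le d$. For $t\in[1,\infty)$, $\mathcal L^A_{X,t,d,\theta_0}(\mathbb R^n)$ is the set of $f\in L^t_{\mathrm{loc}}$ with $$\|f\|_{\mathcal L^A_{X,t,d,\theta_0}}:=\sup\left\|\left\{\sum_{i=1}^m\left[\frac{\lambda_i}{\|\mathbf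 1_{B^{(i)}}\|_X}\right]^{\theta_0}\mathbf 1_{B^{(i)}}\right\}^{1/\theta_0}\right\|_X^{-1}\sum_{j=1}^m\frac{\lambda_j|B^{(j)}|}{\|\mathbf 1_{B^{(j)}}\|_X}\left[\frac1{|B^{(j)}|}\int_{B^{(j)}}|f-P^d_{B^{(j)}}f|^t\right]^{1/t}<\infty$$ (sup over $m\in\mathbb N$, $B^{(j)}\in\mathcal B$, $\lambda_j\ge0$, $\sum_j\lambda_j\ne0$). *)

(* Defs.v *)
From HB Require Import structures.
From mathcomp Require Import all_boot all_order all_algebra.
From mathcomp Require Import all_classical all_reals all_analysis.
From mathcomp Require Import measurable_realfun.
From mathcomp Require Import complex.

Set Implicit Arguments.
Unset Strict Implicit.
Unset Printing Implicit Defensive.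

Import Order.TTheory GRing.Theory Num.Theory.
Import numFieldNormedType.Exports.

Local Open Scope classical_set_scope.
Local Open Scope ring_scope.

(* Lebesgue integral on R^n = 'cV[R]_n of a nonnegative extended-real       *)
(* function, as the iterated one-dimensional Lebesgue integral (Tonelli).   *)
(* It is only ever applied to nonnegative (Lebesgue) measurable functions.  *)
Fixpoint iint {R : realType} (n : nat) : ('cV[R]_n -> \bar R) -> \bar R :=
  match n with
  | 0 => fun f => f 0
  | k.+1 => fun f =>
      (\int[@lebesgue_measure R]_t iint (fun v : 'cV[R]_k => f (col_mx (t%:M) v)))%E
  end.

Section Defs.
Context {R : realType} {n : nat}.
Local Notation V := 'cV[R]_n.

Definition Rvol (E : set V) : \bar R := iint (fun x => (\1_E x)%:E).

Definition int_on (E : set V) (f : V -> \bar R) : \bar R :=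
  iint (fun x => ((\1_E x)%:E * f x)%E).

Definition sint_on (E : set V) (f : V -> R) : \bar R :=
  (int_on E (fun x => (Num.max (f x) 0)%:E) - int_on E (fun x => (Num.max (- f x) 0)%:E))%E.

Definition borel (E : set V) : Prop := <<s [set U : set V | open U] >> E.
Definition borel_fun (g : V -> \bar R) : Prop :=
  forall E : set (\bar R), measurable E -> borel (g @^-1` E).
Definition null_set (N : set V) : Prop := borel N /\ Rvol N = 0%E.
Definition ae (P : V -> Prop) : Prop :=
  exists N, null_set N /\ forall x, ~ N x -> P x.

(* Lebesgue measurable functions (= measurable w.r.t. the completion of the
   Borel sigma-algebra: a.e. equal to a Borel function) *)
Definition lmeas (f : V -> \bar R) : Prop :=
  exists g, borel_fun g /\ ae (fun x => f x = g x).
Definition lmeas_set (E : set V) : Prop := lmeas (fun x => (\1_E x)%:E).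
Definition lmeasR (f : V -> R) : Prop := lmeas (fun x => (f x)%:E).

Definition Lloc (t : R) (f : V -> R) : Prop :=
  lmeasR f /\ forall K : set V, compact K ->
    (int_on K (fun x => (`|f x| `^ t)%:E) < +oo)%E.

Definition cmx (A : 'M[R]_n) : 'M[R[i]]_n := map_mx (fun x : R => Complex x 0) A.

Definition dilation (A : 'M[R]_n) : Prop :=
  forall z : R[i], eigenvalue (cmx A) z -> 1 < `|z|.

Definition eig_bounds (A : 'M[R]_n) (lm lp : R) : Prop :=
  1 < lm /\ forall z : R[i], eigenvalue (cmx A) z ->
    Complex lm 0 < `|z| /\ `|z| < Complex lp 0.

Definition ellipsoid0 (D : set V) : Prop :=
  exists P : 'M[R]_n, P \in unitmx /\
    D = [set x | \sum_(i < n) ((P *m x) i 0) ^+ 2 < 1].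

Definition Apow (A : 'M[R]_n) (k : int) : 'M[R]_n :=
  match k with Posz m => A ^+ m | Negz m => (invmx A) ^+ m.+1 end.

Definition Bk (A : 'M[R]_n) (D : set V) (k : int) : set V :=
  [set Apow A k *m y | y in D].

Definition dball (A : 'M[R]_n) (D : set V) (x : V) (k : int) : set V :=
  [set x + y | y in Bk A D k].

Definition is_dball (A : 'M[R]_n) (D : set V) (B : set V) : Prop :=
  exists (x : V) (k : int), B = dball A D x k.

Definition rho (A : 'M[R]_n) (D : set V) (x : V) : R :=
  if x == 0 then 0
  else `|\det A| ^ (xget 0%R [set k : int | Bk A D (k + 1) x /\ ~ Bk A D k x]).

Definition avg (B : set V) (f : V -> \bar R) : \bar R :=
  (((fine (Rvol B))^-1)%:E * int_on B f)%E.

Definition maxf (A : 'M[R]_n) (D : set V) (f : V -> \bar R) (x : V) : \bar R :=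
  ereal_sup [set avg B (fun y => `|f y|%E) | B in [set B | is_dball A D B /\ B x]].

Definition maxfp (A : 'M[R]_n) (D : set V) (alpha : R) (f : V -> \bar R) (x : V)
  : \bar R :=
  (maxf A D (fun y => `|f y| `^ alpha) x `^ alpha^-1)%E.

(* A quasi-norm is given as a functional nX on all (extended-real valued)
   functions; X = {f measurable : nX f < +oo}. *)
Definition ball_QBFS (A : 'M[R]_n) (D : set V) (nX : (V -> \bar R) -> \bar R)
  : Prop :=
  (forall f, lmeas f -> (0 <= nX f)%E) /\
  (forall f (c : R), lmeas f -> (nX f < +oo)%E ->
     nX (fun x => (c%:E * f x)%E) = (`|c|%:E * nX f)%E) /\
  (exists K : R, 1 <= K /\ forall f g, lmeas f -> lmeas g ->
     (nX f < +oo)%E -> (nX g < +oo)%E ->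
     (nX (fun x => (f x + g x)%E) <= K%:E * (nX f + nX g))%E) /\
  (forall f, lmeas f -> nX f = 0%E -> ae (fun x => f x = 0%E)) /\
  (forall f g, lmeas f -> lmeas g -> ae (fun x => (`|g x| <= `|f x|)%E) ->
     (nX g <= nX f)%E) /\
  (forall (F : nat -> V -> \bar R) f, (forall m, lmeas (F m)) -> lmeas f ->
     (forall m, ae (fun x => (0 <= F m x)%E /\ (F m x <= F m.+1 x)%E)) ->
     ae (fun x => F ^~ x @ \oo --> f x) ->
     (fun m => nX (F m)) @ \oo --> nX f) /\
  (forall B, is_dball A D B -> (nX (fun x => (\1_B x)%:E) < +oo)%E).

Definition ball_BFS (A : 'M[R]_n) (D : set V) (nX : (V -> \bar R) -> \bar R)
  : Prop :=
  ball_QBFS A D nX /\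
  (forall f g, lmeas f -> lmeas g ->
     (nX (fun x => (f x + g x)%E) <= nX f + nX g)%E) /\
  (forall B, is_dball A D B -> exists CB : R, 0 < CB /\
     forall f, lmeas f -> (int_on B (fun x => `|f x|%E) <= CB%:E * nX f)%E).

Definition abs_cont (nX : (V -> \bar R) -> \bar R) : Prop :=
  forall f, lmeas f -> (nX f < +oo)%E ->
  forall E : nat -> set V, (forall j, lmeas_set (E j)) ->
    (forall j, E j.+1 `<=` E j) -> \bigcap_j E j = set0 ->
    (fun j => nX (fun x => ((\1_(E j) x)%:E * f x)%E)) @ \oo --> 0%E.

Definition Xpow (nX : (V -> \bar R) -> \bar R) (p : R) (f : V -> \bar R) : \bar R :=
  (nX (fun x => `|f x| `^ p) `^ p^-1)%E.

Definition assoc (nY : (V -> \bar R) -> \bar R) (f : V -> \bar R) : \bar R :=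
  ereal_sup [set iint (fun x => `|f x * g x|%E) | g in [set g | lmeas g /\ nY g = 1%E]].

Definition assumption_FS (A : 'M[R]_n) (D : set V) (nX : (V -> \bar R) -> \bar R)
  (pm : R) : Prop :=
  forall p u : R, 0 < p -> p < pm -> 1 < u ->
  exists C : R, 0 < C /\
  forall F : nat -> V -> R, (forall k, Lloc 1 (F k)) ->
    (Xpow nX p^-1
       (fun x => (\sum_(k <oo) (maxf A D (fun y => (F k y)%:E) x `^ u)) `^ u^-1)
     <= C%:E * Xpow nX p^-1
       (fun x => (\sum_(k <oo) (`|F k x|%:E `^ u)) `^ u^-1))%E.

Definition conjR (r : R) : R := r / (r - 1).

Definition assumption_A (A : 'M[R]_n) (D : set V) (nX : (V -> \bar R) -> \bar R)
  (th p0 : R) : Prop :=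
  ball_BFS A D (Xpow nX th^-1) /\
  exists C : R, 0 < C /\
    forall f, lmeas f -> (assoc (Xpow nX th^-1) f < +oo)%E ->
      (assoc (Xpow nX th^-1) (maxfp A D (conjR (p0 / th)) f)
        <= C%:E * assoc (Xpow nX th^-1) f)%E.

Definition mono (d : nat) (a : {ffun 'I_n -> 'I_d.+1}) (x : V) : R :=
  \prod_(i < n) (x i 0) ^+ (a i).

Definition is_polyd (d : nat) (P : V -> R) : Prop :=
  exists c : {ffun 'I_n -> 'I_d.+1} -> R, forall x,
    P x = \sum_(a : {ffun 'I_n -> 'I_d.+1} | (\sum_(i < n) (a i : nat) <= d)%N)
            c a * mono a x.

Definition projP (d : nat) (B : set V) (g : V -> R) : V -> R :=
  xget (fun _ => 0) [set P | is_polyd d P /\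
    forall h, is_polyd d h -> sint_on B (fun x => (g x - P x) * h x) = 0%E].

Definition nind (nX : (V -> \bar R) -> \bar R) (B : set V) : R :=
  fine (nX (fun x => (\1_B x)%:E)).

Definition fin_Xnorm (nX : (V -> \bar R) -> \bar R) (th : R) (m : nat)
  (B : nat -> set V) (lam : nat -> R) : \bar R :=
  nX (fun x => ((\sum_(i < m) ((lam i / nind nX (B i)) `^ th * \1_(B i) x)) `^ th^-1)%:E).

Definition inf_Xnorm (nX : (V -> \bar R) -> \bar R) (th : R)
  (B : nat -> set V) (lam : nat -> R) : \bar R :=
  nX (fun x => ((\sum_(i <oo) ((lam i / nind nX (B i)) `^ th * \1_(B i) x)%:E) `^ th^-1)%E).

Definition campanato (A : 'M[R]_n) (D : set V) (nX : (V -> \bar R) -> \bar R)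
  (t : R) (d : nat) (th : R) (f : V -> R) : \bar R :=
  ereal_sup [set v | exists (m : nat) (xc : nat -> V) (l : nat -> int) (lam : nat -> R),
    let B := fun j => dball A D (xc j) (l j) in
    (forall i, 0 <= lam i) /\ \sum_(i < m) lam i != 0 /\
    v = (((fine (fin_Xnorm nX th m B lam))^-1)%:E *
         \sum_(j < m) ((lam j * fine (Rvol (B j)) / nind nX (B j))%:E *
            (avg (B j) (fun x => (`|f x - projP d (B j) f x| `^ t)%:E) `^ t^-1)))%E].

Definition star_norm (A : 'M[R]_n) (D : set V) (nX : (V -> \bar R) -> \bar R)
  (d : nat) (th eps lm : R) (f : V -> R) : \bar R :=
  let b := `|\det A| in
  let beta := eps * ln lm / ln b in
  ereal_sup [set v | exists (xc : nat -> V) (l : nat -> int) (lam : nat -> R),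
    let B := fun j => dball A D (xc j) (l j) in
    (forall i, 0 <= lam i) /\ (\sum_(i <oo) (lam i)%:E != 0)%E /\
    (0 < inf_Xnorm nX th B lam)%E /\ (inf_Xnorm nX th B lam < +oo)%E /\
    v = (((fine (inf_Xnorm nX th B lam))^-1)%:E *
         \sum_(j <oo) ((lam j * fine (Rvol (B j)) / nind nX (B j))%:E *
            iint (fun x => ((b `^ (beta * (l j)%:~R) * `|f x - projP d (B j) f x|)
                   / (b `^ ((l j)%:~R * (1 + beta)) + rho A D (x - xc j) `^ (1 + beta)))%:E)))%E].

End Defs.

(* Main.v *)
(* Both functionals are compared with the single inequality
     (1)  sum_k c_k int_{B_k} |f - P_{B_k} f| <= Phi || (sum_k c_k^theta 1_{B_k})^{1/theta} ||_X
   over finite families of balls (camp_le). It follows from finiteness of the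
   Campanato norm by Hoelder's inequality, and from finiteness of the star norm because
   b^l times the kernel is at least 1/2 on x + B_l.

   (1) bounds the star norm: the integral is split over the annuli of x + B_l, the polynomials of
   successive dilates are telescoped, and Assumption (FS), applied to indicators, replaces the dilated
   balls by the original ones.

   (1) bounds the Campanato norm: for q = 1 this is immediate. For q > 1 one writes
   (avg_B |f - P_B f|^q)^{1/q} as the pairing of |f - P_B f| with g = w^{1/q'}, where w has mean 1
   on B, and builds Whitney coverings of the level sets {M w > 2^{m q'}}. Telescoping P along these
   coverings bounds the pairing by sum_m 2^m times oscillations as in (1) over Whitney balls. The
   resulting sums of indicators of Whitney cores are brought back to 1_B by duality in X^{1/theta}:
   the maximal operator of Assumption (A) acts on the test function, and the level sets decay
   fast enough because q' > p_0. Duality itself (a Lorentz-Luxemburg theorem) is obtained by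
   projecting in L^2 onto the unit ball of X^{1/theta}. *)
Require Import Defs.
From HB Require Import structures.
From mathcomp Require Import all_boot all_order all_algebra.
From mathcomp Require Import all_classical all_reals all_analysis.
From mathcomp Require Import measurable_realfun.
From mathcomp Require Import complex.
From mathcomp Require Import ring lra zify.

Set Implicit Arguments.
Unset Strict Implicit.
Unset Printing Implicit Defensive.

Import Order.TTheory GRing.Theory Num.Theory.
Import numFieldNormedType.Exports.
Local Open Scope classical_set_scope.
Local Open Scope ring_scope.

(** The quasi-norm of X has no usable triangle inequality, so estimates for single balls cannot be
    summed in X: every bound is proved for a whole weighted family at once, and linearity is
    available only in X^{1/theta}. This is why coefficients enter right-hand sides as c^theta. The
    condition on epsilon is used through two consequences: lp^d < b^beta, so that the kernel
    outweighs polynomial growth under dilation, and 2 < theta (1 + beta), which pays for the squared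
    volume ratio b^2 that (FS) with u = 2 charges per dilation. For q > 1 the tower has base 2^{q'},
    so that g has size 2^m at level m. A level set of relative volume 2^{-m q'} contributes 2^{-m q'
    theta / p_0} after a Hoelder inequality of exponent (p_0/theta)', against weights 2^{m theta}.
    As (1) concerns finite families only, sums over annuli, Whitney cores and levels are first
    truncated; monotone convergence removes the truncation. A locally integrable f is only Lebesgue
    measurable while [iint] is an iterated integral, so f is replaced by a Borel representative and
    null sets are carried through [iint] by induction on the dimension. *)

(* Column vectors carry no measurable structure in the library: cvM is R^n with the Borel
   sigma-algebra. *)
Definition cvM (R : realType) (n : nat) := g_sigma_algebraType (@open 'cV[R]_n).

(** * The Borel structure of R^n *)

Section Borel.
Context {R : realType} {n : nat}.

Lemma open_measurable_cV (U : set (cvM R n)) : @open 'cV[R]_n U -> measurable U.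
Proof. by move=> oU; exact: sub_sigma_algebra. Qed.

(** Balls with rational centres and radii 1/(m+1) form a countable base; this is what reduces
    measurability into R^n to the coordinates. *)
Lemma open_bigcup_rat_ball (U : set 'cV[R]_n) : open U ->
  U = \bigcup_(p in [set p : 'cV[rat]_n * nat |
        ball (map_mx ratr p.1 : 'cV[R]_n) (p.2.+1%:R^-1) `<=` U])
      ball (map_mx ratr p.1 : 'cV[R]_n) (p.2.+1%:R^-1).
Proof.
move=> oU; apply/seteqP; split => [x Ux|x [p /= pU px]]; last exact: pU.
have /nbhs_ballP[e /= e0 exU] : nbhs x U by exact: open_nbhs_nbhs.
have [m me] : exists m : nat, m.+1%:R^-1 < e / 2.
  exists (Num.truncn ((e / 2)^-1)).
  rewrite invf_plt ?posrE ?divr_gt0 ?ltr0n//; exact: truncnS_gt.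
have Hq i : exists q : rat, `|ratr q - x i 0| < m.+1%:R^-1.
  have m0 : 0 < m.+1%:R^-1 :> R by rewrite invr_gt0 ltr0n.
  have xm : x i 0 - m.+1%:R^-1 < x i 0 + m.+1%:R^-1.
    by rewrite ltrBlDr -addrA ltrDl addr_gt0.
  have [q] := rat_in_itvoo xm.
  by rewrite in_itv/= => /andP[q1 q2]; exists q; rewrite ltr_norml ltrBlDl ltrBrDl q1 q2.
have {Hq}[q qP] := choice Hq.
have bx : ball (map_mx ratr (\col_i q i) : 'cV[R]_n) (m.+1%:R^-1) x.
  split; first by rewrite invr_gt0 ltr0n.
  by move=> i j; rewrite ord1 !mxE; exact: qP.
exists (\col_i q i, m) => //= y by_; apply: exU.
have := ball_sym bx => /ball_triangle /(_ by_) xy.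
by apply: le_ball xy; move: me; set u := _^-1 => me; lra.
Qed.

(** A ball of the sup norm is a finite intersection of conditions on single coordinates, and
    countably many such balls make up any open set. *)
Lemma measurable_fun_cV d (T : measurableType d) (f : T -> cvM R n) :
  (forall i, measurable_fun setT (fun x => (f x : 'cV[R]_n) i 0)) ->
  measurable_fun setT f.
Proof.
move=> mf; apply: (@measurability _ _ T (cvM R n) setT f (@open 'cV[R]_n)) => // _ [U oU <-].
rewrite setTI (open_bigcup_rat_ball (oU : @open 'cV[R]_n U)) preimage_bigcup.
rewrite bigcup_mkcond; apply: countable_bigcupT_measurable => [|[q m]].
  exact: countableP.
case: ifPn => // _ /=.
rewrite (_ : _ @^-1` _ =
  \bigcap_(i in [set: 'I_n]) ((fun x => (f x : 'cV[R]_n) i 0) @^-1` ball (ratr (q i 0) : R) (m.+1%:R^-1))).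
  apply: fin_bigcap_measurable; first exact: finite_finset.
  move=> i _; rewrite -[X in measurable X]setTI; apply: mf => //.
  by apply: open_measurable; exact: ball_open.
apply/seteqP; split => x /=.
  by move=> [_ Hx] i _ /=; have := Hx i 0; rewrite mxE.
move=> Hx; split; first by rewrite invr_gt0 ltr0n.
by move=> i j; rewrite ord1 mxE; have := Hx i I => /=.
Qed.

Lemma measurable_coord (i : 'I_n) :
  measurable_fun setT (fun x : cvM R n => (x : 'cV[R]_n) i 0).
Proof.
apply: (measurability _ (measurable_realfun.RGenOpens.measurableE R)) => _ [U oU <-].
rewrite setTI; apply: open_measurable_cV.
have [x [y ->]] := oU.
by apply: open_comp; [move=> ? _; exact: coord_continuous|exact: interval_open].
Qed.

End Borel.

(** * Lebesgue measure on R^n and the iterated integral *)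

Section Lebesgue.
Context {R : realType}.

Definition cons_cV (n : nat) (p : measurableTypeR R * cvM R n) : cvM R n.+1 :=
  col_mx (p.1 : R)%:M (p.2 : 'cV[R]_n).

Lemma measurable_cons_cV (n : nat) : measurable_fun setT (@cons_cV n).
Proof.
apply: measurable_fun_cV => i.
rewrite (_ : (fun _ => _) = fun p : (measurableTypeR R * cvM R n)%type =>
    match @fintype.split 1 n i with inl _ => p.1 | inr k => (p.2 : 'cV[R]_n) k 0 end).
  case: (@fintype.split 1 n i) => [_|k]; first exact: measurable_fst.
  by apply: (measurableT_comp (@measurable_coord R n k)); exact: measurable_snd.
apply/funext => p; rewrite mxE; case: fintype.split => // a; rewrite mxE.
by rewrite (ord1 a) eqxx.
Qed.

Lemma measurable_cons_cV1 (n : nat) (t : R) :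
  measurable_fun setT (fun v : cvM R n => cons_cV ((t : measurableTypeR R), v)).
Proof. by apply: (measurableT_comp (@measurable_cons_cV n)); exact: measurable_pair1. Qed.

Lemma sigma_finite_measure_of d (T : measurableType d) (m : set T -> \bar R) :
  m set0 = 0%E -> (forall A, (0 <= m A)%E) -> semi_sigma_additive m ->
  sigma_finite setT m ->
  exists mu : {sigma_finite_measure set T -> \bar R}, forall A, mu A = m A.
Proof.
move=> m0 m_ge0 madd msf.
pose mM := isMeasure.Build _ _ _ m m0 m_ge0 madd.
pose mu1 : {measure set T -> \bar R} := HB.pack m mM.
pose mS := Measure_isSigmaFinite.Build _ _ _ mu1 msf.
pose mu' : {sigma_finite_measure set T -> \bar R} := HB.pack (Measure.sort mu1) mS.
by exists mu'.
Qed.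

(** By induction, the measure on R^(n+1) is the image of the product of [lebesgue_measure] with the
    previous one under the Borel isomorphism [cons_cV], and Tonelli identifies its integral with
    [iint]. The inverse [psi] carries sigma-finiteness over. In dimension 0 the measure is a Dirac
    mass. *)
Lemma iint_measure_exists (n : nat) :
  exists mu : {sigma_finite_measure set (cvM R n) -> \bar R},
  forall f : cvM R n -> \bar R, measurable_fun setT f -> (forall x, (0 <= f x)%E) ->
    iint f = (\int[mu]_x f x)%E.
Proof.
elim: n => [|n [mu IH]].
  exists (\d_ (0 : cvM R 0)) => f mf f0 /=.
  by rewrite integral_dirac// diracT mul1e.
have mc := @measurable_cons_cV n.
pose phi := @cons_cV n.
pose psi := fun x : cvM R n.+1 => ((x : 'cV[R]_n.+1) 0 0 : measurableTypeR R, (@dsubmx _ 1 n 1 x : cvM R n)).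
have mpsi : measurable_fun setT psi.
  apply/measurable_fun_pairP; split; first exact: measurable_coord.
  apply: measurable_fun_cV => i.
  under [X in measurable_fun _ X]eq_fun do rewrite /= mxE.
  exact: measurable_coord.
have psiK : cancel phi psi.
  move=> [t v]; rewrite /psi /phi /cons_cV /= col_mxKd; congr pair.
  rewrite (_ : _ 0 0 = col_mx t%:M v (lshift n 0) 0); last by congr (col_mx _ _ _ _); exact: val_inj.
  by rewrite col_mxEu mxE eqxx.
have phiK : cancel psi phi.
  move=> x; apply/matrixP => i j; rewrite (ord1 j) /phi /psi /cons_cV mxE.
  case: (@fintype.splitP 1 n i) => k ik; rewrite mxE.
    have -> : i = 0 by apply: val_inj; rewrite /= ik (ord1 k).
    by rewrite (ord1 k) eqxx mulr1n.
  by congr (x _ _); apply: val_inj.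
pose m := pushforward (@lebesgue_measure R \x mu)%E (phi : _ -> cvM R n.+1).
have m0 : m set0 = 0%E by rewrite /m /pushforward preimage_set0 measure0.
have m_ge0 A : (0 <= m A)%E by rewrite /m /pushforward measure_ge0.
have madd : semi_sigma_additive m.
  move=> F mF tF mUF; rewrite /m /pushforward preimage_bigcup.
  apply: measure_semi_sigma_additive.
  - by move=> k; rewrite -[X in measurable X]setTI; exact: mc.
  - apply/trivIsetP => i j _ _ ij; rewrite -preimage_setI.
    by move/trivIsetP : tF => ->//; rewrite preimage_set0.
  - by rewrite -preimage_bigcup -[X in measurable X]setTI; exact: mc.
have msf : sigma_finite setT m.
  have /sigma_finiteP[F [FT ndF Foo]] := sigma_finiteT (@lebesgue_measure R).
  have /sigma_finiteP[G [GT ndG Goo]] := sigma_finiteT mu.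
  exists (fun k => psi @^-1` (F k `*` G k)).
    rewrite -preimage_bigcup -(preimage_setT psi); congr (_ @^-1` _).
    rewrite -setXTT FT GT predeqE => -[x y]; split => [|[k _ []/= ? ?]]; last by split; exists k.
    move=> [/= [i _ Fx] [k _ Gy]]; exists (maxn i k) => //; split.
      by move: x Fx; exact/subsetPset/ndF/leq_maxl.
    by move: y Gy; exact/subsetPset/ndG/leq_maxr.
  move=> k; have [? ?] := Foo k; have [? ?] := Goo k; split.
    by rewrite -[X in measurable X]setTI; apply: mpsi => //; exact: measurableX.
  rewrite /m /pushforward -comp_preimage.
  rewrite (_ : psi \o phi = id) ?preimage_id; last by apply/funext => p /=; rewrite psiK.
  by rewrite product_measure1E// lte_mul_pinfty// ge0_fin_numE.
have [mu' mu'E] := sigma_finite_measure_of m0 m_ge0 madd msf.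
exists mu' => f mf f0.
transitivity (\int[pushforward (@lebesgue_measure R \x mu)%E phi]_x f x)%E; last first.
  by apply: eq_measure_integral => A mA _; exact/esym/mu'E.
rewrite ge0_integral_pushforward//= preimage_setT.
rewrite fubini_tonelli1//; last exact: measurableT_comp.
apply: eq_integral => t _ /=; rewrite IH//.
apply: (measurableT_comp mf).
exact: measurable_cons_cV1.
Qed.

Definition vol (n : nat) : {sigma_finite_measure set (cvM R n) -> \bar R} :=
  sval (cid (iint_measure_exists n)).

Lemma iintE (n : nat) (f : cvM R n -> \bar R) : measurable_fun setT f ->
  (forall x, (0 <= f x)%E) -> iint f = (\int[vol n]_x f x)%E.
Proof. by move=> mf f0; rewrite /vol; case: cid => mu /= ->. Qed.

Lemma RvolE (n : nat) (E : set (cvM R n)) : measurable E -> Rvol E = vol n E.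
Proof.
move=> mE; rewrite /Rvol iintE ?integral_indic ?setIT//.
by apply/measurable_EFinP; exact: measurable_indic.
Qed.

Import HBNNSimple.

(** [f] carries no measurability, but its integral is still the supremum over simple functions below
    it. Such functions lie below [g] almost everywhere, which gives one inequality; for the other,
    simple functions below [g] cut to the complement of [N] lie below [f] everywhere because [f] is
    nonnegative. *)
Lemma ge0_integral_eq_off_null d (T : measurableType d) (mu : {measure set T -> \bar R})
    (f g : T -> \bar R) (N : set T) :
  measurable N -> mu N = 0%E -> measurable_fun setT g -> (forall x, (0 <= g x)%E) ->
  (forall x, (0 <= f x)%E) ->
  (forall x, ~ N x -> f x = g x) -> (\int[mu]_x f x = \int[mu]_x g x)%E.
Proof.
move=> mN N0 mg g0 f0 fg.
have mNC : measurable (~` N) by exact: measurableC.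
apply/eqP; rewrite eq_le; apply/andP; split.
  rewrite ge0_integralTE//; apply: ge_ereal_sup => _ [h /= hf <-].
  rewrite -integralT_nnsfun.
  apply: ae_ge0_le_integral => //.
  - by move=> x _; rewrite lee_fin.
  - exact/measurable_EFinP.
  - exists N; split => // x /= /not_implyP[_ hg].
    by apply: contrapT => Nx; apply: hg; rewrite -fg.
have -> : (\int[mu]_x g x = \int[mu]_x (g \_ (~` N)) x)%E.
  rewrite -integral_mkcond; rewrite [RHS]integral_mkcond.
  apply: ge0_ae_eq_integral => //.
  - by apply/(measurable_restrictT _ mNC); exact: measurable_funTS.
  - by move=> x _; rewrite patchE; case: ifP.
  - exists N; split => // x /= /not_implyP[_ hg].
    by apply: contrapT => Nx; apply: hg; rewrite patchE mem_set.
rewrite ge0_integralTE; last by move=> x; rewrite patchE; case: ifP.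
apply: ge_ereal_sup => _ [h /= hf <-].
rewrite ge0_integralTE//; apply: ereal_sup_ubound; exists h => //= x.
apply: (le_trans (hf x)); rewrite patchE; case: ifPn => //.
by rewrite in_setC => xN; rewrite fg//; move: xN; rewrite notin_setE.
Qed.

Lemma integral_eq_off_null d (T : measurableType d) (mu : {measure set T -> \bar R})
    (f g : T -> \bar R) (N : set T) :
  measurable N -> mu N = 0%E -> measurable_fun setT g -> (forall x, (0 <= g x)%E) ->
  (forall x, ~ N x -> f x = g x) -> (\int[mu]_x f x = \int[mu]_x g x)%E.
Proof.
move=> mN N0 mg g0 fg; rewrite integralE.
rewrite (@ge0_integral_eq_off_null _ _ mu f^\+%E g N)//; last first.
  by move=> x Nx; rewrite funeposE fg// max_l.
rewrite (@ge0_integral_eq_off_null _ _ mu f^\-%E (cst 0%E) N)//; last first.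
  by move=> x Nx; rewrite funenegE fg// max_r// leeNl oppe0.
by rewrite integral0 sube0.
Qed.

(** By Tonelli almost every section of [N] is null, and for those parameters the inner integrals
    agree by induction. The inner integral of [f] may fail to be measurable in the outer variable,
    hence the preceding lemmas without measurability of [f]. In dimension 0 a null set misses the
    only point. *)
Lemma iint_eq_off_null (n : nat) (f g : cvM R n -> \bar R) (N : set (cvM R n)) :
  measurable N -> vol n N = 0%E -> measurable_fun setT g -> (forall x, (0 <= g x)%E) ->
  (forall x, ~ N x -> f x = g x) -> iint f = iint g.
Proof.
elim: n f g N => [|n IH] f g N mN N0 mg g0 fg.
  move: N0; rewrite -RvolE// /Rvol /= => -[]; rewrite indicE.
  by case: (boolP (0 \in N)) => [_ /eqP|]; rewrite ?oner_eq0// notin_setE => /fg.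
have mc := @measurable_cons_cV1 n.
pose Nt (t : R) : set (cvM R n) := (fun v => cons_cV ((t : measurableTypeR R), v)) @^-1` N.
have mNt t : measurable (Nt t) by rewrite -[X in measurable X]setTI; exact: mc.
pose F (h : cvM R n.+1 -> \bar R) := h \o (@cons_cV n).
have mF h : measurable_fun setT h -> measurable_fun setT (F h).
  by move=> mh; exact: (measurableT_comp mh (@measurable_cons_cV n)).
have mI h : measurable_fun setT h -> (forall x, (0 <= h x)%E) -> measurable_fun setT
    (fun t : measurableTypeR R => iint (fun v : 'cV[R]_n => h (cons_cV (t, v)))).
  move=> mh h0.
  rewrite (_ : (fun _ => _) = fubini_F (vol n) (F h)).
    by apply: measurable_fun_fubini_tonelli_F => [|x]; [exact: mF|exact: h0].
  apply/funext => t; rewrite iintE//; exact: measurableT_comp.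
have mN1 : measurable_fun setT (fun x : cvM R n.+1 => (\1_N x)%:E : \bar R).
  by apply/measurable_EFinP; exact: measurable_indic.
have mIN := mI _ mN1 (fun x => ltac:(by rewrite lee_fin)).
pose M := [set t : measurableTypeR R | vol n (Nt t) != 0%E].
have NtE : (fun t : measurableTypeR R => vol n (Nt t)) =
    fun t : measurableTypeR R => iint (fun v : 'cV[R]_n => (\1_N (cons_cV (t, v)))%:E).
  by apply/funext => t; rewrite -RvolE.
have mvol : measurable_fun setT (fun t : measurableTypeR R => vol n (Nt t)) by rewrite NtE.
have mM : measurable M.
  rewrite -[M]setTI; exact: emeasurable_neq.
have M0 : @lebesgue_measure R M = 0%E.
  have : (\int[@lebesgue_measure R]_t `|vol n (Nt t)| = 0)%E.
    under eq_integral do rewrite gee0_abs//.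
    by rewrite NtE; move: N0; rewrite -RvolE.
  move=> /(ae_eq_integral_abs _ measurableT mvol)[Z [mZ Z0 MZ]].
  apply: (subset_measure0 mM mZ _ Z0) => t /= Mt; apply: MZ => /= /(_ I) /eqP.
  by rewrite (negbTE Mt).
rewrite /=; apply: (integral_eq_off_null mM M0) => //.
- exact: mI.
- by move=> t; rewrite iintE//; [exact: integral_ge0|exact: (measurableT_comp mg (mc t))].
move=> t /= /negP; rewrite negbK => /eqP Nt0.
apply: (IH _ _ (Nt t)) => //; first exact: (measurableT_comp mg (mc t)).
by move=> v Nv; rewrite fg.
Qed.

End Lebesgue.

(** * Linear change of variables *)

Section ChangeOfVariables.
Context {R : realType}.
Local Notation leb := (@lebesgue_measure R).

(** Uniqueness of Lebesgue measure on half-open intervals, applied to |a| times its image under the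
    affine map; for negative [a] the closed end of the interval changes side. *)
Lemma integral_lebesgue_affine (a c : R) (f : measurableTypeR R -> \bar R) : a != 0 ->
  measurable_fun setT f -> (forall x, (0 <= f x)%E) ->
  (\int[leb]_t f (a * t + c)%R = (`|a|^-1)%:E * \int[leb]_t f t)%E.
Proof.
move=> a0 mf f0.
pose phi (t : measurableTypeR R) : measurableTypeR R := (a * t + c)%R.
have mphi : measurable_fun setT phi.
  by apply: measurable_funD => //; exact: measurable_funM.
have na : (0 < `|a|)%R by rewrite normr_gt0.
pose m := mscale (NngNum (ltW na)) (pushforward leb phi).
have mE A : measurable A -> leb A = m mphi A.
  apply: lebesgue_measure_unique => _ [[x y] _ <-].
  rewrite lebesgue_measure_itv/= /m /mscale /= /pushforward.
  case: (ltP x y) => xy; rewrite ?lte_fin ?xy/=; last first.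
    rewrite ltNge xy/= set_itv_ge ?preimage_set0 ?measure0 ?mule0//.
    by rewrite bnd_simp -leNgt.
  have [a_gt0|a_lt0] : 0 < a \/ a < 0 by case: (ltgtP 0 a) a0 => //; [left|right].
    rewrite (_ : _ @^-1` _ = `]((x - c) / a), ((y - c) / a)]%classic).
      rewrite lebesgue_measure_itv/= lte_fin ltr_pM2r ?invr_gt0// ltrD2r xy.
      rewrite -EFinB -EFinM gtr0_norm//; congr EFin; field.
      exact: lt0r_neq0.
    apply/seteqP; split => t /=; rewrite /phi !in_itv/= ltr_pdivrMr// ler_pdivlMr// ltrBlDr lerBrDr mulrC//.
  rewrite (_ : _ @^-1` _ = `[((y - c) / a), ((x - c) / a)[%classic).
    rewrite lebesgue_measure_itv/= lte_fin ltr_nM2r ?invr_lt0// ltrD2r xy.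
    rewrite -EFinB -EFinM ltr0_norm//; congr EFin; field.
    exact: ltr0_neq0.
  apply/seteqP; split => t /=; rewrite /phi !in_itv/= ler_ndivrMr// ltr_ndivlMr// ltrBlDr lerBrDr mulrC andbC//.
have -> : (\int[leb]_t f t = \int[m mphi]_t f t)%E.
  by apply: eq_measure_integral => A mA _; exact: mE.
rewrite /m ge0_integral_mscale//= ge0_integral_pushforward//= preimage_setT.
by rewrite muleA -EFinM mulVf ?mul1e// normr_eq0.
Qed.

Lemma integral_vol_cons (n : nat) (f : cvM R n.+1 -> \bar R) :
  measurable_fun setT f -> (forall x, (0 <= f x)%E) ->
  (\int[@vol R n.+1]_x f x =
   \int[leb]_t \int[@vol R n]_v f (cons_cV ((t : measurableTypeR R), v)))%E.
Proof.
move=> mf f0; rewrite -iintE//=; apply: eq_integral => t _; rewrite -iintE//.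
by apply: (measurableT_comp mf); exact: measurable_cons_cV1.
Qed.

Lemma integral_vol_cons_swap (n : nat) (f : cvM R n.+1 -> \bar R) :
  measurable_fun setT f -> (forall x, (0 <= f x)%E) ->
  (\int[@vol R n.+1]_x f x =
   \int[@vol R n]_v \int[leb]_t f (cons_cV ((t : measurableTypeR R), v)))%E.
Proof.
move=> mf f0; rewrite integral_vol_cons//.
rewrite (fubini_tonelli (f \o (@cons_cV R n)))//; last by move=> ?; exact: f0.
exact: (measurableT_comp mf (@measurable_cons_cV R n)).
Qed.

(** The translation [c] is quantified so that the off-diagonal block of a triangular factor, which
    is a shift once the other variable is frozen, can be absorbed. *)
Definition scales_vol (n : nat) (M : 'M[R]_n) := forall (c : 'cV[R]_n) (f : cvM R n -> \bar R),
  measurable_fun setT f -> (forall x, (0 <= f x)%E) ->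
  (\int[@vol R n]_x f (M *m x + c)%R = (`|\det M|^-1)%:E * \int[@vol R n]_x f x)%E.

Lemma measurable_affine (m n : nat) (M : 'M[R]_(m, n)) (c : 'cV[R]_m) :
  measurable_fun setT (fun x : cvM R n => M *m (x : 'cV[R]_n) + c : cvM R m).
Proof.
apply: measurable_fun_cV => i.
rewrite (_ : (fun _ => _) = fun x : cvM R n => (\sum_j M i j * (x : 'cV[R]_n) j 0 + c i 0)%R).
  apply: measurable_funD => //; apply: measurable_sum => j.
  by apply: measurable_funM => //; exact: measurable_coord.
by apply/funext => x; rewrite !mxE.
Qed.

Lemma scales_volM (n : nat) (M N : 'M[R]_n) :
  scales_vol M -> scales_vol N -> scales_vol (M *m N).
Proof.
move=> hM hN c f mf f0.
have mg : measurable_fun setT (fun y : cvM R n => f (M *m (y : 'cV[R]_n) + c)).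
  by apply: (measurableT_comp mf); exact: measurable_affine.
have := hN 0 _ mg (fun=> f0 _).
under eq_integral do rewrite addr0 mulmxA.
by move=> ->; rewrite hM// muleA -EFinM det_mulmx normrM invfM mulrC.
Qed.

Lemma block_cons (n : nat) (a : R) (u : 'rV[R]_n) (w : 'cV[R]_n) (L : 'M[R]_n)
    (t : R) (v c : 'cV[R]_n) (c0 : R) :
  block_mx a%:M u w L *m cons_cV ((t : measurableTypeR R), (v : cvM R n)) +
    (cons_cV ((c0 : measurableTypeR R), (c : cvM R n))) =
  cons_cV ((a * t + ((u *m v) 0 0 + c0) : measurableTypeR R), (L *m v + (t *: w + c) : cvM R n)).
Proof.
rewrite /cons_cV /= mul_block_col add_col_mx; congr col_mx; last first.
  by rewrite mul_mx_scalar addrA [_ + L *m v]addrC.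
by apply/matrixP => i j; rewrite !ord1 !mxE !eqxx !mulr1n big_ord1 !mxE !eqxx !mulr1n addrA.
Qed.

Lemma cons_cVK (n : nat) (x : 'cV[R]_n.+1) :
  x = cons_cV ((x 0 0 : measurableTypeR R), ((@dsubmx _ 1 n 1 x) : cvM R n)).
Proof.
apply/matrixP => i j; rewrite (ord1 j) /cons_cV mxE.
case: (@fintype.splitP 1 n i) => k ik; rewrite mxE.
  have -> : i = 0 by apply: val_inj; rewrite /= ik (ord1 k).
  by rewrite (ord1 k) eqxx mulr1n.
by congr (x _ _); apply: val_inj.
Qed.

Lemma scales_vol_lower (n : nat) (a : R) (w : 'cV[R]_n) (L : 'M[R]_n) :
  a != 0 -> scales_vol L -> @scales_vol (1 + n) (block_mx a%:M 0 w L).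
Proof.
move=> a0 hL c f mf f0.
have maff := measurable_affine (block_mx a%:M 0 w L : 'M[R]_n.+1) c.
rewrite integral_vol_cons//; last exact: measurableT_comp mf maff.
rewrite (cons_cVK c); set c0 := c 0 0; set c' := dsubmx _.
have mv (s : R) : measurable_fun setT (fun v : cvM R n => f (cons_cV ((s : measurableTypeR R), v))).
  by apply: (measurableT_comp mf); exact: measurable_cons_cV1.
under eq_integral => t _.
  under eq_integral => v _ do rewrite block_cons mul0mx mxE add0r.
  rewrite (hL _ (fun v => f (cons_cV ((a * t + c0 : measurableTypeR R), v))))//.
  over.
rewrite (@integral_lebesgue_affine a c0 (fun s => (`|\det L|^-1)%:E * \int[@vol R n]_v f (cons_cV (s, v)))%E)//.
- rewrite ge0_integralZl//=.
  + rewrite -integral_vol_cons// muleA -EFinM det_lblock det_scalar1 normrM invfM//.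
  + apply: (@measurable_fun_fubini_tonelli_F _ _ _ _ _ (@vol R n) (f \o (@cons_cV R n))); last by move=> ?; exact: f0.
    exact: (measurableT_comp mf (@measurable_cons_cV R n)).
  + by move=> x _; exact: integral_ge0.
- apply: emeasurable_funM => //.
  apply: (@measurable_fun_fubini_tonelli_F _ _ _ _ _ (@vol R n) (f \o (@cons_cV R n))); last by move=> ?; exact: f0.
  exact: (measurableT_comp mf (@measurable_cons_cV R n)).
- by move=> x; rewrite mule_ge0// integral_ge0.
Qed.

Lemma scales_vol_upper (n : nat) (a : R) (u : 'rV[R]_n) (U : 'M[R]_n) :
  a != 0 -> scales_vol U -> @scales_vol (1 + n) (block_mx a%:M u 0 U).
Proof.
move=> a0 hU c f mf f0.
have maff := measurable_affine (block_mx a%:M u 0 U : 'M[R]_n.+1) c.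
rewrite integral_vol_cons_swap//; last exact: measurableT_comp mf maff.
rewrite (cons_cVK c); set c0 := c 0 0; set c' := dsubmx _.
have mv (v : cvM R n) : measurable_fun setT (fun s : measurableTypeR R => f (cons_cV (s, v))).
  apply: (measurableT_comp mf); apply: (measurableT_comp (@measurable_cons_cV R n)).
  exact: measurable_pair2.
under eq_integral => v _.
  under eq_integral => t _ do rewrite block_cons scaler0 add0r.
  rewrite (@integral_lebesgue_affine a _ (fun s => f (cons_cV (s, (U *m v + c' : cvM R n)))))//.
  over.
have mI : measurable_fun setT (fun v : cvM R n => \int[leb]_s f (cons_cV (s, v)))%E.
  apply: (@measurable_fun_fubini_tonelli_G _ _ _ _ _ leb (f \o (@cons_cV R n))); last by move=> ?; exact: f0.
  exact: (measurableT_comp mf (@measurable_cons_cV R n)).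
rewrite (hU c' (fun v => (`|a|^-1)%:E * \int[leb]_s f (cons_cV (s, v)))%E).
- rewrite ge0_integralZl//=; last by move=> x _; exact: integral_ge0.
  rewrite -integral_vol_cons_swap// muleA -EFinM det_ublock det_scalar1 normrM invfM mulrC//.
- exact: emeasurable_funM.
- by move=> x; rewrite mule_ge0// integral_ge0.
Qed.

(* Induction on the size. A nonzero pivot splits M into a lower times an upper block triangular
   factor, each handled by Tonelli in the appropriate order; a zero pivot is repaired by adding
   a row. *)
Lemma integral_vol_linear (n : nat) (M : 'M[R]_n) : M \in unitmx -> scales_vol M.
Proof.
elim: n M => [|n IH] M uM.
  move=> c f mf f0; rewrite det_mx00 normr1 invr1 mul1e.
  by apply: eq_integral => x _; congr f; rewrite [RHS]flatmx0 [LHS]flatmx0.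
have s1 : @scales_vol n 1%:M by apply: IH; exact: unitmx1.
have pivot (N : 'M[R]_(1 + n)) : N \in unitmx -> ulsubmx N 0 0 != 0 -> @scales_vol (1 + n) N.
  move=> uN; set a := ulsubmx N 0 0 => a0.
  pose S := drsubmx N - a^-1 *: (dlsubmx N *m ursubmx N).
  have NE : N = block_mx 1%:M 0 (a^-1 *: dlsubmx N) 1%:M *m block_mx a%:M (ursubmx N) 0 S.
    rewrite mulmx_block !mul1mx !mul0mx ?mulmx0 !addr0 mul_mx_scalar scalerA mulfV// scale1r.
    rewrite -[LHS]submxK; congr block_mx; first by rewrite [LHS]mx11_scalar.
    by rewrite -scalemxAl /S addrC subrK.
  have uS : S \in unitmx.
    move: uN; rewrite [in X in X -> _]NE unitmxE det_mulmx det_lblock !det1 !mul1r det_ublock.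
    by rewrite unitrM => /andP[_]; rewrite -unitmxE.
  rewrite NE; apply: scales_volM.
    by apply: scales_vol_lower; rewrite ?oner_neq0.
  by apply: scales_vol_upper => //; exact: IH.
change (@scales_vol (1 + n) M).
have [a0|a0] := eqVneq (@ulsubmx _ 1 n 1 n M 0 0) 0; last exact: pivot.
(* A vanishing first column would put the first basis vector in the kernel of [M]. *)
have [i wi] : exists i, @dlsubmx _ 1 n 1 n M i 0 != 0.
  apply: contrapT => /forallNP H.
  have w0 : @dlsubmx _ 1 n 1 n M = 0.
    by apply/matrixP => i j; rewrite (ord1 j) [RHS]mxE; apply/eqP; apply: contrapT => /negP; exact: H.
  have : (M : 'M[R]_(1 + n)) *m (col_mx 1%:M 0 : 'M[R]_(1 + n, 1)) = 0.
    rewrite -[M](@submxK _ 1 n 1 n) mul_block_col !mulmx1 !mulmx0 !addr0 w0.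
    by rewrite [ulsubmx _]mx11_scalar a0 raddf0 col_mx0.
  move=> /(congr1 (mulmx (invmx M))); rewrite mulKmx// mulmx0.
  move=> /(congr1 (@usubmx _ 1 n 1)); rewrite col_mxKu => /matrixP/(_ 0 0).
  by rewrite !mxE eqxx => /eqP; rewrite oner_eq0.
pose E s : 'M[R]_(1 + n) := block_mx 1%:M (s *: delta_mx 0 i) 0 1%:M.
have EE : E (-1) *m E 1 = 1%:M.
  rewrite /E mulmx_block !mul1mx !mulmx1 !mul0mx !mulmx0 !addr0 !add0r -scalerDl subrr scale0r.
  by rewrite -scalar_mx_block.
have hE s : @scales_vol (1 + n) (E s) by apply: scales_vol_upper => //; exact: oner_neq0.
have -> : M = E (-1) *m (E 1 *m (M : 'M[R]_(1 + n))) by rewrite mulmxA EE mul1mx.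
apply: scales_volM; first exact: hE.
apply: pivot.
  by rewrite unitmx_mul uM andbT unitmxE /E det_ublock !det1 mulr1 unitr1.
rewrite -[M](@submxK _ 1 n 1 n) /E mulmx_block block_mxKul mul1mx scale1r mxE a0 add0r.
rewrite mxE (bigD1 i)//= big1; last by move=> j ji; rewrite mxE (negbTE ji) andbF mul0r.
by move: wi; rewrite !mxE !eqxx mul1r addr0.
Qed.

End ChangeOfVariables.

(** * Volumes of affine images and outer regularity *)

Section Vol.
Context {R : realType} {n : nat}.
Local Notation mu := (@vol R n).
Local Notation V := (cvM R n).

Lemma affine_imageE (M : 'M[R]_n) (c : 'cV[R]_n) (E : set V) : M \in unitmx ->
  [set (M *m x + c)%R | x in E] = (fun y : V => (invmx M *m (y : 'cV[R]_n) + (- (invmx M *m c)) : V)) @^-1` E.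
Proof.
move=> uM; apply/seteqP; split => y /=.
  by move=> [x Ex <-]; rewrite mulmxDr mulKmx// addrK.
move=> Ey; eexists; first exact: Ey.
by rewrite mulmxBr !mulKVmx// subrK.
Qed.

Lemma measurable_affine_image (M : 'M[R]_n) (c : 'cV[R]_n) (E : set V) : M \in unitmx ->
  measurable E -> measurable ([set (M *m x + c)%R | x in E] : set V).
Proof.
move=> uM mE; rewrite affine_imageE//; rewrite -[X in measurable X]setTI.
exact: measurable_affine.
Qed.

Lemma det_unit_gt0 (M : 'M[R]_n) : M \in unitmx -> 0 < `|\det M|.
Proof. by rewrite unitmxE unitfE normr_gt0. Qed.

Lemma integral_affine_image (M : 'M[R]_n) (c : 'cV[R]_n) (E : set V) (f : V -> \bar R) :
  M \in unitmx -> measurable E ->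
  measurable_fun setT f -> (forall x, (0 <= f x)%E) ->
  (\int[mu]_(y in [set (M *m x + c)%R | x in E]) f y =
     `|\det M|%:E * \int[mu]_(x in E) f (M *m x + c)%R)%E.
Proof.
move=> uM mE mf f0; set ME : set V := (X in integral _ X).
have mME : measurable ME by exact: measurable_affine_image.
rewrite integral_mkcond.
have mg : measurable_fun setT (f \_ ME).
  by apply/(measurable_restrictT _ mME); exact: measurable_funTS.
have g0 x : (0 <= (f \_ ME) x)%E by rewrite patchE; case: ifP.
have := integral_vol_linear uM c mg g0.
move=> /(congr1 (fun z => `|\det M|%:E * z)%E).
rewrite muleA -EFinM mulfV ?mul1e ?gt_eqF ?det_unit_gt0// => <-.
rewrite [in RHS]integral_mkcond; congr (_ * _)%E; apply: eq_integral => x _.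
rewrite !patchE; congr (if _ then _ else _).
apply/idP/idP; rewrite !inE /ME; last by move=> Ex; exists x.
by move=> [y Ey /addIr /(can_inj (mulKmx uM)) <-].
Qed.

Lemma vol_affine_image (M : 'M[R]_n) (c : 'cV[R]_n) (E : set V) : M \in unitmx ->
  measurable E -> (mu [set (M *m x + c)%R | x in E] = `|\det M|%:E * mu E)%E.
Proof.
move=> uM mE; have := integral_affine_image c uM mE (@measurable_cst _ _ _ _ _ 1%E) (fun=> ltac:(done)).
by rewrite !integral_cst ?mul1e//; exact: measurable_affine_image.
Qed.

Section Regular.
Variable (U0 : set V).
Hypotheses (oU0 : @open 'cV[R]_n U0) (finU0 : (mu U0 < +oo)%E).

Let nu (E : set V) := mu (E `&` U0).
Let mU0 : measurable U0. Proof. exact: open_measurable_cV. Qed.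

(** Closed sets from inside and open sets from outside at once: the condition is symmetric under
    complement, so it can define a sigma-algebra. Measures are cut to [U0] to be finite, as
    continuity from above in [shrink] demands. *)
Let regular (E : set V) := forall e : R, 0 < e -> exists (F O : set V),
  [/\ @closed 'cV[R]_n F, @open 'cV[R]_n O, F `<=` E, E `<=` O & (nu (O `\` F) <= e%:E)%E].

Let mclosed (F : set V) : @closed 'cV[R]_n F -> measurable F.
Proof.
move=> cF; rewrite -[F]setCK; apply: measurableC; apply: open_measurable_cV.
exact: closed_openC.
Qed.

Let fin_nu (E : set V) : measurable E -> (nu E < +oo)%E.
Proof.
move=> mE; apply: le_lt_trans finU0; apply: le_measure; rewrite ?inE//.
exact: measurableI.
Qed.

Let shrink (O : set V) (F : nat -> set V) (e : R) : measurable O -> (forall k, measurable (F k)) ->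
  nondecreasing_seq F -> 0 < e -> (nu (O `\` \bigcup_k F k) < e%:E)%E ->
  exists k, (nu (O `\` F k) <= e%:E)%E.
Proof.
move=> mO mF ndF e0 nue.
have cv : (fun k => nu (O `\` F k)) @ \oo --> nu (O `\` \bigcup_k F k).
  rewrite (_ : nu (O `\` \bigcup_k F k) = mu (\bigcap_k ((O `\` F k) `&` U0))).
    apply: nonincreasing_cvg_mu.
    - by apply: fin_nu; exact: measurableD.
    - by move=> k; apply: measurableI => //; exact: measurableD.
    - by apply: bigcapT_measurable => k; apply: measurableI => //; exact: measurableD.
    - move=> i j ij; apply/subsetPset; apply: setSI; apply: setDS.
      by apply/subsetPset; exact: ndF.
  congr (mu _); apply/seteqP; split => x /=.
    by move=> [[Ox nF] Ux] k _; split => //; split => // Fx; apply: nF; exists k.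
  move=> H; have [[Ox _] Ux] := H 0%N I; split => //; split => // -[k _ Fk].
  by have [[_]] := H k I.
apply: contrapT => /forallNP H.
have : (e%:E <= nu (O `\` \bigcup_k F k))%E.
  rewrite -(cvg_lim _ cv)//; apply: lime_ge; first by apply/cvg_ex; eexists; exact: cv.
  by near=> k; rewrite ltW// ltNge; apply/negP; exact: H.
by rewrite leNgt nue.
Unshelve. all: by end_near.
Qed.

Let regular_open (U : set V) : @open 'cV[R]_n U -> regular U.
Proof.
move=> oU e e0.
pose F k : set V := ~` \bigcup_(x in ~` U) ball (x : 'cV[R]_n) k.+1%:R^-1.
have oF k : @open 'cV[R]_n (~` F k).
  by rewrite /F setCK; apply: bigcup_open => x _; exact: ball_open.
have cF k : @closed 'cV[R]_n (F k) by rewrite -(setCK (F k)); exact: open_closedC.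
have FU k : F k `<=` U.
  move=> x Fx; apply: contrapT => Ux; apply: Fx; exists x => //.
  by apply: ballxx; rewrite invr_gt0 ltr0n.
have ndF : nondecreasing_seq F.
  move=> i j ij; apply/subsetPset; apply: subsetC => y [x Ux xy]; exists x => //.
  by apply: le_ball xy; rewrite lef_pV2 ?posrE ?ltr0n// ler_nat.
have UF : U `\` \bigcup_k F k = set0.
  apply/seteqP; split => // x [Ux nF]; apply: nF.
  have /nbhs_ballP[d /= d0 dU] : nbhs (x : 'cV[R]_n) U by exact: open_nbhs_nbhs.
  exists (Num.truncn d^-1) => // -[y Uy yx]; apply: Uy; apply: dU.
  apply: ball_sym; apply: le_ball yx.
  by rewrite invf_ple ?posrE ?ltr0n//; apply/ltW/truncnS_gt.
have [k Hk] : exists k, (nu (U `\` F k) <= e%:E)%E.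
  apply: shrink => //; first exact: open_measurable_cV.
    by move=> k; exact: mclosed.
  by rewrite UF /nu set0I measure0 lte_fin.
by exists (F k), U; split.
Qed.

Let regularC (E : set V) : regular E -> regular (~` E).
Proof.
move=> rE e /rE[F [W [cF oO FE EO h]]]; exists (~` W), (~` F); split.
- exact: open_closedC.
- exact: closed_openC.
- exact: subsetC.
- exact: subsetC.
- by rewrite setDE setCK setIC -setDE.
Qed.

Let regular_bigcup (E : nat -> set V) : (forall i, regular (E i)) -> regular (\bigcup_i E i).
Proof.
move=> rE e e0.
(* These errors add up to at most [e / 4]. An infinite union of closed sets need not be closed, so
   [shrink] replaces it by a finite one within the remaining margin. *)
have e2 i : 0 < (e / 4) / (2 ^ i.+1)%:R by rewrite !divr_gt0// ltr0n expn_gt0.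
have /choice[F /choice[W FO]] := fun i => rE i _ (e2 i).
have cF i : @closed 'cV[R]_n (F i) by case: (FO i).
have oO i : @open 'cV[R]_n (W i) by case: (FO i).
pose G k := \big[setU/set0]_(i < k) F i.
have cG k : @closed 'cV[R]_n (G k) by apply: closed_bigsetU.
have oUO : @open 'cV[R]_n (\bigcup_i W i) by exact: bigcup_open.
have mF i : measurable (F i) by exact: mclosed.
have mO i : measurable (W i) by exact: open_measurable_cV.
have mOF i : measurable (W i `\` F i) by exact: measurableD.
have GE : \bigcup_k G k = \bigcup_k F k.
  apply/seteqP; split => x [i _].
    by rewrite /G -bigcup_mkord => -[j _ Fx]; exists j.
  by move=> Fx; exists i.+1 => //; rewrite /G -bigcup_mkord; exists i => /=.
have nuG : (nu (\bigcup_i W i `\` \bigcup_k G k) < e%:E)%E.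
  rewrite GE.
  have : (nu (\bigcup_i W i `\` \bigcup_k F k) <= \sum_(i <oo) nu (W i `\` F i))%E.
    apply: measure_sigma_subadditive.
    - by move=> i; exact: measurableI.
    - apply: measurableI => //; apply: measurableD; first exact: bigcupT_measurable.
      exact: bigcupT_measurable.
    - move=> x [[[i _ Ox] nF] Ux]; exists i => //; split => //; split => // Fx.
      by apply: nF; exists i.
  move=> /le_lt_trans; apply.
  apply: (@le_lt_trans _ _ (e / 4)%:E); last by rewrite lte_fin; lra.
  apply: le_trans (epsilon_trick0 xpredT _); last by apply: divr_ge0 => //; exact: ltW.
  by apply: lee_nneseries => // i _; case: (FO i).
have [k Hk] : exists k, (nu (\bigcup_i W i `\` G k) <= e%:E)%E.
  apply: shrink => //; first exact: bigcupT_measurable.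
    by move=> k; exact: mclosed.
  move=> i j ij; apply/subsetPset; rewrite /G -!bigcup_mkord => x [l /= li Fx].
  by exists l => //=; exact: leq_trans ij.
exists (G k), (\bigcup_i W i); split => //.
- rewrite /G -bigcup_mkord => x [i _ Fx]; exists i => //; case: (FO i) => _ _ + _ _; exact.
- by move=> x [i _ Ex]; exists i => //; case: (FO i) => _ _ _ + _; exact.
Qed.

(** The regular sets form a sigma-algebra containing the open sets. The result encloses a level set
    of a Borel function in an open set of comparable volume inside a given ball, so that Whitney
    coverings apply. *)
Lemma vol_outer_regular (E : set V) (e : R) : measurable E -> E `<=` U0 -> 0 < e ->
  exists O : set V, [/\ @open 'cV[R]_n O, E `<=` O, O `<=` U0 & (mu O <= mu E + e%:E)%E].
Proof.
move=> mE EU e0.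
have : regular E.
  apply: (mE regular); split; last exact: regular_open.
  split.
  - exact/regular_open/open0.
  - by move=> A rA; rewrite setTD; exact: regularC.
  - by move=> A rA; exact: regular_bigcup.
move=> /(_ _ e0)[F [W [cF oO FE EO h]]].
have mF := mclosed cF; have mO := open_measurable_cV oO.
exists (W `&` U0); split.
- exact: openI.
- by move=> x Ex; split; [exact: EO|exact: EU].
- by move=> x [].
apply: (@le_trans _ _ (mu E + mu ((W `\` F) `&` U0))%E); last by rewrite leeD2l.
apply: (@le_trans _ _ (mu (E `|` ((W `\` F) `&` U0)))).
  apply: le_measure; rewrite ?inE//.
  - exact: measurableI.
  - by apply: measurableU => //; apply: measurableI => //; exact: measurableD.
  move=> x [Ox Ux]; case: (pselect (E x)) => Ex; [left|right] => //.
  by split => //; split => // /FE.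
by apply: measureU2 => //; apply: measurableI => //; exact: measurableD.
Qed.

End Regular.
End Vol.

(** * Dilated balls and the quasi-norm rho *)

Section PowerBound.
Context {F : numFieldType} {n : nat}.

(* With X = 1 and s the eigenvalues of M, the product vanishes by Cayley-Hamilton. *)
Lemma expmx_bound (M : 'M[F]_n.+1) (lam : F) (s : seq F) : 0 < lam ->
  (forall z, z \in s -> `|z| < lam) ->
  forall X : 'M[F]_n.+1, (\prod_(z <- s) (M - z%:M)) * X = 0 ->
  exists2 C : F, 0 <= C & forall k i j, `|(M ^+ k * X) i j| <= C * lam ^+ k.
Proof.
move=> lam0; elim/last_ind: s => [|s z IH] sl X.
  rewrite big_nil mul1r => ->; exists 0 => // k i j.
  by rewrite mulr0 mxE normr0 mul0r.
rewrite big_rcons/= -mulrA => /IH[|C C0 HC].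
  by move=> w ws; apply: sl; rewrite mem_rcons in_cons ws orbT.
have zl : `|z| < lam by apply: sl; rewrite mem_rcons in_cons eqxx.
have lz : 0 < lam - `|z| by rewrite subr_gt0.
pose C0' := \sum_i \sum_j `|X i j|.
have C0'0 : 0 <= C0' by apply: sumr_ge0 => i _; apply: sumr_ge0.
(* The new constant is stable under the recursion a_(k+1) <= C lam^k + |z| a_k that comes from
   writing M as (M - z) + z. The strict inequality |z| < lam keeps it finite whatever the
   multiplicity of [z]. *)
exists (C0' + C / (lam - `|z|)); first by rewrite addr_ge0// divr_ge0// ltW.
elim=> [|k IHk] i j.
  rewrite !expr0 mul1r mulr1 (@le_trans _ _ C0')//; last first.
    by rewrite lerDl divr_ge0// ltW.
  rewrite /C0' (bigD1 i)//= (bigD1 j)//= -addrA lerDl addr_ge0//.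
    by apply: sumr_ge0.
  by apply: sumr_ge0 => ? _; apply: sumr_ge0.
have -> : M ^+ k.+1 * X = M ^+ k * ((M - z%:M) * X) + z *: (M ^+ k * X).
  rewrite exprSr -mulrA mulrBl mulrBr scalerAr -scalemx1 -scalerAl mul1r.
  by rewrite subrK.
rewrite mxE [in X in `|_ + X|]mxE (le_trans (ler_normD _ _))// normrM.
apply: (@le_trans _ _ (C * lam ^+ k + `|z| * ((C0' + C / (lam - `|z|)) * lam ^+ k))).
  by apply: lerD; [exact: HC|rewrite ler_wpM2l].
rewrite exprSr; set K := C0' + _; set L := lam ^+ k.
have CK : C <= K * (lam - `|z|).
  by rewrite /K mulrDl divfK ?gt_eqF// lerDr mulr_ge0// ltW.
rewrite -subr_ge0.
have -> : K * (L * lam) - (C * L + `|z| * (K * L)) = L * (K * (lam - `|z|) - C) by ring.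
by rewrite mulr_ge0 ?subr_ge0// exprn_ge0// ltW.
Qed.

End PowerBound.

Section Eigen.
Context {R : realType} {n : nat} (A : 'M[R]_n.+1) (lm lp : R).
Hypothesis hlam : eig_bounds A lm lp.

Lemma cmx_exp k : cmx (A ^+ k) = cmx A ^+ k.
Proof.
by rewrite /cmx -[LHS]/(map_mx (real_complex R) _) rmorphXn.
Qed.

Lemma exists_eigenvalue : exists z : R[i], eigenvalue (cmx A) z.
Proof.
have [z rz] : exists z : R[i], root (char_poly (cmx A)) z.
  apply/closed_rootP; rewrite size_char_poly; first by [].
by exists z; rewrite eigenvalue_root_char.
Qed.

(** The bounds would say nothing without an eigenvalue; one exists over the complex numbers and its
    modulus lies between [lm] and [lp]. *)
Lemma eig_bounds_gt1 : 1 < lp.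
Proof.
have [z ez] := exists_eigenvalue; have [lm1 /(_ _ ez)[h1 h2]] := hlam.
by have := lt_trans h1 h2; rewrite ltcE /= => /andP[_]; exact: lt_trans.
Qed.

(** [lp] strictly exceeds the modulus of every eigenvalue, which absorbs the polynomial factors of
    Jordan blocks. The bound is obtained over the complex numbers and read back through the real
    part of the constant. *)
Lemma expmx_entries_bound : exists2 C : R, 0 <= C &
  forall k i j, `|(A ^+ k) i j| <= C * lp ^+ k.
Proof.
have [s sE] := closed_field_poly_normal (char_poly (cmx A)).
have mon : lead_coef (char_poly (cmx A)) = 1 by exact: (monicP (char_poly_monic _)).
rewrite mon scale1r in sE.
have lp0 : 0 < lp by apply: lt_trans eig_bounds_gt1.
have sl z : z \in s -> `|z| < Complex lp 0.
  move=> zs; have [_ /(_ z)[]//] := hlam.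
  by rewrite eigenvalue_root_char sE root_prod_XsubC.
have lpc0 : 0 < Complex lp 0 by rewrite ltcE /= eqxx.
have [|C C0 HC] := @expmx_bound _ n (cmx A) (Complex lp 0) s lpc0 sl 1.
  rewrite mulr1; have := Cayley_Hamilton (cmx A); rewrite sE rmorph_prod /=.
  move=> H; rewrite -[RHS]H; apply: eq_bigr => z _.
  by rewrite rmorphB /= horner_mx_X horner_mx_C.
move: C0; rewrite lecE /= => /andP[/eqP C_im C_re].
exists (complex.Re C) => // k i j.
have := HC k i j; rewrite mulr1 -cmx_exp mxE.
have -> : Complex lp 0 ^+ k = Complex (lp ^+ k) 0.
  by rewrite -[LHS]/((real_complex R lp) ^+ k) -rmorphXn.
have -> : C = Complex (complex.Re C) 0 by case: (C) C_im => a b /= ->.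
rewrite lecE normc_def /= expr0n /= addr0 sqrtr_sqr.
by rewrite !mulr0 ?mul0r subr0 => /andP[].
Qed.

End Eigen.

Section Balls.
Context {R : realType} {n : nat} (A : 'M[R]_n.+1) (D : set 'cV[R]_n.+1) (r : R).
Hypotheses (hA : dilation A) (hD : ellipsoid0 D) (hDvol : Rvol D = 1%E) (hr : 1 < r)
  (hrA : [set r *: x | x in D] `<=` [set A *m x | x in D]).

Local Notation V := (cvM R n.+1).
Local Notation mu := (@vol R n.+1).
Local Notation b := `|\det A|.

Lemma dilation_unit : A \in unitmx.
Proof.
rewrite unitmxE unitfE; apply/negP => /det0P[v v0 vA].
have : eigenvalue (cmx A) 0.
  apply/eigenvalueP; exists (map_mx (real_complex R) v).
    rewrite /cmx -[X in _ *m X]/(map_mx (real_complex R) A) -map_mxM vA scale0r.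
    by rewrite map_mx0.
  by rewrite map_mx_eq0.
by move=> /hA; rewrite normr0 ltr10.
Qed.

Lemma sum_continuous (T : topologicalType) (I : Type) (s : seq I) (f : I -> T -> R) :
  (forall i, continuous (f i)) -> continuous (fun x => \sum_(i <- s) f i x).
Proof.
move=> cf; elim: s => [|i s IH] x.
  rewrite (_ : (fun _ => _) = cst 0); first exact: cst_continuous.
  by apply/funext => y; rewrite big_nil.
rewrite (_ : (fun _ => _) = f i \+ (fun x => \sum_(i <- s) f i x)).
  by apply: continuousD; [exact: cf|exact: IH].
by apply/funext => y; rewrite big_cons.
Qed.

Lemma open_quadratic_lt1 (P : 'M[R]_n.+1) (c : 'cV[R]_n.+1) :
  open [set x : 'cV[R]_n.+1 | \sum_(i < n.+1) ((P *m x + c) i 0) ^+ 2 < 1].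
Proof.
pose Q (x : 'cV[R]_n.+1) := \sum_(i < n.+1) ((P *m x + c) i 0) ^+ 2.
have cQ : continuous Q.
  apply: sum_continuous => i x.
  apply: (@continuous_comp _ _ _ (fun y : 'cV[R]_n.+1 => (P *m y + c) i 0) (fun y : R => y ^+ 2)); last exact: exprn_continuous.
  rewrite (_ : (fun _ => _) = fun y : 'cV[R]_n.+1 => \sum_j P i j * y j 0 + c i 0); last first.
    by apply/funext => y; rewrite !mxE.
  apply: continuousD; last exact: cst_continuous.
  apply: sum_continuous => j y; apply: continuousM; first exact: cst_continuous.
  exact: coord_continuous.
apply: (@open_comp _ _ Q [set y : R | y < 1]); last exact: open_lt.
by move=> x _; exact: cQ.
Qed.

Lemma ellipsoid0_open : open D.
Proof.
have [P [uP ->]] := hD.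
have := @open_quadratic_lt1 P 0; congr (open _); apply/seteqP.
by split => x /=; rewrite addr0.
Qed.

Lemma ellipsoid00 : D 0.
Proof.
have [P [uP ->]] := hD; rewrite /= big1 ?ltr01// => i _.
by rewrite mulmx0 mxE expr0n.
Qed.

Lemma ellipsoid0N x : D x -> D (- x).
Proof.
have [P [uP ->]] /= := hD; congr (_ < 1); apply: eq_bigr => i _.
by rewrite mulmxN [in RHS]mxE sqrrN.
Qed.

Lemma ellipsoid0Z (t : R) x : `|t| <= 1 -> D x -> D (t *: x).
Proof.
move=> t1; have [P [uP ->]] /= := hD => h; apply: le_lt_trans h.
apply: ler_sum => i _; rewrite -scalemxAr mxE exprMn ler_piMl ?sqr_ge0//.
by rewrite -real_normK ?num_real// expr_le1.
Qed.

Lemma ellipsoid0_half x y : D x -> D y -> D (2^-1 *: (x + y)).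
Proof.
have [P [uP ->]] /= := hD => hx hy.
apply: (@le_lt_trans _ _ (2^-1 * \sum_(i < n.+1) ((P *m x) i 0) ^+ 2 +
   2^-1 * \sum_(i < n.+1) ((P *m y) i 0) ^+ 2)); last by lra.
rewrite !mulr_sumr -big_split; apply: ler_sum => i _ /=.
rewrite -scalemxAr mulmxDr mxE [in X in X ^+ 2 <= _]mxE; set u : R := (P *m x) i 0; set v : R := (P *m y) i 0.
rewrite -subr_ge0; have -> : 2^-1 * u ^+ 2 + 2^-1 * v ^+ 2 - (2^-1 * (u + v)) ^+ 2 =
  (2^-1 * (u - v)) ^+ 2 :> R by field.
exact: sqr_ge0.
Qed.

Lemma ellipsoid0_bounded : exists2 M : R, 0 < M & forall x : 'cV[R]_n.+1, D x -> forall i, `|x i 0| <= M.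
Proof.
have [P [uP ->]] /= := hD.
exists (1 + \sum_i \sum_j `|invmx P i j|).
  by rewrite ltr_pwDl// sumr_ge0// => i _; rewrite sumr_ge0.
move=> x hx i; rewrite -(mulKmx uP x) mxE.
apply: (@le_trans _ _ (\sum_j `|invmx P i j|)); last first.
  rewrite [X in _ <= 1 + X](bigD1 i)//= addrCA lerDl addr_ge0// sumr_ge0// => k _.
  by rewrite sumr_ge0.
apply: le_trans (ler_norm_sum _ _ _) _; apply: ler_sum => j _.
rewrite normrM ler_piMr// -(@expr_le1 _ 2)//.
rewrite -normrX ger0_norm ?sqr_ge0//; apply: le_trans (ltW hx).
by rewrite (bigD1 j)//= lerDl sumr_ge0// => k _; exact: sqr_ge0.
Qed.

Lemma ApowE (k : int) : Apow A k = (A : 'M[R]_n.+1) ^ k.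
Proof. by case: k => k //=; rewrite /exprz exprVn. Qed.

Lemma ApowD (k l : int) : Apow A (k + l) = Apow A k *m Apow A l.
Proof. by rewrite !ApowE exprzDr//; exact: dilation_unit. Qed.

Lemma ApowNl k : Apow A (- k) *m Apow A k = 1%:M.
Proof. by rewrite -ApowD addNr. Qed.

Lemma ApowNr k : Apow A k *m Apow A (- k) = 1%:M.
Proof. by rewrite -ApowD addrN. Qed.

Lemma Apow_unit k : Apow A k \in unitmx.
Proof. by have [] := mulmx1_unit (ApowNr k). Qed.

Lemma BkP k x : Bk A D k x <-> D (Apow A (- k) *m x).
Proof.
split; first by move=> [y Dy <-]; rewrite mulmxA ApowNl mul1mx.
by move=> Dx; eexists; first exact: Dx; rewrite mulmxA ApowNr mul1mx.
Qed.

Lemma dballP x k y : dball A D x k y <-> Bk A D k (y - x).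
Proof.
split; first by move=> [z Bz <-]; rewrite addrAC subrr add0r.
by move=> Bz; eexists; first exact: Bz; rewrite addrC subrK.
Qed.

Lemma Bk_shift (k l : int) x : Bk A D (k + l) x <-> Bk A D l (Apow A (- k) *m x).
Proof. by rewrite !BkP opprD [- k - l]addrC ApowD mulmxA. Qed.

Lemma det_Apow k : `|\det (Apow A k)| = b ^ k.
Proof.
have detX (M : 'M[R]_n.+1) m : \det (M ^+ m) = \det M ^+ m.
  elim: m => [|m IH]; first by rewrite !expr0 det1.
  by rewrite !exprS -IH -det_mulmx.
by case: k => k /=; rewrite detX ?det_inv normrX // normfV exprVn.
Qed.

Lemma dball_image x k : dball A D x k = [set (Apow A k *m y + x)%R | y in D].
Proof.
apply/seteqP; split => y; first by move=> [_ [z Dz <-] <-]; exists z => //; rewrite addrC.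
by move=> [z Dz <-]; exists (Apow A k *m z); [exists z|rewrite addrC].
Qed.

Lemma measurable_ellipsoid0 : measurable (D : set V).
Proof. by apply: open_measurable_cV; exact: ellipsoid0_open. Qed.

Lemma vol_dball x k : mu (dball A D x k) = (b ^ k)%:E.
Proof.
rewrite dball_image vol_affine_image ?Apow_unit//; last exact: measurable_ellipsoid0.
by rewrite det_Apow -RvolE ?hDvol ?mule1//; exact: measurable_ellipsoid0.
Qed.

Lemma dball_open x k : open (dball A D x k : set 'cV[R]_n.+1).
Proof.
have [P [uP DE]] := hD.
rewrite (_ : dball A D x k = [set y : 'cV[R]_n.+1 |
    \sum_(i < n.+1) ((P *m Apow A (- k) *m y + (- (P *m Apow A (- k) *m x))) i 0) ^+ 2 < 1]).
  exact: open_quadratic_lt1.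
apply/seteqP; split => y /=.
  by rewrite dballP BkP DE/= mulmxA mulmxBr.
by rewrite -mulmxBr -mulmxA => h; rewrite dballP BkP DE.
Qed.

Lemma measurable_dball x k : measurable (dball A D x k : set V).
Proof.
rewrite dball_image; apply: measurable_affine_image; first exact: Apow_unit.
exact: measurable_ellipsoid0.
Qed.

Lemma Bk_center k : Bk A D k 0.
Proof. by rewrite BkP mulmx0; exact: ellipsoid00. Qed.

Lemma BkN k x : Bk A D k x -> Bk A D k (- x).
Proof. by rewrite !BkP mulmxN; exact: ellipsoid0N. Qed.

Lemma BkZ1 (k : int) (t : R) x : `|t| <= r -> Bk A D k x -> Bk A D (k + 1) (t *: x).
Proof.
rewrite !BkP => tr; set y := _ *m x => Dy.
have [z Dz zE] : [set A *m x | x in D] (t *: y).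
  apply: hrA; exists ((t / r) *: y); last first.
    by rewrite scalerA mulrCA mulfV ?mulr1// gt_eqF// (lt_trans _ hr).
  apply: ellipsoid0Z => //; rewrite normrM normfV ler_pdivrMr; last first.
    by rewrite normr_gt0 gt_eqF// (lt_trans _ hr).
  by rewrite mul1r [`|r|]gtr0_norm// (lt_trans _ hr).
rewrite opprD addrC ApowD -mulmxA -scalemxAr -/y -zE.
by rewrite mulmxA (_ : _ *m A = 1%:M) ?mul1mx//; exact: (ApowNl 1).
Qed.

Lemma Bk_le (k l : int) x : k <= l -> Bk A D k x -> Bk A D l x.
Proof.
move=> kl; have -> : l = k + `|l - k|%N by rewrite gez0_abs ?subr_ge0// addrCA subrr addr0.
elim: `|_|%N => [|m IH] Bx; first by rewrite addr0.
rewrite (_ : Posz m.+1 = m%:Z + 1) ?addrA; last by rewrite -PoszD addn1.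
rewrite -[x]scale1r; apply: BkZ1; last exact: IH.
by rewrite normr1 ltW.
Qed.

Lemma BkZ (m : nat) (k : int) (t : R) x : `|t| <= r ^+ m -> Bk A D k x -> Bk A D (k + m%:Z) (t *: x).
Proof.
have r0 : 0 < r by rewrite (lt_trans _ hr).
elim: m t => [|m IH] t tr Bx.
  move: Bx; rewrite addr0 !BkP -scalemxAr; exact: ellipsoid0Z.
rewrite (_ : Posz m.+1 = m%:Z + 1) ?addrA; last by rewrite -PoszD addn1.
rewrite -[t](@divfK _ r) ?gt_eqF// mulrC -scalerA.
apply: BkZ1; first by rewrite gtr0_norm.
by apply: IH => //; rewrite normrM normfV (gtr0_norm r0) ler_pdivrMr// -exprSr.
Qed.

(** Bernoulli's inequality. *)
Lemma expr_gt_exists (x y : R) : 1 < x -> exists m : nat, y <= x ^+ m.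
Proof.
move=> x1; have x0 : 0 < x - 1 by rewrite subr_gt0.
exists (Num.truncn (y / (x - 1))).+1; set m := _.+1.
have ym : y <= m%:R * (x - 1) by rewrite -ler_pdivrMr// ltW// truncnS_gt.
apply: le_trans ym _; rewrite -{2}(subrK 1 x); move: (x - 1) (ltW x0) => z z0.
apply: (@le_trans _ _ (1 + m%:R * z)); first by rewrite lerDr.
elim: (m) => [|k IHk]; first by rewrite expr0 mul0r addr0.
rewrite exprS; apply: (@le_trans _ _ ((z + 1) * (1 + k%:R * z))); last by rewrite ler_wpM2l// addr_ge0.
rewrite -natr1 -subr_ge0.
have -> : (z + 1) * (1 + k%:R * z) - (1 + (k%:R + 1) * z) = k%:R * (z * z) by ring.
by rewrite mulr_ge0// mulr_ge0.
Qed.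

(* The paper's sigma: B_k + B_k is contained in B_{k + sigma}. *)
Definition dsig : nat := sval (cid (expr_gt_exists 2 hr)).

Lemma dsigP : 2 <= r ^+ dsig.
Proof. by rewrite /dsig; case: cid. Qed.

(** The half-sum stays in B_k by convexity of the ellipsoid, and doubling it costs [dsig] levels
    because 2 <= r^dsig. *)
Lemma BkD (k : int) x y : Bk A D k x -> Bk A D k y -> Bk A D (k + dsig%:Z) (x + y).
Proof.
move=> Bx By; have -> : x + y = 2 *: (2^-1 *: (x + y)) by rewrite scalerA mulfV// scale1r.
apply: BkZ; first by rewrite ger0_norm//; exact: dsigP.
move: Bx By; rewrite !BkP -scalemxAr mulmxDr; exact: ellipsoid0_half.
Qed.

Lemma ball_sub_Bk : exists2 e : R, 0 < e & forall x : 'cV[R]_n.+1, (forall i, `|x i 0| < e) -> D x.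
Proof.
have /nbhs_ballP[e /= e0 eD] : nbhs (0 : 'cV[R]_n.+1) D.
  by apply: open_nbhs_nbhs; split; [exact: ellipsoid0_open|exact: ellipsoid00].
exists e => // x xe; apply: eD; split => // i j; rewrite (ord1 j) mxE.
by rewrite /ball /= sub0r normrN.
Qed.

Lemma Bk_union x : exists k : int, Bk A D k x.
Proof.
have [e e0 eD] := ball_sub_Bk.
have [m Hm] := expr_gt_exists (2 * (\sum_i `|x i 0|) / e + 1) hr.
exists (0 + m%:Z).
have rm0 : 0 < r ^+ m by rewrite exprn_gt0// (lt_trans _ hr).
rewrite -[x]scale1r -(@mulfV _ (r ^+ m)) ?gt_eqF// -scalerA; apply: BkZ.
  by rewrite gtr0_norm.
rewrite BkP oppr0 mul1mx; apply: eD => i; rewrite mxE normrM normfV (gtr0_norm rm0).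
rewrite mulrC ltr_pdivrMr//.
have xi : `|x i 0| <= \sum_i `|x i 0| by rewrite (bigD1 i)//= lerDl sumr_ge0.
have s0 : 0 <= \sum_i `|x i 0| by rewrite sumr_ge0.
apply: (@lt_le_trans _ _ (e * (2 * (\sum_i `|x i 0|) / e + 1))); last by rewrite ler_wpM2l// ltW.
rewrite mulrDr mulr1 mulrCA mulfV ?gt_eqF// mulr1; move: xi s0 e0; set s := \sum_i _; lra.
Qed.

Lemma Bk_small (e : R) : 0 < e -> exists k : int, forall x : 'cV[R]_n.+1, Bk A D k x -> forall i, `|x i 0| < e.
Proof.
move=> e0; have [M M0 DM] := ellipsoid0_bounded.
have [m Hm] := expr_gt_exists (M / e + 1) hr.
have rm0 : 0 < r ^+ m by rewrite exprn_gt0// (lt_trans _ hr).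
exists (- m%:Z) => x Bx i.
have := BkZ (m := m) (t := r ^+ m) (ltac:(by rewrite gtr0_norm)) Bx.
rewrite addNr BkP oppr0 mul1mx => /DM /(_ i); rewrite mxE normrM (gtr0_norm rm0).
rewrite -ler_pdivlMl// => /le_lt_trans; apply.
rewrite mulrC ltr_pdivrMr// -ltr_pdivrMl// [_ * M]mulrC.
by apply: lt_le_trans Hm; rewrite ltrDl.
Qed.

(** Comparing volumes in rD, a subset of AD, gives r^(n+1) <= b. *)
Lemma det_gt1 : 1 < b.
Proof.
have rD : [set (r%:M *m x + 0)%R | x in D] `<=` [set (A *m x + 0)%R | x in D].
  move=> _ [x Dx <-]; have [|y Dy yE] := @hrA (r *: x); first by exists x.
  by exists y => //; rewrite yE mul_scalar_mx.
have r0 : 0 < r by rewrite (lt_trans _ hr).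
have ur : (r%:M : 'M[R]_n.+1) \in unitmx by rewrite unitmxE det_scalar unitfE expf_eq0/= gt_eqF.
have mD := measurable_ellipsoid0.
have : (mu [set (r%:M *m x + 0)%R | x in D] <= mu [set (A *m x + 0)%R | x in D])%E.
  apply: le_measure => //; rewrite inE; apply: measurable_affine_image => //.
  exact: dilation_unit.
rewrite !vol_affine_image//; last exact: dilation_unit.
rewrite -RvolE// hDvol !mule1 lee_fin det_scalar.
apply: lt_le_trans; rewrite normrX (gtr0_norm r0); exact: exprn_egt1.
Qed.

End Balls.

Section Rho.
Context {R : realType} {n : nat} (A : 'M[R]_n.+1) (D : set 'cV[R]_n.+1) (r : R).
Hypotheses (hA : dilation A) (hD : ellipsoid0 D) (hDvol : Rvol D = 1%E) (hr : 1 < r)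
  (hrA : [set r *: x | x in D] `<=` [set A *m x | x in D]).

Local Notation V := (cvM R n.+1).
Local Notation b := `|\det A|.

Let b1 : 1 < b. Proof. exact: (det_gt1 hA hD hDvol hr hrA). Qed.
Let b0 : 0 < b. Proof. exact: lt_trans b1. Qed.

(** The balls are nested, [x] lies in one of them and, being nonzero, outside another; induction
    over the levels in between finds where it enters. *)
Lemma Bk_annulus x : x != 0 -> exists k : int, Bk A D (k + 1) x /\ ~ Bk A D k x.
Proof.
move=> x0.
have [k1 Bk1] := Bk_union hA hD hr hrA x.
have [k0 Bk0] : exists k : int, ~ Bk A D k x.
  have [i xi] : exists i, x i 0 != 0.
    apply: contrapT => /forallNP H; move: x0; apply/negP; rewrite negbK; apply/eqP.
    by apply/matrixP => i j; rewrite (ord1 j) [RHS]mxE; apply/eqP; apply: contrapT => /negP; exact: H.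
  have xi0 : 0 < `|x i 0| by rewrite normr_gt0.
  have [k Hk] := Bk_small hA hD hr hrA xi0.
  by exists k => /Hk /(_ i); rewrite ltxx.
have k01 : k0 <= k1.
  rewrite leNgt; apply/negP => /ltW k10; apply: Bk0.
  exact: (Bk_le hA hD hr hrA k10).
have : Bk A D (k0 + `|k1 - k0|%N%:Z) x.
  by rewrite gez0_abs ?subr_ge0// addrCA subrr addr0.
elim: `|_|%N => [|m IH]; first by rewrite addr0.
rewrite (_ : Posz m.+1 = m%:Z + 1) ?addrA; last by rewrite -PoszD addn1.
move=> Bm.
have [/IH//|nB] := pselect (Bk A D (k0 + m%:Z) x).
by exists (k0 + m%:Z).
Qed.

Lemma rhoP x : x != 0 -> exists k : int, [/\ rho A D x = b ^ k, Bk A D (k + 1) x & ~ Bk A D k x].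
Proof.
move=> x0; rewrite /rho (negbTE x0).
have [k Hk] := Bk_annulus x0.
by case: xgetP => [j _ [h1 h2]|/(_ k)//]; exists j.
Qed.

Lemma exprz_le (k l : int) : k <= l -> b ^ k <= b ^ l.
Proof. by move=> kl; rewrite ler_eXz2l. Qed.

Lemma rho_ge k x : ~ Bk A D k x -> b ^ k <= rho A D x.
Proof.
move=> nB; have x0 : x != 0.
  by apply/eqP => x0; apply: nB; rewrite x0; exact: Bk_center.
have [j [-> Bj _]] := rhoP x0; apply: exprz_le.
rewrite leNgt; apply/negP => jk; apply: nB.
by apply: (Bk_le hA hD hr hrA) Bj; rewrite -ltzD1 ltrD2r.
Qed.

Lemma rho_lt k x : Bk A D k x -> rho A D x < b ^ k.
Proof.
move=> Bx; have [->|x0] := eqVneq x 0; first by rewrite /rho eqxx exprz_gt0.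
have [j [-> _ nB]] := rhoP x0; rewrite ltr_eXz2l// ltNge; apply/negP => kj.
by apply: nB; exact: (Bk_le hA hD hr hrA kj).
Qed.

Lemma rho_ge0 x : 0 <= rho A D x.
Proof.
have [->|x0] := eqVneq x 0; first by rewrite /rho eqxx.
by have [j [-> _ _]] := rhoP x0; rewrite exprz_ge0// ltW.
Qed.

Lemma measurable_Bk k : measurable (Bk A D k : set V).
Proof.
rewrite (_ : Bk A D k = dball A D 0 k); first exact: (measurable_dball hA hD).
by apply/seteqP; split => x; rewrite dballP subr0.
Qed.

Lemma measurable_rho : measurable_fun setT (rho A D : V -> R).
Proof.
apply: (measurability _ (measurable_realfun.RGenOInfty.measurableE R)) => _ [_ [c ->] <-].
rewrite setTI (_ : _ @^-1` _ = if c < 0 then setT else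
   \bigcup_(k in [set k : int | c < b ^ k]) (~` Bk A D k)).
  case: ifPn => // _; rewrite bigcup_mkcond; apply: countable_bigcupT_measurable => [|k].
    exact: countableP.
  by case: ifPn => // _; apply: measurableC; exact: measurable_Bk.
apply/seteqP; split => x /=; rewrite in_itv/= andbT; case: (ltP c 0) => // c0.
- move=> crho; have x0 : x != 0.
    by apply/eqP => x0; move: crho; rewrite x0 /rho eqxx ltNge c0.
  have [j [rE Bj nB]] := rhoP x0; exists j => //=; by rewrite -rE.
- by move=> _; apply: lt_le_trans c0 _; exact: rho_ge0.
- by move=> [k /= ck nB]; apply: lt_le_trans ck _; exact: rho_ge.
Qed.

Variables (lm lp : R).
Hypothesis hlam : eig_bounds A lm lp.

Lemma Bk_growth : exists2 C : R, 0 <= C & forall (k : nat) (x : 'cV[R]_n.+1),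
  Bk A D k%:Z x -> forall i, `|x i 0| <= C * lp ^+ k.
Proof.
have [C C0 HC] := expmx_entries_bound hlam; have [M M0 HM] := ellipsoid0_bounded hD.
exists (\sum_(j < n.+1) C * M); first by rewrite sumr_ge0// => j _; rewrite mulr_ge0// ltW.
move=> k _ [y Dy <-] i; rewrite mxE mulr_suml.
apply: le_trans (ler_norm_sum _ _ _) _; apply: ler_sum => j _.
by rewrite normrM mulrAC ler_pM//; [exact: HC|exact: HM].
Qed.

End Rho.

(** * Polynomials and the projection onto them *)

Section PolyAlgebra.
Context {R : realType} {n : nat}.
Local Notation V := 'cV[R]_n.

Lemma is_polyd_monomial (d : nat) (al : 'I_n -> nat) : (\sum_i al i <= d)%N ->
  is_polyd d (fun x : V => \prod_i (x i 0) ^+ (al i)).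
Proof.
move=> ald; pose a : {ffun 'I_n -> 'I_d.+1} := [ffun i => inord (al i)].
have aE i : (a i : nat) = al i.
  rewrite ffunE inordK// ltnS; apply: leq_trans ald.
  by rewrite (bigD1 i)//= leq_addr.
exists (fun a' => (a' == a)%:R) => x.
rewrite (bigD1 a)/=; last by under eq_bigr do rewrite aE.
rewrite eqxx mul1r [X in _ + X]big1 => [|a' /andP[_ /negbTE ->]]; last by rewrite mul0r.
rewrite addr0.
by apply: eq_bigr => i _; rewrite aE.
Qed.

Lemma is_polydD (d : nat) (P Q : V -> R) : is_polyd d P -> is_polyd d Q ->
  is_polyd d (fun x => P x + Q x).
Proof.
move=> [c cP] [e eQ]; exists (fun a => c a + e a) => x.
by rewrite cP eQ -big_split; apply: eq_bigr => a _; rewrite mulrDl.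
Qed.

Lemma is_polydZ (d : nat) (t : R) (P : V -> R) : is_polyd d P ->
  is_polyd d (fun x => t * P x).
Proof.
move=> [c cP]; exists (fun a => t * c a) => x.
by rewrite cP mulr_sumr; apply: eq_bigr => a _; rewrite mulrA.
Qed.

Lemma is_polydB (d : nat) (P Q : V -> R) : is_polyd d P -> is_polyd d Q ->
  is_polyd d (fun x => P x - Q x).
Proof.
move=> hP /(is_polydZ (-1)) hQ; have := is_polydD hP hQ.
by congr (is_polyd _ _); apply/funext => x; rewrite mulN1r.
Qed.

Lemma is_polyd0 (d : nat) : is_polyd d (fun _ : V => 0).
Proof. by exists (fun _ => 0) => x; rewrite big1// => a _; rewrite mul0r. Qed.

Lemma is_polyd_sum (d : nat) (I : Type) (s : seq I) (p : pred I) (P : I -> V -> R) :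
  (forall i, p i -> is_polyd d (P i)) -> is_polyd d (fun x => \sum_(i <- s | p i) P i x).
Proof.
move=> hP; elim: s => [|i s IH].
  by under [X in is_polyd _ X]eq_fun do rewrite big_nil; exact: is_polyd0.
under [X in is_polyd _ X]eq_fun do rewrite big_cons.
by case pi: (p i) => //; apply: is_polydD => //; exact: hP.
Qed.

Lemma is_polyd_leq (d d' : nat) (P : V -> R) : (d <= d')%N -> is_polyd d P -> is_polyd d' P.
Proof.
move=> dd' [c cP]; rewrite (_ : P = fun x => \sum_(a : {ffun 'I_n -> 'I_d.+1} |
  (\sum_(i < n) (a i : nat) <= d)%N) c a * mono a x); last exact/funext.
apply: is_polyd_sum => a ad; apply: is_polydZ; apply: is_polyd_monomial.
exact: leq_trans dd'.
Qed.

Lemma is_polydM (d d' : nat) (P Q : V -> R) : is_polyd d P -> is_polyd d' Q ->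
  is_polyd (d + d') (fun x => P x * Q x).
Proof.
move=> [c cP] [e eQ]; rewrite (_ : (fun _ => _) = fun x : V =>
   \sum_(a : {ffun 'I_n -> 'I_d.+1} | (\sum_(i < n) (a i : nat) <= d)%N)
   \sum_(a' : {ffun 'I_n -> 'I_d'.+1} | (\sum_(i < n) (a' i : nat) <= d')%N)
     (c a * e a') * \prod_i (x i 0) ^+ (a i + a' i)); last first.
  apply/funext => x; rewrite cP eQ mulr_suml; apply: eq_bigr => a _.
  rewrite mulr_sumr; apply: eq_bigr => a' _.
  rewrite mulrACA; congr (_ * _); rewrite /mono -big_split.
  by apply: eq_bigr => i _; rewrite exprD.
apply: is_polyd_sum => a ad; apply: is_polyd_sum => a' ad'; apply: is_polydZ.
by apply: is_polyd_monomial; rewrite big_split leq_add.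
Qed.

Lemma is_polyd_cst (d : nat) (t : R) : is_polyd d (fun _ : V => t).
Proof.
have := is_polydZ t (@is_polyd_monomial d (fun=> 0%N) (ltac:(by rewrite big1))).
congr (is_polyd _ _); apply/funext => x; rewrite big1 ?mulr1// => i _; exact: expr0.
Qed.

Lemma is_polyd_coord (j : 'I_n) : is_polyd 1 (fun x : V => x j 0).
Proof.
have := @is_polyd_monomial 1 (fun i => (i == j)%N : nat).
rewrite (bigD1 j)//= eqxx big1 ?addn0 => [/(_ isT)|i /negbTE ->//].
congr (is_polyd _ _); apply/funext => x; rewrite (bigD1 j)//= eqxx expr1 big1 ?mulr1//.
by move=> i /negbTE ->; rewrite expr0.
Qed.

Lemma is_polydX (d k : nat) (P : V -> R) : is_polyd d P ->
  is_polyd (d * k) (fun x => P x ^+ k).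
Proof.
move=> hP; elim: k => [|k IH].
  by under [X in is_polyd _ X]eq_fun do rewrite expr0; exact: is_polyd_cst.
under [X in is_polyd _ X]eq_fun do rewrite exprS.
by rewrite mulnS; exact: is_polydM.
Qed.

Lemma is_polyd_prod (I : Type) (s : seq I) (e : I -> nat) (P : I -> V -> R) :
  (forall i, is_polyd (e i) (P i)) ->
  is_polyd (\sum_(i <- s) e i) (fun x => \prod_(i <- s) P i x).
Proof.
move=> hP; elim: s => [|i s IH].
  by under [X in is_polyd _ X]eq_fun do rewrite big_nil; exact: is_polyd_cst.
under [X in is_polyd _ X]eq_fun do rewrite big_cons.
by rewrite big_cons; exact: is_polydM.
Qed.

End PolyAlgebra.

Section PolyAffine.
Context {R : realType} {n : nat}.
Local Notation V := 'cV[R]_n.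

Lemma is_polyd_affine (d : nat) (P : V -> R) (M : 'M[R]_n) (c : V) : is_polyd d P ->
  is_polyd d (fun x : V => P (M *m x + c)).
Proof.
move=> [e eP]; rewrite (_ : (fun _ => _) = fun x => \sum_(a : {ffun 'I_n -> 'I_d.+1} |
  (\sum_(i < n) (a i : nat) <= d)%N) e a * mono a (M *m x + c)); last exact/funext.
apply: is_polyd_sum => a ad; apply: is_polydZ.
apply: (is_polyd_leq (d := \sum_(i < n) 1 * a i)).
  by under eq_bigr do rewrite mul1n.
apply: is_polyd_prod => i; apply: is_polydX.
rewrite (_ : (fun _ => _) = fun x : V => \sum_j M i j * x j 0 + c i 0); last first.
  by apply/funext => x; rewrite !mxE.
apply: is_polydD; last exact: is_polyd_cst.
by apply: is_polyd_sum => j _; apply: is_polydZ; exact: is_polyd_coord.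
Qed.

Lemma measurable_is_polyd (d : nat) (P : V -> R) : is_polyd d P ->
  measurable_fun setT (P : cvM R n -> R).
Proof.
move=> [e eP]; rewrite (_ : P = fun x => \sum_(a : {ffun 'I_n -> 'I_d.+1} |
  (\sum_(i < n) (a i : nat) <= d)%N) e a * mono a x); last exact/funext.
under eq_fun do rewrite big_mkcond.
apply: measurable_sum => a; case: (leqP _ d) => _ //; apply: measurable_funM => //.
apply: measurable_prod => i _; apply: measurable_funX; exact: measurable_coord.
Qed.

Lemma continuous_is_polyd (d : nat) (P : V -> R) : is_polyd d P -> continuous P.
Proof.
move=> [e eP]; rewrite (_ : P = fun x => \sum_(a : {ffun 'I_n -> 'I_d.+1})
   (if (\sum_(i < n) (a i : nat) <= d)%N then e a * mono a x else 0)); last first.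
  by apply/funext => x; rewrite eP big_mkcond.
apply: sum_continuous => a x; case: (leqP _ d) => _; last exact: cst_continuous.
apply: continuousM; first exact: cst_continuous.
rewrite /mono; elim: (index_enum _) => [|i s IH].
  rewrite (_ : (fun _ => _) = cst 1); first exact: cst_continuous.
  by apply/funext => y; rewrite big_nil.
rewrite (_ : (fun _ => _) = (fun y : V => y i 0 ^+ a i) \* (fun y : V => \prod_(i <- s) (y i 0) ^+ a i)); last first.
  by apply/funext => y; rewrite big_cons.
apply: continuousM => //.
apply: (@continuous_comp _ _ _ (fun y : V => y i 0) (fun y : R => y ^+ a i)); last exact: exprn_continuous.
exact: coord_continuous.
Qed.

Lemma mono_bound (d : nat) (a : {ffun 'I_n -> 'I_d.+1}) (x : V) (s : R) :
  (\sum_(i < n) (a i : nat) <= d)%N -> 1 <= s -> (forall i, `|x i 0| <= s) ->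
  `|mono a x| <= s ^+ d.
Proof.
move=> ad s1 xs; rewrite /mono normr_prod.
apply: (@le_trans _ _ (\prod_(i < n) s ^+ a i)).
  apply: ler_prod => i _; rewrite normr_ge0 normrX lerXn2r ?nnegrE ?normr_ge0//.
  exact: le_trans s1.
rewrite prodrXr; exact: ler_weXn2l.
Qed.

Lemma is_polyd_bounded (d : nat) (P : V -> R) : is_polyd d P ->
  forall s : R, exists M : R, forall x : V, (forall i, `|x i 0| <= s) -> `|P x| <= M.
Proof.
move=> [e eP] s.
exists (\sum_(a : {ffun 'I_n -> 'I_d.+1} | (\sum_(i < n) (a i : nat) <= d)%N) `|e a| * Num.max 1 s ^+ d).
move=> x xs; rewrite eP; apply: le_trans (ler_norm_sum _ _ _) _; apply: ler_sum => a ad.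
rewrite normrM ler_wpM2l//; apply: mono_bound => //; first by rewrite le_max lexx.
by move=> i; rewrite le_max xs orbT.
Qed.

(** On each line through the origin the polynomial is a polynomial in one variable with more roots
    than its size allows. *)
Lemma is_polyd_zero_near0 (d : nat) (P : V -> R) (e : R) : is_polyd d P -> 0 < e ->
  (forall x : V, (forall i, `|x i 0| < e) -> P x = 0) -> forall x, P x = 0.
Proof.
move=> [c cP] e0 P0 x.
pose q : {poly R} := \sum_(a : {ffun 'I_n -> 'I_d.+1} | (\sum_(i < n) (a i : nat) <= d)%N)
  (c a * mono a x) *: 'X^(\sum_i (a i : nat)).
have qE t : q.[t] = P (t *: x).
  rewrite cP /q horner_sum; apply: eq_bigr => a _.
  rewrite hornerZ hornerXn -mulrA; congr (_ * _); rewrite /mono.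
  under [RHS]eq_bigr do rewrite mxE exprMn.
  by rewrite big_split /= prodrXr mulrC.
pose S := \sum_i `|x i 0| + 1.
have S0 : 0 < S by rewrite ltr_wpDl// sumr_ge0.
have q0 : q = 0.
  apply: contrapT => /eqP qn0.
  pose t k : R := e / (S * k.+1%:R).
  have tE k : 0 < t k by rewrite divr_gt0// mulr_gt0// ltr0n.
  have tinj : injective t.
    move=> k l /(mulfI (lt0r_neq0 e0)) /invr_inj /(mulfI (lt0r_neq0 S0)) /eqP.
    by rewrite eqr_nat => /eqP [].
  have rt k : root q (t k).
    rewrite /root qE; apply/eqP; apply: P0 => i; rewrite mxE normrM (gtr0_norm (tE k)).
    rewrite /t mulrAC ltr_pdivrMr ?mulr_gt0 ?ltr0n// ltr_pM2l//.
    have xS : `|x i 0| < S by rewrite /S (bigD1 i)//= -addrA ltrDl ltr_wpDl// sumr_ge0.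
    apply: lt_le_trans xS _; rewrite ler_peMr ?ler1n//; exact: ltW.
  have := max_poly_roots qn0 (rs := map t (iota 0 (size q))).
  rewrite size_map size_iota ltnn => H; have : false by apply: H; [apply/allP => _ /mapP[k _ ->]|rewrite map_inj_uniq// iota_uniq].
  by [].
by have := qE 1; rewrite q0 horner0 scale1r => <-.
Qed.

End PolyAffine.

Section Gram.
Context {R : realType} {n : nat} (A : 'M[R]_n.+1) (D : set 'cV[R]_n.+1) (r : R).
Hypotheses (hA : dilation A) (hD : ellipsoid0 D) (hDvol : Rvol D = 1%E) (hr : 1 < r)
  (hrA : [set r *: x | x in D] `<=` [set A *m x | x in D]).

Local Notation V := (cvM R n.+1).
Local Notation mu := (@vol R n.+1).
Local Notation b := `|\det A|.

Let b1 : 1 < b. Proof. exact: (det_gt1 hA hD hDvol hr hrA). Qed.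
Let b0 : 0 < b. Proof. exact: lt_trans b1. Qed.

Lemma dball_bounded x k : exists s : R, forall y, dball A D x k y -> forall i, `|y i 0| <= s.
Proof.
have [M M0 DM] := ellipsoid0_bounded hD.
exists (\sum_i \sum_j `|Apow A k i j| * M + \sum_i `|x i 0|) => y.
rewrite dball_image => -[z Dz <-] i; rewrite mxE.
apply: le_trans (ler_normD _ _) _; apply: lerD; last first.
  by rewrite (bigD1 i)//= lerDl sumr_ge0.
apply: (@le_trans _ _ (\sum_j `|Apow A k i j| * M)); last first.
  rewrite [leRHS](bigD1 i)//= lerDl sumr_ge0// => l _; rewrite sumr_ge0// => j _.
  by rewrite mulr_ge0// ltW.
rewrite mxE; apply: le_trans (ler_norm_sum _ _ _) _; apply: ler_sum => j _.
by rewrite normrM ler_wpM2l//; exact: DM.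
Qed.

Lemma vol_dball_lty x k : (mu (dball A D x k) < +oo)%E.
Proof. by rewrite (vol_dball hA hD hDvol) ltry. Qed.

Lemma integrable_is_polyd d P x k : is_polyd d P ->
  mu.-integrable (dball A D x k : set V) (EFin \o (P : V -> R)).
Proof.
move=> hP; apply: measurable_bounded_integrable.
- exact: (measurable_dball hA hD).
- exact: vol_dball_lty.
- by apply: measurable_funTS; exact: measurable_is_polyd hP.
have [s hs] := dball_bounded x k; have [M HM] := is_polyd_bounded hP s.
exists M; split; first exact: num_real.
move=> M' MM' y /= By; apply: le_trans (ltW MM'); apply: HM; exact: hs.
Qed.

Lemma open_vol0_empty (U : set 'cV[R]_n.+1) : open U -> mu U = 0%E -> U = set0.
Proof.
move=> oU U0; apply/seteqP; split => // x Ux.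
have /nbhs_ballP[e /= e0 eU] : nbhs x U by exact: open_nbhs_nbhs.
have [k Hk] := Bk_small hA hD hr hrA e0.
have BU : dball A D x k `<=` U.
  move=> y; rewrite dballP => /Hk ye; apply: eU; split => // i j.
  by rewrite (ord1 j) -ball_normE /= distrC; move: (ye i); rewrite !mxE.
have : (mu (dball A D x k) <= mu U)%E.
  apply: le_measure => //; rewrite inE; first exact: (measurable_dball hA hD).
  exact: open_measurable_cV.
by rewrite U0 (vol_dball hA hD hDvol) lee_fin leNgt exprz_gt0.
Qed.

(** Inside the ball the set where [P] is nonzero is open and null, hence empty. *)
Lemma is_polyd_sqr_integral0 d P x k : is_polyd d P ->
  (\int[mu]_(y in dball A D x k) (P y ^+ 2)%:E)%E = 0%E ->
  forall y, dball A D x k y -> P y = 0.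
Proof.
move=> hP I0 y By; apply: contrapT => /eqP Py.
have hP2 := is_polydX 2 hP.
have mB := measurable_dball hA hD x k.
have mP2 : measurable_fun (dball A D x k : set V) (fun y => (P y ^+ 2)%:E).
  by apply/measurable_EFinP; apply: measurable_funTS; exact: measurable_is_polyd hP2.
have : (\int[mu]_(y in dball A D x k) `|(P y ^+ 2)%:E| = 0)%E.
  by rewrite -[RHS]I0; apply: eq_integral => z _; rewrite gee0_abs// lee_fin sqr_ge0.
move=> /(ae_eq_integral_abs _ mB mP2)[N [mN N0 HN]].
pose U := dball A D x k `&` P @^-1` [set t | t != 0].
have oU : open U.
  apply: openI; first exact: (dball_open hA hD).
  apply: open_comp; last exact: open_neq.
  by move=> z _; exact: (continuous_is_polyd hP).
have : U = set0.
  apply: open_vol0_empty => //; apply: (subset_measure0 _ mN _ N0).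
    exact: open_measurable_cV.
  move=> z [Bz /= Pz]; apply: HN => /= /(_ Bz) [] /eqP.
  by rewrite sqrf_eq0 (negbTE Pz).
by move=> U0; have : U y by []; rewrite U0.
Qed.

Lemma is_polyd_eq0 d P x k : is_polyd d P ->
  (forall y, dball A D x k y -> P y = 0) -> forall y, P y = 0.
Proof.
move=> hP P0 y.
have [e e0 eD] := ball_sub_Bk hD.
have hQ := is_polyd_affine (Apow A k) x hP.
have Q0 z : P (Apow A k *m z + x) = 0.
  move: z; apply: (is_polyd_zero_near0 hQ e0) => z ze; apply: P0.
  by rewrite dball_image; exists z => //; exact: eD.
rewrite -(Q0 (Apow A (- k) *m (y - x))) mulmxA ApowNr// mul1mx subrK//.
Qed.

Variable d : nat.

Let T := {ffun 'I_n.+1 -> 'I_d.+1}.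
Let N := #|{: T}|.

(** All exponent tuples with entries at most [d] are indexed, and those of total degree above [d]
    give the zero function. The Gram matrix may therefore be singular. *)
Definition poly_basis (i : 'I_N) (x : 'cV[R]_n.+1) : R :=
  if (\sum_(j < n.+1) (enum_val i j : nat) <= d)%N then mono (enum_val i) x else 0.

Lemma is_polyd_basis i : is_polyd d (poly_basis i).
Proof.
rewrite /poly_basis; case: (leqP _ d) => h; last exact: is_polyd0.
exact: is_polyd_monomial.
Qed.

Definition poly_of (c : 'cV[R]_N) (x : 'cV[R]_n.+1) : R := \sum_i c i 0 * poly_basis i x.

Lemma is_polyd_of c : is_polyd d (poly_of c).
Proof. by apply: is_polyd_sum => i _; apply: is_polydZ; exact: is_polyd_basis. Qed.

Lemma is_polyd_ofP P : is_polyd d P -> exists c, P = poly_of c.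
Proof.
move=> [e eP]; exists (\col_i e (enum_val i)); apply/funext => x; rewrite eP.
rewrite /poly_of big_mkcond /= (reindex (@enum_val T {: T})) /=; last first.
  by apply: onW_bij; exact: enum_val_bij.
apply: eq_bigr => i _; rewrite mxE /poly_basis; case: ifP => //.
by rewrite mulr0.
Qed.

Definition gram (x : 'cV[R]_n.+1) (k : int) : 'M[R]_N :=
  \matrix_(i, j) \int[mu]_(y in (dball A D x k : set V)) (poly_basis i y * poly_basis j y).

Lemma integrable_basisM x k i P : is_polyd d P ->
  mu.-integrable (dball A D x k : set V) (EFin \o ((fun y => poly_basis i y * P y) : V -> R)).
Proof.
by move=> hP; apply: (@integrable_is_polyd (d + d)); apply: is_polydM => //; exact: is_polyd_basis.
Qed.

Lemma Rintegral_sum (B : set V) (I : Type) (s : seq I) (f : I -> V -> R) : measurable B ->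
  (forall i, mu.-integrable B (EFin \o f i)) ->
  \int[mu]_(y in B) (\sum_(i <- s) f i y) = \sum_(i <- s) \int[mu]_(y in B) f i y.
Proof.
move=> mB hf; elim: s => [|i s IH].
  rewrite big_nil; under eq_Rintegral do rewrite big_nil.
  by rewrite Rintegral_cst// mul0r.
rewrite big_cons -IH -RintegralD//.
  by apply: eq_Rintegral => y _; rewrite big_cons.
rewrite (_ : EFin \o _ = fun y => \sum_(j <- s) (f j y)%:E)%E.
  by apply: integrable_sum => // j _; exact: hf.
by apply/funext => y /=; rewrite sumEFin.
Qed.

Lemma gram_mulE x k c i : (gram x k *m c) i 0 =
  \int[mu]_(y in (dball A D x k : set V)) (poly_basis i y * poly_of c y).
Proof.
have mB := measurable_dball hA hD x k.
rewrite mxE; under [RHS]eq_Rintegral do rewrite /poly_of mulr_sumr.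
rewrite Rintegral_sum//.
  apply: eq_bigr => j _; rewrite mxE mulrC -RintegralZl//; last first.
    by apply: integrable_basisM; exact: is_polyd_basis.
  by apply: eq_Rintegral => y _; rewrite mulrCA.
by move=> j; apply: integrable_basisM; apply: is_polydZ; exact: is_polyd_basis.
Qed.

(** Pairing with [c] turns the hypothesis into a vanishing integral of the square of [poly_of c]. *)
Lemma gram_ker x k c : gram x k *m c = 0 -> forall y, poly_of c y = 0.
Proof.
move=> Gc; have hc := is_polyd_of c.
have mB := measurable_dball hA hD x k.
apply: (@is_polyd_eq0 d _ x k) => //; apply: (is_polyd_sqr_integral0 hc).
have iP2 : mu.-integrable (dball A D x k : set V) (EFin \o ((fun y => poly_of c y ^+ 2) : V -> R)).
  by apply: integrable_is_polyd; exact: is_polydX hc.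
rewrite -[LHS]fineK; last exact: integrable_fin_num iP2.
congr EFin; transitivity (\int[mu]_(y in (dball A D x k : set V)) (\sum_i c i 0 * (poly_basis i y * poly_of c y))).
  congr fine; apply: eq_integral => y _; congr EFin.
  by rewrite expr2 {1}/poly_of mulr_suml; apply: eq_bigr => i _; rewrite mulrA.
rewrite Rintegral_sum//.
  apply: big1 => i _; rewrite RintegralZl//; last exact: integrable_basisM.
  by rewrite -gram_mulE Gc mxE mulr0.
move=> i; apply: (@integrable_is_polyd (d + d)); apply: is_polydZ; apply: is_polydM => //.
exact: is_polyd_basis.
Qed.

(* Linear independence of the monomials is never needed: a functional killing the kernel of the
   Gram matrix lies in its row space, which gives existence of the projection. *)
Lemma gram_sub x k (v : 'rV[R]_N) : (forall c, (forall y, poly_of c y = 0) -> v *m c = 0) ->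
  (v <= gram x k)%MS.
Proof.
move=> hv; rewrite submxE; apply/eqP; apply/rowP => j; rewrite [RHS]mxE.
have := hv (col j (cokermx (gram x k))).
rewrite colE mulmxA -colE => H.
have /matrixP/(_ 0 0) : col j (v *m cokermx (gram x k)) = 0.
  by rewrite [LHS]colE; apply: H; apply: (@gram_ker x k); rewrite colE mulmxA mulmx_coker mul0mx.
by rewrite !mxE.
Qed.

End Gram.

Section Projection.
Context {R : realType} {n : nat} (A : 'M[R]_n.+1) (D : set 'cV[R]_n.+1) (r : R).
Hypotheses (hA : dilation A) (hD : ellipsoid0 D) (hDvol : Rvol D = 1%E) (hr : 1 < r)
  (hrA : [set r *: x | x in D] `<=` [set A *m x | x in D]).

Local Notation V := (cvM R n.+1).
Local Notation mu := (@vol R n.+1).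
Local Notation b := `|\det A|.
Local Notation ball x k := (dball A D x k : set V).

Let b1 : 1 < b. Proof. exact: (det_gt1 hA hD hDvol hr hrA). Qed.
Let b0 : 0 < b. Proof. exact: lt_trans b1. Qed.
Let bz0 (l : int) : 0 < b ^ l. Proof. exact: exprz_gt0. Qed.

Lemma int_onE (E : set V) (f : V -> \bar R) : measurable E -> measurable_fun setT f ->
  (forall x, (0 <= f x)%E) -> int_on E f = (\int[mu]_(x in E) f x)%E.
Proof.
move=> mE mf f0; rewrite /int_on iintE.
- rewrite [RHS]integral_mkcond; apply: eq_integral => x _.
  by rewrite patchE indicE; case: ifP; rewrite ?mul1e ?mul0e.
- by apply: emeasurable_funM => //; apply/measurable_EFinP; exact: measurable_indic.
- by move=> x; rewrite mule_ge0// lee_fin.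
Qed.

Lemma sint_onE (E : set V) (f : V -> R) : measurable E -> measurable_fun setT f ->
  sint_on E f = (\int[mu]_(x in E) (f x)%:E)%E.
Proof.
move=> mE mf; rewrite /sint_on !int_onE//.
- rewrite [RHS]integralE; congr (_ - _)%E; apply: eq_integral => x _.
    by rewrite funeposE -EFin_max.
  by rewrite funenegE -EFin_max.
- by apply/measurable_EFinP; apply: measurable_maxr => //; exact: measurable_funN.
- by move=> x; rewrite lee_fin le_max lexx orbT.
- by apply/measurable_EFinP; exact: measurable_maxr.
- by move=> x; rewrite lee_fin le_max lexx orbT.
Qed.

Lemma integrableZl_EFin (B : set V) (t : R) (f : V -> R) : measurable B ->
  mu.-integrable B (EFin \o f) -> mu.-integrable B (EFin \o (fun y => t * f y)).
Proof.
move=> mB jf; rewrite (_ : EFin \o _ = (fun y => t%:E * (EFin \o f) y)%E); first exact: integrableZl.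
by apply/funext => y /=; rewrite EFinM.
Qed.

Lemma integrableM_is_polyd d x k (g h : V -> R) : is_polyd d h ->
  mu.-integrable (ball x k) (EFin \o g) ->
  mu.-integrable (ball x k) (EFin \o (fun y => g y * h y)).
Proof.
move=> hh ig.
rewrite (_ : EFin \o _ = ((EFin \o h) \* (EFin \o g))%E); last first.
  by apply/funext => y /=; rewrite mulrC EFinM.
apply: integrableMr => //.
- exact: (measurable_dball hA hD).
- by apply: measurable_funTS; exact: measurable_is_polyd hh.
have [s hs] := dball_bounded A hD x k; have [M HM] := is_polyd_bounded hh s.
exists M; split; first exact: num_real.
move=> M' MM' y /= By; apply: le_trans (ltW MM'); apply: HM; exact: hs.
Qed.

Lemma integrableB_is_polyd d x k (g h : V -> R) : is_polyd d h ->
  mu.-integrable (ball x k) (EFin \o g) ->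
  mu.-integrable (ball x k) (EFin \o (fun y => g y - h y)).
Proof.
move=> hh ig; rewrite (_ : EFin \o _ = ((EFin \o g) \- (EFin \o h))%E)//.
apply: integrableB => //; first exact: (measurable_dball hA hD).
exact: (integrable_is_polyd hA hD hDvol x k hh).
Qed.

(** Normal equations: the moments of [g] annihilate the kernel of the Gram matrix, so they are a
    combination [w] of its rows, and [w] provides the coefficients of the projection. *)
Lemma projection_exists d x k (g : V -> R) : mu.-integrable (ball x k) (EFin \o g) ->
  exists2 P : 'cV[R]_n.+1 -> R, is_polyd d P & forall h, is_polyd d h ->
    \int[mu]_(y in ball x k) ((g y - P y) * h y) = 0.
Proof.
move=> ig; have mB := measurable_dball hA hD x k.
pose N := #|{: {ffun 'I_n.+1 -> 'I_d.+1}}|.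
pose v : 'rV[R]_N := \row_i \int[mu]_(y in ball x k) (g y * poly_basis i y).
have igP P : is_polyd d P -> mu.-integrable (ball x k) (EFin \o (fun y => g y * P y)).
  by move=> hP; exact: integrableM_is_polyd hP ig.
have vc c : (v *m c) 0 0 = \int[mu]_(y in ball x k) (g y * poly_of c y).
  rewrite mxE; under [RHS]eq_Rintegral do rewrite /poly_of mulr_sumr.
  rewrite Rintegral_sum//; last first.
    by move=> i; apply: igP; apply: is_polydZ; exact: is_polyd_basis.
  apply: eq_bigr => i _; rewrite mxE mulrC -RintegralZl//; last by apply: igP; exact: is_polyd_basis.
  by apply: eq_Rintegral => y _; rewrite mulrCA.
have /submxP[w vw] : (v <= gram A D d x k)%MS.
  apply: (gram_sub hA hD hDvol hr hrA) => c c0; apply/matrixP => i j; rewrite !ord1 vc [RHS]mxE.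
  by under eq_Rintegral do rewrite c0 mulr0; rewrite Rintegral_cst// mul0r.
have gramT : (gram A D d x k)^T = gram A D d x k.
  by apply/matrixP => i j; rewrite !mxE; apply: eq_Rintegral => y _; rewrite mulrC.
have Pw : is_polyd d (poly_of w^T) by exact: is_polyd_of.
exists (poly_of w^T) => // h hh; have [c ->] := is_polyd_ofP hh.
have hc := is_polyd_of c.
under eq_Rintegral do rewrite mulrBl.
rewrite RintegralB//; last 2 first.
  exact: igP.
  by apply: (integrable_is_polyd hA hD hDvol x k (d := d + d)); exact: is_polydM.
rewrite -vc vw; apply/eqP; rewrite subr_eq0; apply/eqP.
transitivity (\sum_i w 0 i * (gram A D d x k *m c) i 0).
  by rewrite -mulmxA mxE.
under eq_bigr do rewrite (gram_mulE hA hD hDvol).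
under [RHS]eq_Rintegral do rewrite {1}/poly_of mulr_suml.
rewrite Rintegral_sum//; last first.
  move=> i; apply: (integrable_is_polyd hA hD hDvol x k (d := d + d)); apply: is_polydM => //.
  by apply: is_polydZ; exact: is_polyd_basis.
apply: eq_bigr => i _; rewrite mxE -RintegralZl//; last first.
  by apply: (integrable_is_polyd hA hD hDvol x k (d := d + d)); apply: is_polydM => //; exact: is_polyd_basis.
by apply: eq_Rintegral => y _; rewrite mulrA.
Qed.

Lemma projP_spec d x k (g : V -> R) : measurable_fun setT g ->
  mu.-integrable (ball x k) (EFin \o g) ->
  is_polyd d (projP d (ball x k) g) /\ forall h, is_polyd d h ->
    \int[mu]_(y in ball x k) ((g y - projP d (ball x k) g y) * h y) = 0.
Proof.
move=> mg ig; have mB := measurable_dball hA hD x k.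
have sintE P h : is_polyd d P -> is_polyd d h ->
    sint_on (ball x k) (fun y => (g y - P y) * h y) =
    (\int[mu]_(y in ball x k) ((g y - P y) * h y))%:E.
  move=> hP hh; rewrite sint_onE//.
    rewrite /Rintegral fineK//.
    have /(integrable_fin_num mB) := integrableM_is_polyd hh (integrableB_is_polyd hP ig).
    exact.
  apply: measurable_funM; last exact: measurable_is_polyd hh.
  by apply: measurable_funB => //; exact: measurable_is_polyd hP.
have [P hP HP] := projection_exists d ig.
rewrite /projP; case: xgetP => [Q _ [hQ HQ]|/(_ P)[]]; last first.
  by split => // h hh; rewrite sintE// HP.
split => // h hh.
by have := HQ h hh; rewrite sintE// => -[].
Qed.

Lemma poly_basis_bound d i (x : 'cV[R]_n.+1) (s : R) : 1 <= s -> (forall j, `|x j 0| <= s) ->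
  `|@poly_basis R n d i x| <= s ^+ d.
Proof.
move=> s1 xs; rewrite /poly_basis; case: ifPn => h; first exact: mono_bound.
by rewrite normr0 exprn_ge0// (le_trans _ s1).
Qed.

Lemma dball00 : dball A D 0 0 = D.
Proof.
by apply/seteqP; split => x; rewrite dballP subr0 (BkP _ hA) oppr0 mul1mx.
Qed.

(** Evaluation at [x] factors through the Gram matrix of D, so P(x) is a combination of the moments
    of P on D, each bounded by a constant times the L^1 norm of P there. The pseudo-inverse is
    independent of [x], so the point enters only through s^d. *)
Lemma is_polyd_growth d : exists2 C : R, 0 <= C & forall P, is_polyd d P ->
  forall (x : 'cV[R]_n.+1) (s : R), 1 <= s -> (forall j, `|x j 0| <= s) ->
  `|P x| <= C * s ^+ d * \int[mu]_(y in D) `|P y|.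
Proof.
rewrite -dball00; pose G := gram A D d 0 0; have mB := measurable_dball hA hD 0 0.
have [s0 hs0] := dball_bounded A hD 0 0.
pose M := Num.max 1 s0 ^+ d.
have M0 : 0 <= M by rewrite exprn_ge0// le_max ler01.
exists (\sum_i (\sum_j `|pinvmx G j i|) * M).
  by rewrite sumr_ge0// => i _; rewrite mulr_ge0// sumr_ge0.
move=> P hP x s s1 xs; have [c Pc] := is_polyd_ofP hP.
pose v : 'rV[R]__ := \row_i @poly_basis R n d i x.
have vc c' : (v *m c') 0 0 = poly_of c' x.
  by rewrite mxE; apply: eq_bigr => i _; rewrite mxE mulrC.
have vG : (v <= G)%MS.
  apply: (gram_sub hA hD hDvol hr hrA) => c' c0.
  by apply/matrixP => i j; rewrite !ord1 vc c0 mxE.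
have vE := mulmxKpV vG.
have -> : P x = \sum_i (v *m pinvmx G) 0 i * (G *m c) i 0.
  transitivity (((v *m pinvmx G) *m (G *m c)) 0 0); last by rewrite mxE.
  by rewrite mulmxA vE vc -Pc.
apply: le_trans (ler_norm_sum _ _ _) _.
rewrite -mulrA mulr_suml; apply: ler_sum => i _.
rewrite normrM mulrACA.
have iP : mu.-integrable (ball 0 0) (EFin \o (P : V -> R)) by exact: (integrable_is_polyd hA hD hDvol 0 0 hP).
have inP : mu.-integrable (ball 0 0) (EFin \o (fun y => `|P y|)) by exact: integrable_norm.
apply: ler_pM => //.
- rewrite mxE mulr_suml; apply: le_trans (ler_norm_sum _ _ _) _; apply: ler_sum => j _.
  rewrite normrM mulrC ler_wpM2l// mxE; exact: poly_basis_bound.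
- rewrite (gram_mulE hA hD hDvol) -Pc.
  have ib : mu.-integrable (ball 0 0) (EFin \o (fun y => poly_basis i y * P y)).
    exact: (integrable_basisM hA hD hDvol).
  apply: le_trans (le_normr_Rintegral _ ib) _ => //.
  rewrite -RintegralZl//; apply: le_Rintegral => //.
  + exact: integrable_norm.
  + exact: integrableZl_EFin.
  move=> y By; rewrite normrM ler_wpM2r//; apply: poly_basis_bound.
    by rewrite le_max lexx.
  by move=> j; rewrite le_max (hs0 _ By) orbT.
Qed.

Lemma fine_mulEFin (t : R) (x : \bar R) : 0 < t -> fine (t%:E * x) = t * fine x.
Proof.
move=> t0; case: x => [x| |] //=; rewrite ?mulr0.
- by rewrite gt0_muley ?lte_fin.
- by rewrite gt0_muleNy ?lte_fin.
Qed.

Lemma Rintegral_dball x k (f : V -> R) : measurable_fun setT f -> (forall y, 0 <= f y) ->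
  \int[mu]_(y in ball x k) f y = b ^ k * \int[mu]_(y in D) f (Apow A k *m y + x).
Proof.
move=> mf f0; rewrite /Rintegral dball_image.
rewrite (integral_affine_image x (Apow_unit hA k) (measurable_ellipsoid0 hD) (f := EFin \o f)).
- by rewrite det_Apow fine_mulEFin.
- exact/measurable_EFinP.
- by move=> y /=; rewrite lee_fin.
Qed.

Variables (lm lp : R).
Hypothesis hlam : eig_bounds A lm lp.

(** Pulled back to D by A^(-l), the point has coordinates of size lp^k, and degree d costs the d-th
    power of that size. *)
Lemma is_polyd_dball_growth d : exists2 C : R, 0 <= C & forall P, is_polyd d P ->
  forall (x z : 'cV[R]_n.+1) (l : int) (k : nat), Bk A D (l + k%:Z) (z - x) ->
  `|P z| <= C * (lp ^+ k) ^+ d / b ^ l * \int[mu]_(y in ball x l) `|P y|.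
Proof.
have [C0 C00 HC0] := is_polyd_growth d.
have [C1 C10 HC1] := Bk_growth hD hlam.
have lp1 := eig_bounds_gt1 hlam; have lp0 : 0 < lp by exact: lt_trans lp1.
exists (C0 * Num.max 1 C1 ^+ d) => [|P hP x z l k Bz].
  by rewrite mulr_ge0// exprn_ge0// le_max ler01.
pose Q y := P (Apow A l *m y + x).
have hQ : is_polyd d Q by exact: is_polyd_affine.
have mP := measurable_is_polyd hP.
have := HC0 Q hQ (Apow A (- l) *m (z - x)) (Num.max 1 C1 * lp ^+ k).
rewrite {1}/Q mulmxA ApowNr// mul1mx subrK => H.
rewrite Rintegral_dball//; last exact: measurableT_comp.
rewrite mulrA divfK ?gt_eqF// -[X in X * _]mulrA -exprMn; apply: H.
  rewrite -[leLHS]mulr1 ler_pM// ?le_max ?lexx// exprn_ege1// ltW//.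
move=> j; move: Bz => /(Bk_shift D hA) /HC1 /(_ j) /le_trans; apply.
rewrite ler_wpM2r//; last by rewrite le_max lexx orbT.
by rewrite exprn_ge0// ltW.
Qed.

(** Cauchy-Schwarz against a constant: the integral of (|S| - t)^2 is nonnegative at the mean [t] of
    |S|. *)
Lemma Rintegral_sqr_le x l (S : V -> R) : measurable_fun setT S ->
  mu.-integrable (ball x l) (EFin \o S) ->
  mu.-integrable (ball x l) (EFin \o (fun y => S y ^+ 2)) ->
  (\int[mu]_(y in ball x l) `|S y|) ^+ 2 <= b ^ l * \int[mu]_(y in ball x l) (S y ^+ 2).
Proof.
move=> mS iS iS2; have mB := measurable_dball hA hD x l.
set a := \int[mu]_(y in _) `|S y|; set I2 := \int[mu]_(y in _) _.
have inS : mu.-integrable (ball x l) (EFin \o (fun y => `|S y|)) by exact: integrable_norm.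
have ic (t : R) : mu.-integrable (ball x l) (EFin \o (fun=> t)).
  exact: (integrable_is_polyd hA hD hDvol x l (is_polyd_cst 0 t)).
have iZ (t : R) f := @integrableZl_EFin _ t f mB.
have iD f g : mu.-integrable (ball x l) (EFin \o f) -> mu.-integrable (ball x l) (EFin \o g) ->
    mu.-integrable (ball x l) (EFin \o (fun y => f y + g y)).
  by move=> jf jg; rewrite (_ : EFin \o _ = ((EFin \o f) \+ (EFin \o g))%E)//; exact: integrableD.
pose t := a / b ^ l.
have : 0 <= \int[mu]_(y in ball x l) (S y ^+ 2 + ((- (2 * t)) * `|S y| + t ^+ 2)).
  apply: Rintegral_ge0 => y _.
  have -> : S y ^+ 2 + (- (2 * t) * `|S y| + t ^+ 2) = (`|S y| - t) ^+ 2.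
    by rewrite -[S y ^+ 2]real_normK ?num_real//; ring.
  exact: sqr_ge0.
rewrite RintegralD//; last by apply: iD => //; exact: iZ.
rewrite RintegralD//; last exact: iZ.
have cstE : \int[mu]_(y in ball x l) (t ^+ 2) = t ^+ 2 * b ^ l.
  rewrite Rintegral_cst//; congr (_ * _); apply: (congr1 fine (vol_dball hA hD hDvol x l)).
rewrite RintegralZl// cstE -/a -/I2 => H.
have -> : a = t * b ^ l by rewrite /t divfK// gt_eqF.
move: H; have -> : a = t * b ^ l by rewrite /t divfK// gt_eqF.
move: (bz0 l) => bl0 H.
have : 0 <= b ^ l * (I2 + (- (2 * t) * (t * b ^ l) + t ^+ 2 * b ^ l)).
  by rewrite mulr_ge0// ltW.
by rewrite -subr_ge0; congr (0 <= _); ring.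
Qed.

(** Let S be the projection minus [Q]. Orthogonality turns the integral of S^2 into that of (g - Q)
    S, at most sup |S| times the integral of |g - Q|. On the ball, sup |S| is at most C times the
    mean of |S|, while Cauchy-Schwarz bounds the integral of S^2 from below. Hence the L^1 norm of S
    is at most C times that of g - Q, and polynomial growth moves this to the point [z]. The added 1
    only makes the constant positive. *)
Lemma projP_bound d : exists2 C : R, 0 < C & forall (g : V -> R) (x z : 'cV[R]_n.+1)
    (l : int) (k : nat) Q, measurable_fun setT g ->
  mu.-integrable (ball x l) (EFin \o g) -> is_polyd d Q -> Bk A D (l + k%:Z) (z - x) ->
  `|projP d (ball x l) g z - Q z| <=
    C * (lp ^+ k) ^+ d / b ^ l * \int[mu]_(y in ball x l) `|g y - Q y|.
Proof.
have [C C0 HC] := is_polyd_dball_growth d.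
have lp1 := eig_bounds_gt1 hlam; have lp0 : 0 < lp by exact: lt_trans lp1.
exists (C * C + 1) => [|g x z l k Q mg ig hQ Bz].
  by rewrite ltr_wpDl// mulr_ge0.
have mB := measurable_dball hA hD x l.
have [hP HP] := projP_spec d mg ig; set P := projP _ _ _ in hP HP *.
pose S y := P y - Q y; have hS : is_polyd d S by exact: is_polydB.
have mS := measurable_is_polyd hS.
have iS : mu.-integrable (ball x l) (EFin \o (S : V -> R)) by exact: (integrable_is_polyd hA hD hDvol x l hS).
have hS2 := is_polydX 2 hS.
have iS2 : mu.-integrable (ball x l) (EFin \o ((fun y => S y ^+ 2) : V -> R)).
  exact: (integrable_is_polyd hA hD hDvol x l hS2).
have igQ : mu.-integrable (ball x l) (EFin \o (fun y => g y - Q y)) by exact: integrableB_is_polyd hQ ig.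
have ingQ : mu.-integrable (ball x l) (EFin \o (fun y => `|g y - Q y|)) by exact: integrable_norm.
set I := \int[mu]_(y in ball x l) `|g y - Q y|.
have I0 : 0 <= I by exact: Rintegral_ge0.
set a := \int[mu]_(y in ball x l) `|S y|.
have a0 : 0 <= a by exact: Rintegral_ge0.
have supS y : ball x l y -> `|S y| <= C / b ^ l * a.
  rewrite dballP => By; have := HC S hS x y l 0%N; rewrite addr0 expr0 expr1n mulr1; exact.
have S2E : \int[mu]_(y in ball x l) (S y ^+ 2) = \int[mu]_(y in ball x l) ((g y - Q y) * S y).
  apply/eqP; rewrite -subr_eq0 -RintegralB//; last exact: integrableM_is_polyd hS igQ.
  apply/eqP; rewrite -[RHS](mulr0 (-1)) -(HP S hS) -RintegralZl//; last first.
    by apply: integrableM_is_polyd hS _; exact: integrableB_is_polyd hP ig.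
  by apply: eq_Rintegral => y _; rewrite /S; ring.
have aI : a <= C * I.
  have [->|an0] := eqVneq a 0; first by rewrite mulr_ge0.
  have a_gt0 : 0 < a by rewrite lt_def an0.
  rewrite -(ler_pM2l a_gt0) -expr2; apply: le_trans (Rintegral_sqr_le mS iS iS2) _.
  rewrite S2E.
  apply: (@le_trans _ _ (b ^ l * ((C / b ^ l * a) * I))); last first.
    by rewrite le_eqVlt; apply/orP; left; apply/eqP; field; rewrite gt_eqF.
  rewrite ler_pM2l//.
  have igS : mu.-integrable (ball x l) (EFin \o (fun y => (g y - Q y) * S y)) by exact: integrableM_is_polyd hS igQ.
  apply: le_trans (ler_norm _) _; apply: le_trans (le_normr_Rintegral _ igS) _ => //.
  rewrite -RintegralZl//; apply: le_Rintegral => //.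
  - exact: integrable_norm.
  - exact: integrableZl_EFin.
  by move=> y By; rewrite normrM mulrC ler_wpM2r//; exact: supS.
apply: le_trans (HC S hS x z l k Bz) _; rewrite -/a.
apply: (@le_trans _ _ (C * (lp ^+ k) ^+ d / b ^ l * (C * I))).
  by rewrite ler_wpM2l// divr_ge0 ?(ltW (bz0 l))// mulr_ge0// exprn_ge0// exprn_ge0// ltW.
have -> : C * (lp ^+ k) ^+ d / b ^ l * (C * I) = (C * C) * ((lp ^+ k) ^+ d / b ^ l * I).
  by field; rewrite gt_eqF.
have -> : (C * C + 1) * (lp ^+ k) ^+ d / b ^ l * I = (C * C + 1) * ((lp ^+ k) ^+ d / b ^ l * I).
  by rewrite !mulrA.
rewrite ler_wpM2r ?lerDl// mulr_ge0// divr_ge0 ?(ltW (bz0 l))// exprn_ge0// exprn_ge0//.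
exact: ltW.
Qed.

End Projection.

(** * Vitali and Whitney coverings *)

Section Vitali.
Context {R : realType} {n : nat} (A : 'M[R]_n.+1) (D : set 'cV[R]_n.+1) (r : R).
Hypotheses (hA : dilation A) (hD : ellipsoid0 D) (hDvol : Rvol D = 1%E) (hr : 1 < r)
  (hrA : [set r *: x | x in D] `<=` [set A *m x | x in D]).

Local Notation V := (cvM R n.+1).
Local Notation mu := (@vol R n.+1).
Local Notation b := `|\det A|.
Local Notation T := ('cV[R]_n.+1 * int)%type.
Local Notation sg := ((dsig hr)%:Z).

Let b1 : 1 < b. Proof. exact: (det_gt1 hA hD hDvol hr hrA). Qed.
Let b0 : 0 < b. Proof. exact: lt_trans b1. Qed.
Let bz0 (l : int) : 0 < b ^ l. Proof. exact: exprz_gt0. Qed.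

(** A ball is kept as the pair of its centre and level, so that dilation acts on the pair. *)
Definition pball (p : T) : set V := dball A D p.1 p.2.
Definition dil (k : int) (p : T) : T := (p.1, p.2 + k).

Lemma pballP p x : pball p x <-> Bk A D p.2 (x - p.1).
Proof. exact: dballP. Qed.

Lemma pball_center p : pball p p.1.
Proof. by rewrite /pball dballP subrr; exact: Bk_center. Qed.

Lemma BkDle k l m x y : k <= m -> l <= m ->
  Bk A D k x -> Bk A D l y -> Bk A D (m + sg) (x + y).
Proof.
by move=> km lm Bx By; apply: (BkD hA hD hr hrA);
  [exact: (Bk_le hA hD hr hrA km)|exact: (Bk_le hA hD hr hrA lm)].
Qed.

(** z - q.1 is a sum of three vectors through the common point, and each of the two additions costs
    [sg] levels. *)
Lemma pball_meet_sub p q : p.2 <= q.2 -> pball p `&` pball q !=set0 ->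
  pball p `<=` pball (dil (sg + sg) q).
Proof.
move=> pq [y []]; rewrite /pball !dballP => py qy z; rewrite !dballP => pz.
have -> : z - q.1 = ((z - p.1) + (- (y - p.1))) + (y - q.1).
  by rewrite opprB !subrKA.
rewrite /= addrA; apply: (@BkDle (q.2 + sg) q.2) => //.
  by rewrite lerDl.
by apply: (@BkDle p.2 p.2) => //; exact: BkN.
Qed.

Lemma exists_max_level (E : set T) (K : int) : E !=set0 -> (forall p, E p -> p.2 <= K) ->
  exists2 p, E p & forall q, E q -> q.2 <= p.2.
Proof.
move=> [p0 Ep0] EK.
pose f (p : T) := `|K - p.2|%N.
have ex : exists m : nat, `[< exists2 p, E p & f p = m >].
  by exists (f p0); apply/asboolP; exists p0.
have [m /asboolP[p Ep fp] mmin] := ex_minnP ex.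
exists p => // q Eq; have : (m <= f q)%N by apply: mmin; apply/asboolP; exists q.
rewrite -fp /f; have := EK _ Ep; have := EK _ Eq; lia.
Qed.

(* Zorn on disjoint subfamilies S such that every ball of F meeting S meets one of S of at least
   its level; a ball of maximal level missing S would extend S. *)
Lemma vitali_family (F : set T) (K : int) : (forall p, F p -> p.2 <= K) ->
  exists S : set T, [/\ S `<=` F,
    (forall p q, S p -> S q -> pball p `&` pball q !=set0 -> p = q) &
    forall p, F p -> exists2 q, S q & p.2 <= q.2 /\ pball p `&` pball q !=set0].
Proof.
move=> FK.
pose P (S : set T) := [/\ S `<=` F,
    (forall p q, S p -> S q -> pball p `&` pball q !=set0 -> p = q) &
    forall p, F p -> (exists2 q, S q & pball p `&` pball q !=set0) ->
      exists2 q, S q & p.2 <= q.2 /\ pball p `&` pball q !=set0].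
have [S [[SF Sd Sg] Smax]] : exists S, P S /\ forall S', S `<` S' -> ~ P S'.
  apply: Zorn_bigcup => C CP tC; split.
  - by move=> p [S CS Sp]; have [SF _ _] := CP _ CS; exact: SF.
  - move=> p q [S1 C1 S1p] [S2 C2 S2q].
    have [S12|S21] := tC _ _ C1 C2.
      by have [_ + _] := CP _ C2; apply => //; exact: S12.
    by have [_ + _] := CP _ C1; apply => //; exact: S21.
  - move=> p Fp [q [S CS Sq] pq]; have [_ _ /(_ p Fp)] := CP _ CS.
    by case=> [|q' Sq' H]; [exists q|exists q' => //; exists S].
exists S; split => // p Fp.
have [H|H] := pselect (exists2 q, S q & pball p `&` pball q !=set0); first exact: Sg.
exfalso; pose E := [set p | F p /\ ~ exists2 q, S q & pball p `&` pball q !=set0].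
have [p1 [Fp1 np1] p1max] := @exists_max_level E K (ex_intro _ p (conj Fp H)) (fun q h => FK q h.1).
apply: (Smax (S `|` [set p1])).
  split; first by move=> q; left.
  move=> /(_ p1 (or_intror erefl)) Sp1; apply: np1; exists p1 => //.
  by exists p1.1; split; exact: pball_center.
split.
- by move=> q [/SF//|->].
- move=> q q' [Sq|->] [Sq'|->] // qq'; first exact: Sd.
    by exfalso; apply: np1; exists q => //; rewrite setIC.
  by exfalso; apply: np1; exists q'.
- move=> q Fq [q' Sq' qq'].
  have [/(Sg _ Fq)[q'' Sq'' h]|nq] := pselect (exists2 q', S q' & pball q `&` pball q' !=set0).
    by exists q'' => //; left.
  exists p1; first by right.
  split; first by apply: p1max.
  by case: Sq' qq' => [Sq' qq'|-> //]; exfalso; apply: nq; exists q'.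
Qed.

Lemma pball_rat p : exists q : 'cV[rat]_n.+1, pball p (map_mx ratr q : 'cV[R]_n.+1).
Proof.
have oB : open (dball A D p.1 p.2 : set 'cV[R]_n.+1) by exact: (dball_open hA hD).
have := pball_center p; rewrite {1}/pball (open_bigcup_rat_ball oB) => -[[q m] /= qB _].
by exists q; apply: qB; apply: ballxx; rewrite invr_gt0 ltr0n.
Qed.

Definition oball (o : option T) : set V := if o is Some p then pball p else set0.

Lemma measurable_pball p : measurable (pball p).
Proof. exact: (measurable_dball hA hD). Qed.

Lemma measurable_oball o : measurable (oball o).
Proof. by case: o => [p|]; [exact: measurable_pball|exact: measurable0]. Qed.

Lemma vitali_seq (F : set T) (K : int) : (forall p, F p -> p.2 <= K) ->
  exists e : nat -> option T, [/\ (forall m p, e m = Some p -> F p),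
    trivIset setT (fun m => oball (e m)) &
    forall p, F p -> exists m q, [/\ e m = Some q, p.2 <= q.2 & pball p `&` pball q !=set0]].
Proof.
move=> FK; have [S [SF Sd Sg]] := vitali_family FK.
have [qf qfP] := choice pball_rat.
pose e m : option T := if pselect (exists p, S p /\ pickle (qf p) = m) is left H
  then Some (sval (cid H)) else None.
have eP m p : e m = Some p -> S p /\ pickle (qf p) = m.
  by rewrite /e; case: pselect => // H [<-]; case: cid.
have eS p : S p -> e (pickle (qf p)) = Some p.
  move=> Sp; rewrite /e; case: pselect => [H|]; last by case; exists p.
  congr Some; case: cid => p' /= [Sp' /(pcan_inj pickleK) qq]; apply: Sd => //.
  by exists (map_mx ratr (qf p)); split; [rewrite -qq|]; exact: qfP.
exists e; split.
- by move=> m p /eP[/SF].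
- apply/trivIsetP => i j _ _ ij.
  case Ei: (e i) => [p|]; last by rewrite set0I.
  case Ej: (e j) => [q|]; last by rewrite setI0.
  apply: contrapT => /eqP /set0P pq; move: ij.
  have [Sp <-] := eP _ _ Ei; have [Sq <-] := eP _ _ Ej.
  by rewrite (Sd _ _ Sp Sq pq) eqxx.
- move=> p /Sg[q Sq [pq H]]; exists (pickle (qf q)), q; split => //; exact: eS.
Qed.

Lemma vol_pball p : mu (pball p) = (b ^ p.2)%:E.
Proof. exact: (vol_dball hA hD hDvol). Qed.

Lemma exprz_bounded (C : R) : exists K : int, forall l : int, b ^ l <= C -> l <= K.
Proof.
have [m Hm] := expr_gt_exists (C + 1) b1.
exists m%:Z => l bl; rewrite leNgt; apply/negP => ml.
have : b ^ m%:Z < b ^ l by rewrite ltr_eXz2l.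
by rewrite -exprnP => h; move: (lt_le_trans (le_lt_trans Hm h) bl); rewrite ltNge lerDl ler01.
Qed.

(** The set where the uncentred maximal function of a nonnegative [w] exceeds [lam], written as a
    union of balls and so visibly open. *)
Definition level_set (w : V -> R) (lam : R) : set V :=
  \bigcup_(p in [set p : T | ((lam * b ^ p.2)%:E < \int[mu]_(y in pball p) (w y)%:E)%E]) pball p.

Lemma level_set_open w lam : open (level_set w lam : set 'cV[R]_n.+1).
Proof. by apply: bigcup_open => p _; exact: (dball_open hA hD). Qed.

Lemma level_set_notin w lam x p : ~ level_set w lam x -> pball p x ->
  (\int[mu]_(y in pball p) (w y)%:E <= (lam * b ^ p.2)%:E)%E.
Proof. by move=> nx px; rewrite leNgt; apply/negP => h; apply: nx; exists p. Qed.

Lemma exprz_dil (k l : int) : b ^ (k + l) = b ^ k * b ^ l.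
Proof. by rewrite expfzDr// gt_eqF. Qed.

(** Finiteness of the integral bounds the levels of the balls involved, as the Vitali selection
    requires; [b ^ (sg + sg)] is the volume ratio of the dilates that cover. *)
Lemma weak_type (w : V -> R) (lam : R) : 0 < lam -> measurable_fun setT w ->
  (forall y, 0 <= w y) -> (\int[mu]_y (w y)%:E < +oo)%E ->
  (lam%:E * mu (level_set w lam) <= (b ^ (sg + sg))%:E * \int[mu]_y (w y)%:E)%E.
Proof.
move=> lam0 mw w0 Woo.
pose F := [set p : T | ((lam * b ^ p.2)%:E < \int[mu]_(y in pball p) (w y)%:E)%E].
have mwE : measurable_fun setT (fun y => (w y)%:E) by exact/measurable_EFinP.
have IW (E : set V) : measurable E -> (\int[mu]_(y in E) (w y)%:E <= \int[mu]_y (w y)%:E)%E.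
  by move=> mE; apply: ge0_subset_integral => // y _; rewrite lee_fin.
pose W := fine (\int[mu]_y (w y)%:E).
have WE : (\int[mu]_y (w y)%:E = W%:E)%E.
  by rewrite fineK// ge0_fin_numE// integral_ge0// => y _; rewrite lee_fin.
have [K HK] := exprz_bounded (W / lam).
have FK p : F p -> p.2 <= K.
  move=> Fp; apply: HK; rewrite ler_pdivlMr// mulrC -lee_fin -WE.
  by apply: le_trans (ltW Fp) _; apply: IW; exact: measurable_pball.
have [e [eF eT eC]] := vitali_seq FK.
pose od m := if e m is Some p then pball (dil (sg + sg) p) else set0.
have mod m : measurable (od m).
  by rewrite /od; case: (e m) => [p|]; [exact: measurable_pball|exact: measurable0].
have sub : level_set w lam `<=` \bigcup_m od m.
  move=> x [p Fp px]; have [m [q [em pq H]]] := eC p Fp.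
  by exists m => //; rewrite /od em; exact: (pball_meet_sub pq H).
have mL : measurable (level_set w lam) by apply: open_measurable_cV; exact: level_set_open.
apply: (@le_trans _ _ (lam%:E * \sum_(m <oo) mu (od m))%E).
  apply: lee_wpmul2l; first by rewrite lee_fin ltW.
  exact: measure_sigma_subadditive.
rewrite -nneseriesZl//.
apply: (@le_trans _ _ (\sum_(m <oo) (b ^ (sg + sg))%:E * \int[mu]_(y in oball (e m)) (w y)%:E)%E).
  apply: lee_nneseries => [m _|m _]; first by rewrite mule_ge0// lee_fin ltW.
  rewrite /od; case em : (e m) => [p|]; last by rewrite measure0 mule0 integral_set0 mule0.
  rewrite vol_pball /= exprz_dil -EFinM mulrCA mulrA mulrC EFinM.
  apply: lee_wpmul2l; first by rewrite lee_fin ltW.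
  by rewrite mulrC; exact/ltW/(eF _ _ em).
rewrite nneseriesZl//; last first.
  by move=> m _; apply: integral_ge0 => y _; rewrite lee_fin.
apply: lee_wpmul2l; first by rewrite lee_fin ltW.
rewrite -ge0_integral_bigcup//.
- by apply: IW; apply: bigcupT_measurable => m; exact: measurable_oball.
- by move=> m; exact: measurable_oball.
- exact: measurable_funTS.
- by move=> y _; rewrite lee_fin.
Qed.

(** Around each point of W some ball has its dilate by 4 sg inside W and the next dilate not; the
    Vitali selection makes such balls disjoint while their dilates by 2 sg cover. Finite volume
    bounds the levels and makes dilates leave W eventually. The gap between 2 sg and 4 sg serves
    later to compare balls of two consecutive coverings. *)
Lemma whitney (W : set V) : open (W : set 'cV[R]_n.+1) -> (mu W < +oo)%E ->
  exists e : nat -> option T, [/\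
    (forall m p, e m = Some p -> pball (dil (4 * sg) p) `<=` W /\
                 ~ (pball (dil (4 * sg + 1) p) `<=` W)),
    trivIset setT (fun m => oball (e m)) &
    forall x, W x -> exists m p, e m = Some p /\ pball (dil (sg + sg) p) x].
Proof.
move=> oW Woo; have mW : measurable W by exact: open_measurable_cV.
pose F := [set p : T | pball (dil (4 * sg) p) `<=` W /\ ~ (pball (dil (4 * sg + 1) p) `<=` W)].
have WE : mu W = (fine (mu W))%:E by rewrite fineK// ge0_fin_numE.
have [K HK] := exprz_bounded (fine (mu W)).
have subK x l : pball (x, l) `<=` W -> l <= K.
  move=> BW; apply: HK; rewrite -lee_fin -WE -[l]/((x, l).2) -vol_pball.
  by apply: le_measure => //; rewrite inE//; exact: measurable_pball.
have FK p : F p -> p.2 <= K.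
  by move=> [/subK + _] => /=; apply: le_trans; rewrite lerDl mulr_ge0.
have [e [eF eT eC]] := vitali_seq FK.
exists e; split => // x Wx.
have [l Fl] : exists l : int, F (x, l).
  have /nbhs_ballP[d /= d0 dW] : nbhs (x : 'cV[R]_n.+1) W by exact: open_nbhs_nbhs.
  have [k Hk] := Bk_small hA hD hr hrA d0.
  have kW : pball (x, k) `<=` W.
    move=> y; rewrite /pball dballP => /Hk ye; apply: dW; split => // i j.
    by rewrite (ord1 j) -ball_normE /= distrC; move: (ye i); rewrite !mxE.
  pose k1 := K + 1.
  have nk1 : ~ (pball (x, k1) `<=` W) by move=> /subK; rewrite /k1 gerDl.
  have kk1 : k <= k1 by have := subK _ _ kW; rewrite /k1; lia.
  have : ~ (pball (x, k + `|k1 - k|%N%:Z) `<=` W).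
    by rewrite gez0_abs ?subr_ge0// addrCA subrr addr0.
  elim: `|_|%N => [|m IH]; first by rewrite addr0.
  rewrite (_ : Posz m.+1 = m%:Z + 1) ?addrA; last by rewrite -PoszD addn1.
  move=> nm; have [BW|/IH//] := pselect (pball (x, k + m%:Z) `<=` W).
  exists (k + m%:Z - 4 * sg); split; rewrite /pball /= ?addrA subrK//.
have [m [q [em pq H]]] := eC _ Fl.
by exists m, q; split => //; apply: (pball_meet_sub pq H); exact: pball_center.
Qed.

End Vitali.

(** * Function spaces *)

Section Space.
Context {R : realType} {n : nat} (A : 'M[R]_n.+1) (D : set 'cV[R]_n.+1) (r : R).
Hypotheses (hA : dilation A) (hD : ellipsoid0 D) (hDvol : Rvol D = 1%E) (hr : 1 < r)
  (hrA : [set r *: x | x in D] `<=` [set A *m x | x in D]).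

Local Notation V := (cvM R n.+1).
Local Notation mu := (@vol R n.+1).
Local Notation b := `|\det A|.
Local Notation T := ('cV[R]_n.+1 * int)%type.
Local Notation pball := (@pball R n A D).

Let b1 : 1 < b. Proof. exact: (det_gt1 hA hD hDvol hr hrA). Qed.
Let b0 : 0 < b. Proof. exact: lt_trans b1. Qed.
Let bz0 (l : int) : 0 < b ^ l. Proof. exact: exprz_gt0. Qed.

Lemma null_set0 : Defs.null_set (set0 : set V).
Proof.
by split; [exact: (@measurable0 _ V)|rewrite RvolE ?measure0].
Qed.

Lemma ae_all (P : V -> Prop) : (forall x, P x) -> Defs.ae P.
Proof. by move=> HP; exists set0; split => //; exact: null_set0. Qed.

Lemma lmeas_measurable (f : V -> \bar R) : measurable_fun setT f -> lmeas f.
Proof.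
move=> mf; exists f; split; last exact: ae_all.
by move=> E mE; have := mf measurableT _ mE; rewrite setTI.
Qed.

Lemma borel_fun_measurable (f : V -> \bar R) : borel_fun f -> measurable_fun setT f.
Proof. by move=> bf _ E mE; rewrite setTI; exact: bf. Qed.

Variable nX : (V -> \bar R) -> \bar R.
Hypothesis hX : ball_QBFS A D nX.

Lemma nX_ge0 f : measurable_fun setT f -> (0 <= nX f)%E.
Proof. by move=> /lmeas_measurable mf; case: hX => + _; apply. Qed.

Lemma nX_le f g : measurable_fun setT f -> measurable_fun setT g ->
  (forall x, (`|g x| <= `|f x|)%E) -> (nX g <= nX f)%E.
Proof.
move=> /lmeas_measurable mf /lmeas_measurable mg gf.
by case: hX => _ [_ [_ [_ [+ _]]]]; apply => //; exact: ae_all.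
Qed.

(** The axiom gives homogeneity for finite norms only. If f has infinite norm, a finite norm of c f
    would contradict the axiom for the factor 1/c. *)
Lemma nX_homog f (c : R) : 0 < c -> measurable_fun setT f ->
  nX (fun x => (c%:E * f x)%E) = (c%:E * nX f)%E.
Proof.
move=> c0 mf; have mcf : measurable_fun setT (fun x => (c%:E * f x)%E) by exact: emeasurable_funM.
have hom g (t : R) : 0 < t -> measurable_fun setT g -> (nX g < +oo)%E ->
    nX (fun x => (t%:E * g x)%E) = (t%:E * nX g)%E.
  move=> t0 /lmeas_measurable mg gy; case: hX => _ [+ _] => /(_ g t mg gy) ->.
  by rewrite gtr0_norm.
have [fy|] := ltP (nX f) +oo%E; first exact: hom.
rewrite leye_eq => /eqP fy; rewrite fy gt0_muley ?lte_fin//; apply/eqP; rewrite -leye_eq leNgt.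
apply/negP => clt; have := hom _ c^-1 (ltac:(by rewrite invr_gt0)) mcf clt.
under eq_fun do rewrite muleA -EFinM mulVf ?gt_eqF// mul1e.
rewrite fy; have := nX_ge0 mcf; move: clt.
by case: (nX (fun x => (c%:E * f x)%E)) => [t| |].
Qed.

Lemma nX_cvg (F : nat -> V -> \bar R) (f : V -> \bar R) : (forall m, measurable_fun setT (F m)) ->
  measurable_fun setT f -> (forall m x, (0 <= F m x)%E) ->
  (forall m x, (F m x <= F m.+1 x)%E) -> (forall x, F ^~ x @ \oo --> f x) ->
  (fun m => nX (F m)) @ \oo --> nX f.
Proof.
move=> mF mf F0 Fnd Fcv; case: hX => _ [_ [_ [_ [_ [+ _]]]]]; apply.
- by move=> m; exact: lmeas_measurable.
- exact: lmeas_measurable.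
- by move=> m; apply: ae_all.
- exact: ae_all.
Qed.

Lemma nX_lim_le (F : nat -> V -> \bar R) (f : V -> \bar R) (t : \bar R) : (forall m, measurable_fun setT (F m)) ->
  measurable_fun setT f -> (forall m x, (0 <= F m x)%E) ->
  (forall m x, (F m x <= F m.+1 x)%E) -> (forall x, F ^~ x @ \oo --> f x) ->
  (forall m, (nX (F m) <= t)%E) -> (nX f <= t)%E.
Proof.
move=> mF mf F0 Fnd Fcv Ht; have cv := nX_cvg mF mf F0 Fnd Fcv.
rewrite -(cvg_lim _ cv)//; apply: lime_le; first by apply/cvg_ex; eexists; exact: cv.
exact: nearW.
Qed.

Lemma nX_pball_lty p : (nX (fun x => (\1_(pball p) x)%:E) < +oo)%E.
Proof. by case: hX => _ [_ [_ [_ [_ [_ +]]]]]; apply; exists p.1, p.2. Qed.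

Lemma measurable_indicE (E : set V) : measurable E ->
  measurable_fun setT (fun x : V => (\1_E x)%:E : \bar R).
Proof. by move=> mE; apply/measurable_EFinP; exact: measurable_indic. Qed.

Lemma nX_pball_gt0 p : (0 < nX (fun x => (\1_(pball p) x)%:E))%E.
Proof.
have mB := measurable_pball hA hD p; have mi := measurable_indicE mB.
rewrite lt_def nX_ge0// andbT; apply/eqP => /= n0.
case: hX => _ [_ [_ [/(_ _ (lmeas_measurable mi) n0) [N [[mN N0] HN]] _]]].
have BN : pball p `<=` N.
  move=> x Bx; apply: contrapT => /HN; rewrite indicE mem_set// => -[] /eqP.
  by rewrite oner_eq0.
have : (mu (pball p) <= mu N)%E by apply: le_measure; rewrite ?inE.
by rewrite -[mu N]RvolE// N0 (vol_pball hA hD hDvol) lee_fin leNgt bz0.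
Qed.

Lemma nind_gt0 p : 0 < nind nX (pball p).
Proof. by rewrite /nind fine_gt0// nX_pball_gt0 nX_pball_lty. Qed.

Lemma nX_zero : nX (fun=> 0%E) = 0%E.
Proof.
have p : T := (0, 0).
have mi := measurable_indicE (measurable_pball hA hD p).
have := hX => -[_ [/(_ _ 0 (lmeas_measurable mi) (nX_pball_lty p)) + _]].
by under eq_fun do rewrite mul0e; rewrite normr0 mul0e.
Qed.

End Space.

(** * Projection in L^2 onto a convex solid set closed under monotone limits *)

Section Projection.
Context d (X : measurableType d) (R : realType) (mu : {measure set X -> \bar R}).
Variable B0 : set X.
Hypotheses (mB0 : measurable B0) (fB0 : (mu B0 < +oo)%E).

(** Bounded functions supported in a set of finite measure: all sums and products below stay
    integrable. *)
Definition bdd_on (u : X -> R) :=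
  measurable_fun setT u /\ exists M : R, forall x, `|u x| <= M * \1_B0 x.

Local Notation L u := (\int[mu]_x (u x)).

Lemma bdd_on_le (u v : X -> R) : bdd_on u -> measurable_fun setT v ->
  (forall x, `|v x| <= `|u x|) -> bdd_on v.
Proof.
by move=> [_ [M Mu]] mv vu; split => //; exists M => x; exact: le_trans (vu x) (Mu x).
Qed.

Lemma bdd_onD (u v : X -> R) : bdd_on u -> bdd_on v -> bdd_on (fun x => u x + v x).
Proof.
move=> [mu_ [M Mu]] [mv [N Nv]]; split; first exact: measurable_funD.
exists (M + N) => x; rewrite mulrDl; apply: le_trans (ler_normD _ _) _.
exact: lerD.
Qed.

Lemma bdd_onZ (c : R) (u : X -> R) : bdd_on u -> bdd_on (fun x => c * u x).
Proof.
move=> [mu_ [M Mu]]; split; first exact: measurable_funM.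
by exists (`|c| * M) => x; rewrite normrM -mulrA; apply: ler_wpM2l.
Qed.

Lemma bdd_onB (u v : X -> R) : bdd_on u -> bdd_on v -> bdd_on (fun x => u x - v x).
Proof.
move=> bu /(bdd_onZ (-1)) bv; have := bdd_onD bu bv.
by under eq_fun do rewrite mulN1r.
Qed.

Lemma bdd_onM (u v : X -> R) : bdd_on u -> bdd_on v -> bdd_on (fun x => u x * v x).
Proof.
move=> [mu_ [M Mu]] [mv [N Nv]]; split; first exact: measurable_funM.
exists (M * N) => x; rewrite normrM; apply: le_trans (ler_pM _ _ (Mu x) (Nv x)) _ => //.
by rewrite indicE; case: (_ \in _); rewrite !(mulr1, mulr0).
Qed.

Lemma bdd_on_norm (u : X -> R) : bdd_on u -> bdd_on (fun x => `|u x|).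
Proof.
move=> bu; apply: bdd_on_le (bu) _ _; last by move=> x; rewrite normr_id.
by apply: measurableT_comp => //; case: bu.
Qed.

Lemma bdd_on_indic : bdd_on (\1_B0 : X -> R).
Proof.
split; first exact: measurable_indic.
by exists 1 => x; rewrite mul1r ger0_norm// indicE ler0n.
Qed.

Lemma bdd_on_integrable (u : X -> R) : bdd_on u -> mu.-integrable setT (EFin \o u).
Proof.
move=> [mu_ [M Mu]].
apply: (@le_integrable _ _ _ mu _ measurableT _ (fun x => (M%:E * (\1_B0 x)%:E)%E)).
- exact/measurable_EFinP.
- move=> x _; rewrite /= lee_fin; apply: le_trans (Mu x) _; exact: ler_norm.
- apply: integrableZl => //; apply/integrableP; split.
    by apply/measurable_EFinP; exact: measurable_indic.
  rewrite (eq_integral (fun x => (\1_B0 x)%:E)).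
    by rewrite integral_indic// setIT.
  by move=> x _; rewrite /= ger0_norm// indicE ler0n.
Qed.

Let LD (u v : X -> R) : bdd_on u -> bdd_on v -> L (fun x => u x + v x) = L u + L v.
Proof. by move=> bu bv; rewrite RintegralD//; exact: bdd_on_integrable. Qed.

Let LZ (c : R) (u : X -> R) : bdd_on u -> L (fun x => c * u x) = c * L u.
Proof. by move=> bu; rewrite RintegralZl//; exact: bdd_on_integrable. Qed.

Let Lle (u v : X -> R) : bdd_on u -> bdd_on v -> (forall x, u x <= v x) -> L u <= L v.
Proof. by move=> bu bv uv; apply: le_Rintegral => //; exact: bdd_on_integrable. Qed.

Variables (K : (X -> R) -> Prop) (h : X -> R) (m : R).
Hypotheses (bh : bdd_on h) (h0 : forall x, 0 <= h x) (hm : forall x, h x <= m)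
  (Kbdd : forall g, K g -> bdd_on g) (K0 : forall (g : X -> R) x, K g -> 0 <= g x)
  (Kzero : K (fun=> 0))
  (Kconv : forall (g1 g2 : X -> R) (t : R), K g1 -> K g2 -> 0 <= t <= 1 ->
     K (fun x => (1 - t) * g1 x + t * g2 x))
  (Ksolid : forall (g1 g2 : X -> R), K g1 -> measurable_fun setT g2 ->
     (forall x, 0 <= g2 x <= g1 x) -> K g2)
  (Kmono : forall (G : nat -> X -> R) (g : X -> R), (forall k, K (G k)) ->
     (forall x, nondecreasing_seq (G ^~ x)) -> (forall x, G ^~ x @ \oo --> g x) ->
     (forall x, g x <= h x) -> K g).

Let J g := L (fun x => (h x - g x) ^+ 2).

Let bJ g : K g -> bdd_on (fun x => (h x - g x) ^+ 2).
Proof.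
by move=> /Kbdd bg; under eq_fun do rewrite expr2; apply: bdd_onM; exact: bdd_onB.
Qed.

Let dist := inf [set J g | g in K].

Let J_ge g : K g -> dist <= J g.
Proof.
move=> Kg; apply: ge_inf; last by exists g.
by exists 0 => _ [g' _ <-]; apply: Rintegral_ge0 => x _; exact: sqr_ge0.
Qed.

Let exJ (e : R) : 0 < e -> exists g, [/\ K g, forall x, g x <= h x & J g < dist + e].
Proof.
move=> e0; have hi : has_inf [set J g | g in K].
  split; first by exists (J (fun=> 0)), (fun=> 0).
  by exists 0 => _ [g' _ <-]; apply: Rintegral_ge0 => x _; exact: sqr_ge0.
have [_ [g Kg <-] Jg] := inf_adherent e0 hi.
(* Cutting a competitor down to [h] keeps it in K by solidity and only decreases its distance to
   [h]. *)
have Kg' : K (fun x => Num.min (g x) (h x)).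
  apply: (Ksolid Kg); first by apply: measurable_minr; [case: (Kbdd Kg)|case: bh].
  by move=> x; rewrite le_min K0// h0 ge_min lexx.
exists (fun x => Num.min (g x) (h x)); split=> //.
  by move=> x; rewrite ge_min lexx orbT.
apply: le_lt_trans Jg; apply: Lle; [exact: bJ|exact: bJ|] => x.
have [gh|hg] := leP (g x) (h x) => //.
by rewrite subrr expr0n/= sqr_ge0.
Qed.

Let L_sq k : (0 : R) < 4^-1 ^+ k. Proof. by rewrite exprn_gt0// invr_gt0. Qed.

(* Parallelogram law at the midpoint of g1 and g2. *)
Let mid g1 g2 : K g1 -> K g2 ->
  L (fun x => (g1 x - g2 x) ^+ 2) <= 2 * J g1 + 2 * J g2 - 4 * dist.
Proof.
move=> K1 K2.
have K3 : K (fun x => (1 - 2^-1) * g1 x + 2^-1 * g2 x) by apply: Kconv => //; apply/andP; split; lra.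
have e : L (fun x => (g1 x - g2 x) ^+ 2) =
    2 * J g1 + (2 * J g2 + (-4) * J (fun x => (1 - 2^-1) * g1 x + 2^-1 * g2 x)).
  rewrite /J -!LZ -?LD; try exact: bJ.
  - by apply: eq_Rintegral => x _; field.
  all: try (by apply: bdd_onZ; exact: bJ).
  by apply: bdd_onD; apply: bdd_onZ; exact: bJ.
rewrite e; have := J_ge K3; lra.
Qed.

Let bminseq : exists G : nat -> X -> R, forall k,
  [/\ K (G k), forall x, G k x <= h x & J (G k) < dist + 4^-1 ^+ k].
Proof. by have [G HG] := choice (fun k => exJ (L_sq k)); exists G. Qed.

(** K is closed only under increasing limits, so the limit must be reached from below. A minimizing
    sequence [G] with errors 4^(-k) has summable L^1 increments. Its tail infima lie in K by
    solidity and increase to a limit [g] in K, and they are so close to [G] in L^1 that [g] is a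
    minimizer. *)
Lemma exists_minimizer : exists g, [/\ K g, forall x, g x <= h x &
  forall g', K g' -> J g <= J g'].
Proof.
have [G HG] := bminseq.
have KG k : K (G k) by case: (HG k).
have Gh k x : G k x <= h x by case: (HG k).
have JG k : J (G k) <= dist + 4^-1 ^+ k by rewrite ltW//; case: (HG k).
have G0 k x : 0 <= G k x by exact: K0.
have mG k : measurable_fun setT (G k) by case: (Kbdd (KG k)).
pose C : R := 5 / 2 + L (\1_B0 : X -> R) / 2.
have LI : 0 <= L (\1_B0 : X -> R) by apply: Rintegral_ge0 => x _; rewrite indicE ler0n.
(* On B0, |u| <= 2^k u^2 / 2 + 2^(-k) / 2. The parallelogram law bounds the integral of u^2 by a
   multiple of 4^(-k), so both terms are of order 2^(-k); this gives the constant [C]. *)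
have step k : L (fun x => `|G k.+1 x - G k x|) <= C * 2^-1 ^+ k.
  have bd := bdd_onB (Kbdd (KG k.+1)) (Kbdd (KG k)).
  have := mid (KG k.+1) (KG k) => M.
  have p2 : (0 : R) < 2 ^+ k by rewrite exprn_gt0.
  apply: (@le_trans _ _ (L (fun x => (2 ^+ k / 2) * (G k.+1 x - G k x) ^+ 2 + (2^-1 ^+ k / 2) * \1_B0 x))).
    apply: Lle; [exact: bdd_on_norm| | ].
      apply: bdd_onD; apply: bdd_onZ; last exact: bdd_on_indic.
      by under eq_fun do rewrite expr2; exact: bdd_onM.
    move=> x; rewrite indicE; case: (boolP (x \in B0)) => [_|xB].
      rewrite mulr1 -[X in _ * X]real_normK ?num_real//.
      set t := `|_|; have := sqr_ge0 (2 ^+ k * t - 1).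
      rewrite exprVn => H; rewrite -(ler_pM2l p2).
      have -> : 2 ^+ k * (2 ^+ k / 2 * t ^+ 2 + (2 ^+ k)^-1 / 2) = (2^+k * t)^+2 / 2 + 1 / 2.
        by field; rewrite gt_eqF.
      by move: H; set s := 2 ^+ k * t; nra.
    case: (bd) => _ [M0 /(_ x)]; rewrite indicE (negbTE xB) mulr0 => H.
    by rewrite mulr0 addr0; apply: le_trans H _; rewrite mulr_ge0 ?sqr_ge0// divr_ge0// ltW.
  rewrite LD; first last.
  - by apply: bdd_onZ; exact: bdd_on_indic.
  - by apply: bdd_onZ; under eq_fun do rewrite expr2; exact: bdd_onM.
  rewrite !LZ; first last.
  - by under eq_fun do rewrite expr2; exact: bdd_onM.
  - exact: bdd_on_indic.
  have S : L (fun x => (G k.+1 x - G k x) ^+ 2) <= 5 * 4^-1 ^+ k.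
    apply: le_trans M _; have := JG k; have := JG k.+1; rewrite exprS.
    have := L_sq k; set s := 4^-1 ^+ k; move: (J _) (J _) => a c; lra.
  have -> : C * 2^-1 ^+ k = 2 ^+ k / 2 * (5 * 4^-1 ^+ k) + 2^-1 ^+ k / 2 * L (\1_B0 : X -> R).
    have -> : (4^-1 : R) ^+ k = 2^-1 ^+ k * 2^-1 ^+ k.
      by rewrite -exprMn -invfM -natrM.
    by rewrite /C !exprVn; field; rewrite gt_eqF.
  by rewrite lerD2r ler_wpM2l// divr_ge0// ltW.
pose I j x := infs (G ^~ x) j.
have lb x : has_lbound (range (G ^~ x)) by exists 0 => _ [k _ <-].
have mI j : measurable_fun setT (I j) by apply: measurable_fun_infs => // x _; exact: lb.
have I0 j x : 0 <= I j x.
  by apply: lb_le_inf; [exists (G j x), j => /=|move=> _ [k _ <-]].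
have IG j x : I j x <= G j x.
  by apply: ge_inf; [exists 0 => _ [k _ <-]|exists j => /=].
have KI j : K (I j) by apply: Ksolid (KG j) (mI j) _ => x; rewrite I0 IG.
have ndI x : nondecreasing_seq (I ^~ x) by move=> i j; exact: nondecreasing_infs.
pose g x := sup (range (I ^~ x)).
have ubI x : has_ubound (range (I ^~ x)).
  by exists (h x) => _ [k _ <-]; exact: le_trans (IG k x) (Gh k x).
have cvI x : I ^~ x @ \oo --> g x by exact: nondecreasing_cvgn.
have gh x : g x <= h x.
  apply: sup_le_ub; first by exists (I 0%N x), 0%N.
  by move=> _ [k _ <-]; exact: le_trans (IG k x) (Gh k x).
have Ig j x : I j x <= g x by apply: ub_le_sup => //; exists j.
have Kg : K g by exact: Kmono KI ndI cvI gh.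
exists g; split => // g' Kg'; apply: le_trans (J_ge Kg').
(* For k >= j the drop from G_j to G_k is at most the sum of the increments in between, so G_j minus
   the tail infimum is bounded by the whole series of increments. *)
have GI j : L (fun x => G j x - I j x) <= C * 2 * 2^-1 ^+ j.
  have bGI : bdd_on (fun x => G j x - I j x) by apply: bdd_onB; exact: Kbdd.
  have pt x : ((G j x - I j x)%:E <= \sum_(0 <= k <oo) (`|G (j + k).+1 x - G (j + k)%N x|)%:E)%E.
    set S := (\sum_(0 <= k <oo) _)%E.
    have S0 : (0 <= S)%E by apply: nneseries_ge0 => k _ _; rewrite lee_fin.
    have [fS|] := ltP S +oo%E; last by rewrite leye_eq => /eqP ->; rewrite leey.
    have SE : S = (fine S)%:E by rewrite fineK// ge0_fin_numE.
    rewrite SE lee_fin lerBlDl -lerBlDr; apply: lb_le_inf; first by exists (G j x), j => /=.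
    move=> _ [k /= jk <-]; rewrite lerBlDr -lerBlDl -lee_fin -SE.
    apply: le_trans (nneseries_lim_ge (k - j) _); last by move=> i _; rewrite lee_fin.
    rewrite sumEFin lee_fin -(subnKC jk); move: (k - j)%N => i.
    rewrite addKn; elim: i => [|i IHi]; first by rewrite addn0 subrr big_nil.
    rewrite big_nat_recr//= addnS.
    have := ler_norm (G (j + i)%N x - G (j + i).+1 x); rewrite distrC; lra.
  rewrite -lee_fin /Rintegral fineK; last exact/integrable_fin_num/bdd_on_integrable.
  apply: (@le_trans _ _ (\int[mu]_x \sum_(0 <= k <oo) (`|G (j + k).+1 x - G (j + k)%N x|)%:E)%E).
    apply: ge0_le_integral => //.
    - by move=> x _; rewrite lee_fin subr_ge0.
    - by apply/measurable_EFinP; case: bGI.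
    - apply: ge0_emeasurable_sum => [k x _ _|k _]; first by rewrite lee_fin.
      apply/measurable_EFinP.
      by apply: measurableT_comp => //; exact: measurable_funB.
  rewrite integral_nneseries//; last first.
    move=> k; apply/measurable_EFinP.
    by apply: measurableT_comp => //; exact: measurable_funB.
  apply: (@le_trans _ _ (\sum_(0 <= k <oo) ((C * 2 * 2^-1 ^+ j) / (2 ^ k.+1)%:R)%:E)%E).
    apply: lee_nneseries => k.
      by move=> _ _; apply: integral_ge0 => x _; rewrite lee_fin.
    have := step (j + k)%N; rewrite -lee_fin /Rintegral fineK.
      move=> S _; apply: le_trans S _; rewrite lee_fin exprD natrX exprS le_eqVlt.
      by apply/orP; left; apply/eqP; rewrite !exprVn; field; rewrite !gt_eqF ?exprn_gt0.
    apply: integrable_fin_num => //; apply: (bdd_on_integrable (u := fun x => `|_|)).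
    by apply: bdd_on_norm; apply: bdd_onB; exact: Kbdd.
  apply: epsilon_trick0; rewrite mulr_ge0 ?exprn_ge0 ?invr_ge0// mulr_ge0// /C.
  by rewrite addr_ge0// divr_ge0.
have C0 : 0 <= C by rewrite /C addr_ge0// divr_ge0.
(* As I_j <= g <= h, the distance from h to g is at most that from h to I_j. Passing from I_j to G_j
   changes the square by at most 2 m (G_j - I_j), because h is bounded by m. *)
have est j : J g <= dist + (1 + 2 * `|m| * (C * 2)) * 2^-1 ^+ j.
  have bGI : bdd_on (fun x => G j x - I j x) by apply: bdd_onB; exact: Kbdd.
  apply: (@le_trans _ _ (J (G j) + 2 * `|m| * L (fun x => G j x - I j x))).
    rewrite -LZ// /J -LD; [|exact: bJ|exact: bdd_onZ].
    apply: Lle; [exact: bJ| |].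
      by apply: bdd_onD; [exact: bJ|exact: bdd_onZ].
    move=> x; have mm : h x <= `|m| by exact: le_trans (hm x) (ler_norm m).
    move: (IG j x) (Ig j x) (gh x) (Gh j x) (I0 j x) (h0 x) mm.
    move: (h x) (I j x) (g x) (G j x) `|m| => hx Ix gx Gx M *.
    have H1 : (hx - gx) ^+ 2 <= (hx - Ix) ^+ 2 by rewrite ler_sqr ?nnegrE; lra.
    apply: le_trans H1 _.
    have -> : (hx - Ix) ^+ 2 = (hx - Gx) ^+ 2 + (2 * hx - Gx - Ix) * (Gx - Ix) by ring.
    rewrite lerD2l; apply: ler_wpM2r; lra.
  rewrite (_ : _ + _ * 2^-1 ^+ j = (dist + 2^-1 ^+ j) + 2 * `|m| * (C * 2 * 2^-1 ^+ j)); last by ring.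
  apply: lerD.
    apply: le_trans (JG j) _; rewrite lerD2l.
    have -> : (4^-1 : R) ^+ j = 2^-1 ^+ j * 2^-1 ^+ j.
      by rewrite -exprMn -invfM -natrM.
    rewrite ger_pMl ?exprn_gt0 ?invr_gt0//; apply: exprn_ile1; first by rewrite invr_ge0.
    by rewrite invf_le1 ?ler1n.
  by apply: ler_wpM2l (GI j); rewrite mulr_ge0.
set D' := 1 + _ in est.
have D'0 : 0 < D' by rewrite /D' ltr_pwDl// mulr_ge0// mulr_ge0.
apply/ler_addgt0Pr => e e0.
have l12 : (1 : R) < 2 by rewrite ltr1n.
have [j Hj] := expr_gt_exists (D' / e) l12.
apply: le_trans (est j) _; rewrite lerD2l exprVn ler_pdivrMr ?exprn_gt0//.
by rewrite mulrC -ler_pdivrMr.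
Qed.

Lemma exists_projection : exists g, [/\ K g, forall x, g x <= h x &
  forall g', K g' -> L (fun x => (h x - g x) * (g' x - g x)) <= 0].
Proof.
have [g [Kg gh gmin]] := exists_minimizer; exists g; split => // g' Kg'.
have bg := Kbdd Kg; have bg' := Kbdd Kg'.
pose a := L (fun x => (h x - g x) * (g' x - g x)); rewrite -/a; pose c := L (fun x => (g' x - g x) ^+ 2).
have bq : bdd_on (fun x => (g' x - g x) ^+ 2).
  by under eq_fun do rewrite expr2; apply: bdd_onM; exact: bdd_onB.
have ba : bdd_on (fun x => (h x - g x) * (g' x - g x)) by apply: bdd_onM; exact: bdd_onB.
have c0 : 0 <= c by apply: Rintegral_ge0 => x _; exact: sqr_ge0.
have H (t : R) : 0 <= t <= 1 -> 2 * t * a <= t ^+ 2 * c.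
  move=> t01; have Kt := Kconv Kg Kg' t01.
  have := gmin _ Kt; rewrite /J.
  have -> : L (fun x => (h x - ((1 - t) * g x + t * g' x)) ^+ 2) =
     L (fun x => (h x - g x) ^+ 2) + ((- (2 * t)) * a + t ^+ 2 * c).
    rewrite /a /c -!LZ// -!LD//; first by apply: eq_Rintegral => x _; ring.
    - exact: bJ.
    - by apply: bdd_onD; apply: bdd_onZ.
    - exact: bdd_onZ.
    - exact: bdd_onZ.
  lra.
rewrite leNgt; apply/negP => a0.
(* With [a] positive this [t] breaks the inequality 2 t a <= t^2 c, since t (c + 1) <= a. *)
pose t := Num.min 1 (a / (c + 1)).
have c1 : 0 < c + 1 by lra.
have t0 : 0 < t by rewrite lt_min ltr01 divr_gt0.
have t1 : t <= 1 by rewrite ge_min lexx.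
have := H t; rewrite t1 (ltW t0) => /(_ isT).
have ta : t * (c + 1) <= a by rewrite -ler_pdivlMr// ge_min lexx orbT.
nra.
Qed.

End Projection.

(** * Lorentz-Luxemburg duality for ball Banach function spaces *)

Section Luxemburg.
Context {R : realType} {n : nat} (A : 'M[R]_n.+1) (D : set 'cV[R]_n.+1) (r : R).
Hypotheses (hA : dilation A) (hD : ellipsoid0 D) (hDvol : Rvol D = 1%E) (hr : 1 < r)
  (hrA : [set r *: x | x in D] `<=` [set A *m x | x in D]).

Local Notation V := (cvM R n.+1).
Local Notation mu := (@vol R n.+1).
Local Notation pball := (@pball R n A D).

(** Truncation in height and in space: increasing approximations that belong to the class [bdd_on],
    where the L^2 projection is available. *)
Definition trunc (H : V -> \bar R) (m : nat) (x : V) : R :=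
  fine (Order.min (H x) m%:R%:E) * \1_(pball (0, m%:Z)) x.

Lemma pball0_le (k m : nat) : (k <= m)%N -> pball (0, k%:Z) `<=` pball (0, m%:Z).
Proof.
move=> km x [y By <-]; exists y => //; apply: (Bk_le hA hD hr hrA _ By).
by rewrite lez_nat.
Qed.

Lemma pball0_union (x : V) : exists k : nat, pball (0, k%:Z) x.
Proof.
have [k Bx] := Bk_union hA hD hr hrA x; exists `|k|%N; exists x; last by rewrite add0r.
by apply: (Bk_le hA hD hr hrA _ Bx); rewrite lez_abs.
Qed.

Section Trunc.
Variables (H : V -> \bar R) (H0 : forall x, (0 <= H x)%E).

Let fmin (m : nat) x : (fine (Order.min (H x) m%:R%:E))%:E = Order.min (H x) m%:R%:E.
Proof.
rewrite fineK// ge0_fin_numE; last by rewrite le_min H0 lee_fin ler0n.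
by apply: le_lt_trans (ltry m%:R); rewrite ge_min lexx orbT.
Qed.

Let fmin0 (m : nat) x : 0 <= fine (Order.min (H x) m%:R%:E).
Proof. by rewrite fine_ge0// le_min H0 lee_fin ler0n. Qed.

Lemma trunc_ge0 m x : 0 <= trunc H m x.
Proof. by rewrite mulr_ge0// indicE ler0n. Qed.

Lemma trunc_le m x : ((trunc H m x)%:E <= H x)%E.
Proof.
rewrite /trunc indicE; case: (_ \in _); last by rewrite mulr0.
by rewrite mulr1 fmin ge_min lexx.
Qed.

Lemma trunc_leB m x : trunc H m x <= m%:R * \1_(pball (0, m%:Z)) x.
Proof.
apply: ler_wpM2r; first by rewrite indicE ler0n.
by rewrite -lee_fin fmin ge_min lexx orbT.
Qed.

Lemma trunc_nd x : nondecreasing_seq ((trunc H) ^~ x).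
Proof.
move=> k m km; rewrite /trunc; apply: ler_pM; [exact: fmin0|by rewrite indicE ler0n| |].
  rewrite -lee_fin !fmin le_min ge_min lexx/= ge_min; apply/orP; right.
  by rewrite lee_fin ler_nat.
rewrite !indicE ler_nat; case: (boolP (x \in pball (0, k%:Z))) => //.
by rewrite inE => /(pball0_le km) Bx; rewrite mem_set.
Qed.

Lemma trunc_cvg x : (fun m => (trunc H m x)%:E) @ \oo --> H x.
Proof.
suff <- : ereal_sup (range (fun m => (trunc H m x)%:E)) = H x.
  by apply: ereal_nondecreasing_cvgn => k m km; rewrite lee_fin; exact: trunc_nd.
apply/eqP; rewrite eq_le; apply/andP; split.
  by apply: ge_ereal_sup => _ [m _ <-]; exact: trunc_le.
have [k Bk] := pball0_union x.
have big (m : nat) (t : R) : (k <= m)%N -> t <= m%:R -> (t%:E <= H x)%E ->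
    (t%:E <= ereal_sup (range (fun m => (trunc H m x)%:E)))%E.
  move=> km tm tH; apply: le_trans (ereal_sup_ubound _); last by exists m.
  rewrite /trunc indicE mem_set ?mulr1; last exact: pball0_le km _ Bk.
  by rewrite fmin le_min tH lee_fin.
have nat_ge (t : R) : exists m : nat, (k <= m)%N /\ t <= m%:R.
  exists (k + (Num.truncn `|t|).+1)%N; split; first exact: leq_addr.
  apply: le_trans (ler_norm t) _; apply: (@le_trans _ _ (Num.truncn `|t|).+1%:R).
    by rewrite ltW// truncnS_gt.
  by rewrite ler_nat leq_addl.
case Hx : (H x) => [t| |].
- by have [m [km tm]] := nat_ge t; apply: big km tm _; rewrite Hx.
- rewrite leye_eq; apply/eqP/eqyP => t t0.
  by have [m [km tm]] := nat_ge t; apply: big km tm _; rewrite Hx leey.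
- by rewrite leNye.
Qed.

Lemma measurable_trunc m : measurable_fun setT H -> measurable_fun setT (trunc H m).
Proof.
move=> mH; apply: measurable_funM; last by apply: measurable_indic; exact: measurable_pball.
by apply: measurableT_comp => //; apply: measurable_mine.
Qed.

Lemma bdd_on_trunc m : measurable_fun setT H -> bdd_on (pball (0, m%:Z)) (trunc H m).
Proof.
move=> mH; split; first exact: measurable_trunc.
by exists m%:R => x; rewrite ger0_norm ?trunc_ge0// trunc_leB.
Qed.
End Trunc.

Variable nY : (V -> \bar R) -> \bar R.
Hypothesis hY : ball_BFS A D nY.

Let hYq : ball_QBFS A D nY. Proof. by case: hY. Qed.

Lemma nY_triangle (f g : V -> \bar R) : measurable_fun setT f -> measurable_fun setT g ->
  (nY (fun x => f x + g x)%E <= nY f + nY g)%E.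
Proof.
by move=> /lmeas_measurable mf /lmeas_measurable mg; case: hY => _ [+ _]; apply.
Qed.

Lemma nY_homog_le (f : V -> \bar R) (c : R) (t : R) : 0 <= c -> measurable_fun setT f ->
  (nY f <= t%:E)%E -> (nY (fun x => c%:E * f x)%E <= (c * t)%:E)%E.
Proof.
move=> c0 /lmeas_measurable mf ft; have fl : (nY f < +oo)%E by apply: le_lt_trans ft _; rewrite ltry.
case: hYq => _ [/(_ f c mf fl) -> _].
by rewrite ger0_norm// EFinM; apply: lee_wpmul2l ft; rewrite lee_fin.
Qed.

(* Project h in L^2 onto the convex set K = {nY <= t}: the difference of h and its projection,
   suitably normalized, separates h from K. *)
Let lux_core (h : V -> R) (m : nat) (t : R) : bdd_on (pball (0, m%:Z)) h ->
  (forall x, 0 <= h x <= m%:R) -> 0 < t -> (t%:E < nY (EFin \o h))%E ->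
  exists phi : V -> R, [/\ measurable_fun setT phi, forall x, 0 <= phi x,
    (assoc nY (EFin \o phi) <= 1)%E & (t%:E < \int[mu]_x (h x * phi x)%:E)%E].
Proof.
move=> bh h0m t0 th; set B0 := pball _ in bh.
have mB : measurable B0 by exact: measurable_pball.
have fB : (mu B0 < +oo)%E by rewrite vol_pball// ltry.
have h0 x : 0 <= h x by case/andP: (h0m x).
have hm x : h x <= m%:R by case/andP: (h0m x).
pose K (G : V -> R) := [/\ bdd_on B0 G, forall x, 0 <= G x & (nY (EFin \o G) <= t%:E)%E].
have Ksolid (g1 g2 : V -> R) : K g1 -> measurable_fun setT g2 ->
    (forall x, 0 <= g2 x <= g1 x) -> K g2.
  move=> [b1 p1 n1] m2 g12; have p2 x : 0 <= g2 x by case/andP: (g12 x).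
  have l12 x : g2 x <= g1 x by case/andP: (g12 x).
  split => //; first by apply: bdd_on_le b1 m2 _ => x; rewrite !ger0_norm.
  apply: le_trans n1; apply: (nX_le hYq).
  - by apply/measurable_EFinP; case: b1.
  - exact/measurable_EFinP.
  - by move=> x; rewrite /= lee_fin !ger0_norm.
have Kzero : K (fun=> 0).
  split => //; last by rewrite (nX_zero hA hD hYq) lee_fin ltW.
  by split=> //; exists 0 => x; rewrite normr0 mul0r.
have Kconv (g1 g2 : V -> R) (s : R) : K g1 -> K g2 -> 0 <= s <= 1 ->
    K (fun x => (1 - s) * g1 x + s * g2 x).
  move=> [b1 p1 n1] [b2 p2 n2] /andP[s0 s1]; split.
  - by apply: bdd_onD; exact: bdd_onZ.
  - by move=> x; rewrite addr_ge0// mulr_ge0// subr_ge0.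
  - have m1 : measurable_fun setT (fun x : V => ((1 - s)%:E * (EFin \o g1) x)%E).
      by apply/measurable_EFinP; case: (bdd_onZ (1 - s) b1).
    have m2 : measurable_fun setT (fun x : V => (s%:E * (EFin \o g2) x)%E).
      by apply/measurable_EFinP; case: (bdd_onZ s b2).
    apply: le_trans (nY_triangle m1 m2) _.
    have -> : t%:E = (((1 - s) * t)%:E + (s * t)%:E)%E by rewrite -EFinD; congr (_%:E); ring.
    apply: leeD; apply: nY_homog_le => //; first by rewrite subr_ge0.
      by apply/measurable_EFinP; case: b1.
    by apply/measurable_EFinP; case: b2.
have Kmono (G : nat -> V -> R) (g : V -> R) : (forall k, K (G k)) ->
    (forall x, nondecreasing_seq (G ^~ x)) -> (forall x, G ^~ x @ \oo --> g x) ->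
    (forall x, g x <= h x) -> K g.
  move=> KG nd cv gh.
  have mG k : measurable_fun setT (G k) by case: (KG k) => -[].
  have mg : measurable_fun setT g.
    by apply: (measurable_fun_cvg (h := G)) => // x _; exact: cv.
  have G0 k x : 0 <= G k x by case: (KG k).
  have Gg k x : G k x <= g x.
    by rewrite -(cvg_lim _ (cv x))//; apply: nondecreasing_cvgn_le => //; apply/cvg_ex; exists (g x); exact: cv.
  have g0 x : 0 <= g x by exact: le_trans (G0 0%N x) (Gg 0%N x).
  split => //; first by apply: bdd_on_le bh mg _ => x; rewrite !ger0_norm.
  apply: (nX_lim_le hYq (F := fun k => EFin \o G k)) => //.
  - by move=> k; apply/measurable_EFinP.
  - exact/measurable_EFinP.
  - by move=> k x; rewrite /= lee_fin; exact: nd.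
  - by move=> x; apply: cvg_EFin; [exact: nearW|exact: cv].
  - by move=> k; case: (KG k).
have [G [KG Gh var]] := @exists_projection _ V R mu B0 mB fB K h m%:R bh h0 hm
  (fun g Kg => let: And3 a _ _ := Kg in a) (fun g x Kg => let: And3 _ a _ := Kg in a x)
  Kzero Kconv Ksolid Kmono.
have [bG G0 nG] := KG.
pose f x := h x - G x.
have f0 x : 0 <= f x by rewrite subr_ge0.
have bf : bdd_on B0 f by exact: bdd_onB.
have mf : measurable_fun setT f by case: bf.
have Rint (u : V -> R) : bdd_on B0 u -> (\int[mu]_x (u x)%:E)%E = (\int[mu]_x (u x))%:E.
  by move=> bu; rewrite /Rintegral fineK//; apply: integrable_fin_num => //; exact: (bdd_on_integrable mB fB bu).
pose s := \int[mu]_x (f x * G x); pose dd := \int[mu]_x (f x * f x).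
have bfG : bdd_on B0 (fun x => f x * G x) by exact: bdd_onM.
have bff : bdd_on B0 (fun x => f x * f x) by exact: bdd_onM.
have s0 : 0 <= s by apply: Rintegral_ge0 => x _; exact: mulr_ge0.
(* Otherwise h equals its projection almost everywhere and has norm at most t. *)
have dd0 : 0 < dd.
  rewrite lt_def Rintegral_ge0 ?andbT; last by move=> x _; exact: mulr_ge0.
  apply/eqP => d0; move: th; rewrite ltNge => /negP; apply.
  apply: le_trans nG.
  have := Rint _ bff; rewrite -/dd d0 => I0.
  have mff : measurable_fun setT (fun x : V => (f x * f x)%:E).
    by apply/measurable_EFinP; case: bff.
  have : ae_eq mu setT (fun x : V => (f x * f x)%:E) (cst 0%E).
    apply: (ae_eq_integral_abs mu measurableT mff).1.
    etransitivity; last exact: I0.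
    apply: eq_integral => x _.
    by rewrite /= ger0_norm// mulr_ge0.
  move=> [N [mN N0 HN]].
  case: hYq => _ [_ [_ [_ [+ _]]]]; apply.
  - by apply: lmeas_measurable; apply/measurable_EFinP; case: bG.
  - by apply: lmeas_measurable; apply/measurable_EFinP; case: bh.
  exists N; split; first by split=> //; rewrite RvolE.
  move=> x Nx; have : f x * f x = 0.
    by apply: contrapT => fx; apply/Nx/HN => /= /(_ I) [].
  move/eqP; rewrite mulf_eq0 orbb /f subr_eq0 => /eqP hG.
  by rewrite /= hG.
have key (g : V -> R) : bdd_on B0 g -> (forall x, 0 <= g x) -> (nY (EFin \o g) <= 1%:E)%E ->
    t * \int[mu]_x (f x * g x) <= s.
  move=> bg g0 n1; have Kg : K (fun x => t * g x).
    split; [exact: bdd_onZ|by move=> x; rewrite mulr_ge0// ltW|].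
    rewrite -[t in (_ <= t%:E)%E]mulr1; apply: (@nY_homog_le (EFin \o g)) => //; first exact: ltW.
    by apply/measurable_EFinP; case: bg.
  have bfg : bdd_on B0 (fun x => f x * g x) by exact: bdd_onM.
  have e : t * \int[mu]_x (f x * g x) - s = \int[mu]_x ((h x - G x) * (t * g x - G x)).
    rewrite -RintegralZl//; last exact: bdd_on_integrable bfg.
    rewrite -RintegralB//; [|exact: (bdd_on_integrable mB fB (bdd_onZ t bfg))|exact: bdd_on_integrable bfG].
    by apply: eq_Rintegral => x _; rewrite /f; ring.
  by have := var _ Kg; rewrite -e subr_le0.
(* Any normalization strictly between s and s + dd works. Pairings of f with the unit ball are at
   most s / t, so c f has associate norm at most 1, while h pairs with c f to t (s + dd) / (s + dd /
   2), which exceeds t. *)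
pose c := t / (s + dd / 2).
have sd : 0 < s + dd / 2 by rewrite ltr_wpDl// divr_gt0.
have c0 : 0 < c by rewrite divr_gt0.
exists (fun x => c * f x); split.
- exact: measurable_funM.
- by move=> x; rewrite mulr_ge0// ltW.
- apply: ge_ereal_sup => _ [g [[g0 [bg0 [N [[mN N0] HN]]]] n1] <-].
  have mg0 := borel_fun_measurable bg0.
  have mcfg : measurable_fun setT (fun x : V => ((c * f x)%:E * `|g0 x|)%E).
    apply: emeasurable_funM; last exact: measurableT_comp.
    by apply/measurable_EFinP; exact: measurable_funM.
  have p0 x : (0 <= (c * f x)%:E * `|g0 x|)%E.
    by apply: mule_ge0 => //; rewrite lee_fin mulr_ge0// ltW.
  rewrite (@iint_eq_off_null _ _ _ (fun x : V => ((c * f x)%:E * `|g0 x|)%E) N)//.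
  + rewrite iintE//.
    have ng0 : (nY (fun x => `|g0 x|) <= 1%:E)%E.
      rewrite -n1; case: hYq => _ [_ [_ [_ [+ _]]]]; apply.
      * by exists g0; split => //; exists N.
      * by apply: lmeas_measurable; exact: measurableT_comp.
      * by exists N; split => // x /HN ->; rewrite abse_id.
    have mag : measurable_fun setT (fun x : V => `|g0 x|%E) by exact: measurableT_comp.
    (* The test function may be unbounded, whereas [key] concerns bounded functions on B0: it is
       truncated, cut to B0 where f lives, and recovered by monotone convergence. *)
    pose gM k x := trunc (fun y => `|g0 y|%E) k x.
    have cvI := @cvg_monotone_convergence _ _ _ mu setT measurableT
      (fun k (x : V) => (c * f x * gM k x)%:E).
    have : (fun k => \int[mu]_x (c * f x * gM k x)%:E)%E @ \oo --> (\int[mu]_x ((c * f x)%:E * `|g0 x|))%E.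
      rewrite (eq_integral (fun x => limn (fun k => (c * f x * gM k x)%:E))); first apply: cvI.
      * move=> k; apply/measurable_EFinP; apply: measurable_funM; first exact: measurable_funM.
        exact: measurable_trunc.
      * by move=> k x _; rewrite lee_fin mulr_ge0 ?trunc_ge0// mulr_ge0// ltW.
      * move=> x _ k l kl; rewrite lee_fin; apply: ler_wpM2l; first by rewrite mulr_ge0// ltW.
        exact: trunc_nd.
      * move=> x _; apply/esym/cvg_lim => //; under eq_fun do rewrite EFinM.
        by apply: cvgeZl => //; apply: trunc_cvg.
    move=> cv; apply: (cvge_to_le cv); apply: nearW => k.
    have bgB : bdd_on B0 (fun x => gM k x * \1_B0 x).
      split; first by apply: measurable_funM; [exact: measurable_trunc|exact: measurable_indic].
      exists k%:R => x; rewrite ger0_norm; last by rewrite mulr_ge0 ?trunc_ge0// indicE ler0n.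
      apply: ler_wpM2r; first by rewrite indicE ler0n.
      apply: le_trans (trunc_leB _ _ _) _ => //.
      by rewrite ler_piMr// indicE lern1 leq_b1.
    have ff x : f x * (gM k x * \1_B0 x) = f x * gM k x.
      case: (bf) => _ [M /(_ x)]; rewrite indicE; case: (x \in B0); rewrite ?mulr1//.
      by rewrite !mulr0 normr_le0 => /eqP ->; rewrite mul0r.
    have gB0 x : 0 <= gM k x * \1_B0 x by rewrite mulr_ge0 ?trunc_ge0// indicE ler0n.
    have gB1 x : gM k x * \1_B0 x <= gM k x.
      by rewrite ler_piMr ?trunc_ge0// indicE lern1 leq_b1.
    have n1' : (nY (fun x : V => (gM k x * \1_B0 x)%:E) <= 1%:E)%E.
      apply: le_trans ng0; apply: (nX_le hYq) => //.
        by apply/measurable_EFinP; case: bgB.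
      move=> x; rewrite abse_id gee0_abs ?lee_fin//.
      apply: (@le_trans _ _ (gM k x)%:E); first by rewrite lee_fin.
      exact: (trunc_le (fun y => abse_ge0 (g0 y))).
    have := key _ bgB gB0 n1'; under eq_Rintegral do rewrite ff; move=> ks.
    have bfg : bdd_on B0 (fun x => f x * gM k x).
      by have := bdd_onM bf bgB; under eq_fun do rewrite ff.
    rewrite (eq_integral (fun x => (c * (f x * gM k x))%:E)); last by move=> x _; rewrite mulrA.
    rewrite (Rint (fun x => c * (f x * gM k x))); last exact: bdd_onZ.
    rewrite lee_fin RintegralZl//; last exact: bdd_on_integrable bfg.
    rewrite /c mulrAC ler_pdivrMr// mul1r; apply: le_trans ks _.
    by rewrite lerDl divr_ge0// ltW.
  + by rewrite -RvolE.
  + move=> x Nx; rewrite abseM -(HN x Nx) /= ger0_norm//; apply: mulr_ge0 => //; exact: ltW.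
- have -> : (\int[mu]_x (h x * (c * f x))%:E)%E = (c * (s + dd))%:E.
    have e : (fun x => h x * (c * f x)) = (fun x => c * (f x * G x + f x * f x)).
      by apply/funext => x; rewrite /f; ring.
    rewrite (eq_integral (fun x => (c * (f x * G x + f x * f x))%:E)).
      rewrite (Rint (fun x => c * (f x * G x + f x * f x))); last by apply: bdd_onZ; exact: bdd_onD.
      rewrite RintegralZl//; last exact: (bdd_on_integrable mB fB (bdd_onD bfG bff)).
      by rewrite RintegralD//; [exact: bdd_on_integrable bfG|exact: bdd_on_integrable bff].
    by move=> x _; rewrite (congr1 (@^~ x) e).
  rewrite lte_fin /c mulrAC ltr_pdivlMr// ltr_pM2l// ltrD2l.
  by rewrite ltr_pdivrMr// ltr_pMr// ltr1n.
Qed.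

(** If the norm of H exceeded t it would exceed some s > t, and so would that of a truncation by the
    Fatou property; [lux_core] then yields a test function violating the hypothesis. *)
Lemma lorentz_luxemburg (H : V -> \bar R) (t : R) : 0 <= t -> measurable_fun setT H ->
  (forall x, 0 <= H x)%E ->
  (forall phi : V -> R, measurable_fun setT phi -> (forall x, 0 <= phi x) ->
    (assoc nY (EFin \o phi) <= 1)%E -> (\int[mu]_x (H x * (phi x)%:E) <= t%:E)%E) ->
  (nY H <= t%:E)%E.
Proof.
move=> t0 mH H0 hyp; rewrite leNgt; apply/negP => tH.
have [s ts sH] : exists2 s : R, t < s & (s%:E < nY H)%E.
  case e : (nY H) tH => [a| |] //.
    by rewrite lte_fin => ta; exists ((t + a) / 2); rewrite ?lte_fin; lra.
  by move=> _; exists (t + 1); [rewrite ltrDl|rewrite ltry].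
have [m sm] : exists m, (s%:E < nY (EFin \o trunc H m))%E.
  apply: contrapT => /forallNP hm; move: sH; rewrite ltNge => /negP; apply.
  apply: (nX_lim_le hYq (F := fun m => EFin \o trunc H m)) => //.
  - by move=> m; apply/measurable_EFinP; exact: measurable_trunc.
  - by move=> m x; rewrite /= lee_fin trunc_ge0.
  - by move=> m x; rewrite /= lee_fin; exact: trunc_nd.
  - by move=> x; exact: trunc_cvg.
  - by move=> m; rewrite leNgt; apply/negP.
have [phi [mphi phi0 a1 Ip]] := lux_core (bdd_on_trunc H0 m mH)
  (ltac:(move=> x; rewrite trunc_ge0//=; apply: le_trans (trunc_leB H0 m x) _;
         by rewrite ler_piMr// indicE lern1 leq_b1)) (le_lt_trans t0 ts) sm.
have := hyp phi mphi phi0 a1; rewrite leNgt => /negP; apply.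
apply: (@lt_trans _ _ s%:E); first by rewrite lte_fin.
apply: lt_le_trans Ip _; apply: ge0_le_integral => //.
- by move=> x _; rewrite lee_fin mulr_ge0// trunc_ge0.
- by apply/measurable_EFinP; apply: measurable_funM => //; exact: measurable_trunc.
- by apply: emeasurable_funM => //; exact/measurable_EFinP.
- by move=> x _; rewrite EFinM; apply: lee_wpmul2r; [rewrite lee_fin|exact: trunc_le].
Qed.

End Luxemburg.

(** * Assumption (FS) for weighted families of balls *)

Section Fefferman_Stein.
Context {R : realType} {n : nat} (A : 'M[R]_n.+1) (D : set 'cV[R]_n.+1) (r : R).
Hypotheses (hA : dilation A) (hD : ellipsoid0 D) (hDvol : Rvol D = 1%E) (hr : 1 < r)
  (hrA : [set r *: x | x in D] `<=` [set A *m x | x in D]).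

Local Notation V := (cvM R n.+1).
Local Notation mu := (@vol R n.+1).
Local Notation b := `|\det A|.
Local Notation T := ('cV[R]_n.+1 * int)%type.
Local Notation pball := (@pball R n A D).

Let b1 : 1 < b. Proof. exact: (det_gt1 hA hD hDvol hr hrA). Qed.
Let b0 : 0 < b. Proof. exact: lt_trans b1. Qed.
Let bz0 (l : int) : 0 < b ^ l. Proof. exact: exprz_gt0. Qed.

Lemma maxf_open (f : V -> \bar R) (t : R) : open [set x : 'cV[R]_n.+1 | (t%:E < maxf A D f x)%E].
Proof.
suff -> : [set x : 'cV[R]_n.+1 | (t%:E < maxf A D f x)%E] =
    \bigcup_(p in [set p : T | (t%:E < avg (pball p) (fun y => `|f y|))%E]) pball p.
  by apply: bigcup_open => p _; exact: (dball_open hA hD).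
apply/seteqP; split=> x /=.
  rewrite /maxf => /ereal_sup_gt[_ [B [[c [k ->]] Bx] <-] tB].
  by exists (c, k).
move=> [p tp px]; apply: lt_le_trans tp _; apply: ereal_sup_ubound.
by exists (pball p) => //; split => //; exists p.1, p.2.
Qed.

Lemma measurable_maxf (f : V -> \bar R) : measurable_fun setT (maxf A D f : V -> \bar R).
Proof.
apply: (measurability _ (ErealGenOInfty.measurableE R)) => _ [_ [x ->] <-].
rewrite setTI; suff -> : maxf A D f @^-1` `]x%:E, +oo[%classic = [set y | (x%:E < maxf A D f y)%E].
  apply: open_measurable_cV; exact: maxf_open.
by apply/seteqP; split=> y /=; rewrite in_itv/= ?andbT.
Qed.

Lemma maxf_ge (f : V -> \bar R) p x : pball p x ->
  (avg (pball p) (fun y => `|f y|) <= maxf A D f x)%E.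
Proof.
move=> px; apply: ereal_sup_ubound; exists (pball p) => //.
by split => //; exists p.1, p.2.
Qed.

Lemma avg_pball p (f : V -> \bar R) : measurable_fun setT f -> (forall x, (0 <= f x)%E) ->
  avg (pball p) f = ((b ^ p.2)^-1%:E * \int[mu]_(x in pball p) f x)%E.
Proof.
move=> mf f0; rewrite /avg int_onE//; last exact: measurable_pball.
by rewrite RvolE ?vol_pball//; exact: measurable_pball.
Qed.

Lemma nneseries_finite (f : nat -> \bar R) N : (forall k, (0 <= f k)%E) ->
  (forall k, (N <= k)%N -> f k = 0%E) -> (\sum_(k <oo) f k = \sum_(0 <= k < N) f k)%E.
Proof.
move=> f0 fN; rewrite (nneseries_split 0 N) ?add0n; last by move=> k _; exact: f0.
by rewrite [X in (_ + X)%E]eseries0 ?adde0// => k Nk _; exact: fN.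
Qed.

Variables (nX : (V -> \bar R) -> \bar R) (pm th : R).
Hypotheses (hX : ball_QBFS A D nX) (hFS : assumption_FS A D nX pm)
  (hth : 0 < th) (hthm : th < pm).

(** For nonnegative u this is the norm of u in X^{1/theta} raised to 1/theta, the quantity that
    appears in both functionals. *)
Definition Xnorm (u : V -> R) : \bar R := nX (fun x => (u x `^ th^-1)%:E).

Let XpE (S : V -> \bar R) : (forall x, 0 <= S x)%E ->
  Xpow nX (th / 2)^-1 (fun x => S x `^ 2^-1)%E = (nX (fun x => S x `^ th^-1) `^ (th / 2))%E.
Proof.
move=> S0; rewrite /Xpow invrK; congr (nX _ `^ _)%E; apply/funext => x.
rewrite gee0_abs ?poweR_ge0// -poweRrM; congr (_ `^ _)%E.
by field; rewrite gt_eqF.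
Qed.

(** With p = th/2 and u = 2 the inner power 1/u and the outer power 1/p combine to 1/th; the outer
    root of [Xpow] is then removed from both sides. *)
Let FS_raw : exists C : R, 0 < C /\ forall F : nat -> V -> R, (forall k, Lloc 1 (F k)) ->
  (forall k, measurable_fun setT (F k)) ->
  (nX (fun x => (\sum_(k <oo) (maxf A D (fun y => (F k y)%:E) x `^ 2)) `^ th^-1)
   <= C%:E * nX (fun x => (\sum_(k <oo) (`|F k x|%:E `^ 2)) `^ th^-1))%E.
Proof.
have t2 : 0 < th / 2 by rewrite divr_gt0.
have t2pm : th / 2 < pm by apply: le_lt_trans hthm; rewrite ler_pdivrMr// ler_pMr// ler1n.
have l12 : (1 : R) < 2 by rewrite ltr1n.
have [C [C0 HC]] := hFS t2 t2pm l12.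
exists (C `^ (th / 2)^-1); split; first exact: powR_gt0.
move=> F LF mF; have := HC F LF.
have mS1 : measurable_fun setT (fun x : V => \sum_(k <oo) (maxf A D (fun y => (F k y)%:E) x `^ 2))%E.
  apply: ge0_emeasurable_sum => [k x _ _|k _]; first exact: poweR_ge0.
  by apply: measurableT_comp (measurable_poweR _) _; exact: measurable_maxf.
have mS2 : measurable_fun setT (fun x : V => \sum_(k <oo) (`|F k x|%:E `^ 2))%E.
  apply: ge0_emeasurable_sum => [k x _ _|k _]; first exact: poweR_ge0.
  apply: measurableT_comp (measurable_poweR _) _; apply/measurable_EFinP.
  exact: measurableT_comp.
rewrite !XpE; try by move=> x; apply: nneseries_ge0 => k _ _; exact: poweR_ge0.
set N1 := nX _; set N2 := nX _ => H.
have N1_0 : (0 <= N1)%E by apply: (nX_ge0 hX); apply: measurableT_comp (measurable_poweR _) _.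
have N2_0 : (0 <= N2)%E by apply: (nX_ge0 hX); apply: measurableT_comp (measurable_poweR _) _.
have can (N : \bar R) : (0 <= N)%E -> ((N `^ (th / 2)) `^ (th / 2)^-1 = N)%E.
  by move=> N0; rewrite -poweRrM mulfV ?poweRe1// gt_eqF.
rewrite -(can _ N1_0) -[X in (_ <= _ * X)%E](can _ N2_0) -poweR_EFin -poweRM ?poweR_ge0//; last by rewrite lee_fin ltW.
apply: gt0_ler_poweR H; rewrite ?invr_ge0 ?ltW//; rewrite in_itv/= leey andbT ?poweR_ge0//.
by apply: mule_ge0; [rewrite lee_fin ltW|exact: poweR_ge0].
Qed.

(* On pball (p k) the maximal function of 1_(E k) is at least mu (E k) / b ^ (p k).2, so
   Assumption (FS) applies with exponents u = 2 and th / 2. *)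
Lemma FS_balls : exists C : R, 0 < C /\ forall (I : Type) (s : seq I) (a : I -> R)
    (p : I -> T) (E : I -> set V), (forall k, 0 <= a k) ->
    (forall k, measurable (E k)) -> (forall k, E k `<=` pball (p k)) ->
  (Xnorm (fun x => (\sum_(k <- s) a k * (fine (mu (E k)) / b ^ (p k).2) ^+ 2 * \1_(pball (p k)) x)%R)
   <= C%:E * Xnorm (fun x => (\sum_(k <- s) a k * \1_(E k) x)%R))%E.
Proof.
have [C [C0 HC]] := FS_raw; exists C; split=> // I s a p E a0 mE Ep.
case: s => [|i0 s].
  have Z (f : I -> V -> R) : Xnorm (fun x => \sum_(k <- [::]) f k x) = 0%E.
    rewrite /Xnorm -(nX_zero hA hD hX); congr nX; apply/funext => x.
    by rewrite big_nil powR0// invr_eq0 gt_eqF.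
  by rewrite !Z mule0.
set s' := i0 :: s.
(* The square root compensates the exponent u = 2. The sequence is zero beyond the family because
   (FS) is about infinite sequences. *)
pose F (k : nat) (x : V) : R :=
  if (k < size s')%N then Num.sqrt (a (nth i0 s' k)) * \1_(E (nth i0 s' k)) x else 0.
have F0 k x : 0 <= F k x.
  by rewrite /F; case: ifP => // _; rewrite mulr_ge0 ?sqrtr_ge0// indicE ler0n.
have mF k : measurable_fun setT (F k).
  rewrite /F; case: (ltnP k (size s')) => _ //.
  by apply: measurable_funM => //; exact: measurable_indic.
have mE_lty k : (mu (E k) < +oo)%E.
  apply: (@le_lt_trans _ _ (mu (pball (p k)))); last by rewrite vol_pball// ltry.
  by apply: le_measure; rewrite ?inE//; exact: measurable_pball.
have LF k : Lloc 1 (F k).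
  split; first by apply: lmeas_measurable; exact/measurable_EFinP.
  move=> K cK; have mK : measurable (K : set V).
    rewrite -[K]setCK; apply: measurableC; apply: open_measurable_cV; rewrite openC.
    by apply: compact_closed cK; exact: norm_hausdorff.
  have mF1 : measurable_fun setT (fun x : V => (`|F k x| `^ 1)%:E).
    by apply/measurable_EFinP; apply: measurableT_comp (measurable_powR _) _; exact: measurableT_comp.
  rewrite int_onE//.
  rewrite /F in mF1 *; case: (ltnP k (size s')) mF1 => [ks|ks] mF1.
    set i := nth i0 s' k in mF1 *.
    apply: (@le_lt_trans _ _ (\int[mu]_(x in setT) ((Num.sqrt (a i))%:E * (\1_(E i) x)%:E))%E).
      apply: (@le_trans _ _ (\int[mu]_(x in setT) (`|Num.sqrt (a i) * \1_(E i) x| `^ 1)%:E)%E).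
        by apply: ge0_subset_integral => // x _; rewrite lee_fin powR_ge0.
      apply: ge0_le_integral => //.
      - apply: emeasurable_funM => //; exact: measurable_indicE.
      - move=> x _; rewrite powRr1// ger0_norm ?EFinM// mulr_ge0 ?sqrtr_ge0//.
    rewrite ge0_integralZl ?lee_fin ?sqrtr_ge0//; last exact: measurable_indicE.
    rewrite integral_indic// setIT; apply: lte_mul_pinfty; rewrite ?lee_fin ?sqrtr_ge0//; exact: mE_lty.
  by rewrite integral0_eq// => x _; rewrite normr0 powRr1.
have mS : measurable_fun setT (fun x : V => \sum_(k <oo) (maxf A D (fun y => (F k y)%:E) x `^ 2))%E.
  apply: ge0_emeasurable_sum => [k x _ _|k _]; first exact: poweR_ge0.
  by apply: measurableT_comp (measurable_poweR _) _; exact: measurable_maxf.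
have term0 k x : 0 <= a k * (fine (mu (E k)) / b ^ (p k).2) ^+ 2 * \1_(pball (p k)) x.
  by rewrite mulr_ge0 ?indicE ?ler0n// mulr_ge0// sqr_ge0.
have e1 x : (\sum_(k <oo) (`|F k x|%:E `^ 2) = (\sum_(k <- s') a k * \1_(E k) x)%R%:E)%E.
  rewrite (@nneseries_finite _ (size s')); first last.
  - move=> k sk; have -> : F k x = 0 by rewrite /F ltnNge sk.
    rewrite normr0 poweR_EFin powR0//.
  - by move=> k; exact: poweR_ge0.
  rewrite (big_nth i0) -sumEFin; apply: eq_big_nat => k /andP[_ ks].
  rewrite poweR_EFin powR_mulrn// real_normK ?num_real// /F ks exprMn sqr_sqrtr//.
  by rewrite indicE; case: (_ \in _); rewrite ?expr1n ?expr0n.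
have := HC F LF mF; under [X in (_ <= C%:E * nX X)%E -> _]eq_fun do rewrite e1 poweR_EFin.
apply: le_trans; rewrite /Xnorm; apply: (nX_le hX).
- by apply: measurableT_comp (measurable_poweR _) mS.
- apply/measurable_EFinP; apply: measurableT_comp (measurable_powR _) _.
  apply: measurable_sum => k; apply: measurable_funM => //.
  by apply: measurable_indic; exact: measurable_pball.
- move=> x; rewrite gee0_abs; last by rewrite lee_fin powR_ge0.
  rewrite gee0_abs ?poweR_ge0// -poweR_EFin.
  have S0 : (0 <= (\sum_(k <oo) (maxf A D (fun y => (F k y)%:E) x `^ 2)))%E.
    by apply: nneseries_ge0 => k _ _; exact: poweR_ge0.
  apply: gt0_ler_poweR; first by rewrite invr_ge0 ltW.
  - by rewrite in_itv/= leey andbT lee_fin sumr_ge0.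
  - by rewrite in_itv/= leey andbT.
  apply: le_trans (nneseries_lim_ge (size s') _); last by move=> k _ _; exact: poweR_ge0.
  rewrite (big_nth i0) -sumEFin big_nat [X in (_ <= X)%E]big_nat; apply: lee_sum => k /andP[_ ks].
  set i := nth i0 s' k.
  rewrite indicE; case: (boolP (x \in pball (p i))) => [|_]; last by rewrite mulr0 poweR_ge0.
  rewrite inE mulr1 => /(maxf_ge (fun y => (F k y)%:E)).
  rewrite avg_pball; first last.
  + by move=> y.
  + by apply: measurableT_comp => //; exact/measurable_EFinP.
  have -> : (\int[mu]_(y in pball (p i)) `|(F k y)%:E| = (Num.sqrt (a i) * fine (mu (E i)))%:E)%E.
    rewrite (eq_integral (fun y => ((Num.sqrt (a i))%:E * (\1_(E i) y)%:E)%E)); last first.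
      by move=> y _; rewrite gee0_abs ?lee_fin// /F ks.
    have mB := measurable_pball hA hD (p i).
    rewrite ge0_integralZl ?lee_fin ?sqrtr_ge0//; last by apply: measurable_funTS; exact: measurable_indicE.
    by rewrite integral_indic// setIidl// EFinM fineK// ge0_fin_numE.
  rewrite -EFinM => H.
  have c0 : 0 <= (b ^ (p i).2)^-1 * (Num.sqrt (a i) * fine (mu (E i))).
    by rewrite mulr_ge0 ?invr_ge0 ?(ltW (bz0 _))// mulr_ge0 ?sqrtr_ge0// fine_ge0.
  have -> : (a i * (fine (mu (E i)) / b ^ (p i).2) ^+ 2)%:E =
     (((b ^ (p i).2)^-1 * (Num.sqrt (a i) * fine (mu (E i))))%:E `^ 2)%E.
    rewrite poweR_EFin powR_mulrn// !exprMn sqr_sqrtr//; congr (_%:E).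
    by ring.
  apply: gt0_ler_poweR => //; rewrite ?in_itv/= ?leey ?andbT//.
  exact: le_trans H.
Qed.

End Fefferman_Stein.

(** Truncated generating functions: S is the convolution of [o] with the powers of [g], so its
    series at [w] is that of [o] divided by 1 - w g, up to the remainder at N. *)
Lemma sum_geom_conv (R : realFieldType) (w g : R) (o S : nat -> R) : S 0%N = o 0%N ->
  (forall k, S k.+1 = g * S k + o k.+1) -> forall N,
  (1 - w * g) * (\sum_(0 <= k < N.+1) w ^+ k * S k) + w ^+ N.+1 * g * S N =
  \sum_(0 <= k < N.+1) w ^+ k * o k.
Proof.
move=> S0 SS; elim=> [|N IH]; first by rewrite !big_nat1 S0 !expr0 expr1; ring.
rewrite big_nat_recr//= [RHS]big_nat_recr//= -IH SS !exprS; ring.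
Qed.

Lemma geom_sum_le (R : realFieldType) (w : R) N : 0 <= w < 1 ->
  \sum_(0 <= k < N) w ^+ k <= (1 - w)^-1.
Proof.
move=> /andP[w0 w1]; have w1' : 0 < 1 - w by rewrite subr_gt0.
rewrite -[leRHS]mul1r ler_pdivlMr// mulrC.
suff -> : (1 - w) * \sum_(0 <= k < N) w ^+ k = 1 - w ^+ N by rewrite gerBl exprn_ge0.
elim: N => [|N IH]; first by rewrite big_nil mulr0 expr0 subrr.
by rewrite big_nat_recr//= mulrDr IH exprS; ring.
Qed.

Lemma ler_dist_sum (R : realFieldType) (q : nat -> R) (y : R) m :
  `|y - q 0%N| <= `|y - q m| + \sum_(0 <= i < m) `|q i - q i.+1|.
Proof.
elim: m => [|m IH]; first by rewrite big_nil addr0.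
apply: le_trans IH _; rewrite big_nat_recr//= addrCA [leRHS]addrC lerD2r.
by rewrite [X in _ <= _ + X]distrC ler_distD.
Qed.

Section Xnorm.
Context {R : realType} {n : nat} (A : 'M[R]_n.+1) (D : set 'cV[R]_n.+1).
Local Notation V := (cvM R n.+1).
Variables (nX : (V -> \bar R) -> \bar R) (th : R).
Hypotheses (hX : ball_QBFS A D nX) (hth : 0 < th).

Local Notation Xn := (Xnorm nX th).

Lemma measurable_Xnorm (u : V -> R) : measurable_fun setT u ->
  measurable_fun setT (fun x : V => (u x `^ th^-1)%:E).
Proof.
by move=> mu; apply/measurable_EFinP; exact: measurableT_comp (measurable_powR _) mu.
Qed.

Lemma Xnorm_ge0 (u : V -> R) : measurable_fun setT u -> (0 <= Xn u)%E.
Proof. by move=> mu; apply: (nX_ge0 hX); exact: measurable_Xnorm. Qed.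

Lemma Xnorm_le (u v : V -> R) : measurable_fun setT u -> measurable_fun setT v ->
  (forall x, 0 <= u x <= v x) -> (Xn u <= Xn v)%E.
Proof.
move=> mu mv uv; apply: (nX_le hX); try exact: measurable_Xnorm.
move=> x; have /andP[u0 uvx] := uv x.
rewrite !gee0_abs ?lee_fin ?powR_ge0//; apply: ge0_ler_powR => //.
- by rewrite invr_ge0 ltW.
- by rewrite nnegrE (le_trans u0).
Qed.

Lemma Xnorm_scale (c : R) (u : V -> R) : 0 < c -> measurable_fun setT u ->
  (forall x, 0 <= u x) -> (Xn (fun x => (c * u x)%R) = (c `^ th^-1)%:E * Xn u)%E.
Proof.
move=> c0 mu u0; rewrite /Xnorm -(nX_homog hX) ?powR_gt0//; last exact: measurable_Xnorm.
by congr nX; apply/funext => x; rewrite powRM ?EFinM// ltW.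
Qed.

End Xnorm.

(** * Oscillations and the bound for the star functional *)

Section Oscillation.
Context {R : realType} {n : nat} (A : 'M[R]_n.+1) (D : set 'cV[R]_n.+1) (r : R).
Hypotheses (hA : dilation A) (hD : ellipsoid0 D) (hDvol : Rvol D = 1%E) (hr : 1 < r)
  (hrA : [set r *: x | x in D] `<=` [set A *m x | x in D]).
Variables (lm lp : R) (hlam : eig_bounds A lm lp) (d : nat).

Local Notation V := (cvM R n.+1).
Local Notation mu := (@vol R n.+1).
Local Notation b := `|\det A|.
Local Notation T := ('cV[R]_n.+1 * int)%type.
Local Notation pball := (@pball R n A D).

Let b1 : 1 < b. Proof. exact: (det_gt1 hA hD hDvol hr hrA). Qed.
Let b0 : 0 < b. Proof. exact: lt_trans b1. Qed.
Let bz0 (l : int) : 0 < b ^ l. Proof. exact: exprz_gt0. Qed.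

Definition locint (f : V -> R) :=
  measurable_fun setT f /\ forall p, mu.-integrable (pball p) (EFin \o f).

Definition PP (f : V -> R) (p : T) : V -> R := projP d (pball p) f.

Definition osc (f : V -> R) (p : T) : R := \int[mu]_(x in pball p) `|f x - PP f p x|.

Lemma osc_ge0 f p : 0 <= osc f p.
Proof. by apply: Rintegral_ge0. Qed.

Lemma PP_polyd f p : locint f -> is_polyd d (PP f p).
Proof. by move=> [mf lf]; have [] := projP_spec hA hD hDvol hr hrA d mf (lf p). Qed.

Lemma measurable_PP f p : locint f -> measurable_fun setT (PP f p).
Proof. by move=> /PP_polyd hp; exact: measurable_is_polyd. Qed.

Lemma integrable_diff f (p q : T) : locint f ->
  mu.-integrable (pball q) (EFin \o (fun x => `|f x - PP f p x|)).
Proof.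
move=> lf; have := integrableB_is_polyd hA hD hDvol (PP_polyd p lf) (lf.2 q).
by move=> /integrable_abse.
Qed.

Lemma measurable_diff f p : locint f -> measurable_fun setT (fun x => `|f x - PP f p x|).
Proof.
move=> lf; apply: measurableT_comp => //; apply: measurable_funB; first by case: lf.
exact: measurable_PP.
Qed.

Lemma sub_dil (p : T) (i k : nat) : (i <= k)%N -> pball (dil i%:Z p) `<=` pball (dil k%:Z p).
Proof.
move=> ik x [y By <-]; exists y => //; apply: (Bk_le hA hD hr hrA _ By).
by rewrite /= lerD2l lez_nat.
Qed.

Lemma Rintegral_sub (E F : set V) (u : V -> R) : measurable E -> measurable F ->
  E `<=` F -> (forall x, 0 <= u x) -> mu.-integrable F (EFin \o u) ->
  \int[mu]_(x in E) u x <= \int[mu]_(x in F) u x.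
Proof.
move=> mE mF EF u0 iu; have iE := integrableS mF mE EF iu.
rewrite /Rintegral; apply: fine_le; rewrite ?integrable_fin_num//.
apply: ge0_subset_integral => //; first by case/integrableP: iu.
by move=> x _; rewrite lee_fin.
Qed.

Lemma Rintegral_diff_le f p q q' : locint f -> pball q `<=` pball q' ->
  \int[mu]_(x in pball q) `|f x - PP f p x| <= \int[mu]_(x in pball q') `|f x - PP f p x|.
Proof.
move=> lf qq; apply: Rintegral_sub => //; try exact: measurable_pball.
exact: integrable_diff.
Qed.

(** Consecutive projections P_i and P_(i+1) differ on the k-th dilate by lp^(d(k-i)) / b^(p.2+i)
    times the oscillation at i+1, and the volume b^(p.2+k) turns this into (b lp^d)^(k-i). Counting
    the oscillation at its own index i+1 costs one more factor b lp^d, whence the constant 1 + C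
    g. *)
Lemma osc_telescope : exists2 C : R, 0 < C & forall f p k, locint f ->
  \int[mu]_(x in pball (dil k%:Z p)) `|f x - PP f p x| <=
  C * \sum_(0 <= i < k.+1) (b * lp ^+ d) ^+ (k - i) * osc f (dil i%:Z p).
Proof.
have [C C0 HC] := projP_bound hA hD hDvol hr hrA hlam d.
have lp1 := eig_bounds_gt1 hlam; have lp0 : 0 < lp by exact: lt_trans lp1.
pose g := b * lp ^+ d; have g0 : 0 < g by rewrite mulr_gt0// exprn_gt0.
exists (1 + C * g); first by rewrite addr_gt0// mulr_gt0.
move=> f p k lf; rewrite -/g; have [mf fint] := lf.
have dil0 : dil 0%:Z p = p by rewrite /dil addr0 -surjective_pairing.
pose P i := PP f (dil i%:Z p).
pose K (i : nat) := C * (lp ^+ (k - i)) ^+ d / b ^ (p.2 + i%:Z) * osc f (dil i.+1%:Z p).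
have mB := measurable_pball hA hD (dil k%:Z p).
have ic : mu.-integrable (pball (dil k%:Z p)) (EFin \o cst (\sum_(0 <= i < k) K i)).
  have Bfin : (mu (pball (dil k%:Z p)) < +oo)%E by rewrite vol_pball// ltry.
  apply: measurable_bounded_integrable => //.
  exists `|\sum_(0 <= i < k) K i|; split; first exact: num_real.
  by move=> M /ltW cM y _.
have pt x : pball (dil k%:Z p) x ->
    `|f x - PP f p x| <= `|f x - P k x| + \sum_(0 <= i < k) K i.
  move=> Bx; have := ler_dist_sum (fun i => P i x) (f x) k.
  rewrite {1}/P dil0 => /le_trans; apply.
  rewrite lerD2l !big_nat; apply: ler_sum => i /andP[_ ik].
  have Bz : Bk A D ((p.2 + i%:Z) + (k - i)%:Z) (x - p.1).
    rewrite -addrA -PoszD subnKC; last exact: ltnW.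
    by move: Bx; rewrite /pball dballP.
  have := HC f p.1 x (p.2 + i%:Z) (k - i)%N (P i.+1) mf (fint (dil i%:Z p)) (PP_polyd _ lf) Bz.
  move=> H; apply: le_trans H _; apply: ler_wpM2l.
    by rewrite mulr_ge0 ?invr_ge0 ?(ltW (bz0 _))// mulr_ge0 ?(ltW C0)// !exprn_ge0 ?ltW.
  exact: (Rintegral_diff_le (dil i.+1%:Z p) lf (sub_dil (leqnSn i))).
apply: (@le_trans _ _ (\int[mu]_(x in pball (dil k%:Z p)) (`|f x - P k x| + \sum_(0 <= i < k) K i))).
  apply: le_Rintegral => //; first exact: integrable_diff.
  have := integrableD mB (integrable_diff (dil k%:Z p) (dil k%:Z p) lf) ic.
  by apply: eq_integrable => // x _.
rewrite RintegralD//; last exact: integrable_diff.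
have -> : \int[mu]_(_ in pball (dil k%:Z p)) (\sum_(0 <= i < k) K i) =
    (\sum_(0 <= i < k) K i) * b ^ (p.2 + k%:Z).
  by rewrite Rintegral_cst//; congr (_ * _); apply: (congr1 fine (vol_pball hA hD hDvol _)).
rewrite mulr_suml -/(osc f (dil k%:Z p)).
rewrite mulrDl mul1r; apply: lerD.
  rewrite big_nat_recr//= subnn expr0 mul1r lerDr.
  by apply: sumr_ge0 => i _; rewrite mulr_ge0 ?osc_ge0// exprn_ge0// ltW.
rewrite big_nat_recl// mulrDr ler_wpDl//.
  by rewrite !mulr_ge0 ?osc_ge0 ?exprn_ge0 ?ltW.
rewrite mulr_sumr !big_nat; apply: ler_sum => i /andP[_ ik].
have -> : b ^ (p.2 + k%:Z) = b ^ (p.2 + i%:Z) * b ^+ (k - i).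
  rewrite (_ : k%:Z = i%:Z + (k - i)%:Z); last by rewrite -PoszD subnKC// ltnW.
  rewrite (addrA p.2); exact: (exprz_dil hA hD hDvol hr hrA).
rewrite /K /g (_ : (k - i)%N = (k - i.+1).+1); last by rewrite subnSK.
rewrite le_eqVlt; apply/orP; left; apply/eqP.
rewrite !exprS !exprMn -!exprM mulnC exprM; field.
by rewrite gt_eqF.
Qed.

End Oscillation.

Lemma gt1_ltr_powR (R : realType) (a x y : R) : 1 < a -> x < y -> a `^ x < a `^ y.
Proof.
move=> a1 xy; have a0 : 0 < a by exact: lt_trans a1.
by rewrite /powR gt_eqF// ltr_expR ltr_pM2r// ln_gt0.
Qed.

Section Star_bound.
Context {R : realType} {n : nat} (A : 'M[R]_n.+1) (D : set 'cV[R]_n.+1) (r : R).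
Hypotheses (hA : dilation A) (hD : ellipsoid0 D) (hDvol : Rvol D = 1%E) (hr : 1 < r)
  (hrA : [set r *: x | x in D] `<=` [set A *m x | x in D]).
Variables (lm lp : R) (hlam : eig_bounds A lm lp) (d : nat).

Local Notation V := (cvM R n.+1).
Local Notation mu := (@vol R n.+1).
Local Notation b := `|\det A|.
Local Notation T := ('cV[R]_n.+1 * int)%type.
Local Notation pball := (@pball R n A D).
Local Notation PP := (@PP R n A D d).
Local Notation osc := (@osc R n A D d).
Local Notation locint := (@locint R n A D).

Let b1 : 1 < b. Proof. exact: (det_gt1 hA hD hDvol hr hrA). Qed.
Let b0 : 0 < b. Proof. exact: lt_trans b1. Qed.
Let bz0 (l : int) : 0 < b ^ l. Proof. exact: exprz_gt0. Qed.

Variables (nX : (V -> \bar R) -> \bar R) (pm th : R).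
Hypotheses (hX : ball_QBFS A D nX) (hFS : assumption_FS A D nX pm)
  (hth : 0 < th) (hthm : th < pm).

(** Inequality (1) for an arbitrary index type, since it is applied to balls, to pairs of a ball and
    an annulus, and to triples of a ball, a level and a core. *)
Definition camp_le (f : V -> R) (Phi : R) := forall (I : Type) (s : seq I) (c : I -> R)
  (p : I -> T), (forall k, 0 <= c k) ->
  ((\sum_(k <- s) c k * osc f (p k))%R%:E <=
   Phi%:E * Xnorm nX th (fun x => (\sum_(k <- s) (c k `^ th) * \1_(pball (p k)) x)%R))%E.

Variable be : R.
Hypotheses (hbe1 : lp ^+ d < b `^ be) (hbe2 : 2 < th * (1 + be)).

(** Decay of the kernel from one annulus to the next, where rho is multiplied by b. *)
Let om : R := (b `^ (1 + be))^-1.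
Let om0 : 0 < om. Proof. by rewrite invr_gt0 powR_gt0. Qed.

Let omV : 0 < om^-1. Proof. by rewrite invr_gt0. Qed.

Let be1 : 0 < 1 + be.
Proof. by rewrite -(pmulr_rgt0 _ hth) (lt_trans _ hbe2). Qed.

Let om1 : om < 1.
Proof.
rewrite invf_lt1 ?powR_gt0// -[X in X < _](powRr0 b).
exact: gt1_ltr_powR.
Qed.

Definition star_kernel (l : int) (y : V) : R :=
  b `^ (be * l%:~R) / (b `^ (l%:~R * (1 + be)) + rho A D y `^ (1 + be)).

Lemma star_kernel_ge0 l y : 0 <= star_kernel l y.
Proof. by rewrite divr_ge0 ?powR_ge0// addr_ge0// powR_ge0. Qed.

Lemma measurable_star_kernel l : measurable_fun setT (star_kernel l).
Proof.
rewrite (_ : star_kernel l = fun y => b `^ (be * l%:~R) *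
  (b `^ (l%:~R * (1 + be)) + rho A D y `^ (1 + be)) `^ (-1)); last first.
  by apply/funext => y; rewrite powR_inv1// addr_ge0// powR_ge0.
apply: measurable_funM => //; apply: measurableT_comp (measurable_powR _) _.
apply: measurable_funD => //.
by apply: measurableT_comp (measurable_powR _) _; exact: (measurable_rho hA hD hDvol hr hrA).
Qed.

Lemma measurable_star_kernel_shift l (x0 : 'cV[R]_n.+1) :
  measurable_fun setT (fun x : V => star_kernel l (x - x0)).
Proof.
apply: (@measurableT_comp _ _ _ _ _ _ (star_kernel l) _ (fun x : V => x - x0 : V)).
  exact: measurable_star_kernel.
have := measurable_affine (1%:M : 'M[R]_n.+1) (- x0).
by apply: eq_measurable_fun => x _; rewrite mul1mx addrC.
Qed.

Let XE (l : int) : b ^ l * b `^ (be * l%:~R) = b `^ (l%:~R * (1 + be)).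
Proof.
rewrite -powR_intmul; last exact: ltW.
rewrite -powRD ?(gt_eqF b0) ?implybT//; congr (_ `^ _); ring.
Qed.

Let powb (k : nat) : (b ^+ k) `^ (1 + be) = om^-1 ^+ k.
Proof.
by rewrite /om invrK -powR_mulrn ?(ltW b0)// -powRrM mulrC powRrM powR_mulrn// powR_ge0.
Qed.

(** If k > 0 is the least index with y in B_(l+k), then rho is at least b^(l+k-1), so the kernel has
    gained only om^(k-1): this is the factor om^(-1) in front. *)
Lemma star_kernel_annuli l (N : nat) y : Bk A D (l + N%:Z) y ->
  b ^ l * star_kernel l y <=
    om^-1 * \sum_(0 <= k < N.+1) om ^+ k * \1_(Bk A D (l + k%:Z)) y.
Proof.
move=> BN; rewrite /star_kernel mulrA XE; set X := b `^ _.
have X0 : 0 < X by rewrite powR_gt0.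
have rp : 0 <= rho A D y `^ (1 + be) by exact: powR_ge0.
have exk : exists k : nat, `[< Bk A D (l + k%:Z) y >] by exists N; exact/asboolP.
case: (ex_minnP exk) => k /asboolP Bk kmin.
have kN : (k < N.+1)%N by rewrite ltnS; apply: kmin; exact/asboolP.
apply: (@le_trans _ _ (om^-1 * om ^+ k)); last first.
  rewrite (ler_pM2l omV) big_mkord (bigD1 (Ordinal kN))//= indicE mem_set// mulr1.
  by rewrite lerDl sumr_ge0// => i _; rewrite mulr_ge0 ?exprn_ge0 ?(ltW om0)// indicE ler0n.
case: k => [|k] in Bk kmin kN *.
  rewrite expr0 mulr1 ler_pdivrMr ?ltr_wpDr//.
  apply: (@le_trans _ _ (1 * (X + rho A D y `^ (1 + be)))); first by rewrite mul1r lerDl.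
  by apply: ler_wpM2r; [rewrite addr_ge0// ltW|rewrite invf_ge1// ltW].
rewrite exprS mulrA mulVf ?gt_eqF// mul1r.
have nB : ~ Defs.Bk A D (l + k%:Z) y.
  by move=> H; have := kmin k (asboolT H); rewrite ltnn.
have := rho_ge hA hD hDvol hr hrA nB => rg.
have : X * om^-1 ^+ k <= rho A D y `^ (1 + be).
  rewrite -powb /X powRrM powR_intmul ?(ltW b0)// -powRM ?(ltW (bz0 _)) ?exprn_ge0 ?(ltW b0)//.
  apply: ge0_ler_powR; rewrite ?nnegrE ?(ltW be1)//.
  - by rewrite mulr_ge0 ?exprn_ge0 ?(ltW b0)// ltW.
  - by rewrite (le_trans _ rg)// ltW.
  - by apply: le_trans rg; rewrite (exprz_dil hA hD hDvol hr hrA).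
rewrite exprVn => H; rewrite ler_pdivrMr ?ltr_wpDr//.
have H2 : X <= om ^+ k * (rho A D y `^ (1 + be)).
  by rewrite -ler_pdivrMl ?exprn_gt0// mulrC.
apply: le_trans H2 _; apply: ler_wpM2l; first by rewrite exprn_ge0// ltW.
by rewrite lerDr ltW.
Qed.

Let g := b * lp ^+ d.
Let lp0 : 0 < lp. Proof. exact: lt_trans (eig_bounds_gt1 hlam). Qed.
Let g0 : 0 < g. Proof. by rewrite mulr_gt0// exprn_gt0. Qed.
(** Equivalent to lp^d < b^be: the decay of the kernel beats the growth g in [osc_telescope]. *)
Let omg : om * g < 1.
Proof.
rewrite /om mulrC ltr_pdivrMr ?powR_gt0// mul1r /g powRD ?(gt_eqF b0) ?implybT//.
by rewrite powRr1 ?(ltW b0)// ltr_pM2l.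
Qed.

(** Telescoping on each annulus produces a convolution of oscillations with powers of g;
    [sum_geom_conv] and om g < 1 turn it into a single weighted sum. *)
Let kernel_int : exists2 C : R, 0 < C & forall f p (N : nat), locint f ->
  ((b ^ p.2)%:E * \int[mu]_(x in pball (dil N%:Z p))
     (star_kernel p.2 (x - p.1) * `|f x - PP f p x|)%:E <=
   (C * \sum_(0 <= i < N.+1) om ^+ i * osc f (dil i%:Z p))%:E)%E.
Proof.
have [C C0 HC] := osc_telescope hA hD hDvol hr hrA hlam d.
exists (om^-1 * (C * (1 - om * g)^-1)).
  apply: mulr_gt0 => //; apply: mulr_gt0 => //; rewrite invr_gt0 subr_gt0; exact: omg.
move=> f p N lf; have mB k := measurable_pball hA hD (dil k p).
pose u (x : V) := `|f x - PP f p x|.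
have mu_ : measurable_fun setT u by exact: (measurable_diff hA hD hDvol hr hrA).
have mk : measurable_fun setT (fun x : V => star_kernel p.2 (x - p.1)).
  exact: measurable_star_kernel_shift.
have k0 x : 0 <= star_kernel p.2 (x - p.1) * u x.
  by rewrite mulr_ge0 ?star_kernel_ge0 /u ?normr_ge0.
pose S (k : nat) := \sum_(0 <= i < k.+1) g ^+ (k - i) * osc f (dil i%:Z p).
have conv : \sum_(0 <= k < N.+1) om ^+ k * S k <=
    (1 - om * g)^-1 * \sum_(0 <= i < N.+1) om ^+ i * osc f (dil i%:Z p).
  rewrite -(@sum_geom_conv _ om g (fun i => osc f (dil i%:Z p)) S); first last.
  - move=> k; rewrite /S big_nat_recr//= subnn expr0 mul1r; congr (_ + _).
    rewrite mulr_sumr !big_nat; apply: eq_bigr => i /andP[_ ik].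
    by rewrite subSn// exprS mulrA.
  - by rewrite /S big_nat1 subnn expr0 mul1r.
  rewrite mulrDr mulrA mulVf ?gt_eqF ?subr_gt0// mul1r lerDl.
  apply: mulr_ge0; first by rewrite invr_ge0 subr_ge0 ltW.
  apply: mulr_ge0; first by apply: mulr_ge0; [rewrite exprn_ge0// ltW|exact: ltW].
  by apply: sumr_ge0 => i _; apply: mulr_ge0; [rewrite exprn_ge0// ltW|exact: osc_ge0].
rewrite -ge0_integralZl//; first last.
- by rewrite lee_fin ltW.
- by move=> x _; rewrite lee_fin; exact: k0.
- by apply: measurable_funTS; apply/measurable_EFinP; exact: measurable_funM.
apply: (@le_trans _ _ (\int[mu]_(x in pball (dil N%:Z p))
   (\sum_(0 <= k < N.+1) ((om^-1 * om ^+ k)%:E * (\1_(pball (dil k%:Z p)) x * u x)%:E)))%E).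
  apply: ge0_le_integral => //.
  - by move=> x _; rewrite -EFinM lee_fin mulr_ge0 ?(ltW (bz0 _)).
  - apply: measurable_funTS; apply: emeasurable_funM => //.
    by apply/measurable_EFinP; exact: measurable_funM.
  - apply: measurable_funTS; apply: emeasurable_sum => k; apply: emeasurable_funM => //.
    apply/measurable_EFinP; apply: measurable_funM => //; exact: measurable_indic.
  - move=> x Bx; have BN : Bk A D (p.2 + N%:Z) (x - p.1).
      by move: Bx; rewrite pballP.
    rewrite -EFinM; under eq_bigr do rewrite -EFinM.
    rewrite sumEFin lee_fin mulrA.
    apply: le_trans (ler_wpM2r (normr_ge0 _) (star_kernel_annuli BN)) _.
    rewrite -mulrA mulr_suml mulr_sumr; apply: ler_sum => k _.
    rewrite le_eqVlt; apply/orP; left; apply/eqP; rewrite -!mulrA; congr (_ * (_ * (_ * _))).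
    by rewrite !indicE; congr (_%:R); congr nat_of_bool; apply: asbool_equiv_eq; rewrite pballP.
rewrite ge0_integral_sum//; first last.
- move=> k x _; rewrite -EFinM lee_fin; apply: mulr_ge0.
    by apply: mulr_ge0; [exact: ltW|rewrite exprn_ge0// ltW].
  by apply: mulr_ge0; [rewrite indicE ler0n|exact: normr_ge0].
- move=> k; apply: measurable_funTS; apply: emeasurable_funM => //.
  by apply/measurable_EFinP; apply: measurable_funM => //; exact: measurable_indic.
apply: (@le_trans _ _ (\sum_(0 <= k < N.+1) (om^-1 * om ^+ k * (C * S k))%:E)%E).
  rewrite !big_nat; apply: lee_sum => k /andP[_ kN].
  rewrite ge0_integralZl//; first last.
  - by rewrite lee_fin mulr_ge0 ?invr_ge0 ?exprn_ge0// ltW.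
  - by move=> x _; rewrite lee_fin; apply: mulr_ge0; [rewrite indicE ler0n|exact: normr_ge0].
  - apply: measurable_funTS; apply/measurable_EFinP; apply: measurable_funM => //; exact: measurable_indic.
  rewrite [X in (_ <= X)%E]EFinM; apply: lee_wpmul2l.
    by rewrite lee_fin mulr_ge0 ?invr_ge0 ?exprn_ge0// ltW.
  have := HC f p k lf; rewrite -lee_fin -/(S k); apply: le_trans.
  rewrite /Rintegral fineK; last first.
    have /(integrable_fin_num (mB k%:Z)) := integrable_diff hA hD hDvol hr hrA d p (dil k%:Z p) lf.
    exact.
  rewrite [leRHS]integral_mkcond [leLHS]integral_mkcond; apply: ge0_le_integral => //.
  - by move=> x _; rewrite patchE; case: ifP => // _; rewrite lee_fin; apply: mulr_ge0; [rewrite indicE ler0n|exact: normr_ge0].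
  - apply/(measurable_restrictT _ (mB N%:Z)); apply: measurable_funTS; apply/measurable_EFinP.
    by apply: measurable_funM => //; exact: measurable_indic.
  - by apply/(measurable_restrictT _ (mB k%:Z)); apply: measurable_funTS; exact/measurable_EFinP.
  - move=> x _; rewrite !patchE indicE; case: (boolP (x \in pball (dil k%:Z p))) => [_|_].
      by case: ifP => _; rewrite ?mul1r ?lee_fin.
    by case: ifP => _; rewrite ?mul0r.
rewrite sumEFin lee_fin.
have -> : \sum_(0 <= k < N.+1) om^-1 * om ^+ k * (C * S k) =
    om^-1 * (C * \sum_(0 <= k < N.+1) om ^+ k * S k).
  by rewrite !mulr_sumr; apply: eq_bigr => k _; ring.
by rewrite -!mulrA (ler_pM2l omV) (ler_pM2l C0); exact: conv.
Qed.

(** Ratio of the series over annuli: coefficients om^i enter with power th and (FS) charges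
    b^(2i). *)
Let w2 := om `^ th * b ^+ 2.
Let w20 : 0 < w2. Proof. by rewrite mulr_gt0 ?powR_gt0// exprn_gt0. Qed.
Let w21 : w2 < 1.
Proof.
have -> : w2 = b ^+ 2 / b `^ (th * (1 + be)).
  rewrite /w2 /om -powR_inv1 ?powR_ge0// -!powRrM mulrC; congr (_ * _).
  by rewrite -powR_inv1 ?powR_ge0// -powRrM; congr (_ `^ _); ring.
rewrite ltr_pdivrMr ?powR_gt0// mul1r -powR_mulrn ?(ltW b0)//.
exact: gt1_ltr_powR.
Qed.

(* Sum over annuli: each step outwards costs lp ^ d by osc_telescope and gains b ^ (- be) from the
   kernel, and (FS) replaces the dilated balls by the original ones at the price of squared volume
   ratios, which 2 < th * (1 + be) makes summable. *)
Lemma star_bound : exists2 C : R, 0 < C & forall f (Phi : R), locint f -> 0 <= Phi ->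
  camp_le f Phi -> forall (I : Type) (s : seq I) (c : I -> R) (p : I -> T),
  (forall k, 0 <= c k) ->
  (\sum_(j <- s) (c j)%:E * ((b ^ (p j).2)%:E *
      \int[mu]_x (star_kernel (p j).2 (x - (p j).1) * `|f x - PP f (p j) x|)%:E) <=
   (C * Phi)%:E * Xnorm nX th (fun x => (\sum_(k <- s) (c k `^ th) * \1_(pball (p k)) x)%R))%E.
Proof.
have [C1 C10 HC1] := kernel_int.
have [C2 [C20 HC2]] := FS_balls hA hD hDvol hr hrA hX hFS hth hthm.
pose G := (1 - w2)^-1; have G0 : 0 < G by rewrite invr_gt0 subr_gt0; exact: w21.
exists (C1 * C2 * G `^ th^-1); first by rewrite !mulr_gt0// powR_gt0.
move=> f Phi lf Phi0 camp I s c p c0.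
set u := fun x => \sum_(k <- s) _.
have mu_ : measurable_fun setT u.
  apply: measurable_sum => k; apply: measurable_funM => //.
  by apply: measurable_indic; exact: measurable_pball.
have u0 x : 0 <= u x by apply: sumr_ge0 => k _; rewrite mulr_ge0 ?powR_ge0// indicE ler0n.
pose K j (x : V) := star_kernel (p j).2 (x - (p j).1) * `|f x - PP f (p j) x|.
have K0 j x : 0 <= K j x by rewrite mulr_ge0// star_kernel_ge0.
have mK j : measurable_fun setT (K j).
  apply: measurable_funM; last exact: (measurable_diff hA hD hDvol hr hrA).
  exact: measurable_star_kernel_shift.
pose t j (N : nat) := ((c j)%:E * ((b ^ (p j).2)%:E * \int[mu]_(x in pball (dil N%:Z (p j))) (K j x)%:E))%E.
have step N : (\sum_(j <- s) t j N <= (C1 * C2 * G `^ th^-1 * Phi)%:E * Xnorm nX th u)%E.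
  pose s2 := [seq (j, i) | j <- s, i <- index_iota 0 N.+1].
  pose c2 (ji : I * nat) := c ji.1 * om ^+ ji.2.
  pose p2 (ji : I * nat) := dil ji.2%:Z (p ji.1).
  have c20 ji : 0 <= c2 ji by rewrite mulr_ge0 ?exprn_ge0 ?(ltW om0).
  apply: (@le_trans _ _ (C1%:E * (\sum_(ji <- s2) c2 ji * osc f (p2 ji))%:E)%E).
    rewrite -EFinM big_allpairs mulr_sumr -sumEFin; apply: lee_sum => j _.
    rewrite (_ : C1 * _ = c j * (C1 * \sum_(0 <= i < N.+1) om ^+ i * osc f (dil i%:Z (p j)))).
      rewrite EFinM; apply: lee_wpmul2l; first by rewrite lee_fin.
      exact: HC1.
    rewrite !mulr_sumr; apply: eq_bigr => i _; rewrite /c2 /p2/=; ring.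
  apply: (@le_trans _ _ (C1%:E * (Phi%:E * (C2%:E * ((G `^ th^-1)%:E * Xnorm nX th u))))%E); last first.
    by rewrite !muleA -!EFinM; apply: lee_wpmul2r; [exact: (Xnorm_ge0 th hX)|rewrite lee_fin; lra].
  apply: lee_wpmul2l; first by rewrite lee_fin ltW.
  apply: le_trans (camp _ s2 c2 p2 c20) _; apply: lee_wpmul2l; first by rewrite lee_fin.
  (* The factor b^(2i) cancels the squared volume ratio of the ball to its i-th dilate in
     [FS_balls]. *)
  pose a (ji : I * nat) := (c2 ji) `^ th * b ^+ 2 ^+ ji.2.
  have a0 ji : 0 <= a ji by rewrite mulr_ge0 ?powR_ge0// !exprn_ge0// ltW.
  have := HC2 _ s2 a p2 (fun ji => pball (p ji.1)) a0
    (fun ji => measurable_pball hA hD (p ji.1)).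
  have sub ji : pball (p ji.1) `<=` pball (p2 ji).
    have := sub_dil hA hD hr hrA (p := p ji.1) (leq0n ji.2).
    by rewrite {1}/dil addr0 -surjective_pairing.
  move=> /(_ sub) H.
  apply: (@le_trans _ _ (Xnorm nX th (fun x => (\sum_(k <- s2) a k *
      (fine (mu (pball (p k.1))) / b ^ (p2 k).2) ^+ 2 * \1_(pball (p2 k)) x)%R))).
    rewrite le_eqVlt; apply/orP; left; apply/eqP; congr (Xnorm _ _ _).
    apply/funext => x; apply: eq_bigr => k _; congr (_ * _).
    rewrite (_ : fine _ = b ^ (p k.1).2); last exact: (congr1 fine (vol_pball hA hD hDvol _)).
    rewrite /a /p2/= (exprz_dil hA hD hDvol hr hrA) -exprnP.
    have bk : b ^+ k.2 != 0 by rewrite gt_eqF// exprn_gt0.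
    rewrite -exprM mulnC exprM; field.
    by rewrite bk gt_eqF.
  apply: le_trans H _; apply: lee_wpmul2l; first by rewrite lee_fin ltW.
  rewrite -(Xnorm_scale th hX)//; apply: (Xnorm_le hX hth).
  - apply: measurable_sum => k; apply: measurable_funM => //.
    by apply: measurable_indic; exact: measurable_pball.
  - exact: measurable_funM.
  - move=> x; apply/andP; split.
      by apply: sumr_ge0 => k _; rewrite mulr_ge0// indicE ler0n.
    rewrite big_allpairs /u mulr_sumr; apply: ler_sum => j _.
    rewrite (eq_bigr (fun i => w2 ^+ i * (c j `^ th * \1_(pball (p j)) x))).
      rewrite -mulr_suml; apply: ler_wpM2r.
        by rewrite mulr_ge0 ?powR_ge0// indicE ler0n.
      by apply: geom_sum_le; rewrite (ltW w20).
    move=> i _; rewrite /a /c2/= powRM ?exprn_ge0 ?(ltW om0)//.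
    have -> : (om ^+ i) `^ th = (om `^ th) ^+ i.
      by rewrite -powR_mulrn ?(ltW om0)// -powRrM mulrC powRrM powR_mulrn// powR_ge0.
    have alg (x1 x2 x3 x4 : R) : x1 * x2 * x3 * x4 = x2 * x3 * (x1 * x4) by ring.
    have w2E : w2 ^+ i = (om `^ th) ^+ i * (b ^+ 2) ^+ i := exprMn _ _ _.
    by rewrite w2E alg.
(* The dilates of each ball exhaust R^n, so the truncated integrals increase to the full ones. *)
have cv : (fun N => \sum_(j <- s) t j N)%E @ \oo -->
    (\sum_(j <- s) (c j)%:E * ((b ^ (p j).2)%:E * \int[mu]_x (K j x)%:E))%E.
  apply: cvg_nnesum => j _.
    apply: nearW => N; rewrite mule_ge0 ?lee_fin// mule_ge0 ?lee_fin ?(ltW (bz0 _))//.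
    by apply: integral_ge0 => x _; rewrite lee_fin.
  apply: cvgeZl => //; apply: cvgeZl => //.
  rewrite (_ : (\int[mu]_x _)%E = (\int[mu]_(x in \bigcup_N pball (dil N%:Z (p j))) (K j x)%:E)%E); last first.
    congr (integral _ _ _); apply/esym/seteqP; split => // x _.
    have [k Bx] := Bk_union hA hD hr hrA (x - (p j).1).
    have [m Hm] : exists m : nat, k <= (p j).2 + m%:Z.
      by exists `|k - (p j).2|%N; rewrite -lerBlDl lez_abs.
    exists m => //; rewrite pballP; exact: (Bk_le hA hD hr hrA Hm Bx).
  apply: ge0_nondecreasing_set_cvg_integral.
  - by move=> k m km; apply/subsetPset; exact: (sub_dil hA hD hr hrA).
  - by move=> k; exact: measurable_pball.
  - by move=> k; apply: measurable_funTS; exact/measurable_EFinP.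
  - by move=> k x _; rewrite lee_fin.
by apply: (cvge_to_le cv); exact: nearW.
Qed.

End Star_bound.

Lemma lee_div_of_mul (R : realType) (c t : R) (x : \bar R) : 0 < t ->
  (t%:E * x <= c%:E)%E -> (x <= (c / t)%:E)%E.
Proof.
move=> t0 H; have -> : x = ((t^-1)%:E * (t%:E * x))%E.
  by rewrite muleA -EFinM mulVf ?gt_eqF// mul1e.
by rewrite mulrC EFinM; apply: lee_wpmul2l H; rewrite lee_fin invr_ge0 ltW.
Qed.

(** * Whitney towers and the local L^q oscillation *)

Section Tower.
Context {R : realType} {n : nat} (A : 'M[R]_n.+1) (D : set 'cV[R]_n.+1) (r : R).
Hypotheses (hA : dilation A) (hD : ellipsoid0 D) (hDvol : Rvol D = 1%E) (hr : 1 < r)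
  (hrA : [set r *: x | x in D] `<=` [set A *m x | x in D]).

Local Notation V := (cvM R n.+1).
Local Notation mu := (@vol R n.+1).
Local Notation b := `|\det A|.
Local Notation T := ('cV[R]_n.+1 * int)%type.
Local Notation pball := (@pball R n A D).
Local Notation oball := (@oball R n A D).
Local Notation sg := ((dsig hr)%:Z).

Let b1 : 1 < b. Proof. exact: (det_gt1 hA hD hDvol hr hrA). Qed.
Let b0 : 0 < b. Proof. exact: lt_trans b1. Qed.
Let bz0 (l : int) : 0 < b ^ l. Proof. exact: exprz_gt0. Qed.

Lemma pball_dil_le (p : T) (k l : int) : k <= l -> pball (dil k p) `<=` pball (dil l p).
Proof.
move=> kl x [y By <-]; exists y => //; apply: (Bk_le hA hD hr hrA _ By).
by rewrite /= lerD2l.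
Qed.

Lemma dil_dil (p : T) (k l : int) : dil k (dil l p) = dil (l + k) p.
Proof. by rewrite /dil /= addrA. Qed.

Lemma dil_0 (p : T) : dil 0 p = p.
Proof. by rewrite /dil addr0 -surjective_pairing. Qed.

Lemma exprz_le_inv (k l : int) : b ^ k <= b ^ l -> k <= l.
Proof.
move=> kl; rewrite leNgt; apply/negP => lk.
have lk1 : l + 1 <= k by rewrite lezD1.
have := le_trans (exprz_le hA hD hDvol hr hrA lk1) kl.
rewrite (exprz_dil hA hD hDvol hr hrA) ger_pMr//.
by rewrite leNgt expr1z b1.
Qed.

(** b^(2 sg) comes from the weak type inequality, 2 from outer regularity, and the outer factor 2
    from summing all levels above m with rho >= 2. *)
Definition tower_cst : R := 2 * (b ^ (sg + sg) + 2).

(* Om m stands for the set where the maximal function of w exceeds rho ^ m, and e m enumerates the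
   disjoint cores of a Whitney covering of it (None pads a finite family). Level 0 is the single
   ball p0. *)
Record whitney_tower (rho : R) (p0 : T) (w : V -> R) (Om : nat -> set V)
    (e : nat -> nat -> option T) : Prop := WhitneyTower {
  wt_zero : forall i, e 0%N i = if i is 0%N then Some p0 else None;
  wt_meas : forall m, measurable (Om m);
  wt_Om0 : Om 0%N = pball p0;
  wt_dec : forall m, Om m.+2 `<=` Om m.+1;
  wt_vol : forall m, (mu (Om m) <= (tower_cst * b ^ p0.2 / rho ^+ m)%:E)%E;
  wt_sub : forall m, Om m `<=` pball (dil (sg + sg) p0);
  wt_off : forall m x, ~ Om m.+1 x -> w x <= rho ^+ m.+1;
  wt_avg : forall m j p, e m.+1 j = Some p ->
    (\int[mu]_(y in pball (dil (4 * sg + 1) p)) (w y)%:E <=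
     (rho ^+ m.+1 * b ^ (p.2 + (4 * sg + 1)))%:E)%E;
  wt_meet : forall m i j p p', e m i = Some p -> e m.+1 j = Some p' ->
    pball (dil (sg + sg) p) `&` pball (dil (sg + sg) p') !=set0 ->
    pball (dil (sg + sg) p') `<=` pball (dil (6 * sg) p);
  wt_core : forall m i p, e m i = Some p -> pball p `<=` Om m;
  wt_disj : forall m, trivIset setT (fun i => oball (e m i));
  wt_cover : forall m x, Om m.+1 x -> exists i p,
    e m.+1 i = Some p /\ pball (dil (sg + sg) p) x }.

Let sg0 : 0 <= sg. Proof. by []. Qed.

Let meet_sub (p p' : T) : p'.2 <= p.2 + (sg + sg) ->
  pball (dil (sg + sg) p) `&` pball (dil (sg + sg) p') !=set0 ->
  pball (dil (sg + sg) p') `<=` pball (dil (6 * sg) p).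
Proof.
move=> le [x [px p'x]].
have -> : dil (6 * sg) p = dil (sg + sg) (dil (4 * sg) p).
  by rewrite dil_dil; congr (dil _ _); lia.
apply: (pball_meet_sub hA hD hr hrA); first by rewrite /=; lia.
by exists x; split => //; apply: pball_dil_le px; lia.
Qed.

(** Every level has to be open, nested and of volume of order rho^(-m), with w at most rho^m
    outside. The level set of the maximal function alone would need Lebesgue differentiation for the
    last property; adding an open neighbourhood of {w > rho^m} makes it immediate and valid at every
    point. *)
Lemma exists_whitney_tower (rho : R) (p0 : T) (w : V -> R) : 2 <= rho ->
  measurable_fun setT w -> (forall x, 0 <= w x) -> (forall x, ~ pball p0 x -> w x = 0) ->
  (\int[mu]_x (w x)%:E <= (b ^ p0.2)%:E)%E ->
  exists Om e, whitney_tower rho p0 w Om e.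
Proof.
move=> rho2 mw w0 wsupp Iw.
have rho0 : 0 < rho by apply: lt_le_trans rho2.
have rhom m : 0 < rho ^+ m by rewrite exprn_gt0.
have Iwoo : (\int[mu]_x (w x)%:E < +oo)%E by apply: le_lt_trans Iw _; rewrite ltry.
pose E m : set V := [set x | rho ^+ m < w x].
have mE m : measurable (E m).
  rewrite -[E m]setTI; have := mw measurableT _ (measurable_itv `]rho ^+ m, +oo[).
  by congr measurable; apply/seteqP; split => x [_ /=]; rewrite in_itv/= andbT.
have EB m : E m `<=` pball p0.
  by move=> x Ex; apply: contrapT => /wsupp w0x; move: Ex; rewrite /E/= w0x ltNge ltW.
have volE m : (mu (E m) <= (b ^ p0.2 / rho ^+ m)%:E)%E.
  apply: lee_div_of_mul => //; apply: le_trans Iw.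
  have -> : mu (E m) = (\int[mu]_x (\1_(E m) x)%:E)%E by rewrite integral_indic// setIT.
  rewrite -ge0_integralZl//; [|exact: measurable_indicE|by rewrite lee_fin ltW].
  apply: ge0_le_integral => //.
  - by move=> x _; rewrite -EFinM lee_fin mulr_ge0 ?(ltW (rhom m))// indicE ler0n.
  - by apply: emeasurable_funM => //; exact: measurable_indicE.
  - exact/measurable_EFinP.
  - move=> x _; rewrite -EFinM lee_fin indicE; case: (boolP (x \in E m)) => [|_].
      by rewrite inE mulr1 => /ltW.
    by rewrite mulr0.
have oB : open (pball p0 : set 'cV[R]_n.+1) by exact: (dball_open hA hD).
have fB : (mu (pball p0) < +oo)%E by rewrite vol_pball// ltry.
have exW m : exists W : set V, [/\ @open 'cV[R]_n.+1 W, E m `<=` W, W `<=` pball p0 &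
    (mu W <= (2 * b ^ p0.2 / rho ^+ m)%:E)%E].
  have e0 : 0 < b ^ p0.2 / rho ^+ m by rewrite divr_gt0.
  have [W [oW EW WB muW]] := vol_outer_regular oB fB (mE m) (@EB m) e0.
  exists W; split => //; apply: le_trans muW _.
  rewrite (_ : (2 * b ^ p0.2 / rho ^+ m)%:E = ((b ^ p0.2 / rho ^+ m)%:E + (b ^ p0.2 / rho ^+ m)%:E)%E).
    exact: leeD2r.
  by rewrite -EFinD; congr (_%:E); ring.
have [W HW] := choice exW.
pose U m : set V := level_set A D w (rho ^+ m) `|` W m.
have oU m : open (U m : set 'cV[R]_n.+1).
  by apply: openU; [exact: level_set_open|case: (HW m)].
have volU m : (mu (U m) <= ((b ^ (sg + sg) + 2) * b ^ p0.2 / rho ^+ m)%:E)%E.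
  have mL : measurable (level_set A D w (rho ^+ m)).
    by apply: open_measurable_cV; exact: level_set_open.
  have mW : measurable (W m) by apply: open_measurable_cV; case: (HW m).
  apply: (@le_trans _ _ (mu (level_set A D w (rho ^+ m)) + mu (W m))%E); first exact: measureU2.
  rewrite (_ : ((b ^ (sg + sg) + 2) * b ^ p0.2 / rho ^+ m)%:E =
    ((b ^ (sg + sg) * b ^ p0.2 / rho ^+ m)%:E + (2 * b ^ p0.2 / rho ^+ m)%:E)%E); last first.
    by rewrite -EFinD; congr (_%:E); ring.
  apply: leeD; last by case: (HW m).
  have := weak_type hA hD hDvol hr hrA (rhom m) mw w0 Iwoo => wk.
  apply: lee_div_of_mul => //; apply: le_trans wk _.
  by rewrite EFinM; apply: lee_wpmul2l => //; rewrite lee_fin ltW.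
have Usub m : (0 < m)%N -> U m `<=` pball (dil (sg + sg) p0).
  move=> m0 x [[p /= wp px]|]; last first.
    case: (HW m) => _ _ WB _ /WB; rewrite -{1}(dil_0 p0); apply: pball_dil_le; lia.
  have Ip : (\int[mu]_(y in pball p) (w y)%:E <= (b ^ p0.2)%:E)%E.
    apply: le_trans Iw; apply: ge0_subset_integral => //; [exact: measurable_pball|exact/measurable_EFinP|].
    by move=> y _; rewrite lee_fin.
  (* The mean of w over [p] exceeds rho^m >= 1 while its total mass is at most the volume of [p0],
     so [p] is no larger than [p0]; carrying mass, it also meets [p0]. *)
  have pl : p.2 <= p0.2.
    apply: exprz_le_inv; rewrite -lee_fin; apply: le_trans Ip; apply: le_trans (ltW wp).
    rewrite lee_fin ler_peMl ?(ltW (bz0 _))//; apply: exprn_ege1.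
    by apply: le_trans rho2; rewrite ler1n.
  apply: (pball_meet_sub hA hD hr hrA pl) px.
  apply: contrapT => /set0P/negP/negPn/eqP disj.
  move: wp; rewrite integral0_eq; first by rewrite lte_fin ltNge mulr_ge0// ltW.
  move=> y py; rewrite wsupp// => p0y.
  by have : (pball p `&` pball p0) y by []; rewrite disj.
(* The neighbourhoods W are chosen independently at each level, so nesting is forced by taking the
   union of all higher levels. Nesting starts at level 1: [Om 1] lies in a dilate of [p0], not
   necessarily in [p0]. *)
pose Om m : set V := if m is m'.+1 then \bigcup_k U (m + k)%N else pball p0.
have oOm m : open (Om m : set 'cV[R]_n.+1).
  by case: m => [//|m]; apply: bigcup_open => k _; exact: oU.
have mOm m : measurable (Om m) by exact: open_measurable_cV.
have volOm m : (mu (Om m) <= (tower_cst * b ^ p0.2 / rho ^+ m)%:E)%E.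
  case: m => [|m].
    rewrite /Om expr0 divr1 vol_pball// lee_fin ler_peMl ?(ltW (bz0 _))//.
    by rewrite /tower_cst; have := bz0 (sg + sg); lra.
  pose c := (b ^ (sg + sg) + 2) * b ^ p0.2 / rho ^+ m.+1.
  have c0 : 0 <= c by rewrite divr_ge0 ?(ltW (rhom _))// mulr_ge0 ?(ltW (bz0 _))// addr_ge0// ltW.
  apply: (@le_trans _ _ (\sum_(0 <= k <oo) mu (U (m.+1 + k)%N))%E).
    apply: measure_sigma_subadditive => //.
    by move=> k; apply: open_measurable_cV; exact: oU.
  apply: (@le_trans _ _ (\sum_(0 <= k <oo) ((2 * c) / (2 ^ k.+1)%:R)%:E)%E).
    apply: lee_nneseries => k; first by move=> _ _; exact: measure_ge0.
    move=> _; apply: le_trans (volU _) _; rewrite lee_fin.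
    have -> : (b ^ (sg + sg) + 2) * b ^ p0.2 / rho ^+ (m.+1 + k) = c / rho ^+ k.
      by rewrite /c exprD invfM mulrA.
    have -> : 2 * c / (2 ^ k.+1)%:R = c / 2 ^+ k.
      by rewrite natrX exprS; field; rewrite gt_eqF// exprn_gt0.
    apply: ler_wpM2l => //.
    by rewrite lef_pV2 ?posrE ?exprn_gt0//; apply: lerXn2r; rewrite ?nnegrE// ltW.
  apply: le_trans (epsilon_trick0 _ _) _; first by rewrite mulr_ge0.
  by rewrite lee_fin /tower_cst /c -!mulrA.
have exe m : exists e : nat -> option T, [/\
    (forall j p, e j = Some p -> pball (dil (4 * sg) p) `<=` Om m.+1 /\
                 ~ (pball (dil (4 * sg + 1) p) `<=` Om m.+1)),
    trivIset setT (fun j => oball (e j)) &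
    forall x, Om m.+1 x -> exists j p, e j = Some p /\ pball (dil (sg + sg) p) x].
  apply: (whitney hA hD hDvol hr hrA) => //.
  by apply: le_lt_trans (volOm m.+1) _; rewrite ltry.
have [e' He'] := choice exe.
pose e m := if m is m'.+1 then e' m' else fun i => if i is 0%N then Some p0 else None.
have eW m j p : e m.+1 j = Some p -> pball (dil (4 * sg) p) `<=` Om m.+1 /\
    ~ (pball (dil (4 * sg + 1) p) `<=` Om m.+1).
  by case: (He' m) => + _ _; apply.
have Omdec m : Om m.+2 `<=` Om m.+1.
  move=> x [k _ Ux]; exists k.+1 => //.
  by rewrite addnS -addSn.
have Omsub m : Om m `<=` pball (dil (sg + sg) p0).
  case: m => [|m]; first by rewrite /Om -{1}(dil_0 p0); apply: pball_dil_le; lia.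
  by move=> x [k _]; apply: Usub; rewrite addSn.
exists Om, e; split => //.
- move=> m x nOm; rewrite leNgt; apply/negP => wx; apply: nOm; exists 0%N => //.
  by rewrite addn0; right; case: (HW m.+1) => _ + _ _; apply.
(* The first dilate not contained in Om holds a point outside the level set, and a ball through such
   a point has mean at most rho^(m+1). *)
- move=> m j p /eW[_ nsub].
  have [y [py nOy]] : exists y, pball (dil (4 * sg + 1) p) y /\ ~ Om m.+1 y.
    apply: contrapT => /forallNP H; apply: nsub => y py; apply: contrapT => nO.
    exact: (H y).
  apply: (level_set_notin _ py) => L; apply: nOy; exists 0%N => //; left.
  by rewrite addn0.
(* A ball p' of the next level cannot exceed p by more than 2 sg levels. At level 0 volumes decide;
   above, a larger p' would have the dilate of p by 4 sg + 1 inside its own dilate by 4 sg, hence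
   inside Om, against the Whitney choice of p. *)
- move=> m i j p p' ep ep' meet; apply: meet_sub (meet).
  have [sub' nsub'] := eW _ _ _ ep'.
  case: m ep ep' sub' nsub' => [|m] ep ep' sub' nsub'.
    have {ep} -> : p = p0 by case: i ep => //= -[].
    have : (mu (pball (dil (4 * sg) p')) <= mu (pball (dil (sg + sg) p0)))%E.
      apply: le_measure; rewrite ?inE; try exact: measurable_pball.
      exact: subset_trans sub' (Omsub 1%N).
    rewrite !vol_pball// lee_fin => /exprz_le_inv /=; lia.
  rewrite leNgt; apply/negP => lt.
  have [_ nsub] := eW _ _ _ ep.
  apply: nsub; apply: subset_trans (@Omdec m); apply: subset_trans sub'.
  have -> : dil (4 * sg) p' = dil (sg + sg) (dil (sg + sg) p').
    by rewrite dil_dil; congr (dil _ _); lia.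
  apply: (pball_meet_sub hA hD hr hrA); first by rewrite /=; lia.
  have [x [px p'x]] := meet; exists x; split => //.
  by apply: pball_dil_le px; lia.
- case=> [|m] i p /=; first by case: i => // -[->].
  move=> /(eW m)[+ _]; apply: subset_trans.
  by rewrite -{1}(dil_0 p); apply: pball_dil_le; lia.
- case=> [|m] /=; last by case: (He' m).
  by move=> i j _ _; case: i => [|i]; case: j => [|j] //= [x []].
- by move=> m; case: (He' m).
Qed.

End Tower.

(** * Telescoping along a Whitney tower *)

Section Level_bound.
Context {R : realType} {n : nat} (A : 'M[R]_n.+1) (D : set 'cV[R]_n.+1) (r : R).
Hypotheses (hA : dilation A) (hD : ellipsoid0 D) (hDvol : Rvol D = 1%E) (hr : 1 < r)
  (hrA : [set r *: x | x in D] `<=` [set A *m x | x in D]).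
Variables (lm lp : R) (hlam : eig_bounds A lm lp) (d : nat).

Local Notation V := (cvM R n.+1).
Local Notation mu := (@vol R n.+1).
Local Notation b := `|\det A|.
Local Notation T := ('cV[R]_n.+1 * int)%type.
Local Notation pball := (@pball R n A D).
Local Notation oball := (@oball R n A D).
Local Notation PP := (@PP R n A D d).
Local Notation osc := (@osc R n A D d).
Local Notation locint := (@locint R n A D).
Local Notation sg := ((dsig hr)%:Z).

Let b1 : 1 < b. Proof. exact: (det_gt1 hA hD hDvol hr hrA). Qed.
Let b0 : 0 < b. Proof. exact: lt_trans b1. Qed.
Let bz0 (l : int) : 0 < b ^ l. Proof. exact: exprz_gt0. Qed.
Let lp0 : 0 < lp. Proof. exact: lt_trans (eig_bounds_gt1 hlam). Qed.

Lemma Rintegral_diffE f (p q : T) : locint f ->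
  ((\int[mu]_(x in pball q) `|f x - PP f p x|)%:E =
   \int[mu]_(x in pball q) (`|f x - PP f p x|)%:E)%E.
Proof.
move=> lf; rewrite /Rintegral fineK//.
have /(integrable_fin_num (measurable_pball hA hD q)) :=
  integrable_diff hA hD hDvol hr hrA d p q lf.
exact.
Qed.

Lemma ge0_integralZl_cst (E : set V) (c : R) (h : V -> R) : measurable E -> 0 <= c ->
  measurable_fun setT h -> (forall x, 0 <= h x) ->
  (\int[mu]_(x in E) (c%:E * (h x)%:E) = c%:E * \int[mu]_(x in E) (h x)%:E)%E.
Proof.
move=> mE c0 mh h0; apply: ge0_integralZl => //.
  by apply: measurable_funTS; exact/measurable_EFinP.
by move=> x _; rewrite lee_fin.
Qed.

Lemma integral_cst_pball (p : T) (c : R) :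
  (\int[mu]_(x in pball p) c%:E = (c * b ^ p.2)%:E)%E.
Proof.
rewrite integral_cst; last exact: measurable_pball.
by rewrite EFinM; congr (_ * _)%E; exact: vol_pball.
Qed.

(** Replacing the projection on p by the one on its k-th dilate costs a constant depending only on
    k. *)
Lemma integral_diff_le_osc (k : nat) : exists2 C : R, 0 < C & forall f p, locint f ->
  (\int[mu]_(x in pball (dil k%:Z p)) (`|f x - PP f p x|)%:E <=
   (C * osc f (dil k%:Z p))%:E)%E.
Proof.
have [C C0 HC] := projP_bound hA hD hDvol hr hrA hlam d.
pose L := C * (lp ^+ k) ^+ d * b ^+ k.
have L0 : 0 < L by rewrite !mulr_gt0 ?exprn_gt0.
exists (1 + L); first by rewrite addr_gt0.
move=> f p lf; have [mf fint] := lf; pose p' := dil k%:Z p.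
have mB := measurable_pball hA hD p'.
have sub : pball p `<=` pball p'.
  by have := sub_dil hA hD hr hrA (p := p) (leq0n k); rewrite dil_0.
pose c := C * (lp ^+ k) ^+ d / b ^ p.2 * osc f p'.
have osc0 := osc_ge0 A D d f p'.
have c0 : 0 <= c.
  by rewrite mulr_ge0// mulr_ge0 ?invr_ge0 ?(ltW (bz0 _))// mulr_ge0 ?(ltW C0)// !exprn_ge0// ltW.
have md q : measurable_fun setT (fun x : V => `|f x - PP f q x|).
  exact: (measurable_diff hA hD hDvol hr hrA).
apply: (@le_trans _ _ (\int[mu]_(x in pball p') ((`|f x - PP f p' x|)%:E + c%:E))%E).
  apply: ge0_le_integral => //.
  - by apply: measurable_funTS; exact/measurable_EFinP.
  - by apply: measurable_funTS; apply: emeasurable_funD => //; exact/measurable_EFinP.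
  - move=> x Bx; rewrite -EFinD lee_fin.
    have Bz : Bk A D (p.2 + k%:Z) (x - p.1) by move: Bx; rewrite pballP.
    have := HC f p.1 x p.2 k (PP f p') mf (fint p) (PP_polyd hA hD hDvol hr hrA d p' lf) Bz.
    move=> H; have H2 : `|PP f p x - PP f p' x| <= c.
      apply: le_trans H _; apply: ler_wpM2l.
        by rewrite mulr_ge0 ?invr_ge0 ?(ltW (bz0 _))// mulr_ge0 ?(ltW C0)// !exprn_ge0// ltW.
      exact: (Rintegral_diff_le hA hD hDvol hr hrA d p' lf sub).
    apply: le_trans (ler_distD (PP f p' x) _ _) _; rewrite lerD2l distrC.
    exact: H2.
rewrite ge0_integralD//; first last.
- by apply: measurable_funTS; exact/measurable_EFinP.
rewrite -Rintegral_diffE// integral_cst_pball.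
rewrite -EFinD lee_fin mulrDl mul1r lerD2l /c /L (exprz_dil hA hD hDvol hr hrA).
rewrite le_eqVlt; apply/orP; left; apply/eqP; rewrite -exprnP; field.
by rewrite gt_eqF.
Qed.

(** The dilation by 6 sg is the one of [wt_meet]: it contains every next-level ball that the
    covering dilate of p meets. *)
Definition osco (f : V -> R) (o : option T) : R :=
  if o is Some p then osc f (dil (6 * sg) p) else 0.

Section Pointwise.
Variables (f : V -> R) (rho : R) (p0 : T) (w : V -> R) (Om : nat -> set V)
  (e : nat -> nat -> option T).
Hypotheses (lf : locint f) (wt : whitney_tower A D hr rho p0 w Om e).

Let Q (p : T) := pball (dil (sg + sg) p).

(** A leaf is where telescoping stops, on the part of a covering ball outside the next level; a link
    exchanges the polynomial of p for that of p' on their overlap. All overlaps are summed, with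
    multiplicity, so no chain of balls has to be selected measurably. *)
Definition tower_leaf (m i : nat) (x : V) : R :=
  if e m i is Some p then \1_(Q p `\` Om m.+1) x * `|f x - PP f p x| else 0.

Definition tower_link (m i j : nat) (x : V) : R :=
  if e m i is Some p then
    if e m.+1 j is Some p' then \1_(Q p `&` Q p') x * `|PP f p' x - PP f p x| else 0
  else 0.

Definition tower_level (m : nat) (x : V) : \bar R :=
  (\sum_(i <oo) ((tower_leaf m i x)%:E + \sum_(j <oo) (tower_link m i j x)%:E))%E.

Lemma tower_leaf_ge0 m i x : 0 <= tower_leaf m i x.
Proof. by rewrite /tower_leaf; case: (e m i) => // p; rewrite mulr_ge0// indicE ler0n. Qed.

Lemma tower_link_ge0 m i j x : 0 <= tower_link m i j x.
Proof.
by rewrite /tower_link; case: (e m i) => // p; case: (e _ j) => // p'; apply: mulr_ge0.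
Qed.

Lemma measurable_tower_leaf m i : measurable_fun setT (tower_leaf m i).
Proof.
rewrite /tower_leaf; case: (e m i) => [p|]; last exact: measurable_cst.
apply: measurable_funM; last exact: (measurable_diff hA hD hDvol hr hrA).
apply: measurable_indic; apply: measurableD; first exact: measurable_pball.
by case: wt => _ + *; apply.
Qed.

Lemma measurable_tower_link m i j : measurable_fun setT (tower_link m i j).
Proof.
rewrite /tower_link; case: (e m i) => [p|]; last exact: measurable_cst.
case: (e _ j) => [p'|]; last exact: measurable_cst.
apply: measurable_funM; last first.
  apply: measurableT_comp => //; apply: measurable_funB;
    exact: (measurable_PP hA hD hDvol hr hrA).
by apply: measurable_indic; apply: measurableI; exact: measurable_pball.
Qed.

Let sum2_ge0 m i x : (0 <= \sum_(j <oo) (tower_link m i j x)%:E)%E.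
Proof. by apply: nneseries_ge0 => j _ _; rewrite lee_fin tower_link_ge0. Qed.

Let term_ge0 m i x : (0 <= (tower_leaf m i x)%:E + \sum_(j <oo) (tower_link m i j x)%:E)%E.
Proof. by apply: adde_ge0 => //; rewrite lee_fin tower_leaf_ge0. Qed.

Lemma tower_level_ge0 m x : (0 <= tower_level m x)%E.
Proof. exact: nneseries_ge0. Qed.

Let nneseries_ge1 (u : nat -> \bar R) i : (forall k, (0 <= u k)%E) -> (u i <= \sum_(k <oo) u k)%E.
Proof.
move=> u0; apply: le_trans (nneseries_lim_ge i.+1 _); last by move=> k _ _; exact: u0.
by rewrite big_nat_recr//= leeDr// sume_ge0.
Qed.

Let tower_leaf_le m i x : ((tower_leaf m i x)%:E <= tower_level m x)%E.
Proof.
apply: (@le_trans _ _ ((tower_leaf m i x)%:E + \sum_(j <oo) (tower_link m i j x)%:E)%E); first exact: leeDl.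
exact: (nneseries_ge1 (u := fun i => _)).
Qed.

Let tower_link_le m i j x : ((tower_link m i j x)%:E <= tower_level m x)%E.
Proof.
apply: (@le_trans _ _ (\sum_(j <oo) (tower_link m i j x)%:E)%E).
  by apply: (nneseries_ge1 (u := fun j => (tower_link m i j x)%:E)) => k; rewrite lee_fin tower_link_ge0.
apply: (@le_trans _ _ ((tower_leaf m i x)%:E + \sum_(j <oo) (tower_link m i j x)%:E)%E).
  by apply: leeDr; rewrite lee_fin tower_leaf_ge0.
exact: (nneseries_ge1 (u := fun i => _)).
Qed.

(* Outside Om (m + k + 1), the point x leaves the tower at some level between m and m + k: f - PP f p
   telescopes along the Whitney balls containing x down to that level. *)
Lemma tower_pointwise k m i p x : e m i = Some p -> Q p x -> ~ Om (m + k.+1)%N x ->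
  ((`|f x - PP f p x|)%:E <= \sum_(0 <= l < k.+1) tower_level (m + l) x)%E.
Proof.
elim: k m i p => [|k IH] m i p ep Qx nOm.
  rewrite big_nat1 addn0; apply: le_trans (tower_leaf_le m i x); rewrite /tower_leaf ep lee_fin.
  by rewrite indicE mem_set ?mul1r//; split => //; move: nOm; rewrite addn1.
have [Ox|nO] := pselect (Om m.+1 x); last first.
  rewrite big_nat_recl// addn0; apply: (@le_trans _ _ (tower_level m x)); last first.
    by apply: leeDl; apply: sume_ge0 => l _; exact: tower_level_ge0.
  apply: le_trans (tower_leaf_le m i x); rewrite /tower_leaf ep lee_fin.
  by rewrite indicE mem_set ?mul1r.
have [j [p' [ep' Qx']]] := wt_cover wt Ox.
have nOm' : ~ Om (m.+1 + k.+1)%N x by rewrite addSnnS.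
have := IH m.+1 j p' ep' Qx' nOm' => H.
rewrite big_nat_recl// addn0.
have -> : (\sum_(0 <= i0 < k.+1) tower_level (m + i0.+1) x = \sum_(0 <= l < k.+1) tower_level (m.+1 + l) x)%E.
  by apply: eq_bigr => l _; rewrite addnS.
apply: (@le_trans _ _ ((`|PP f p' x - PP f p x|)%:E + (`|f x - PP f p' x|)%:E)%E).
  by rewrite -EFinD lee_fin [leRHS]addrC ler_distD.
apply: leeD => //; apply: le_trans (tower_link_le m i j x).
by rewrite /tower_link ep ep' lee_fin indicE mem_set ?mul1r.
Qed.

Lemma emeasurable_tower_link m i : measurable_fun setT (fun x => \sum_(j <oo) (tower_link m i j x)%:E)%E.
Proof.
apply: ge0_emeasurable_sum => [j x _ _|j _]; first by rewrite lee_fin tower_link_ge0.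
by apply/measurable_EFinP; exact: measurable_tower_link.
Qed.

Lemma measurable_tower_level m : measurable_fun setT (tower_level m).
Proof.
apply: ge0_emeasurable_sum => [j x _ _|j _]; first exact: term_ge0.
by apply: emeasurable_funD; [apply/measurable_EFinP; exact: measurable_tower_leaf|exact: emeasurable_tower_link].
Qed.

Lemma integral_tower_level (g : V -> R) m : measurable_fun setT g -> (forall x, 0 <= g x) ->
  (\int[mu]_x (tower_level m x * (g x)%:E) =
   \sum_(i <oo) (\int[mu]_x (tower_leaf m i x * g x)%:E + \sum_(j <oo) \int[mu]_x (tower_link m i j x * g x)%:E))%E.
Proof.
move=> mg g0; have mgE : measurable_fun setT (fun x : V => (g x)%:E) by exact/measurable_EFinP.
have m2 i j : measurable_fun setT (fun x : V => (tower_link m i j x * g x)%:E).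
  by apply/measurable_EFinP; apply: measurable_funM => //; exact: measurable_tower_link.
have m1 i : measurable_fun setT (fun x : V => (tower_leaf m i x * g x)%:E).
  by apply/measurable_EFinP; apply: measurable_funM => //; exact: measurable_tower_leaf.
have p2 i j x : (0 <= (tower_link m i j x * g x)%:E)%E by rewrite lee_fin mulr_ge0// tower_link_ge0.
have p1 i x : (0 <= (tower_leaf m i x * g x)%:E)%E by rewrite lee_fin mulr_ge0// tower_leaf_ge0.
transitivity (\int[mu]_x (\sum_(i <oo) ((tower_leaf m i x * g x)%:E + \sum_(j <oo) (tower_link m i j x * g x)%:E)))%E.
  apply: eq_integral => x _; rewrite muleC -nneseriesZl; last by move=> i _; exact: term_ge0.
  apply: eq_eseriesr => i _; rewrite ge0_muleDr ?lee_fin ?tower_leaf_ge0//.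
  rewrite -EFinM mulrC -nneseriesZl; last by move=> j _; rewrite lee_fin tower_link_ge0.
  by congr (_ + _)%E; apply: eq_eseriesr => j _; rewrite -EFinM mulrC.
have ms i : measurable_fun setT (fun x : V => \sum_(j <oo) (tower_link m i j x * g x)%:E)%E.
  by apply: ge0_emeasurable_sum => j *; [exact: p2|exact: m2].
have ps i x : (0 <= \sum_(j <oo) (tower_link m i j x * g x)%:E)%E by apply: nneseries_ge0 => j *; exact: p2.
rewrite integral_nneseries//; last 2 first.
- by move=> i; exact: emeasurable_funD.
- by move=> i x _; exact: adde_ge0.
apply: eq_eseriesr => i _; rewrite ge0_integralD//.
by rewrite integral_nneseries.
Qed.

End Pointwise.

(* In aq_bound, g = w ^ (1 / ka) with rho = 2 ^ ka; the two growth conditions say that g is of size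
   2 ^ m at level m. *)
Lemma level_bound : exists2 C : R, 0 < C & forall (f : V -> R) (rho : R) p0 (w g : V -> R)
    (Om : nat -> set V) e, locint f ->
  0 < rho -> measurable_fun setT w -> (forall x, 0 <= w x) ->
  whitney_tower A D hr rho p0 w Om e ->
  measurable_fun setT g -> (forall x, 0 <= g x) ->
  (forall (m : nat) x, g x <= 2 ^+ m + 2 ^+ m / rho ^+ m * w x) ->
  (forall (m : nat) x, w x <= rho ^+ m -> g x <= 2 ^+ m) -> forall M,
  (\int[mu]_(x in pball p0 `\` Om M) (`|f x - PP f p0 x| * g x)%:E <=
   \sum_(0 <= m < M) \sum_(i <oo) (C * (2 ^+ m * osco f (e m i)))%:E)%E.
Proof.
have sg0 : 0 <= sg by [].
have sgA : sg + sg <= 6 * sg by lia.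
have sgB : sg + sg <= 4 * sg + 1 by lia.
have sgC : 0 <= 6 * sg by lia.
have sgD : 0 <= sg + sg by lia.
have sub0 (k : int) p : 0 <= k -> pball p `<=` pball (dil k p).
  by move=> k0; have := pball_dil_le hA hD hr hrA (p := p) k0; rewrite dil_0.
have [C1 C10 HC1] := integral_diff_le_osc (6 * dsig hr).
have [C2 C20 HC2] := projP_bound hA hD hDvol hr hrA hlam d.
pose L := (lp ^+ (dsig hr + dsig hr)) ^+ d; have L0 : 0 < L by rewrite !exprn_gt0.
pose c4 := b ^ (4 * sg + 1); have c40 : 0 < c4 := bz0 _.
pose K2 := C2 * L * (4 * c4); have K20 : 0 < K2 by rewrite !mulr_gt0.
exists (2 * C1 + K2 * C1); first by rewrite addr_gt0// mulr_gt0.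
move=> f rho p0 w g Om e lf rho0 mw w0 wt mg g0 hg1 hg2 M.
have [mf fint] := lf.
have tpow m : 0 < (2 : R) ^+ m by rewrite exprn_gt0.
have md p : measurable_fun setT (fun x : V => `|f x - PP f p x|).
  exact: (measurable_diff hA hD hDvol hr hrA).
have mdE p : measurable_fun setT (fun x : V => (`|f x - PP f p x|)%:E) by exact/measurable_EFinP.
case: M => [|M].
  by rewrite (wt_Om0 wt) setDv integral_set0 big_geq.
have mOm m : measurable (Om m) by exact: (wt_meas wt).
have mgE : measurable_fun setT (fun x : V => (g x)%:E) by exact/measurable_EFinP.
have mS m := measurable_tower_level lf wt m.
have S0 m x := tower_level_ge0 f Om e m x.
apply: (@le_trans _ _ (\int[mu]_x \sum_(0 <= m < M.+1) (tower_level f Om e m x * (g x)%:E))%E).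
  apply: (@le_trans _ _ (\int[mu]_(x in pball p0 `\` Om M.+1)
      \sum_(0 <= m < M.+1) (tower_level f Om e m x * (g x)%:E))%E).
    have mB := measurable_pball hA hD p0.
    apply: ge0_le_integral => //.
    - exact: measurableD.
    - by move=> x _; rewrite lee_fin mulr_ge0.
    - by apply: measurable_funTS; apply/measurable_EFinP; exact: measurable_funM.
    - by apply: measurable_funTS; apply: emeasurable_sum => m; exact: emeasurable_funM.
    - move=> x [Bx nOx]; have e0 : e 0%N 0%N = Some p0 by exact: (wt_zero wt 0%N).
      have Qx : pball (dil (sg + sg) p0) x.
        exact: sub0.
      have := tower_pointwise f wt e0 Qx (k := M); rewrite add0n => /(_ nOx) H.
      rewrite EFinM -ge0_sume_distrl; last by move=> m _; exact: S0.
      by apply: lee_wpmul2r; rewrite ?lee_fin.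
  apply: ge0_subset_integral => //.
  - by apply: measurableD => //; exact: measurable_pball.
  - by apply: emeasurable_sum => m; exact: emeasurable_funM.
  - by move=> x _; apply: sume_ge0 => m _; apply: mule_ge0; [exact: S0|rewrite lee_fin].
rewrite ge0_integral_sum//; last 2 first.
- by move=> m; exact: emeasurable_funM.
- by move=> m x _; apply: mule_ge0; [exact: S0|rewrite lee_fin].
apply: lee_sum => m _; rewrite (integral_tower_level lf wt)//.
apply: lee_nneseries => [i _ _|i _].
  apply: adde_ge0; first by apply: integral_ge0 => x _; rewrite lee_fin mulr_ge0// tower_leaf_ge0.
  apply: nneseries_ge0 => j _ _; apply: integral_ge0 => x _.
  by rewrite lee_fin mulr_ge0// tower_link_ge0.
case ei : (e m i) => [p|]; last first.
  rewrite integral0_eq; last by move=> x _; rewrite /tower_leaf ei mul0r.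
  rewrite eseries0 ?adde0 ?mulr0// => j _ _.
  by rewrite integral0_eq// => x _; rewrite /tower_link ei mul0r.
pose u (x : V) := `|f x - PP f p x|; pose Qs := pball (dil (6 * sg) p).
have muE : measurable_fun setT (fun x : V => (u x)%:E) := mdE p.
have mQs : measurable Qs by exact: measurable_pball.
have sg6 : 6 * sg = (6 * dsig hr)%:Z by rewrite PoszM.
have IQs : (\int[mu]_(x in Qs) (u x)%:E <= (C1 * osc f (dil (6 * sg) p))%:E)%E.
  by rewrite /Qs sg6; exact: HC1.
have QQs : pball (dil (sg + sg) p) `<=` Qs.
  exact: (pball_dil_le hA hD hr hrA sgA).
have mR (h : V -> \bar R) (E : set V) : measurable E -> measurable_fun setT h -> measurable_fun setT (h \_ E).
  by move=> mE mh; apply/(measurable_restrictT _ mE); exact: measurable_funTS.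
(* Leaves: outside [Om m.+1] one has w <= rho^(m+1), hence g <= 2^(m+1). *)
rewrite mulrDl EFinD /osco; apply: leeD.
  apply: (@le_trans _ _ (\int[mu]_(x in Qs) ((2 ^+ m.+1)%:E * (u x)%:E))%E).
    rewrite [leRHS]integral_mkcond; apply: ge0_le_integral => //.
    - by move=> x _; rewrite lee_fin mulr_ge0// tower_leaf_ge0.
    - apply/measurable_EFinP; apply: measurable_funM => //; exact: (measurable_tower_leaf lf wt).
    - by apply: mR => //; exact: emeasurable_funM.
    - move=> x _; rewrite /tower_leaf ei patchE indicE.
      case: (boolP (x \in pball (dil (sg + sg) p) `\` Om m.+1)) => [|_].
        rewrite inE => -[Qx nO]; rewrite (mem_set (QQs _ Qx)) -EFinM lee_fin mul1r mulrC.
        by apply: ler_wpM2r => //; apply: hg2; exact: (wt_off wt).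
      rewrite mulr0n !mul0r; case: ifP => [_|//].
      by rewrite -EFinM lee_fin; apply: mulr_ge0; rewrite ?normr_ge0 ?exprn_ge0.
  rewrite ge0_integralZl_cst; [|exact: mQs|exact: ltW|exact: md|by move=> x; exact: normr_ge0].
  rewrite (_ : 2 * C1 * _ = 2 ^+ m.+1 * (C1 * osc f (dil (6 * sg) p))); last by rewrite exprS; ring.
  by rewrite EFinM; apply: lee_wpmul2l => //; rewrite lee_fin ltW.
pose meets p' := pball (dil (sg + sg) p) `&` pball (dil (sg + sg) p') !=set0.
(* Cores of the next-level balls that p meets: they are disjoint and lie in [Qs], so integrals over
   them add up to at most the integral over [Qs]. *)
pose N j : set V := if e m.+1 j is Some p' then (if `[< meets p' >] then pball p' else set0) else set0.
have mN j : measurable (N j).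
  rewrite /N; case: (e _ j) => [p'|]; last exact: measurable0.
  by case: ifP => _; [exact: measurable_pball|exact: measurable0].
have NO j : N j `<=` oball (e m.+1 j).
  by rewrite /N; case: (e _ j) => [p'|] //; case: asboolP => // _ x.
have tN : trivIset setT N.
  have dj : trivIset setT (fun i => oball (e m.+1 i)) by exact: (wt_disj wt).
  apply/trivIsetP => j k _ _ jk; have /trivIsetP/(_ j k I I jk) := dj.
  by apply: subsetI_eq0; exact: NO.
have NQs : \bigcup_j N j `<=` Qs.
  move=> x [j _]; rewrite /N; case ej : (e m.+1 j) => [p'|] //.
  case: asboolP => // meet p'x; apply: (wt_meet wt ei ej meet).
  exact: sub0 p'x.
(* By [wt_avg] w has mean at most rho^(m+1) on the larger dilate, so the linear bound on g gives
   mean at most 2^(m+1) + 2^(m+1), whence 4; [c4] is the volume ratio. *)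
have gQ p' j : e m.+1 j = Some p' ->
    (\int[mu]_(x in pball (dil (sg + sg) p')) (g x)%:E <= (4 * c4 * 2 ^+ m * b ^ p'.2)%:E)%E.
  move=> ej; set QQ := pball (dil (4 * sg + 1) p').
  have mQQ : measurable QQ by exact: measurable_pball.
  apply: (@le_trans _ _ (\int[mu]_(x in QQ) ((2 ^+ m.+1)%:E + (2 ^+ m.+1 / rho ^+ m.+1)%:E * (w x)%:E))%E).
    apply: (@le_trans _ _ (\int[mu]_(x in QQ) (g x)%:E)%E).
      apply: ge0_subset_integral => //; [exact: measurable_pball|exact: measurable_funTS| |].
        by move=> x _; rewrite lee_fin.
      exact: (pball_dil_le hA hD hr hrA sgB).
    apply: ge0_le_integral => //.
    - by move=> x _; rewrite lee_fin.
    - exact: measurable_funTS.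
    - apply: measurable_funTS; apply: emeasurable_funD => //; apply: emeasurable_funM => //.
      exact/measurable_EFinP.
    - by move=> x _; rewrite -EFinM -EFinD lee_fin.
  have mwE : measurable_fun setT (fun x : V => (w x)%:E) by exact/measurable_EFinP.
  have rm : 0 <= 2 ^+ m.+1 / rho ^+ m.+1 by rewrite divr_ge0// exprn_ge0// ltW.
  rewrite ge0_integralD; first last.
  - by apply: measurable_funTS; exact: emeasurable_funM.
  - by move=> x _; rewrite -EFinM lee_fin; apply: mulr_ge0.
  - exact: measurable_cst.
  - by move=> x _; rewrite lee_fin exprn_ge0.
  - exact: mQQ.
  rewrite integral_cst_pball ge0_integralZl_cst//.
  have := wt_avg wt ej => av.
  rewrite (_ : 4 * c4 * 2 ^+ m * b ^ p'.2 = 2 ^+ m.+1 * b ^ (p'.2 + (4 * sg + 1)) +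
      (2 ^+ m.+1 / rho ^+ m.+1) * (rho ^+ m.+1 * b ^ (p'.2 + (4 * sg + 1)))); last first.
    rewrite (exprz_dil hA hD hDvol hr hrA) -/c4 (exprS 2).
    by field; rewrite gt_eqF// exprn_gt0.
  rewrite EFinD; apply: leeD => //; rewrite [X in (_ <= X)%E]EFinM.
  by apply: lee_wpmul2l => //; rewrite lee_fin.
apply: (@le_trans _ _ (\sum_(j <oo) ((K2 * 2 ^+ m)%:E * \int[mu]_(x in N j) (u x)%:E))%E).
  apply: lee_nneseries => [j _ _|j _].
    by apply: integral_ge0 => x _; rewrite lee_fin mulr_ge0// tower_link_ge0.
  have rhs0 : (0 <= (K2 * 2 ^+ m)%:E * \int[mu]_(x in N j) (u x)%:E)%E.
    apply: mule_ge0; first by rewrite lee_fin mulr_ge0 ?(ltW K20) ?exprn_ge0.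
    by apply: integral_ge0 => x _; rewrite lee_fin; exact: normr_ge0.
  case ej : (e m.+1 j) => [p'|]; last first.
    by rewrite integral0_eq// => x _; rewrite /tower_link ei ej mul0r.
  have [meet|nmeet] := pselect (meets p'); last first.
    rewrite integral0_eq// => x _; rewrite /tower_link ei ej indicE memNset ?mul0r ?mul0r//.
    by move=> Qx; apply: nmeet; exists x.
  have -> : N j = pball p' by rewrite /N ej asboolT.
  set Ru := \int[mu]_(x in pball p') `|f x - PP f p x|.
  have Ru0 : 0 <= Ru by exact: Rintegral_ge0.
  have IuE : (\int[mu]_(x in pball p') (u x)%:E = Ru%:E)%E.
    exact: (esym (Rintegral_diffE p p' lf)).
  rewrite IuE.
  (* On its covering dilate, the polynomial of p' differs from that of p by a constant times the
     mean of |f - P_p| over the core p'; the integral of g there then cancels the volume of p'. *)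
  pose c := C2 * L / b ^ p'.2 * Ru.
  have c0 : 0 <= c by rewrite mulr_ge0// divr_ge0 ?(ltW (bz0 _))// mulr_ge0// ltW.
  apply: (@le_trans _ _ (\int[mu]_(x in pball (dil (sg + sg) p')) (c%:E * (g x)%:E))%E).
    rewrite [leRHS]integral_mkcond; apply: ge0_le_integral => //.
    - by move=> x _; rewrite lee_fin mulr_ge0// tower_link_ge0.
    - apply/measurable_EFinP; apply: measurable_funM => //; exact: (measurable_tower_link _ lf).
    - apply: mR; [exact: measurable_pball|exact: emeasurable_funM].
    - move=> x _; rewrite /tower_link ei ej patchE indicE.
      case: (boolP (x \in pball (dil (sg + sg) p) `&` pball (dil (sg + sg) p'))) => [|_].
        rewrite inE => -[_ Qx']; rewrite (mem_set Qx') -EFinM lee_fin mul1r.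
        apply: ler_wpM2r => //.
        have Bz : Bk A D (p'.2 + (dsig hr + dsig hr)%:Z) (x - p'.1).
          by move: Qx'; rewrite pballP /= PoszD.
        exact: (HC2 f p'.1 x p'.2 _ (PP f p) mf (fint p') (PP_polyd hA hD hDvol hr hrA d p lf) Bz).
      rewrite mulr0n !mul0r; case: ifP => [_|//].
      by rewrite -EFinM lee_fin; apply: mulr_ge0.
  rewrite (ge0_integralZl_cst (measurable_pball hA hD _) c0 mg g0).
  apply: (@le_trans _ _ (c%:E * (4 * c4 * 2 ^+ m * b ^ p'.2)%:E)%E).
    by apply: lee_wpmul2l => //; apply: gQ ej.
  rewrite -!EFinM lee_fin /c /K2 le_eqVlt; apply/orP; left; apply/eqP; field.
  by rewrite gt_eqF.
rewrite nneseriesZl; last by move=> j _; apply: integral_ge0 => x _; rewrite lee_fin; exact: normr_ge0.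
rewrite (_ : K2 * C1 * _ = K2 * 2 ^+ m * (C1 * osc f (dil (6 * sg) p))); last by ring.
rewrite [X in (_ <= X)%E]EFinM; apply: lee_wpmul2l; first by rewrite lee_fin mulr_ge0 ?(ltW K20) ?exprn_ge0.
apply: le_trans IQs; rewrite -ge0_integral_bigcup//; last 2 first.
- by apply: measurable_funTS; exact: mdE.
- by move=> x _; rewrite lee_fin; exact: normr_ge0.
apply: ge0_subset_integral => //; [exact: bigcup_measurable|by apply: measurable_funTS; exact: mdE|].
by move=> x _; rewrite lee_fin; exact: normr_ge0.
Qed.

End Level_bound.

(** A substitute for Hoelder's inequality once [s] is tuned to the data: if y > s, then (y/s)^(t-1)
    >= 1. *)
Lemma le_add_powR (R : realType) (t s y : R) : 1 < t -> 0 < s -> 0 <= y -> y <= s + s `^ (1 - t) * y `^ t.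
Proof.
move=> t1 s0 y0; have [ys|sy] := leP y s.
  by apply: le_trans ys _; rewrite lerDl mulr_ge0// powR_ge0.
apply: (@le_trans _ _ (s `^ (1 - t) * y `^ t)); last by rewrite lerDr ltW.
have y0' : 0 < y by exact: lt_trans sy.
have -> : s `^ (1 - t) = (s `^ (t - 1))^-1.
  by rewrite -powR_inv1 ?powR_ge0// -powRrM; congr (_ `^ _); ring.
rewrite mulrC ler_pdivlMr ?powR_gt0//.
have -> : y `^ t = y * y `^ (t - 1).
  rewrite -{2}[y]powRr1 ?(ltW y0')// -powRD ?(gt_eqF y0') ?implybT//.
  by congr (_ `^ _); ring.
apply: ler_wpM2l; first exact: ltW.
by apply: ge0_ler_powR; rewrite ?nnegrE ?(ltW s0) ?(ltW y0') ?(ltW sy)// subr_ge0 ltW.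
Qed.

Lemma pow2_powR (R : realType) (th : R) (m : nat) : (2 ^+ m) `^ th = (2 `^ th) ^+ m.
Proof. by rewrite -powR_mulrn// -powRrM mulrC powRrM powR_mulrn// powR_ge0. Qed.

(** * Tower sums and duality in X^{1/theta} *)

Section Dual.
Context {R : realType} {n : nat} (A : 'M[R]_n.+1) (D : set 'cV[R]_n.+1) (r : R).
Hypotheses (hA : dilation A) (hD : ellipsoid0 D) (hDvol : Rvol D = 1%E) (hr : 1 < r)
  (hrA : [set r *: x | x in D] `<=` [set A *m x | x in D]).

Local Notation V := (cvM R n.+1).
Local Notation mu := (@vol R n.+1).
Local Notation b := `|\det A|.
Local Notation T := ('cV[R]_n.+1 * int)%type.
Local Notation pball := (@pball R n A D).
Local Notation oball := (@oball R n A D).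
Local Notation sg := ((dsig hr)%:Z).

Let b1 : 1 < b. Proof. exact: (det_gt1 hA hD hDvol hr hrA). Qed.
Let b0 : 0 < b. Proof. exact: lt_trans b1. Qed.
Let bz0 (l : int) : 0 < b ^ l. Proof. exact: exprz_gt0. Qed.

Variables (th pz ka : R).
Hypotheses (hth : 0 < th) (hthp : th < pz) (hka : pz < ka).

Let pz0 : 0 < pz. Proof. exact: lt_trans hthp. Qed.
Let t : R := conjR (pz / th).
Let thp : th / pz < 1. Proof. by rewrite ltr_pdivrMr// mul1r. Qed.
Let tE : t^-1 = 1 - th / pz.
Proof.
have x0 : pz / th != 0 by rewrite gt_eqF// divr_gt0.
by rewrite /t /conjR invf_div mulrBl mul1r (divff x0) invf_div.
Qed.
Let t1 : 1 < t.
Proof.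
have ti : 0 < t^-1 < 1.
  by rewrite tE subr_gt0 thp ltrBlDr ltrDl divr_gt0.
by move/andP: ti => [ti0 ti1]; rewrite -[t]invrK invf_gt1// posrE.
Qed.
Let t0 : 0 < t. Proof. exact: lt_trans t1. Qed.

Let rho : R := 2 `^ ka.
Let rho0 : 0 < rho. Proof. by rewrite powR_gt0. Qed.

Let ze : R := 2 `^ (th * (1 - ka / pz)).
Let ze0 : 0 < ze. Proof. by rewrite powR_gt0. Qed.
Let ze1 : ze < 1.
Proof.
rewrite /ze -[X in _ < X](powRr0 2); apply: gt1_ltr_powR; first by rewrite ltr1n.
by rewrite pmulr_rlt0// subr_lt0 ltr_pdivlMr// mul1r.
Qed.

(* The volume decay rho ^ (- m * th / pz) beats the weight 2 ^ (m * th) exactly because pz < ka. *)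
Let zeE (m : nat) : (2 ^+ m) `^ th * (rho ^+ m) `^ (- (th / pz)) = ze ^+ m.
Proof.
rewrite pow2_powR -powR_mulrn ?(ltW rho0)// -powRrM mulrC powRrM mulrC.
rewrite -(powR_mulrn m (powR_ge0 _ _)).
have -> : rho `^ m%:R `^ (- (th / pz)) = (rho `^ (- (th / pz))) `^ m%:R by rewrite powRAC.
rewrite !powR_mulrn ?powR_ge0// -exprMn; congr (_ ^+ _).
rewrite /rho -powRrM -powRD ?implybT ?pnatr_eq0// ?implybT//.
by congr (_ `^ _); field; rewrite gt_eqF.
Qed.

Variables (p0 : T) (w : V -> R) (Om : nat -> set V) (e : nat -> nat -> option T).
Hypothesis wt : whitney_tower A D hr rho p0 w Om e.

Let Bs := dil (sg + sg) p0.
Let ceta := tower_cst A hr + b ^ (sg + sg).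
Let ceta0 : 0 < ceta.
Proof. by rewrite /ceta /tower_cst; have := bz0 (sg + sg); lra. Qed.

(* phi <= s + s ^ (1 - t) * phi ^ t with s tuned to the volume of Om m. *)
Let level_int (phi : V -> R) (tau : R) m : measurable_fun setT phi -> (forall x, 0 <= phi x) ->
  0 < tau -> (\int[mu]_(x in pball Bs) (phi x `^ t)%:E <= (tau `^ t * b ^ (p0.2 + (sg + sg)))%:E)%E ->
  (\int[mu]_(x in Om m) (phi x)%:E <= (ceta * tau * b ^ p0.2 * (rho ^+ m) `^ (- (th / pz)))%:E)%E.
Proof.
move=> mphi phi0 tau0 It.
have rm0 : 0 < rho ^+ m by rewrite exprn_gt0.
pose s := tau * (rho ^+ m) `^ t^-1.
have s0 : 0 < s by rewrite mulr_gt0// powR_gt0.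
have mOm : measurable (Om m) by exact: (wt_meas wt).
have mpt : measurable_fun setT (fun x : V => phi x `^ t) by exact: measurableT_comp (measurable_powR _) mphi.
have st0 : 0 <= s `^ (1 - t) by exact: powR_ge0.
apply: (@le_trans _ _ (\int[mu]_(x in Om m) (s%:E + (s `^ (1 - t))%:E * (phi x `^ t)%:E))%E).
  apply: ge0_le_integral => //.
  - by move=> x _; rewrite lee_fin.
  - by apply: measurable_funTS; exact/measurable_EFinP.
  - apply: measurable_funTS; apply: emeasurable_funD => //; apply: emeasurable_funM => //.
    exact/measurable_EFinP.
  - by move=> x _; rewrite -EFinM -EFinD lee_fin; exact: le_add_powR.
rewrite ge0_integralD; first last.
- apply: measurable_funTS; apply: emeasurable_funM => //; exact/measurable_EFinP.
- by move=> x _; rewrite -EFinM lee_fin; apply: mulr_ge0; rewrite ?powR_ge0.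
- exact: measurable_cst.
- by move=> x _; rewrite lee_fin ltW.
- exact: mOm.
rewrite (ge0_integralZl_cst mOm st0 mpt (fun x => powR_ge0 _ _)) integral_cst//.
have alg : ceta * tau * b ^ p0.2 * (rho ^+ m) `^ (- (th / pz)) =
    s * (tower_cst A hr * b ^ p0.2 / rho ^+ m) + s `^ (1 - t) * (tau `^ t * b ^ (p0.2 + (sg + sg))).
  have E1 : (rho ^+ m) `^ t^-1 / rho ^+ m = (rho ^+ m) `^ (- (th / pz)).
    rewrite -(powR_inv1 (ltW rm0)) -powRD ?(gt_eqF rm0) ?implybT//; congr (_ `^ _); rewrite tE; ring.
  have E2 : s `^ (1 - t) * tau `^ t = tau * (rho ^+ m) `^ (- (th / pz)).
    rewrite /s powRM ?(ltW tau0) ?powR_ge0// mulrAC -powRD ?(gt_eqF tau0) ?implybT//.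
    rewrite subrK powRr1 ?(ltW tau0)// -powRrM; congr (_ * _ `^ _).
    rewrite mulrBr mulr1 mulVf ?gt_eqF// tE; ring.
  rewrite [s `^ (1 - t) * (_ * _)]mulrA E2 (exprz_dil hA hD hDvol hr hrA) -E1 /s /ceta; field.
  by rewrite gt_eqF.
rewrite alg EFinD [X in (_ <= X + _)%E]EFinM [X in (_ <= _ + X)%E]EFinM; apply: leeD.
  by apply: lee_wpmul2l; [rewrite lee_fin ltW|exact: (wt_vol wt)].
apply: lee_wpmul2l => //; apply: le_trans It; apply: ge0_subset_integral => //.
- exact: measurable_pball.
- by apply: measurable_funTS; exact/measurable_EFinP.
- by move=> x _; rewrite lee_fin powR_ge0.
- exact: (wt_sub wt).
Qed.

(** The weight 2^m of level m in [level_bound] enters the right-hand side of (1) as its power th,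
    carried here by the cores. *)
Definition tower_sum (M N : nat) (x : V) : R :=
  \sum_(0 <= m < M) \sum_(0 <= i < N) (2 ^+ m) `^ th * \1_(oball (e m i)) x.

Lemma tower_sum_ge0 M N x : 0 <= tower_sum M N x.
Proof.
apply: sumr_ge0 => m _; apply: sumr_ge0 => i _.
by rewrite mulr_ge0 ?powR_ge0// indicE ler0n.
Qed.

Lemma measurable_tower_sum M N : measurable_fun setT (tower_sum M N).
Proof.
apply: measurable_sum => m; apply: measurable_sum => i; apply: measurable_funM => //.
by apply: measurable_indic; exact: measurable_oball.
Qed.

Let core_int (phi : V -> R) m N : measurable_fun setT phi -> (forall x, 0 <= phi x) ->
  (\sum_(0 <= i < N) \int[mu]_x (\1_(oball (e m i)) x * phi x)%:E <= \int[mu]_(x in Om m) (phi x)%:E)%E.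
Proof.
move=> mphi phi0; have mO i := measurable_oball hA hD (e m i).
have mphiE : measurable_fun setT (fun x : V => (phi x)%:E) by exact/measurable_EFinP.
have -> : (\sum_(0 <= i < N) \int[mu]_x (\1_(oball (e m i)) x * phi x)%:E =
    \sum_(0 <= i < N) \int[mu]_(x in oball (e m i)) (phi x)%:E)%E.
  apply: eq_bigr => i _; rewrite [RHS]integral_mkcond; apply: eq_integral => x _.
  rewrite patchE indicE; case: (x \in _); first by rewrite mul1r.
  by rewrite mulr0n mul0r.
have sub i : oball (e m i) `<=` Om m.
  by case ei : (e m i) => [p|] //; exact: (wt_core wt ei).
apply: (@le_trans _ _ (\int[mu]_(x in \bigcup_i oball (e m i)) (phi x)%:E)%E).
  rewrite ge0_integral_bigcup//; first last.
  - exact: (wt_disj wt).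
  - by move=> x _; rewrite lee_fin.
  - exact: measurable_funTS.
  apply: nneseries_lim_ge => i _ _; apply: integral_ge0 => x _.
  by rewrite lee_fin.
apply: ge0_subset_integral => //.
- exact: bigcup_measurable.
- exact: (wt_meas wt).
- exact: measurable_funTS.
- by move=> x _; rewrite lee_fin.
- by move=> x [i _]; exact: sub.
Qed.

Definition cdual : R := (tower_cst A hr + b ^ (sg + sg)) / (1 - 2 `^ (th * (1 - ka / pz))).

Lemma cdual_gt0 : 0 < cdual.
Proof. by rewrite divr_gt0// subr_gt0; exact: ze1. Qed.

Let tower_int (phi : V -> R) (tau : R) M N : measurable_fun setT phi -> (forall x, 0 <= phi x) ->
  0 < tau -> (\int[mu]_(x in pball Bs) (phi x `^ t)%:E <= (tau `^ t * b ^ (p0.2 + (sg + sg)))%:E)%E ->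
  (\int[mu]_x (tower_sum M N x * phi x)%:E <= (cdual * (tau * b ^ p0.2))%:E)%E.
Proof.
move=> mphi phi0 tau0 It.
have p2 m : 0 <= (2 ^+ m : R) `^ th by exact: powR_ge0.
have mterm m i : measurable_fun setT (fun x : V => \1_(oball (e m i)) x * phi x).
  by apply: measurable_funM => //; apply: measurable_indic; exact: measurable_oball.
have term0 m i x : 0 <= \1_(oball (e m i)) x * phi x :> R by rewrite mulr_ge0// indicE ler0n.
have -> : (\int[mu]_x (tower_sum M N x * phi x)%:E = \sum_(0 <= m < M) \sum_(0 <= i < N)
    ((2 ^+ m) `^ th)%:E * \int[mu]_x (\1_(oball (e m i)) x * phi x)%:E)%E.
  transitivity (\int[mu]_x (\sum_(0 <= m < M) \sum_(0 <= i < N)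
      ((2 ^+ m) `^ th)%:E * (\1_(oball (e m i)) x * phi x)%:E))%E.
    apply: eq_integral => x _; rewrite /tower_sum mulr_suml -sumEFin; apply: eq_bigr => m _.
    rewrite mulr_suml -sumEFin; apply: eq_bigr => i _.
    by rewrite -EFinM mulrA.
  have mT m i : measurable_fun setT (fun x : V => ((2 ^+ m) `^ th)%:E * (\1_(oball (e m i)) x * phi x)%:E)%E.
    by apply: emeasurable_funM => //; exact/measurable_EFinP.
  have T0 m i x : (0 <= ((2 ^+ m) `^ th)%:E * (\1_(oball (e m i)) x * phi x)%:E)%E.
    by rewrite -EFinM lee_fin mulr_ge0.
  rewrite ge0_integral_sum//; first last.
  - by move=> m x _; apply: sume_ge0 => i _; exact: T0.
  - by move=> m; apply: emeasurable_sum => i; exact: mT.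
  apply: eq_bigr => m _; rewrite ge0_integral_sum//.
  by apply: eq_bigr => i _; rewrite (ge0_integralZl_cst measurableT (p2 m) (mterm m i) (term0 m i)).
apply: (@le_trans _ _ (\sum_(0 <= m < M) (ze ^+ m * (ceta * (tau * b ^ p0.2)))%:E)%E).
  apply: lee_sum => m _; rewrite -ge0_sume_distrr; last first.
    by move=> i _; apply: integral_ge0 => x _; rewrite lee_fin.
  have := le_trans (core_int m N mphi phi0) (level_int m mphi phi0 tau0 It) => H.
  rewrite -zeE (_ : _ * _ * _ = (2 ^+ m) `^ th * (ceta * tau * b ^ p0.2 * (rho ^+ m) `^ (- (th / pz)))); last by ring.
  by rewrite [X in (_ <= X)%E]EFinM; apply: lee_wpmul2l.
rewrite sumEFin lee_fin -mulr_suml /cdual -/ceta -/ze [leRHS]mulrAC -mulrA mulrC.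
rewrite [leRHS]mulrA; apply: ler_wpM2l.
  by rewrite mulr_ge0 ?(ltW ceta0)// mulr_ge0 ?(ltW tau0)// ltW.
by apply: geom_sum_le; rewrite (ltW ze0).
Qed.

(** Let [al] be the mean of phi^t over the dilated base ball, t being the exponent in Assumption
    (A). On that whole ball [maxfp] is at least al^(1/t), while the tower pairs with phi to at most
    cdual al^(1/t) times the volume of the base ball. *)
Lemma dual_bound (phi : V -> R) M N : measurable_fun setT phi -> (forall x, 0 <= phi x) ->
  (\int[mu]_x (tower_sum M N x * phi x)%:E <=
   cdual%:E * \int[mu]_(x in pball (dil (sg + sg) p0)) maxfp A D (conjR (pz / th)) (EFin \o phi) x)%E.
Proof.
move=> mphi phi0; rewrite -/t -/Bs.
have mpt : measurable_fun setT (fun x : V => phi x `^ t) by exact: measurableT_comp (measurable_powR _) mphi.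
have mptE : measurable_fun setT (fun x : V => (phi x `^ t)%:E) by exact/measurable_EFinP.
pose al := (((b ^ Bs.2)^-1)%:E * \int[mu]_(x in pball Bs) (phi x `^ t)%:E)%E.
have al0 : (0 <= al)%E.
  apply: mule_ge0; first by rewrite lee_fin invr_ge0 ltW.
  by apply: integral_ge0 => x _; rewrite lee_fin powR_ge0.
have IE : (\int[mu]_(x in pball Bs) (phi x `^ t)%:E = (b ^ Bs.2)%:E * al)%E.
  by rewrite /al muleA -EFinM mulfV ?gt_eqF// mul1e.
have mx x : pball Bs x -> (al `^ t^-1 <= maxfp A D t (EFin \o phi) x)%E.
  move=> Bx; rewrite /maxfp.
  have al_max : (al <= maxf A D (fun y => `|(EFin \o phi) y| `^ t)%E x)%E.
    apply: le_trans (maxf_ge _ Bx); rewrite (avg_pball hA hD hDvol); first last.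
    - by move=> y; exact: abse_ge0.
    - apply: measurableT_comp => //; apply: measurableT_comp (measurable_poweR _) _.
      by apply: measurableT_comp => //; exact/measurable_EFinP.
    rewrite le_eqVlt; apply/orP; left; apply/eqP; rewrite /al; congr (_ * _)%E.
    apply: eq_integral => y _; rewrite /= ger0_norm ?phi0// ger0_norm// powR_ge0.
  apply: gt0_ler_poweR => //; first by rewrite invr_ge0 ltW.
  - by rewrite in_itv/= al0 leey.
  - by rewrite in_itv/= (le_trans al0 al_max) leey.
have step : (\int[mu]_x (tower_sum M N x * phi x)%:E <= (cdual * b ^ p0.2)%:E * al `^ t^-1)%E.
  have cb : 0 < cdual * b ^ p0.2 by rewrite mulr_gt0// cdual_gt0.
  case ale : al al0 IE => [a| |] // a0 IE; last first.
    by rewrite /= invr_eq0 (gt_eqF t0) gt0_muley ?lte_fin// leey.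
  rewrite poweR_EFin -EFinM; apply/lee_addgt0Pr => ep ep0.
  (* [tower_int] needs a positive bound, hence the small excess over al^(1/t), which is let go to
     0. *)
  pose tau := a `^ t^-1 + ep / (cdual * b ^ p0.2).
  have tau0 : 0 < tau by rewrite ltr_wpDl ?powR_ge0// divr_gt0.
  apply: le_trans (@tower_int phi tau M N mphi phi0 tau0 _) _.
    rewrite IE -EFinM lee_fin mulrC /= ler_pM2r//.
    rewrite -[leLHS](_ : (a `^ t^-1) `^ t = _); last first.
      by rewrite -powRrM mulVf ?gt_eqF// powRr1.
    apply: ge0_ler_powR; rewrite ?nnegrE ?powR_ge0 ?(ltW t0) ?(ltW tau0)//.
    by rewrite lerDl divr_ge0// ltW.
  rewrite -EFinD lee_fin /tau le_eqVlt; apply/orP; left; apply/eqP; field.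
  by rewrite !gt_eqF// cdual_gt0.
apply: le_trans step _; rewrite EFinM -muleA; apply: lee_wpmul2l.
  by rewrite lee_fin ltW// cdual_gt0.
apply: (@le_trans _ _ (\int[mu]_(x in pball Bs) (al `^ t^-1))%E); last first.
  apply: ge0_le_integral => //; first exact: measurable_pball.
  - by move=> x _; exact: poweR_ge0.
  - by apply: measurable_funTS; apply: measurableT_comp (measurable_poweR _) _; exact: measurable_maxf.
rewrite integral_cst; last exact: measurable_pball.
rewrite muleC; apply: lee_wpmul2l; first exact: poweR_ge0.
have vE : ((b ^ (p0.2 + (sg + sg)))%:E <= mu (pball Bs))%E by rewrite vol_pball.
apply: le_trans vE.
by rewrite lee_fin; apply: (exprz_le hA hD hDvol hr hrA); rewrite lerDl.
Qed.

End Dual.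

Section Assoc.
Context {R : realType} {n : nat} (A : 'M[R]_n.+1) (D : set 'cV[R]_n.+1) (r : R).
Hypotheses (hA : dilation A) (hD : ellipsoid0 D) (hDvol : Rvol D = 1%E) (hr : 1 < r)
  (hrA : [set r *: x | x in D] `<=` [set A *m x | x in D]).

Local Notation V := (cvM R n.+1).
Local Notation mu := (@vol R n.+1).
Local Notation b := `|\det A|.
Local Notation T := ('cV[R]_n.+1 * int)%type.
Local Notation pball := (@pball R n A D).

Variable nY : (V -> \bar R) -> \bar R.
Hypothesis hY : ball_BFS A D nY.

Let hYq : ball_QBFS A D nY. Proof. by case: hY. Qed.

(** [assoc] tests only functions of norm exactly 1, so U is normalized; if its norm is 0, it
    vanishes almost everywhere and the left side is 0. *)
Lemma assoc_holder (U : V -> R) (psi : V -> \bar R) : measurable_fun setT U ->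
  (forall x, 0 <= U x) -> (nY (EFin \o U) < +oo)%E -> measurable_fun setT psi ->
  (forall x, 0 <= psi x)%E ->
  (\int[mu]_x ((U x)%:E * psi x) <= nY (EFin \o U) * assoc nY psi)%E.
Proof.
move=> mU U0 Uoo mpsi psi0.
have mUE : measurable_fun setT (EFin \o U : V -> \bar R) by exact/measurable_EFinP.
have mUp : measurable_fun setT (fun x : V => ((U x)%:E * psi x)%E) by exact: emeasurable_funM.
have Up0 x : (0 <= (U x)%:E * psi x)%E by rewrite mule_ge0 ?lee_fin.
have nU0 : (0 <= nY (EFin \o U))%E by exact: (nX_ge0 hYq).
have yE : nY (EFin \o U) = (fine (nY (EFin \o U)))%:E by rewrite fineK// ge0_fin_numE.
set y := fine _ in yE; have [y0|y0] := ltP 0 y; last first.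
  have nU : nY (EFin \o U) = 0%E.
    by apply/eqP; rewrite eq_le nU0 andbT yE lee_fin.
  rewrite nU mul0e.
  case: hYq => _ [_ [_ [/(_ _ (lmeas_measurable mUE) nU) [N [[mN N0] HN]] _]]].
  have N0' : mu N = 0%E by rewrite -RvolE.
  rewrite (@ge0_integral_eq_off_null _ _ _ mu _ (cst 0%E) N)//.
  - by rewrite integral_cst// mul0e.
  - by move=> x /HN /= ->; rewrite mul0e.
have y1 : 0 < y^-1 by rewrite invr_gt0.
pose g (x : V) := (y^-1%:E * (EFin \o U) x)%E.
have mg : measurable_fun setT g by exact: emeasurable_funM.
have ng : nY g = 1%E by rewrite (nX_homog hYq)// yE -EFinM mulVf ?gt_eqF.
have : (\int[mu]_x (psi x * g x) <= assoc nY psi)%E.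
  apply: (@le_trans _ _ (iint (fun x => `|psi x * g x|%E))); last first.
    by apply: ereal_sup_ubound; exists g => //; split => //; exact: lmeas_measurable.
  rewrite iintE; first last.
  - by move=> x; exact: abse_ge0.
  - by apply: measurableT_comp => //; exact: emeasurable_funM.
  rewrite le_eqVlt; apply/orP; left; apply/eqP; apply: eq_integral => x _.
  by rewrite gee0_abs// mule_ge0// mule_ge0// lee_fin// ltW.
move=> H; rewrite yE.
have -> : (\int[mu]_x ((U x)%:E * psi x) = y%:E * \int[mu]_x (psi x * g x))%E.
  rewrite -ge0_integralZl//.
  - apply: eq_integral => x _; rewrite /g /= (muleC (psi x)) !muleA -EFinM mulfV ?gt_eqF//.
    by rewrite mul1r.
  - exact: emeasurable_funM.
  - by move=> x _; rewrite mule_ge0// mule_ge0// lee_fin// ltW.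
  - by rewrite lee_fin ltW.
by apply: lee_wpmul2l => //; rewrite lee_fin ltW.
Qed.

Lemma nY_sum_lty (I : Type) (s : seq I) (c : I -> R) (p : I -> T) : (forall k, 0 <= c k) ->
  (nY (EFin \o (fun x => \sum_(k <- s) c k * \1_(pball (p k)) x)%R) < +oo)%E.
Proof.
move=> c0; have mi k : measurable_fun setT (fun x : V => c k * \1_(pball (p k)) x).
  by apply: measurable_funM => //; apply: measurable_indic; exact: measurable_pball.
elim: s => [|k s IH].
  rewrite (_ : _ \o _ = fun=> 0%E); first by rewrite (nX_zero hA hD hYq) ltry.
  by apply/funext => x /=; rewrite big_nil.
rewrite (_ : _ \o _ = (fun x => (c k * \1_(pball (p k)) x)%R%:E +
    (EFin \o (fun x => \sum_(k <- s) c k * \1_(pball (p k)) x)%R) x)%E); last first.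
  by apply/funext => x /=; rewrite big_cons.
apply: le_lt_trans (nY_triangle hY _ _) _.
- exact/measurable_EFinP.
- by apply/measurable_EFinP; exact: measurable_sum.
apply: lte_add_pinfty => //.
case: hYq => _ [+ _].
have mB := measurable_indicE (measurable_pball hA hD (p k)).
move=> /(_ _ (c k) (lmeas_measurable mB) (nX_pball_lty hYq (p k))) e.
rewrite (_ : (fun x => _) = (fun x => (c k)%:E * (\1_(pball (p k)) x)%:E)%E) ?e; last first.
  by apply/funext => x; rewrite EFinM.
by apply: lte_mul_pinfty => //; exact: (nX_pball_lty hYq).
Qed.

End Assoc.

Section Dual_family.
Context {R : realType} {n : nat} (A : 'M[R]_n.+1) (D : set 'cV[R]_n.+1) (r : R).
Hypotheses (hA : dilation A) (hD : ellipsoid0 D) (hDvol : Rvol D = 1%E) (hr : 1 < r)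
  (hrA : [set r *: x | x in D] `<=` [set A *m x | x in D]).

Local Notation V := (cvM R n.+1).
Local Notation mu := (@vol R n.+1).
Local Notation b := `|\det A|.
Local Notation T := ('cV[R]_n.+1 * int)%type.
Local Notation pball := (@pball R n A D).
Local Notation oball := (@oball R n A D).
Local Notation sg := ((dsig hr)%:Z).

Let b1 : 1 < b. Proof. exact: (det_gt1 hA hD hDvol hr hrA). Qed.
Let b0 : 0 < b. Proof. exact: lt_trans b1. Qed.
Let bz0 (l : int) : 0 < b ^ l. Proof. exact: exprz_gt0. Qed.

Variables (nX : (V -> \bar R) -> \bar R) (pm th pz ka : R).
Hypotheses (hX : ball_QBFS A D nX) (hFS : assumption_FS A D nX pm)
  (hth : 0 < th) (hthm : th < pm) (hthp : th < pz) (hka : pz < ka)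
  (hAA : assumption_A A D nX th pz).

Let nY := Xpow nX th^-1.

Lemma XpowE (u : V -> R) : (forall x, 0 <= u x) ->
  nY (EFin \o u) = (Xnorm nX th u `^ th)%E.
Proof.
move=> u0; rewrite /nY /Xpow invrK /Xnorm; congr (nX _ `^ _)%E; apply/funext => x /=.
by rewrite ger0_norm.
Qed.

Lemma Xnorm_sum_lty (I : Type) (s : seq I) (c : I -> R) (p : I -> T) : (forall k, 0 <= c k) ->
  (Xnorm nX th (fun x => \sum_(k <- s) c k * \1_(pball (p k)) x)%R < +oo)%E.
Proof.
move=> c0; have [hY _] := hAA.
have : (nY (EFin \o (fun x => \sum_(k <- s) c k * \1_(pball (p k)) x)%R) < +oo)%E.
  exact: (nY_sum_lty hA hD hY).
rewrite XpowE; last first.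
  by move=> x; apply: sumr_ge0 => k _; rewrite mulr_ge0// indicE ler0n.
have : (0 <= Xnorm nX th (fun x => \sum_(k <- s) c k * \1_(pball (p k)) x)%R)%E.
  apply: (Xnorm_ge0 th hX); apply: measurable_sum => k; apply: measurable_funM => //.
  by apply: measurable_indic; exact: measurable_pball.
by case: (Xnorm _ _ _) => [t _ _|_|] //; [rewrite ltry|rewrite /= gt_eqF// ltxx].
Qed.

(** [FS_balls] with E the original ball; coefficients multiplied by b^(2K) cancel the squared volume
    ratio. *)
Lemma FS_dil (K : nat) : exists2 C : R, 0 < C & forall (I : Type) (s : seq I) (a : I -> R)
    (p : I -> T), (forall k, 0 <= a k) ->
  (Xnorm nX th (fun x => \sum_(k <- s) a k * \1_(pball (dil K%:Z (p k))) x)%R <=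
   C%:E * Xnorm nX th (fun x => \sum_(k <- s) a k * \1_(pball (p k)) x)%R)%E.
Proof.
have [C [C0 HC]] := FS_balls hA hD hDvol hr hrA hX hFS hth hthm.
pose c := b ^+ (2 * K); have c0 : 0 < c by rewrite exprn_gt0.
exists (C * c `^ th^-1); first by rewrite mulr_gt0// powR_gt0.
move=> I s a p a0.
have sub k : pball (p k) `<=` pball (dil K%:Z (p k)).
  by have := sub_dil hA hD hr hrA (p := p k) (leq0n K); rewrite dil_0.
have ca0 k : 0 <= c * a k by rewrite mulr_ge0// ltW.
have := HC I s (fun k => c * a k) (fun k => dil K%:Z (p k)) (fun k => pball (p k)) ca0
  (fun k => measurable_pball hA hD (p k)) sub.
have -> : (fun x => \sum_(k <- s) c * a k * (fine (mu (pball (p k))) / b ^ (dil K%:Z (p k)).2) ^+ 2 *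
      \1_(pball (dil K%:Z (p k))) x) = (fun x => \sum_(k <- s) a k * \1_(pball (dil K%:Z (p k))) x).
  apply/funext => x; apply: eq_bigr => k _; congr (_ * _).
  rewrite (_ : fine _ = b ^ (p k).2); last exact: (congr1 fine (vol_pball hA hD hDvol _)).
  rewrite /= (exprz_dil hA hD hDvol hr hrA) -exprnP /c mulnC exprM.
  have bk : b ^+ K != 0 by rewrite gt_eqF// exprn_gt0.
  by field; rewrite bk gt_eqF.
move=> H; apply: le_trans H _; rewrite EFinM -muleA; apply: lee_wpmul2l; first by rewrite lee_fin ltW.
rewrite -(Xnorm_scale th hX)//; first last.
- by move=> x; apply: sumr_ge0 => k _; rewrite mulr_ge0// indicE ler0n.
- apply: measurable_sum => k; apply: measurable_funM => //.
  by apply: measurable_indic; exact: measurable_pball.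
rewrite le_eqVlt; apply/orP; left; apply/eqP; congr (Xnorm _ _ _); apply/funext => x.
by rewrite mulr_sumr; apply: eq_bigr => k _; rewrite mulrA.
Qed.

(* Duality: test against phi in the unit ball of the associate space; dual_bound trades the tower for
   its base ball and a maximal function of phi, which Assumption (A) controls. *)
Lemma dual_family : exists2 C : R, 0 < C & forall (I : Type) (s : seq I) (c : I -> R)
    (p : I -> T) (w : I -> V -> R) (Om : I -> nat -> set V) (e : I -> nat -> nat -> option T) (M N : nat),
  (forall k, 0 <= c k) ->
  (forall k, whitney_tower A D hr (2 `^ ka) (p k) (w k) (Om k) (e k)) ->
  (Xnorm nX th (fun x => \sum_(k <- s) c k * tower_sum A D th (e k) M N x)%R <=
   C%:E * Xnorm nX th (fun x => \sum_(k <- s) c k * \1_(pball (p k)) x)%R)%E.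
Proof.
have [hY [CA [CA0 HCA]]] := hAA.
have [C1 C10 HC1] := FS_dil (dsig hr + dsig hr).
pose cd := cdual A hr th pz ka.
have cd0 : 0 < cd by exact: (cdual_gt0 hA hD hDvol hr hrA hth hthp hka).
exists ((cd * CA) `^ th^-1 * C1); first by rewrite mulr_gt0// powR_gt0// mulr_gt0.
move=> I s c p w Om e M N c0 wt.
pose U (x : V) := \sum_(k <- s) c k * \1_(pball (dil (sg + sg) (p k))) x.
pose H (x : V) := \sum_(k <- s) c k * tower_sum A D th (e k) M N x.
have mU : measurable_fun setT U.
  apply: measurable_sum => k; apply: measurable_funM => //.
  by apply: measurable_indic; exact: measurable_pball.
have mH : measurable_fun setT H.
  apply: measurable_sum => k; apply: measurable_funM => //.
  exact: measurable_tower_sum.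
have U0 x : 0 <= U x by apply: sumr_ge0 => k _; rewrite mulr_ge0// indicE ler0n.
have H0 x : 0 <= H x by apply: sumr_ge0 => k _; rewrite mulr_ge0// tower_sum_ge0.
have Uoo : (nY (EFin \o U) < +oo)%E by exact: (nY_sum_lty hA hD hY).
have nU0 : (0 <= nY (EFin \o U))%E by apply: (nX_ge0 hY.1); exact/measurable_EFinP.
have yE : nY (EFin \o U) = (fine (nY (EFin \o U)))%:E by rewrite fineK// ge0_fin_numE.
set y := fine _ in yE; have y0 : 0 <= y by rewrite fine_ge0.
have cy : (nY (EFin \o H) <= (cd * CA * y)%:E)%E.
  apply: (lorentz_luxemburg hA hD hDvol hr hrA hY).
  - by rewrite mulr_ge0// mulr_ge0 ?ltW.
  - exact/measurable_EFinP.
  - by move=> x; rewrite /= lee_fin.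
  move=> phi mphi phi0 a1.
  pose mx : V -> \bar R := maxfp A D (conjR (pz / th)) (EFin \o phi).
  have mmx : measurable_fun setT (mx : V -> \bar R).
    by apply: measurableT_comp (measurable_poweR _) _; exact: measurable_maxf.
  have mx0 x : (0 <= mx x)%E by exact: poweR_ge0.
  have mts k : measurable_fun setT (fun x : V => (tower_sum A D th (e k) M N x * phi x)).
    by apply: measurable_funM => //; exact: measurable_tower_sum.
  have ts0 k x : 0 <= tower_sum A D th (e k) M N x * phi x by rewrite mulr_ge0// tower_sum_ge0.
  have -> : (\int[mu]_x ((EFin \o H) x * (phi x)%:E) =
      \sum_(k <- s) (c k)%:E * \int[mu]_x (tower_sum A D th (e k) M N x * phi x)%:E)%E.
    transitivity (\int[mu]_x (\sum_(k <- s) (c k)%:E * (tower_sum A D th (e k) M N x * phi x)%:E))%E.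
      apply: eq_integral => x _; rewrite /= -EFinM /H mulr_suml -sumEFin.
      by apply: eq_bigr => k _; rewrite -EFinM mulrA.
    rewrite ge0_integral_sum//; first last.
    - by move=> k x _; rewrite -EFinM lee_fin mulr_ge0.
    - by move=> k; apply: emeasurable_funM => //; exact/measurable_EFinP.
    by apply: eq_bigr => k _; rewrite (ge0_integralZl_cst measurableT (c0 k) (mts k) (ts0 k)).
  apply: (@le_trans _ _ (cd%:E * \int[mu]_x ((U x)%:E * mx x))%E).
    have -> : (\int[mu]_x ((U x)%:E * mx x) =
        \sum_(k <- s) (c k)%:E * \int[mu]_(x in pball (dil (sg + sg) (p k))) mx x)%E.
      transitivity (\int[mu]_x (\sum_(k <- s) (c k)%:E * ((\1_(pball (dil (sg + sg) (p k))) x)%:E * mx x)))%E.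
        apply: eq_integral => x _; rewrite /U -sumEFin ge0_sume_distrl.
          by apply: eq_bigr => k _; rewrite EFinM muleA.
        by move=> k _; rewrite lee_fin mulr_ge0// indicE ler0n.
      have mi k : measurable_fun setT (fun x : V => ((\1_(pball (dil (sg + sg) (p k))) x)%:E * mx x)%E).
        apply: emeasurable_funM => //; apply: measurable_indicE; exact: measurable_pball.
      have i0 k x : (0 <= (\1_(pball (dil (sg + sg) (p k))) x)%:E * mx x)%E.
        by rewrite mule_ge0// lee_fin indicE ler0n.
      rewrite ge0_integral_sum//; first last.
      - by move=> k x _; rewrite mule_ge0// lee_fin.
      - by move=> k; exact: emeasurable_funM.
      apply: eq_bigr => k _; rewrite ge0_integralZl//; last by rewrite lee_fin.
      congr (_ * _)%E; rewrite [RHS]integral_mkcond; apply: eq_integral => x _.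
      by rewrite patchE indicE; case: (x \in _); rewrite ?mul1e ?mul0e.
    rewrite ge0_sume_distrr; last first.
      by move=> k _; rewrite mule_ge0 ?lee_fin// integral_ge0.
    apply: lee_sum => k _; rewrite muleCA; apply: lee_wpmul2l; first by rewrite lee_fin.
    have := dual_bound hA hD hDvol hrA hth hthp hka (wt k) M N mphi phi0.
    exact.
  rewrite -(mulrA cd) [X in (_ <= X)%E]EFinM; apply: lee_wpmul2l; first by rewrite lee_fin ltW.
  apply: le_trans (assoc_holder hY mU U0 Uoo mmx mx0) _.
  rewrite -/nY yE [CA * y]mulrC [X in (_ <= X)%E]EFinM; apply: lee_wpmul2l; first by rewrite lee_fin.
  have a_oo : (assoc nY (EFin \o phi) < +oo)%E by apply: le_lt_trans a1 _; rewrite ltry.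
  have lphi : lmeas (EFin \o phi) by apply: lmeas_measurable; exact/measurable_EFinP.
  apply: le_trans (HCA _ lphi a_oo) _.
  rewrite -[leRHS]mule1; apply: lee_wpmul2l a1; by rewrite lee_fin ltW.
have XH0 : (0 <= Xnorm nX th H)%E by exact: (Xnorm_ge0 th hX).
have XU0 : (0 <= Xnorm nX th U)%E by exact: (Xnorm_ge0 th hX).
have can (z : \bar R) : (0 <= z)%E -> ((z `^ th) `^ th^-1 = z)%E.
  by move=> z0; rewrite -poweRrM mulfV ?poweRe1// gt_eqF.
have : (Xnorm nX th H <= ((cd * CA) `^ th^-1)%:E * Xnorm nX th U)%E.
  move: cy; rewrite XpowE// EFinM -yE XpowE// => cy.
  rewrite -(can _ XH0) -[X in (_ <= _ * X)%E](can _ XU0) -poweR_EFin -poweRM ?poweR_ge0//; last first.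
    by rewrite lee_fin mulr_ge0// ltW.
  have ccd : (0 <= (cd * CA)%:E * Xnorm nX th U `^ th)%E.
    by rewrite mule_ge0 ?poweR_ge0// lee_fin mulr_ge0// ltW.
  apply: gt0_ler_poweR cy; first by rewrite invr_ge0 ltW.
  - by rewrite in_itv/= poweR_ge0 leey.
  - by rewrite in_itv/= ccd leey.
move=> Hle; apply: le_trans Hle _; rewrite EFinM -muleA; apply: lee_wpmul2l.
  by rewrite lee_fin powR_ge0.
exact: HC1.
Qed.

End Dual_family.

Lemma powRV (R : realType) (a s : R) : 0 <= a -> a^-1 `^ s = (a `^ s)^-1.
Proof.
by move=> a0; rewrite -(powR_inv1 a0) -(powR_inv1 (powR_ge0 a s)) -!powRrM mulrC.
Qed.

(** * From (1) to the L^q oscillation *)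

Section Campanato_bound.
Context {R : realType} {n : nat} (A : 'M[R]_n.+1) (D : set 'cV[R]_n.+1) (r : R).
Hypotheses (hA : dilation A) (hD : ellipsoid0 D) (hDvol : Rvol D = 1%E) (hr : 1 < r)
  (hrA : [set r *: x | x in D] `<=` [set A *m x | x in D]).
Variables (lm lp : R) (hlam : eig_bounds A lm lp) (d : nat).

Local Notation V := (cvM R n.+1).
Local Notation mu := (@vol R n.+1).
Local Notation b := `|\det A|.
Local Notation T := ('cV[R]_n.+1 * int)%type.
Local Notation pball := (@pball R n A D).
Local Notation oball := (@oball R n A D).
Local Notation PP := (@PP R n A D d).
Local Notation osc := (@osc R n A D d).
Local Notation locint := (@locint R n A D).
Local Notation sg := ((dsig hr)%:Z).
Local Notation osc_o := (@osco R n A D r hr d).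

Let b1 : 1 < b. Proof. exact: (det_gt1 hA hD hDvol hr hrA). Qed.
Let b0 : 0 < b. Proof. exact: lt_trans b1. Qed.
Let bz0 (l : int) : 0 < b ^ l. Proof. exact: exprz_gt0. Qed.

(** The levels shrink to a null set by [wt_vol], so what is left outside them exhausts the ball up
    to measure zero. The index M.+1 is there because nesting starts at level 1. *)
Lemma tower_cvg (rho : R) p0 (w : V -> R) (Om : nat -> set V) e (h : V -> \bar R) : 2 <= rho ->
  whitney_tower A D hr rho p0 w Om e -> measurable_fun setT h -> (forall x, 0 <= h x)%E ->
  (fun M => \int[mu]_(x in pball p0 `\` Om M.+1) h x)%E @ \oo --> (\int[mu]_(x in pball p0) h x)%E.
Proof.
move=> rho2 wt mh h0; have mB := measurable_pball hA hD p0.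
have rho0 : 0 < rho by apply: lt_le_trans rho2.
have mOm m : measurable (Om m) by exact: (wt_meas wt).
pose N := \bigcap_m Om m.+1.
have mN : measurable N by exact: bigcapT_measurable.
have N0 : mu N = 0%E.
  apply/eqP; rewrite eq_le measure_ge0 andbT; apply/lee_addgt0Pr => ep ep0; rewrite add0e.
  pose c := tower_cst A hr * b ^ p0.2.
  have c0 : 0 < c.
    by rewrite /c mulr_gt0// /tower_cst; have := bz0 (sg + sg); lra.
  have rho1 : 1 < rho by apply: lt_le_trans rho2; rewrite ltr1n.
  have [m Hm] := expr_gt_exists (c / ep) rho1.
  have NO : (mu N <= mu (Om m.+1))%E by apply: le_measure; rewrite ?inE// => x; apply.
  apply: le_trans NO _; apply: le_trans (wt_vol wt m.+1) _; rewrite lee_fin -/c.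
  rewrite ler_pdivrMr ?exprn_gt0// mulrC -ler_pdivrMr//; apply: le_trans Hm _.
  by rewrite exprS ler_peMl ?exprn_ge0 ?ltW.
rewrite (_ : (\int[mu]_(x in pball p0) h x)%E = (\int[mu]_(x in \bigcup_M (pball p0 `\` Om M.+1)) h x)%E).
  apply: ge0_nondecreasing_set_cvg_integral.
  - move=> k m km; apply/subsetPset => x [Bx nO]; split => // Ox; apply: nO.
    elim: m km Ox => [|m IH]; first by rewrite leqn0 => /eqP ->.
    rewrite leq_eqVlt => /orP[/eqP ->//|]; rewrite ltnS => km /(wt_dec wt).
    exact: IH.
  - by move=> M; exact: measurableD.
  - by move=> M; exact: measurable_funTS.
  - by [].
have -> : \bigcup_M (pball p0 `\` Om M.+1) = pball p0 `\` N.
  apply/seteqP; split => x.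
    by move=> [M _ [Bx nO]]; split => // Nx; apply: nO; exact: Nx.
  move=> [Bx nN]; apply: contrapT => H; apply: nN => M _.
  by apply: contrapT => nO; apply: H; exists M.
by apply: ge0_negligible_integral => //; exact: measurable_funTS.
Qed.

Variables (nX : (V -> \bar R) -> \bar R) (pm th pz q : R).
Hypotheses (hX : ball_QBFS A D nX) (hFS : assumption_FS A D nX pm)
  (hth : 0 < th) (hthm : th < pm) (hthp : th < pz)
  (hAA : assumption_A A D nX th pz) (hq : 1 < q).
Let ka : R := q / (q - 1).
Hypothesis hka : pz < ka.

Local Notation camp_le := (@camp_le R n A D d nX th).

Let q0 : 0 < q. Proof. exact: lt_trans hq. Qed.
Let q10 : 0 < q - 1. Proof. by rewrite subr_gt0. Qed.
Let ka1 : 1 < ka.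
Proof. by rewrite /ka ltr_pdivlMr// mul1r gtrBl. Qed.
Let ka0 : 0 < ka. Proof. exact: lt_trans ka1. Qed.
Let rho : R := 2 `^ ka.
Let rho2 : 2 <= rho.
Proof. by rewrite -[leLHS]powRr1// /rho ler_powR ?ler1n// ltW. Qed.
Let rho0 : 0 < rho. Proof. by apply: lt_le_trans rho2. Qed.

(** (1) is applied to all dilated cores of all towers at once. Then [FS_balls] shrinks the dilates
    to the cores, and [dual_family] replaces each tower of cores by its base ball. *)
Let osc_tower_finite : exists2 C : R, 0 < C & forall f (Phi : R), 0 <= Phi -> camp_le f Phi ->
  forall (I : Type) (s : seq I) (c : I -> R)
    (p : I -> T) (w : I -> V -> R) (Om : I -> nat -> set V) (e : I -> nat -> nat -> option T) (M N : nat),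
  (forall k, 0 <= c k) ->
  (forall k, whitney_tower A D hr rho (p k) (w k) (Om k) (e k)) ->
  ((\sum_(k <- s) \sum_(0 <= m < M) \sum_(0 <= i < N) c k * (2 ^+ m * osc_o f (e k m i)))%R%:E <=
   (C * Phi)%:E * Xnorm nX th (fun x => \sum_(k <- s) c k `^ th * \1_(pball (p k)) x)%R)%E.
Proof.
have [C1 [C10 HC1]] := FS_balls hA hD hDvol hr hrA hX hFS hth hthm.
have [C2 C20 HC2] := dual_family hA hD hDvol hr hrA hX hFS hth hthm hthp hka hAA.
pose K := (6 * dsig hr)%N; pose c6 := b ^+ (2 * K); have c60 : 0 < c6 by rewrite exprn_gt0.
exists (C1 * c6 `^ th^-1 * C2); first by rewrite !mulr_gt0// powR_gt0.
move=> f Phi Phi0 camp I s c p w Om e M N c0 wt.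
pose s3 := [seq (kmi.1, kmi.2, i) | kmi <- [seq (k, m) | k <- s, m <- index_iota 0 M], i <- index_iota 0 N].
pose o (t : I * nat * nat) := e t.1.1 t.1.2 t.2.
(* An empty slot receives coefficient 0 and an arbitrary ball. *)
pose c3 (t : I * nat * nat) : R := if o t is Some _ then c t.1.1 * 2 ^+ t.1.2 else 0.
pose p3 (t : I * nat * nat) : T := if o t is Some p' then dil K%:Z p' else p t.1.1.
have c30 t : 0 <= c3 t by rewrite /c3; case: (o t) => // *; rewrite mulr_ge0// exprn_ge0.
have sum3 (U : nmodType) (F : I * nat * nat -> U) : \sum_(t <- s3) F t =
    \sum_(k <- s) \sum_(0 <= m < M) \sum_(0 <= i < N) F (k, m, i).
  by rewrite big_allpairs_dep big_allpairs.
have -> : \sum_(k <- s) \sum_(0 <= m < M) \sum_(0 <= i < N) c k * (2 ^+ m * osc_o f (e k m i)) =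
    \sum_(t <- s3) c3 t * osc f (p3 t).
  rewrite sum3; apply: eq_bigr => k _; apply: eq_bigr => m _; apply: eq_bigr => i _.
  rewrite /c3 /p3 /o /=; case: (e k m i) => [p'|]; last by rewrite /osco !mulr0 mul0r.
  by rewrite /osco mulrA (_ : 6 * sg = K%:Z)// /K PoszM.
apply: le_trans (camp _ s3 c3 p3 c30) _.
rewrite (mulrC _ Phi) EFinM -muleA; apply: lee_wpmul2l; first by rewrite lee_fin.
have mO t := measurable_oball hA hD (o t).
pose a3 t := c3 t `^ th * c6; have a30 t : 0 <= a3 t by rewrite mulr_ge0 ?powR_ge0// ltW.
have Osub t : oball (o t) `<=` pball (p3 t).
  rewrite /p3; case: (o t) => [p'|] //=.
  by have := sub_dil hA hD hr hrA (p := p') (leq0n K); rewrite dil_0.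
have := HC1 _ s3 a3 p3 (fun t => oball (o t)) a30 mO Osub.
have -> : (fun x => \sum_(k <- s3) a3 k * (fine (mu (oball (o k))) / b ^ (p3 k).2) ^+ 2 * \1_(pball (p3 k)) x)
    = (fun x => \sum_(k <- s3) c3 k `^ th * \1_(pball (p3 k)) x).
  apply/funext => x; apply: eq_bigr => t _; congr (_ * _).
  rewrite /a3 /c3 /p3; case: (o t) => [p'|]; last by rewrite powR0 ?mul0r// gt_eqF.
  rewrite (_ : fine _ = b ^ p'.2); last exact: (congr1 fine (vol_pball hA hD hDvol _)).
  rewrite /= (exprz_dil hA hD hDvol hr hrA) -exprnP /c6 mulnC exprM.
  have bk : b ^+ K != 0 by rewrite gt_eqF// exprn_gt0.
  by field; rewrite bk gt_eqF.
move=> H; apply: le_trans H _; rewrite -mulrA EFinM -muleA; apply: lee_wpmul2l; first by rewrite lee_fin ltW.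
have cth0 k : 0 <= c k `^ th by exact: powR_ge0.
have := HC2 I s (fun k => c k `^ th) p w Om e M N cth0 wt => H2.
rewrite EFinM -muleA.
apply: (@le_trans _ _ ((c6 `^ th^-1)%:E *
    Xnorm nX th (fun x => \sum_(k <- s) c k `^ th * tower_sum A D th (e k) M N x)%R)%E); last first.
  by apply: lee_wpmul2l => //; rewrite lee_fin powR_ge0.
rewrite -(Xnorm_scale th hX)//; first last.
- by move=> x; apply: sumr_ge0 => k _; rewrite mulr_ge0// tower_sum_ge0.
- apply: measurable_sum => k; apply: measurable_funM => //; exact: measurable_tower_sum.
rewrite le_eqVlt; apply/orP; left; apply/eqP; congr (Xnorm _ _ _); apply/funext => x.
rewrite sum3 mulr_sumr; apply: eq_bigr => k _; rewrite /tower_sum !mulr_sumr.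
apply: eq_bigr => m _; rewrite !mulr_sumr; apply: eq_bigr => i _.
rewrite /a3 /c3 /o /=; case: (e k m i) => [p'|] /=.
  by rewrite powRM ?exprn_ge0//; ring.
by rewrite indicE in_set0 !mulr0.
Qed.

Definition locintq (f : V -> R) := locint f /\
  forall p, mu.-integrable (pball p) (EFin \o (fun x => `|f x - PP f p x| `^ q)).

(* The L^q mean oscillation over p; camp_le above is the case q = 1 of the Campanato bound, and
   aq_bound upgrades it to q: a John-Nirenberg self-improvement. *)
Definition aq (f : V -> R) (p : T) : R :=
  ((b ^ p.2)^-1 * \int[mu]_(x in pball p) (`|f x - PP f p x| `^ q)) `^ q^-1.

Let hg1 (m : nat) (y : R) : 0 <= y -> y `^ ka^-1 <= 2 ^+ m + 2 ^+ m / rho ^+ m * y.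
Proof.
move=> y0; have m0 : 0 < (2 : R) ^+ m by rewrite exprn_gt0.
have := le_add_powR ka1 m0 (powR_ge0 y ka^-1).
rewrite -powRrM mulVf ?gt_eqF// powRr1//.
suff -> : (2 ^+ m) `^ (1 - ka) = 2 ^+ m / rho ^+ m by [].
rewrite powRD ?(gt_eqF m0) ?implybT// powRr1 ?(ltW m0)//; congr (_ * _).
by rewrite /rho -pow2_powR -powR_inv1 ?powR_ge0// -powRrM mulrN1.
Qed.

Let hg2 (m : nat) (y : R) : 0 <= y -> y <= rho ^+ m -> y `^ ka^-1 <= 2 ^+ m.
Proof.
move=> y0 yr; have m0 : 0 <= (2 : R) ^+ m by rewrite exprn_ge0.
rewrite [leRHS](_ : _ = (rho ^+ m) `^ ka^-1); last first.
  by rewrite /rho -pow2_powR -powRrM mulfV ?gt_eqF// powRr1.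
by apply: ge0_ler_powR; rewrite ?nnegrE ?invr_ge0 ?(ltW ka0) ?exprn_ge0 ?(ltW rho0).
Qed.

(** Normalizing |f - P f|^q by its mean gives a weight w of mean 1, and g = w^(1/q') is the extremal
    function for the L^q duality. Pairing with it recovers [aq], and the tower of w bounds the
    pairing. *)
Lemma aq_bound : exists2 C : R, 0 < C & forall f (Phi : R), locintq f -> 0 <= Phi -> camp_le f Phi ->
  forall (I : Type) (s : seq I) (c : I -> R) (p : I -> T), (forall k, 0 <= c k) ->
  ((\sum_(k <- s) c k * (b ^ (p k).2 * aq f (p k)))%R%:E <=
   (C * Phi)%:E * Xnorm nX th (fun x => \sum_(k <- s) c k `^ th * \1_(pball (p k)) x)%R)%E.
Proof.
have [C1 C10 HC1] := osc_tower_finite.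
have [C2 C20 HC2] := level_bound hA hD hDvol hr hrA hlam d.
exists (C2 * C1); first exact: mulr_gt0.
move=> f Phi [lf lfq] Phi0 camp I s c p c0.
pose F k (x : V) := `|f x - PP f (p k) x|.
have mF k : measurable_fun setT (F k) by exact: (measurable_diff hA hD hDvol hr hrA).
have F0 k x : 0 <= F k x by exact: normr_ge0.
pose a k := aq f (p k); have a0 k : 0 <= a k by exact: powR_ge0.
pose w k (x : V) : R := if 0 < a k then (F k x / a k) `^ q * \1_(pball (p k)) x else 0.
have mw k : measurable_fun setT (w k).
  rewrite /w; case: ltP => _ //; apply: measurable_funM.
    by apply: measurableT_comp (measurable_powR _) _; exact: measurable_funM.
  by apply: measurable_indic; exact: measurable_pball.
have w0 k x : 0 <= w k x by rewrite /w; case: ltP => // _; rewrite mulr_ge0 ?powR_ge0// indicE ler0n.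
have mB k := measurable_pball hA hD (p k).
have FqE k : (\int[mu]_(x in pball (p k)) (F k x `^ q)%:E = (b ^ (p k).2 * a k `^ q)%:E)%E.
  rewrite /a /aq -powRrM mulVf ?gt_eqF// powRr1; last first.
    by rewrite mulr_ge0 ?invr_ge0 ?(ltW (bz0 _))//; apply: Rintegral_ge0 => x _; exact: powR_ge0.
  rewrite mulrA mulfV ?gt_eqF// mul1r /Rintegral fineK//.
  have /(integrable_fin_num (mB k)) := lfq (p k); exact.
have wE k : 0 < a k -> (\int[mu]_x (w k x)%:E = (b ^ (p k).2)%:E)%E.
  move=> ak; have aqk : 0 <= (a k `^ q)^-1 by rewrite invr_ge0 powR_ge0.
  have mFq : measurable_fun setT (fun x : V => F k x `^ q) by exact: measurableT_comp (measurable_powR _) (mF k).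
  have -> : (\int[mu]_x (w k x)%:E = \int[mu]_(x in pball (p k)) (((a k `^ q)^-1)%:E * (F k x `^ q)%:E))%E.
    rewrite [RHS]integral_mkcond; apply: eq_integral => x _; rewrite /w ak patchE indicE.
    case: (x \in _); last by rewrite mulr0.
    rewrite mulr1 -EFinM powRM ?invr_ge0// mulrC; congr (_ * _)%:E.
    exact: powRV.
  rewrite (ge0_integralZl_cst (mB k) aqk mFq (fun x => powR_ge0 _ _)) FqE -EFinM.
  by congr (_%:E); field; rewrite gt_eqF// powR_gt0.
have wsupp k x : ~ pball (p k) x -> w k x = 0.
  by move=> nB; rewrite /w; case: ifP => // _; rewrite indicE memNset// mulr0.
have Iw k : (\int[mu]_x (w k x)%:E <= (b ^ (p k).2)%:E)%E.
  have [ak|ak] := ltP 0 (a k); first by rewrite wE.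
  rewrite integral0_eq ?lee_fin ?ltW// => x _.
  by rewrite /w ltNge ak.
have ext k : exists Oe : (nat -> set V) * (nat -> nat -> option T),
    whitney_tower A D hr rho (p k) (w k) Oe.1 Oe.2.
  have [Om [e wt]] := exists_whitney_tower hA hD hDvol hr hrA rho2 (mw k) (w0 k) (@wsupp k) (Iw k).
  by exists (Om, e).
have [Oe wt] := choice ext.
pose g k (x : V) := w k x `^ ka^-1.
have mg k : measurable_fun setT (g k) by exact: measurableT_comp (measurable_powR _) (mw k).
have g0 k x : 0 <= g k x by exact: powR_ge0.
pose E k := (fun x : V => (F k x * g k x)%:E).
have mE k : measurable_fun setT (E k) by apply/measurable_EFinP; exact: measurable_funM.
have E0 k x : (0 <= E k x)%E by rewrite lee_fin mulr_ge0.
(* Equality in Hoelder: q/ka = q - 1, so F g is F^q / a^(q-1), with integral the volume times [a].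
   For a = 0 the left side vanishes. *)
have aE k : ((b ^ (p k).2 * a k)%:E <= \int[mu]_(x in pball (p k)) E k x)%E.
  have [ak|ak] := ltP 0 (a k); last first.
    have -> : a k = 0 by apply/eqP; rewrite eq_le ak a0.
    by rewrite mulr0; apply: integral_ge0 => x _; exact: E0.
  have aq1 : 0 <= (a k `^ (q - 1))^-1 by rewrite invr_ge0 powR_ge0.
  have mFq : measurable_fun setT (fun x : V => F k x `^ q) by exact: measurableT_comp (measurable_powR _) (mF k).
  have -> : (\int[mu]_(x in pball (p k)) E k x =
      \int[mu]_(x in pball (p k)) (((a k `^ (q - 1))^-1)%:E * (F k x `^ q)%:E))%E.
    apply: eq_integral => x Bx; rewrite /E /g /w ak indicE Bx mulr1 -EFinM; congr (_%:E).
    rewrite -powRrM (_ : q * ka^-1 = q - 1); last by rewrite /ka; field; rewrite !gt_eqF.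
    rewrite powRM ?invr_ge0 ?(ltW ak)// mulrA mulrC; congr (_ * _).
      exact: powRV.
    have [F00|Fx] := eqVneq (F k x) 0; first by rewrite F00 mul0r powR0// gt_eqF.
    rewrite -{1}[F k x]powRr1// -powRD ?Fx ?implybT//; congr (_ `^ _); ring.
  rewrite (ge0_integralZl_cst (mB k) aq1 mFq (fun x => powR_ge0 _ _)) FqE -EFinM lee_fin.
  rewrite le_eqVlt; apply/orP; left; apply/eqP.
  have -> : a k `^ q = a k * a k `^ (q - 1).
    rewrite -{2}[a k]powRr1// -powRD ?(gt_eqF ak) ?implybT//; congr (_ `^ _); ring.
  by field; rewrite gt_eqF// powR_gt0.
set X := Xnorm _ _ _.
pose J k M := (\int[mu]_(x in pball (p k) `\` (Oe k).1 M.+1) E k x)%E.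
have J0 k M : (0 <= J k M)%E by apply: integral_ge0 => x _; exact: E0.
(* Two limits: the number of cores N goes to infinity for a fixed number of levels, and afterwards M
   goes to infinity through [tower_cvg]. *)
have JM M : (\sum_(k <- s) (c k)%:E * J k M <= (C2 * C1 * Phi)%:E * X)%E.
  pose S k (N : nat) : \bar R := (\sum_(0 <= m < M.+1) \sum_(0 <= i < N) (C2 * (2 ^+ m * osc_o f ((Oe k).2 m i)))%:E)%E.
  pose Soo k : \bar R := (\sum_(0 <= m < M.+1) \sum_(i <oo) (C2 * (2 ^+ m * osc_o f ((Oe k).2 m i)))%:E)%E.
  have o0 k m i : (0 <= (C2 * (2 ^+ m * osc_o f ((Oe k).2 m i)))%:E)%E.
    rewrite lee_fin mulr_ge0 ?(ltW C20)// mulr_ge0 ?exprn_ge0// /osco.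
    by case: ((Oe k).2 m i) => // p'; exact: osc_ge0.
  have cvS : (fun N => \sum_(k <- s) (c k)%:E * S k N)%E @ \oo --> (\sum_(k <- s) (c k)%:E * Soo k)%E.
    apply: cvg_nnesum => k _.
      apply: nearW => N; rewrite mule_ge0 ?lee_fin//; apply: sume_ge0 => m _.
      by apply: sume_ge0 => i _; exact: o0.
    apply: cvgeZl => //; apply: cvg_nnesum => m _.
      by apply: nearW => N; apply: sume_ge0 => i _; exact: o0.
    by apply: is_cvg_nneseries => i _ _; exact: o0.
  apply: (@le_trans _ _ (\sum_(k <- s) (c k)%:E * Soo k)%E).
    apply: lee_sum => k _; apply: lee_wpmul2l; first by rewrite lee_fin.
    apply: (HC2 f rho (p k) (w k) (g k)) (wt k) _ _ _ _ _ => //.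
    - by move=> m x; exact: hg1.
    - by move=> m x; exact: hg2.
  apply: (cvge_to_le cvS); apply: nearW => N.
  have -> : (\sum_(k <- s) (c k)%:E * S k N)%E = (C2%:E * (\sum_(k <- s) \sum_(0 <= m < M.+1) \sum_(0 <= i < N)
      c k * (2 ^+ m * osc_o f ((Oe k).2 m i)))%R%:E)%E.
    rewrite -EFinM mulr_sumr -sumEFin; apply: eq_bigr => k _.
    rewrite /S mulr_sumr; under eq_bigr do rewrite sumEFin.
    rewrite sumEFin -EFinM; congr (_%:E); rewrite mulr_sumr; apply: eq_bigr => m _.
    rewrite !mulr_sumr; apply: eq_bigr => i _; ring.
  rewrite -(mulrA C2) EFinM -muleA; apply: lee_wpmul2l; first by rewrite lee_fin ltW.
  exact: (HC1 f Phi Phi0 camp I s c p w (fun k => (Oe k).1) (fun k => (Oe k).2) M.+1 N c0 wt).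
have cvJ : (fun M => \sum_(k <- s) (c k)%:E * J k M)%E @ \oo -->
    (\sum_(k <- s) (c k)%:E * \int[mu]_(x in pball (p k)) E k x)%E.
  apply: cvg_nnesum => k _; first by apply: nearW => M; rewrite mule_ge0 ?lee_fin.
  by apply: cvgeZl => //; apply: (tower_cvg rho2 (wt k)).
apply: (@le_trans _ _ (\sum_(k <- s) (c k)%:E * \int[mu]_(x in pball (p k)) E k x)%E).
  rewrite -sumEFin; apply: lee_sum => k _; rewrite EFinM; apply: lee_wpmul2l; first by rewrite lee_fin.
  exact: aE.
by apply: (cvge_to_le cvJ); exact: nearW.
Qed.

End Campanato_bound.

(** * Passing to a Borel representative and conclusion *)

Section Transfer.
Context {R : realType} {n : nat} (A : 'M[R]_n.+1) (D : set 'cV[R]_n.+1) (r : R).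
Hypotheses (hA : dilation A) (hD : ellipsoid0 D) (hDvol : Rvol D = 1%E) (hr : 1 < r)
  (hrA : [set r *: x | x in D] `<=` [set A *m x | x in D]).
Variable d : nat.

Local Notation V := (cvM R n.+1).
Local Notation mu := (@vol R n.+1).
Local Notation b := `|\det A|.
Local Notation T := ('cV[R]_n.+1 * int)%type.
Local Notation pball := (@pball R n A D).
Local Notation PP := (@PP R n A D d).
Local Notation locint := (@locint R n A D).

Lemma trmx_continuous m k : continuous (trmx : 'M[R]_(m, k) -> 'M[R]_(k, m)).
Proof.
move=> x U /nbhs_ballP[e e0 eU]; apply/nbhs_ballP; exists e => // y xy.
by apply: eU; split => // i j; rewrite !mxE; have [_] := xy; exact.
Qed.

Lemma compact_box (s : R) : compact [set x : 'cV[R]_n.+1 | forall i, `|x i 0| <= s].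
Proof.
have -> : [set x : 'cV[R]_n.+1 | forall i, `|x i 0| <= s] =
    trmx @` [set v : 'rV[R]_n.+1 | forall i, `[- s, s]%classic (v ord0 i)].
  apply/seteqP; split => x /=.
    move=> xs; exists x^T; last by rewrite trmxK.
    by move=> i; rewrite mxE /= in_itv/= -ler_norml.
  by move=> [v vs <-] i; rewrite mxE ler_norml; have := vs i; rewrite /= in_itv.
apply: continuous_compact.
  by apply: continuous_subspaceT => v; exact: trmx_continuous.
apply: (@rV_compact R n.+1 (fun _ => `[- s, s]%classic)) => i; exact: segment_compact.
Qed.

Lemma pball_sub_compact p : exists K : set 'cV[R]_n.+1, compact K /\ pball p `<=` K.
Proof.
have [s hs] := dball_bounded A hD p.1 p.2.
by exists [set x : 'cV[R]_n.+1 | forall i, `|x i 0| <= s]; split => //; exact: compact_box.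
Qed.

Lemma measurable_compact_cV (K : set 'cV[R]_n.+1) : compact K -> measurable (K : set V).
Proof.
move=> cK; rewrite -[K]setCK; apply: measurableC; apply: open_measurable_cV.
by rewrite openC; apply: compact_closed cK; exact: norm_hausdorff.
Qed.

Lemma int_on_eq_off_null (E : set V) (f g : V -> \bar R) (N : set V) : measurable E ->
  measurable N -> mu N = 0%E -> measurable_fun setT g -> (forall x, 0 <= g x)%E ->
  (forall x, ~ N x -> f x = g x) -> int_on E f = int_on E g.
Proof.
move=> mE mN N0 mg g0 fg; rewrite /int_on; apply: (@iint_eq_off_null _ _ _ _ N) => //.
- by apply: emeasurable_funM => //; exact: measurable_indicE.
- by move=> x; rewrite mule_ge0// lee_fin indicE ler0n.
- by move=> x Nx; rewrite fg.
Qed.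

Variables (f f0 : V -> R) (N : set V).
Hypotheses (mN : measurable N) (N0 : mu N = 0%E) (mf0 : measurable_fun setT f0)
  (ff0 : forall x, ~ N x -> f x = f0 x).

(** The polynomials admissible for f and for f0 form the same set, and [xget] applied to equal sets
    returns the same element. *)
Lemma projP_eq_off_null p : projP d (pball p) f = PP f0 p.
Proof.
have mB := measurable_pball hA hD p.
have sE P h : is_polyd d P -> is_polyd d h ->
    sint_on (pball p) (fun x => (f x - P x) * h x) = sint_on (pball p) (fun x => (f0 x - P x) * h x).
  move=> hP hh; rewrite /sint_on.
  have mP := measurable_is_polyd hP; have mh := measurable_is_polyd hh.
  have mu1 : measurable_fun setT (fun x : V => (f0 x - P x) * h x).
    by apply: measurable_funM => //; exact: measurable_funB.
  congr (_ - _)%E; apply: (int_on_eq_off_null mB mN N0).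
  - by apply/measurable_EFinP; exact: measurable_maxr.
  - by move=> x; rewrite lee_fin le_max lexx orbT.
  - by move=> x Nx; rewrite ff0.
  - apply/measurable_EFinP; apply: measurable_maxr => //.
    exact: measurableT_comp.
  - by move=> x; rewrite lee_fin le_max lexx orbT.
  - by move=> x Nx; rewrite ff0.
rewrite /PP /projP; congr (xget _ _); apply/seteqP; split => P [hP HP]; split => // h hh.
  by rewrite -sE//; exact: HP.
by rewrite sE//; exact: HP.
Qed.

Variable q : R.
Hypothesis hq : 1 <= q.
Hypothesis hfq : forall K : set 'cV[R]_n.+1, compact K ->
  (int_on K (fun x => (`|f x| `^ q)%:E) < +oo)%E.

Let q0 : 0 < q. Proof. exact: lt_le_trans hq. Qed.

Let mpow (g : V -> R) : measurable_fun setT g -> measurable_fun setT (fun x : V => `|g x| `^ q).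
Proof. by move=> mg; apply: measurableT_comp (measurable_powR _) _; exact: measurableT_comp. Qed.

Let int_q p : (\int[mu]_(x in pball p) (`|f0 x| `^ q)%:E < +oo)%E.
Proof.
have [K [cK BK]] := pball_sub_compact p.
have mK := measurable_compact_cV cK; have mB := measurable_pball hA hD p.
have mE : measurable_fun setT (fun x : V => (`|f0 x| `^ q)%:E) by apply/measurable_EFinP; exact: mpow.
have := hfq cK; rewrite (@int_on_eq_off_null K _ (fun x => (`|f0 x| `^ q)%:E) N)//; first last.
- by move=> x Nx; rewrite ff0.
rewrite int_onE//; apply: le_lt_trans; apply: ge0_subset_integral => //.
exact: measurable_funTS.
Qed.

Let le1_powR (y : R) : 0 <= y -> y <= 1 + y `^ q.
Proof.
move=> y0; have [y1|y1] := leP y 1; first by apply: le_trans y1 _; rewrite lerDl powR_ge0.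
by apply: (@le_trans _ _ (y `^ q)); [apply: le1r_powR => //; exact: ltW|rewrite lerDr].
Qed.

Lemma locint_Borel : locint f0.
Proof.
split => // p; have mB := measurable_pball hA hD p.
apply/integrableP; split; first by apply: measurable_funTS; exact/measurable_EFinP.
have mE : measurable_fun setT (fun x : V => (`|f0 x| `^ q)%:E) by apply/measurable_EFinP; exact: mpow.
apply: (@le_lt_trans _ _ (\int[mu]_(x in pball p) (1%:E + (`|f0 x| `^ q)%:E))%E).
  apply: ge0_le_integral => //.
  - by apply: measurable_funTS; apply/measurable_EFinP; exact: measurableT_comp.
  - by apply: measurable_funTS; exact: emeasurable_funD.
  - by move=> x _; rewrite /= lee_fin; exact: le1_powR.
rewrite ge0_integralD//; last exact: measurable_funTS.
rewrite (integral_cst_pball hA hD hDvol); apply: lte_add_pinfty; [exact: ltry|exact: int_q].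
Qed.

(** The projection is bounded on the ball, say by M, so |f0 - P|^q is at most (2M)^q or (2|f0|)^q,
    according to which of |f0| and M is larger. *)
Lemma locintq_Borel : locintq A D d q f0.
Proof.
split; first exact: locint_Borel.
move=> p; have mB := measurable_pball hA hD p.
have hP := PP_polyd hA hD hDvol hr hrA d p locint_Borel.
have [s hs] := dball_bounded A hD p.1 p.2; have [M HM] := is_polyd_bounded hP s.
have md : measurable_fun setT (fun x : V => f0 x - PP f0 p x).
  by apply: measurable_funB => //; exact: measurable_is_polyd hP.
have mE : measurable_fun setT (fun x : V => (`|f0 x| `^ q)%:E) by apply/measurable_EFinP; exact: mpow.
apply/integrableP; split.
  apply: measurable_funTS; apply/measurable_EFinP.
  apply: measurableT_comp (measurable_powR _) _; exact: measurableT_comp.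
pose c := (2 * `|M|) `^ q.
apply: (@le_lt_trans _ _ (\int[mu]_(x in pball p) (c%:E + (2 `^ q)%:E * (`|f0 x| `^ q)%:E))%E).
  apply: ge0_le_integral => //.
  - apply: measurable_funTS; apply/measurable_EFinP; apply: measurableT_comp => //.
    by apply: measurableT_comp (measurable_powR _) _; exact: measurableT_comp.
  - by apply: measurable_funTS; apply: emeasurable_funD => //; exact: emeasurable_funM.
  - move=> x Bx; rewrite /= ger0_norm ?powR_ge0// -EFinM -EFinD lee_fin.
    have Px : `|PP f0 p x| <= `|M| by apply: le_trans (HM x (hs x Bx)) (ler_norm M).
    have dx : `|f0 x - PP f0 p x| <= `|f0 x| + `|M|.
      by apply: le_trans (ler_normB _ _) _; rewrite lerD2l.
    have [fM|Mf] := leP `|f0 x| `|M|.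
      apply: (@le_trans _ _ c); last by rewrite lerDl mulr_ge0 ?powR_ge0.
      apply: ge0_ler_powR; rewrite ?nnegrE ?(ltW q0) ?mulr_ge0//.
      by apply: le_trans dx _; lra.
    apply: (@le_trans _ _ (2 `^ q * `|f0 x| `^ q)); last by rewrite lerDr powR_ge0.
    rewrite -powRM//; apply: ge0_ler_powR; rewrite ?nnegrE ?(ltW q0) ?mulr_ge0//.
    by apply: le_trans dx _; lra.
have c0 : 0 <= c by exact: powR_ge0.
rewrite ge0_integralD//; first last.
- by apply: measurable_funTS; exact: emeasurable_funM.
rewrite (integral_cst_pball hA hD hDvol) (ge0_integralZl_cst mB (powR_ge0 _ _) (mpow mf0) (fun x => powR_ge0 _ _)).
apply: lte_add_pinfty; first exact: ltry.
by apply: lte_mul_pinfty; rewrite ?lee_fin ?powR_ge0//; exact: int_q.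
Qed.

Lemma avg_eq_off_null p :
  (avg (pball p) (fun x => (`|f x - projP d (pball p) f x| `^ q)%:E) `^ q^-1 =
   (aq A D d q f0 p)%:E)%E.
Proof.
have mB := measurable_pball hA hD p; have lf := locint_Borel.
have md : measurable_fun setT (fun x : V => `|f0 x - PP f0 p x| `^ q).
  apply: mpow; apply: measurable_funB => //.
  exact: measurable_is_polyd (PP_polyd hA hD hDvol hr hrA d p lf).
have mdE : measurable_fun setT (fun x : V => (`|f0 x - PP f0 p x| `^ q)%:E) by exact/measurable_EFinP.
rewrite projP_eq_off_null /avg.
rewrite (@int_on_eq_off_null _ _ (fun x => (`|f0 x - PP f0 p x| `^ q)%:E) N)//; last first.
  by move=> x Nx; rewrite ff0.
rewrite int_onE// RvolE// (congr1 fine (vol_pball hA hD hDvol p)) /=.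
have -> : (\int[mu]_(x in pball p) (`|f0 x - PP f0 p x| `^ q)%:E =
    (\int[mu]_(x in pball p) (`|f0 x - PP f0 p x| `^ q))%:E)%E.
  rewrite /Rintegral fineK//.
  have /(integrable_fin_num mB) := locintq_Borel.2 p; exact.
by rewrite -EFinM poweR_EFin.
Qed.

(** Integrating y <= s + s^(1-q) y^q with s just above the L^q mean [a] gives 2 s times the volume.
    The excess keeps s positive; q = 1 is direct. *)
Lemma osc_le_aq p : osc A D d f0 p <= 2 * (b ^ p.2 * aq A D d q f0 p).
Proof.
have mB := measurable_pball hA hD p; have lf := locint_Borel.
have bp : 0 < b ^ p.2 by rewrite exprz_gt0// (lt_trans ltr01 (det_gt1 hA hD hDvol hr hrA)).
pose a := aq A D d q f0 p; rewrite -/a.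
have a0 : 0 <= a by exact: powR_ge0.
pose F (x : V) := `|f0 x - PP f0 p x|.
have I0 : 0 <= \int[mu]_(x in pball p) (F x `^ q) by apply: Rintegral_ge0 => x _; exact: powR_ge0.
have IE : \int[mu]_(x in pball p) (F x `^ q) = b ^ p.2 * a `^ q.
  rewrite /a /aq -powRrM mulVf ?gt_eqF// powRr1; first by rewrite mulrA mulfV ?gt_eqF// mul1r.
  by rewrite mulr_ge0 ?invr_ge0 ?(ltW bp).
have [q1|q1] := eqVneq q 1.
  have -> : osc A D d f0 p = b ^ p.2 * a.
    rewrite -[a in RHS]powRr1// -[X in a `^ X]q1 -IE.
    by rewrite q1 /osc; congr fine; apply: eq_integral => x _; rewrite powRr1//; exact: normr_ge0.
  by rewrite ler_peMl ?mulr_ge0 ?(ltW bp)// ler1n.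
have {}q1 : 1 < q by rewrite lt_neqAle eq_sym q1.
have iF := integrable_diff hA hD hDvol hr hrA d p p lf.
have iFq := locintq_Borel.2 p.
apply/ler_addgt0Pr => ep ep0.
pose s := a + ep / (2 * b ^ p.2).
have s0 : 0 < s by rewrite ltr_wpDl// divr_gt0// mulr_gt0.
have -> : 2 * (b ^ p.2 * a) + ep = b ^ p.2 * s + b ^ p.2 * s.
  by rewrite /s; field; rewrite gt_eqF.
have sq : s `^ (1 - q) * a `^ q <= s.
  apply: (@le_trans _ _ (s `^ (1 - q) * s `^ q)).
    rewrite ler_wpM2l ?powR_ge0//; apply: ge0_ler_powR; rewrite ?nnegrE ?(ltW q0) ?(ltW s0)//.
    by rewrite /s lerDl ltW// divr_gt0// mulr_gt0.
  by rewrite -powRD ?(gt_eqF s0) ?implybT// subrK powRr1// ltW.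
have ics : mu.-integrable (pball p) (EFin \o (fun=> s)).
  apply/integrableP; split; first exact: measurable_cst.
  apply: (@le_lt_trans _ _ (\int[mu]_(x in pball p) (`|s|)%:E)%E); first exact: lexx.
  by rewrite (integral_cst_pball hA hD hDvol) ltry.
have icF : mu.-integrable (pball p) (EFin \o (fun x => s `^ (1 - q) * F x `^ q)).
  by apply: eq_integrable (integrableZl mB (s `^ (1 - q)) iFq) => // x _; rewrite /= EFinM.
apply: (@le_trans _ _ (\int[mu]_(x in pball p) (s + s `^ (1 - q) * F x `^ q))).
  apply: le_Rintegral => //.
  - exact: eq_integrable (integrableD mB ics icF).
  - by move=> x _; exact: le_add_powR.
rewrite RintegralD// RintegralZl// IE.
have -> : \int[mu]_(x in pball p) s = b ^ p.2 * s.
  by rewrite /Rintegral (integral_cst_pball hA hD hDvol)/= mulrC.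
rewrite lerD2l mulrCA ler_wpM2l ?(ltW bp)//.
Qed.

End Transfer.

(** * The two functionals as suprema over finite families *)

Section CampanatoForm.
Context {R : realType} {n : nat} (A : 'M[R]_n.+1) (D : set 'cV[R]_n.+1) (r : R).
Hypotheses (hA : dilation A) (hD : ellipsoid0 D) (hDvol : Rvol D = 1%E) (hr : 1 < r)
  (hrA : [set r *: x | x in D] `<=` [set A *m x | x in D]).
Variable d : nat.

Local Notation V := (cvM R n.+1).
Local Notation mu := (@vol R n.+1).
Local Notation b := `|\det A|.
Local Notation T := ('cV[R]_n.+1 * int)%type.
Local Notation pball := (@pball R n A D).
Local Notation PP := (@PP R n A D d).
Local Notation osc := (@osc R n A D d).

Variables (nX : (V -> \bar R) -> \bar R) (th pz : R).
Hypotheses (hX : ball_QBFS A D nX) (hth : 0 < th) (hAA : assumption_A A D nX th pz).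

Local Notation camp_le := (@camp_le R n A D d nX th).

(** Here c stands for lambda divided by the X-norm of the indicator of the ball: in this variable
    the weights of both functionals take the form of (1). *)
Definition ball_sum m (c : nat -> R) (p : nat -> T) : V -> R :=
  fun x => \sum_(k <- index_iota 0 m) c k `^ th * \1_(pball (p k)) x.

Definition ball_norm m c p : R := fine (Xnorm nX th (ball_sum m c p)).

Let b0 : 0 < b. Proof. exact: lt_trans ltr01 (det_gt1 hA hD hDvol hr hrA). Qed.
Let bl (l : int) : 0 < b ^ l. Proof. by rewrite exprz_gt0. Qed.

Lemma measurable_ball_sum m c p : measurable_fun setT (ball_sum m c p).
Proof.
apply: measurable_sum => k; apply: measurable_funM => //.
by apply: measurable_indic; exact: measurable_pball.
Qed.

Lemma ball_sum_ge0 m c p x : 0 <= ball_sum m c p x.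
Proof. by apply: sumr_ge0 => k _; rewrite mulr_ge0 ?powR_ge0// indicE ler0n. Qed.

Lemma Xnorm_ball_sum m c p : Xnorm nX th (ball_sum m c p) = (ball_norm m c p)%:E.
Proof.
rewrite /ball_norm fineK// ge0_fin_numE.
  by apply: (Xnorm_sum_lty hA hD hX hth hAA) => k; exact: powR_ge0.
by apply: (Xnorm_ge0 th hX); exact: measurable_ball_sum.
Qed.

Lemma ball_norm_ge0 m c p : 0 <= ball_norm m c p.
Proof. by rewrite -lee_fin -Xnorm_ball_sum; apply: (Xnorm_ge0 th hX); exact: measurable_ball_sum. Qed.

Lemma ball_norm_gt0 m c p k0 : (forall k, 0 <= c k) -> (k0 < m)%N -> c k0 != 0 -> 0 < ball_norm m c p.
Proof.
move=> c0 k0m ck; have {}ck : 0 < c k0 by rewrite lt_def ck c0.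
have mB := measurable_pball hA hD (p k0).
have mi : measurable_fun setT (\1_(pball (p k0)) : V -> R) by exact: measurable_indic.
rewrite -lte_fin -Xnorm_ball_sum.
apply: (@lt_le_trans _ _ (Xnorm nX th (fun x => c k0 `^ th * \1_(pball (p k0)) x))).
  rewrite (Xnorm_scale th hX)//; first last.
  - exact: powR_gt0.
  rewrite mule_gt0 ?lte_fin ?powR_gt0//.
  rewrite (_ : Xnorm _ _ _ = nX (fun x => (\1_(pball (p k0)) x)%:E)); last first.
    congr nX; apply/funext => x; rewrite indicE; case: (x \in _); rewrite ?powR1// powR0//.
    by rewrite invr_eq0 gt_eqF.
  exact: (nX_pball_gt0 hA hD hDvol hr hrA hX).
apply: (Xnorm_le hX hth).
- by apply: measurable_funM.
- exact: measurable_ball_sum.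
move=> x; rewrite mulr_ge0 ?powR_ge0 ?indicE ?ler0n//=.
rewrite /ball_sum (bigD1_seq k0) ?mem_index_iota ?iota_uniq//= indicE lerDl.
by apply: sumr_ge0 => k _; rewrite mulr_ge0 ?powR_ge0// ler0n.
Qed.

(** The functionals index families by natural numbers, while [camp_le] allows any list: a list is
    read through its positions. *)
Lemma camp_le_nat f Phi : (forall m (c : nat -> R) (p : nat -> T), (forall k, 0 <= c k) ->
  \sum_(k <- index_iota 0 m) c k * osc f (p k) <= Phi * ball_norm m c p) -> camp_le f Phi.
Proof.
move=> H I s c p c0; case: s => [|i0 s'].
  have := H 0%N (fun=> 0) (fun=> (0, 0)) (fun=> lexx 0).
  rewrite -lee_fin EFinM -Xnorm_ball_sum !big_nil => /le_trans; apply.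
  by rewrite (_ : ball_sum _ _ _ = fun x => \sum_(k <- [::]) c k `^ th * \1_(pball (p k)) x)//;
    apply/funext => x; rewrite /ball_sum !big_nil.
set s := i0 :: s'.
have := H (size s) (fun k => c (nth i0 s k)) (fun k => p (nth i0 s k)) (fun k => c0 _).
rewrite -lee_fin EFinM -Xnorm_ball_sum -(big_nth i0 predT (fun k => c k * osc f (p k))).
rewrite (_ : ball_sum _ _ _ = fun x => \sum_(k <- s) c k `^ th * \1_(pball (p k)) x)//.
by apply/funext => x; rewrite /ball_sum -(big_nth i0 predT (fun k => c k `^ th * \1_(pball (p k)) x)).
Qed.

Variables (f f0 : V -> R) (N : set V).
Hypotheses (mN : measurable N) (N0 : mu N = 0%E) (mf0 : measurable_fun setT f0)
  (ff0 : forall x, ~ N x -> f x = f0 x).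
Variable q : R.
Hypothesis hq : 1 <= q.
Hypothesis hfq : forall K : set 'cV[R]_n.+1, compact K ->
  (int_on K (fun x => (`|f x| `^ q)%:E) < +oo)%E.

Local Notation aq := (@aq R n A D d q f0).

Lemma ball_norm_nind m (xc : nat -> 'cV[R]_n.+1) (l : nat -> int) (lam : nat -> R) :
  fin_Xnorm nX th m (fun j => dball A D (xc j) (l j)) lam =
  Xnorm nX th (ball_sum m (fun k => lam k / nind nX (pball (xc k, l k))) (fun k => (xc k, l k))).
Proof.
by congr nX; apply/funext => x; rewrite /ball_sum big_mkord.
Qed.

Lemma campanato_le Psi : 0 <= Psi -> (forall m (c : nat -> R) (p : nat -> T), (forall k, 0 <= c k) ->
  \sum_(k <- index_iota 0 m) c k * (b ^ (p k).2 * aq (p k)) <= Psi * ball_norm m c p) ->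
  (campanato A D nX q d th f <= Psi%:E)%E.
Proof.
move=> Psi0 H; apply: ge_ereal_sup => v [m [xc [l [lam [lam0 [_ ->]]]]]].
rewrite ball_norm_nind.
set c := fun k => _; set p := fun k => (xc k, l k).
have c0 k : 0 <= c k by rewrite divr_ge0// ltW// (nind_gt0 hA hD hDvol hr hrA hX).
have e (j : 'I_m) : ((lam j * fine (Rvol (dball A D (xc j) (l j))) / nind nX (dball A D (xc j) (l j)))%:E *
   (avg (dball A D (xc j) (l j)) (fun x => (`|f x - projP d (dball A D (xc j) (l j)) f x| `^ q)%:E) `^ q^-1) =
   (c j * (b ^ (p j).2 * aq (p j)))%:E)%E.
  rewrite (avg_eq_off_null hA hD hDvol hr hrA d mN N0 mf0 ff0 hq hfq (p j)) -EFinM.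
  rewrite (_ : fine _ = b ^ l j); last first.
    rewrite RvolE; last exact: (measurable_pball hA hD (p j)).
    exact: (congr1 fine (vol_pball hA hD hDvol (p j))).
  by congr (_%:E); rewrite /c /p /=; ring.
rewrite (eq_bigr _ (fun j _ => e j)) sumEFin -EFinM lee_fin -/(ball_norm m c p).
have := H m c p c0; rewrite big_mkord => Hm.
(* For a vanishing norm the prefactor is the inverse of 0, that is 0. *)
have [->|n0] := eqVneq (ball_norm m c p) 0; first by rewrite invr0 mul0r.
rewrite mulrC ler_pdivrMr// lt_def n0; exact: ball_norm_ge0.
Qed.

Lemma campanato_elem m (c : nat -> R) (p : nat -> T) k0 : (forall k, 0 <= c k) -> (k0 < m)%N ->
  c k0 != 0 ->
  (((ball_norm m c p)^-1 * \sum_(k <- index_iota 0 m) c k * (b ^ (p k).2 * aq (p k)))%:E <=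
   campanato A D nX q d th f)%E.
Proof.
move=> c0 k0m ck; apply: ereal_sup_ubound => /=.
have nd k : 0 < nind nX (pball (p k)) by exact: (nind_gt0 hA hD hDvol hr hrA hX).
exists m, (fst \o p), (snd \o p), (fun k => c k * nind nX (pball (p k))); split=> [k|].
  by rewrite mulr_ge0// ltW.
split.
  rewrite gt_eqF// (bigD1 (Ordinal k0m))//= ltr_pwDl//.
    by rewrite mulr_gt0// lt_def ck c0.
  by apply: sumr_ge0 => k _; rewrite mulr_ge0// ltW.
rewrite ball_norm_nind (_ : ball_sum _ _ _ = ball_sum m c p); last first.
  apply/funext => x; apply: eq_bigr => k _ /=; rewrite -surjective_pairing mulfK//.
  by rewrite gt_eqF.
rewrite EFinM; congr (_ * _)%E; rewrite -sumEFin big_mkord; apply: eq_bigr => k _.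
have e := avg_eq_off_null hA hD hDvol hr hrA d mN N0 mf0 ff0 hq hfq (p k).
rewrite /pball in e *; rewrite /= e -EFinM.
rewrite (_ : fine _ = b ^ (p k).2); last first.
  rewrite RvolE; last exact: (measurable_pball hA hD (p k)).
  exact: (congr1 fine (vol_pball hA hD hDvol (p k))).
congr (_%:E); have := nd k; rewrite /pball => ndk; field.
by rewrite gt_eqF.
Qed.

Lemma campanato_ge0 : (0 <= campanato A D nX q d th f)%E.
Proof.
apply: le_trans (@campanato_elem 1%N (fun=> 1) (fun=> (0, 0)) 0%N _ _ _) => //.
- rewrite lee_fin mulr_ge0 ?invr_ge0 ?ball_norm_ge0//; apply: sumr_ge0 => k _.
  by rewrite mul1r mulr_ge0 ?powR_ge0// ltW.
Qed.

Lemma campanato_camp_le : (campanato A D nX q d th f < +oo)%E ->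
  camp_le f0 (2 * fine (campanato A D nX q d th f)).
Proof.
move=> fin; set Q := campanato _ _ _ _ _ _ _ in fin *.
have QE : Q = (fine Q)%:E by rewrite fineK// ge0_fin_numE//; exact: campanato_ge0.
have Q0 : 0 <= fine Q by apply: fine_ge0; exact: campanato_ge0.
apply: camp_le_nat => m c p c0.
(* A family with all coefficients zero is not admissible in the supremum, but both sides of (1) can
   then be compared directly. *)
have [/existsP[k0 ck]|/existsPn z] := boolP [exists k : 'I_m, c k != 0]; last first.
  rewrite big_mkord big1; first by rewrite !mulr_ge0// ball_norm_ge0.
  by move=> k _; have /negPn/eqP -> := z k; rewrite mul0r.
have np : 0 < ball_norm m c p by exact: (ball_norm_gt0 p c0 (ltn_ord k0) ck).
have := campanato_elem p c0 (ltn_ord k0) ck; rewrite -/Q QE lee_fin mulrC ler_pdivrMr// => H.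
rewrite -mulrA; apply: le_trans (_ : _ <= 2 * \sum_(k <- index_iota 0 m) c k * (b ^ (p k).2 * aq (p k))) _.
  rewrite mulr_sumr; apply: ler_sum => k _; rewrite mulrCA ler_wpM2l//.
  exact: (osc_le_aq hA hD hDvol hr hrA d mN N0 mf0 ff0 hq hfq).
by rewrite ler_pM2l.
Qed.

End CampanatoForm.

Section StarForm.
Context {R : realType} {n : nat} (A : 'M[R]_n.+1) (D : set 'cV[R]_n.+1) (r : R).
Hypotheses (hA : dilation A) (hD : ellipsoid0 D) (hDvol : Rvol D = 1%E) (hr : 1 < r)
  (hrA : [set r *: x | x in D] `<=` [set A *m x | x in D]).
Variables (lm : R) (d : nat).

Local Notation V := (cvM R n.+1).
Local Notation mu := (@vol R n.+1).
Local Notation b := `|\det A|.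
Local Notation T := ('cV[R]_n.+1 * int)%type.
Local Notation pball := (@pball R n A D).
Local Notation PP := (@PP R n A D d).
Local Notation osc := (@osc R n A D d).

Variables (nX : (V -> \bar R) -> \bar R) (th pz : R).
Hypotheses (hX : ball_QBFS A D nX) (hth : 0 < th) (hAA : assumption_A A D nX th pz).

Local Notation camp_le := (@camp_le R n A D d nX th).
Local Notation ball_sum := (@ball_sum R n A D th).
Local Notation ball_norm := (@ball_norm R n A D nX th).

Let b0 : 0 < b. Proof. exact: lt_trans ltr01 (det_gt1 hA hD hDvol hr hrA). Qed.
Let bl (l : int) : 0 < b ^ l. Proof. by rewrite exprz_gt0. Qed.
Let nd p : 0 < nind nX (pball p). Proof. exact: (nind_gt0 hA hD hDvol hr hrA hX). Qed.

Variables (f f0 : V -> R) (N : set V).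
Hypotheses (mN : measurable N) (N0 : mu N = 0%E) (ff0 : forall x, ~ N x -> f x = f0 x).
Hypothesis lf : locint A D f0.

Variables (eps : R).
Let be : R := eps * ln lm / ln b.
Hypotheses (hbe0 : 0 <= 1 + be).

Let mf0 : measurable_fun setT f0. Proof. by case: lf. Qed.

Let I (p : T) : \bar R :=
  (\int[mu]_x (star_kernel A D be p.2 (x - p.1) * `|f0 x - PP f0 p x|)%:E)%E.

Let mI p : measurable_fun setT (fun x : V => (star_kernel A D be p.2 (x - p.1) * `|f0 x - PP f0 p x|)%:E).
Proof.
apply/measurable_EFinP; apply: measurable_funM; first exact: (measurable_star_kernel_shift hA hD hDvol hr hrA).
apply: measurableT_comp => //; apply: measurable_funB => //.
exact: measurable_is_polyd (PP_polyd hA hD hDvol hr hrA d p lf).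
Qed.

Let I_ge0 p : (0 <= I p)%E.
Proof. by apply: integral_ge0 => x _; rewrite lee_fin mulr_ge0// star_kernel_ge0. Qed.

Let star_term (x0 : 'cV[R]_n.+1) l lam :
  ((lam * fine (Rvol (dball A D x0 l)) / nind nX (dball A D x0 l))%:E *
    iint (fun x => ((b `^ (be * l%:~R) * `|f x - projP d (dball A D x0 l) f x|)
       / (b `^ (l%:~R * (1 + be)) + rho A D (x - x0) `^ (1 + be)))%:E) =
  (lam / nind nX (dball A D x0 l))%:E * ((b ^ l)%:E * I (x0, l)))%E.
Proof.
rewrite (@iint_eq_off_null _ _ _ _ N mN N0 (mI (x0, l))); first last.
- move=> x Nx; rewrite ff0// /star_kernel /= -(projP_eq_off_null hA hD d mN N0 mf0 ff0 (x0, l)).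
  by rewrite mulrAC.
- by move=> x; rewrite lee_fin mulr_ge0// star_kernel_ge0.
rewrite iintE; [|exact: mI|by move=> x; rewrite lee_fin mulr_ge0// star_kernel_ge0].
rewrite (_ : fine _ = b ^ l); last first.
  rewrite RvolE; last exact: (measurable_pball hA hD (x0, l)).
  exact: (congr1 fine (vol_pball hA hD hDvol (x0, l))).
by rewrite muleA -EFinM mulrAC.
Qed.

Let star_set v := exists (xc : nat -> 'cV[R]_n.+1) (l : nat -> int) (lam : nat -> R),
  let B := fun j => dball A D (xc j) (l j) in
  [/\ (forall i, 0 <= lam i), (\sum_(i <oo) (lam i)%:E != 0)%E,
    (0 < inf_Xnorm nX th B lam)%E, (inf_Xnorm nX th B lam < +oo)%E &
    v = (((fine (inf_Xnorm nX th B lam))^-1)%:E *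
      \sum_(j <oo) ((lam j / nind nX (B j))%:E * ((b ^ l j)%:E * I (xc j, l j))))%E].

(** The volume of the ball moves inside as b^l in front of the kernel, and f is replaced by its
    Borel representative. *)
Lemma star_normE : star_norm A D nX d th eps lm f = ereal_sup star_set.
Proof.
congr ereal_sup; apply/seteqP; split => v.
  move=> [xc [l [lam [h1 [h2 [h3 [h4 ->]]]]]]]; exists xc, l, lam; split => //.
  by congr (_ * _)%E; apply: eq_eseriesr => j _; exact: star_term.
move=> [xc [l [lam [h1 h2 h3 h4 ->]]]]; exists xc, l, lam; do 4!split => //.
by congr (_ * _)%E; apply: eq_eseriesr => j _; rewrite star_term.
Qed.

Let summand_ge0 xc l (lam : nat -> R) j : (forall i, 0 <= lam i) ->
  (0 <= (lam j / nind nX (dball A D (xc j) (l j)))%:E * ((b ^ l j)%:E * I (xc j, l j)))%E.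
Proof.
move=> l0; rewrite mule_ge0 ?lee_fin//; last by rewrite mule_ge0// lee_fin ltW.
by rewrite divr_ge0//; have := nd (xc j, l j); exact: ltW.
Qed.

Let ball_norm_le_inf xc l (lam : nat -> R) m :
  (Xnorm nX th (ball_sum m (fun k => (lam k / nind nX (dball A D (xc k) (l k)))%R) (fun k => (xc k, l k)))
    <= inf_Xnorm nX th (fun j => dball A D (xc j) (l j)) lam)%E.
Proof.
have term0 j x : (0 <= ((lam j / nind nX (dball A D (xc j) (l j))) `^ th * \1_(dball A D (xc j) (l j)) x)%:E)%E.
  by rewrite lee_fin mulr_ge0 ?powR_ge0// indicE ler0n.
apply: (nX_le hX).
- apply: measurableT_comp (measurable_poweR _) _.
  apply: ge0_emeasurable_sum => [k x _ _|k _]; first exact: term0.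
  apply/measurable_EFinP; apply: measurable_funM => //; apply: measurable_indic.
  exact: (measurable_pball hA hD (xc k, l k)).
- by apply: measurable_Xnorm; exact: (measurable_ball_sum hA hD).
move=> x; rewrite !gee0_abs ?lee_fin ?powR_ge0 ?poweR_ge0// -poweR_EFin.
have S0 : (0 <= \sum_(i <oo) ((lam i / nind nX (dball A D (xc i) (l i))) `^ th * \1_(dball A D (xc i) (l i)) x)%:E)%E.
  by apply: nneseries_ge0 => k _ _.
apply: gt0_ler_poweR.
- by rewrite invr_ge0 ltW.
- by rewrite in_itv/= leey andbT lee_fin (ball_sum_ge0 A D th).
- by rewrite in_itv/= leey andbT.
rewrite /ball_sum -sumEFin; exact: nneseries_lim_ge.
Qed.

(** Countable families reduce to their partial sums: the series is the limit of these, and the norm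
    of a partial sum is at most that of the whole by the lattice property. *)
Lemma star_norm_le (Psi : R) : 0 <= Psi -> (forall m (c : nat -> R) (p : nat -> T), (forall k, 0 <= c k) ->
  (\sum_(k <- index_iota 0 m) (c k)%:E * ((b ^ (p k).2)%:E * I (p k)) <= (Psi * ball_norm m c p)%:E)%E) ->
  (star_norm A D nX d th eps lm f <= Psi%:E)%E.
Proof.
move=> Psi0 H; rewrite star_normE; apply: ge_ereal_sup => v [xc [l [lam [l0 _ X0 Xfin ->]]]].
set X := inf_Xnorm _ _ _ _ in X0 Xfin *.
have XE : X = (fine X)%:E by rewrite fineK// ge0_fin_numE// ltW.
have x0 : 0 < fine X by rewrite fine_gt0// X0.
set S := (\sum_(_ <= _ <oo) _)%E.
suff HS : (S <= (Psi * fine X)%:E)%E.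
  have := lee_wpmul2l (_ : 0 <= ((fine X)^-1)%:E)%E HS.
  rewrite -EFinM mulrCA mulVf ?gt_eqF// mulr1; apply.
  by rewrite lee_fin invr_ge0 ltW.
apply: lime_le; first by apply: is_cvg_nneseries => k _ _; exact: summand_ge0.
apply: nearW => m; have c0 k : 0 <= lam k / nind nX (pball (xc k, l k)) by rewrite divr_ge0// ltW.
apply: le_trans (H m _ (fun k => (xc k, l k)) c0) _.
rewrite lee_fin ler_wpM2l// -lee_fin -XE -(Xnorm_ball_sum hA hD hX hth hAA).
exact: ball_norm_le_inf.
Qed.

(** Padding with zeros makes a finite family countable without changing the sum or the norm; the
    nonzero coefficient makes that norm positive, as admissibility requires. *)
Lemma star_norm_elem m (c : nat -> R) (p : nat -> T) k0 : (forall k, 0 <= c k) -> (k0 < m)%N ->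
  c k0 != 0 ->
  (((ball_norm m c p)^-1)%:E * \sum_(k <- index_iota 0 m) ((c k)%:E * ((b ^ (p k).2)%:E * I (p k))) <=
   star_norm A D nX d th eps lm f)%E.
Proof.
move=> c0 k0m ck; rewrite star_normE; apply: ereal_sup_ubound => /=.
pose lam k := if (k < m)%N then c k * nind nX (pball (p k)) else 0.
have lam0 k : 0 <= lam k by rewrite /lam; case: ifP => // _; rewrite mulr_ge0// ltW.
have lamE k : (k < m)%N -> lam k / nind nX (dball A D (p k).1 (p k).2) = c k.
  by move=> km; rewrite /lam km mulfK// gt_eqF//; exact: nd.
have lamz k : (m <= k)%N -> lam k = 0 by move=> mk; rewrite /lam ltnNge mk.
have XE : inf_Xnorm nX th (fun j => dball A D (p j).1 (p j).2) lam = (ball_norm m c p)%:E.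
  rewrite -(Xnorm_ball_sum hA hD hX hth hAA) /inf_Xnorm /Xnorm; congr nX; apply/funext => x.
  rewrite (@nneseries_finite _ _ m) ?sumEFin ?poweR_EFin.
  - congr (_ `^ _)%:E; apply: eq_big_nat => k /andP[_ km]; by rewrite lamE.
  - by move=> k; rewrite lee_fin mulr_ge0 ?powR_ge0// indicE ler0n.
  - by move=> k mk; rewrite lamz// mul0r powR0 ?mul0r// gt_eqF.
exists (fst \o p), (snd \o p), lam; split => //.
- rewrite (@nneseries_finite _ _ m) ?sumEFin; first last.
  + by move=> k mk; rewrite lamz.
  + by move=> k; rewrite lee_fin.
  rewrite gt_eqF// lte_fin (bigD1_seq k0) ?mem_index_iota ?iota_uniq//= ltr_pwDl ?sumr_ge0//.
  by rewrite /lam k0m mulr_gt0// lt_def ck c0.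
- by rewrite XE lte_fin; exact: (ball_norm_gt0 hA hD hDvol hr hrA hX hth hAA p c0 k0m ck).
- by rewrite XE ltry.
rewrite XE; congr (_ * _)%E; rewrite (@nneseries_finite _ _ m); first last.
- by move=> k mk; rewrite lamz// mul0r mul0e.
- by move=> k; exact: (summand_ge0 (fst \o p) (snd \o p)).
by apply: eq_big_nat => k /andP[_ km] /=; rewrite lamE// -surjective_pairing.
Qed.

Lemma star_norm_ge0 : (0 <= star_norm A D nX d th eps lm f)%E.
Proof.
apply: le_trans (@star_norm_elem 1%N (fun=> 1) (fun=> (0, 0)) 0%N _ _ _) => //.
apply: mule_ge0; first by rewrite lee_fin invr_ge0; exact: (ball_norm_ge0 hA hD hX hth hAA).
by apply: sume_ge0 => k _; rewrite mul1e mule_ge0// lee_fin ltW.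
Qed.

(* On the ball x0 + B_l one has rho(x - x0) < b^l, so b^l times the kernel is at least 1/2. *)
Let osc_le_I p : ((osc f0 p)%:E <= 2%:E * ((b ^ p.2)%:E * I p))%E.
Proof.
have mB := measurable_pball hA hD p.
have mF : measurable_fun setT (fun x : V => `|f0 x - PP f0 p x|).
  apply: measurableT_comp => //; apply: measurable_funB => //.
  exact: measurable_is_polyd (PP_polyd hA hD hDvol hr hrA d p lf).
have iF := integrable_diff hA hD hDvol hr hrA d p p lf.
have -> : (osc f0 p)%:E = (\int[mu]_(x in pball p) (`|f0 x - PP f0 p x|)%:E)%E.
  by rewrite /osc /Rintegral fineK//; have /(integrable_fin_num mB) := iF; exact.
have ker x : pball p x -> 1 <= 2 * b ^ p.2 * star_kernel A D be p.2 (x - p.1).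
  move=> /(dballP A D p.1 p.2 x) Bx; have rl := rho_lt hA hD hDvol hr hrA Bx.
  have e1 : b `^ (p.2%:~R * (1 + be)) = (b ^ p.2) `^ (1 + be).
    by rewrite powRrM powR_intmul.
  have e2 : b ^ p.2 * b `^ (be * p.2%:~R) = (b ^ p.2) `^ (1 + be).
    rewrite -e1 mulrDr mulr1 powRD; last by rewrite (gt_eqF b0) implybT.
    by rewrite powR_intmul// [be * _]mulrC.
  rewrite /star_kernel mulrA -[2 * _ * _]mulrA e2 e1.
  have B0 : 0 < (b ^ p.2) `^ (1 + be) by rewrite powR_gt0.
  have r0 : rho A D (x - p.1) `^ (1 + be) <= (b ^ p.2) `^ (1 + be).
    apply: ge0_ler_powR => //; rewrite ?nnegrE ?(ltW (bl _)) ?(ltW rl)//.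
    exact: (rho_ge0 hA hD hr hrA).
  rewrite ler_pdivlMr ?mul1r; last by rewrite ltr_pwDl// powR_ge0.
  by rewrite mulr_natl mulr2n lerD2l.
have c0 : 0 <= 2 * b ^ p.2 by rewrite mulr_ge0// ltW.
rewrite muleA -EFinM.
have -> : ((2 * b ^ p.2)%:E * I p = \int[mu]_x ((2 * b ^ p.2)%:E *
    (star_kernel A D be p.2 (x - p.1) * `|f0 x - PP f0 p x|)%:E))%E.
  rewrite ge0_integralZl_EFin// => x _.
  by rewrite lee_fin mulr_ge0// star_kernel_ge0.
apply: (@le_trans _ _ (\int[mu]_(x in pball p) ((2 * b ^ p.2)%:E *
    (star_kernel A D be p.2 (x - p.1) * `|f0 x - PP f0 p x|)%:E))%E).
  apply: ge0_le_integral => //.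
  - by apply: measurable_funTS; exact/measurable_EFinP.
  - by apply: measurable_funTS; exact: emeasurable_funM.
  - move=> x Bx; rewrite -EFinM lee_fin mulrA ler_peMl//; exact: ker.
apply: ge0_subset_integral => //.
- exact: emeasurable_funM.
- by move=> x _; rewrite -EFinM lee_fin; apply: mulr_ge0 => //; rewrite mulr_ge0// star_kernel_ge0.
Qed.

Lemma star_norm_camp_le : (star_norm A D nX d th eps lm f < +oo)%E ->
  camp_le f0 (2 * fine (star_norm A D nX d th eps lm f)).
Proof.
move=> fin; set Q := star_norm _ _ _ _ _ _ _ _ in fin *.
have Q0' : (0 <= Q)%E by exact: star_norm_ge0.
have QE : Q = (fine Q)%:E by rewrite fineK// ge0_fin_numE.
have Q0 : 0 <= fine Q by exact: fine_ge0.
apply: (camp_le_nat hA hD hX hth hAA) => m c p c0.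
have np0 := ball_norm_ge0 hA hD hX hth hAA m c p.
have [/existsP[k0 ck]|/existsPn z] := boolP [exists k : 'I_m, c k != 0]; last first.
  rewrite big_mkord big1; first by rewrite !mulr_ge0.
  by move=> k _; have /negPn/eqP -> := z k; rewrite mul0r.
have np : 0 < ball_norm m c p by exact: (ball_norm_gt0 hA hD hDvol hr hrA hX hth hAA p c0 (ltn_ord k0) ck).
have := star_norm_elem p c0 (ltn_ord k0) ck; rewrite -/Q QE => H.
have {}H : ((\sum_(k <- index_iota 0 m) c k * osc f0 (p k))%:E <=
    2%:E * \sum_(k <- index_iota 0 m) ((c k)%:E * ((b ^ (p k).2)%:E * I (p k))))%E /\
   (\sum_(k <- index_iota 0 m) ((c k)%:E * ((b ^ (p k).2)%:E * I (p k))) <= (fine Q * ball_norm m c p)%:E)%E.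
  split.
    rewrite -sumEFin ge0_sume_distrr; last first.
      by move=> k _; rewrite mule_ge0 ?lee_fin// mule_ge0// lee_fin ltW.
    apply: lee_sum => k _; rewrite EFinM muleCA; apply: lee_wpmul2l; [by rewrite lee_fin|exact: osc_le_I].
  rewrite mulrC EFinM; have : ((ball_norm m c p)%:E * ((ball_norm m c p)^-1%:E *
    \sum_(k <- index_iota 0 m) ((c k)%:E * ((b ^ (p k).2)%:E * I (p k)))) <= (ball_norm m c p)%:E * (fine Q)%:E)%E.
    by apply: lee_wpmul2l H; rewrite lee_fin.
  by rewrite muleA -[X in (X * _ <= _)%E -> _]EFinM mulfV ?gt_eqF// mul1e.
rewrite -lee_fin; apply: le_trans H.1 _; rewrite -mulrA EFinM; apply: lee_wpmul2l H.2; by rewrite lee_fin.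
Qed.

End StarForm.

(** Divided by ln b / ln lm, the hypothesis reads 2/s + d ln lp / ln b < be. Each conclusion keeps
    one of the two summands; the second also uses s < th. *)
Lemma star_exponent (R : realType) (b lm lp eps th s : R) (d : nat) : 1 < b -> 1 < lm -> 1 < lp ->
  0 < s -> s < th -> ln b / ln lm * (2 / s + d%:R * ln lp / ln b) < eps ->
  lp ^+ d < b `^ (eps * ln lm / ln b) /\ 2 < th * (1 + eps * ln lm / ln b).
Proof.
move=> b1 lm1 lp1 s0 sth heps; set be := eps * ln lm / ln b.
have lb : 0 < ln b by rewrite ln_gt0.
have lL : 0 < ln lm by rewrite ln_gt0.
have lP : 0 < ln lp by rewrite ln_gt0.
have hbe : 2 / s + d%:R * ln lp / ln b < be.
  rewrite /be ltr_pdivlMr// -ltr_pdivrMr//.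
  by rewrite (_ : _ / ln lm = ln b / ln lm * (2 / s + d%:R * ln lp / ln b))//; ring.
have s2 : 0 < 2 / s by rewrite divr_gt0.
have d0 : 0 <= d%:R * ln lp / ln b by rewrite divr_ge0 ?mulr_ge0// ltW.
split.
  rewrite -powR_mulrn ?(ltW (lt_trans ltr01 lp1))// /powR !gt_eqF ?(lt_trans ltr01)//.
  rewrite ltr_expR -ltr_pdivrMr//; apply: le_lt_trans hbe; by rewrite lerDr ltW.
have : 2 / s < be by apply: le_lt_trans hbe; rewrite lerDl.
rewrite ltr_pdivrMr// => h; apply: lt_trans h _; rewrite mulrC.
apply: (@lt_trans _ _ (th * be)); first by rewrite ltr_pM2r// (lt_trans s2)//; apply: le_lt_trans hbe; rewrite lerDl.
by rewrite ltr_pM2l ?ltrDr// (lt_trans s0).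
Qed.

(** q < p_0' is the same as p_0 < q' when p_0 > 1, and q' > 1 settles the remaining cases. *)
Lemma lt_conj (R : realType) (pz q : R) : 1 < q -> pz < 1 \/ pz = 1 \/ 1 < pz /\ q < conjR pz ->
  pz < q / (q - 1).
Proof.
move=> q1; have q1' : 0 < q - 1 by rewrite subr_gt0.
have : 1 < q / (q - 1) by rewrite ltr_pdivlMr// mul1r ltrBlDr ltrDl.
move=> h [p1|[->//|[p1]]]; first exact: lt_trans h.
rewrite /conjR ltr_pdivlMr ?subr_gt0// ltr_pdivlMr//; lra.
Qed.

(** * Equivalence of the two functionals *)

Section Assembly.
Context {R : realType} {n : nat} (A : 'M[R]_n.+1) (D : set 'cV[R]_n.+1) (r : R).
Hypotheses (hA : dilation A) (hD : ellipsoid0 D) (hDvol : Rvol D = 1%E) (hr : 1 < r)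
  (hrA : [set r *: x | x in D] `<=` [set A *m x | x in D]).
Variables (lm lp : R) (hlam : eig_bounds A lm lp) (d : nat).

Local Notation V := (cvM R n.+1).
Local Notation mu := (@vol R n.+1).
Local Notation b := `|\det A|.
Local Notation T := ('cV[R]_n.+1 * int)%type.

Variables (nX : (V -> \bar R) -> \bar R) (pm th pz q eps : R).
Hypotheses (hX : ball_QBFS A D nX) (hFS : assumption_FS A D nX pm)
  (hth : 0 < th) (hthm : th < pm) (hthp : th < pz)
  (hAA : assumption_A A D nX th pz) (hq : 1 <= q)
  (hqp : pz < 1 \/ pz = 1 \/ 1 < pz /\ q < conjR pz).

Let b0 : 0 < b. Proof. exact: lt_trans ltr01 (det_gt1 hA hD hDvol hr hrA). Qed.

Lemma aq1E f p : b ^ p.2 * aq A D d 1 f p = osc A D d f p.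
Proof.
have bp : 0 < b ^ p.2 by rewrite exprz_gt0.
rewrite /aq invr1 (_ : \int[mu]_(x in _) _ = osc A D d f p); last first.
  by congr fine; apply: eq_integral => x _; rewrite powRr1.
rewrite powRr1 ?mulr_ge0 ?invr_ge0 ?osc_ge0 ?(ltW bp)//.
by rewrite mulrA mulfV ?gt_eqF// mul1r.
Qed.

Lemma aq_bound_ge1 : exists2 C : R, 0 < C & forall f (Phi : R), locintq A D d q f -> 0 <= Phi ->
  camp_le A D d nX th f Phi -> forall m (c : nat -> R) (p : nat -> T), (forall k, 0 <= c k) ->
  \sum_(k <- index_iota 0 m) c k * (b ^ (p k).2 * aq A D d q f (p k)) <=
   C * Phi * ball_norm A D nX th m c p.
Proof.
(* For q = 1 the volume times [aq] is the oscillation itself, so the claim is (1). *)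
have [q1|q1] := eqVneq q 1.
  exists 1 => // f Phi lf Phi0 H m c p c0; rewrite mul1r.
  rewrite -lee_fin EFinM -(Xnorm_ball_sum hA hD hX hth hAA).
  rewrite q1 (eq_bigr (fun k => c k * osc A D d f (p k))); last by move=> k _; rewrite aq1E.
  exact: H.
have {}q1 : 1 < q by rewrite lt_neqAle eq_sym q1.
have [C C0 HC] := aq_bound hA hD hDvol hr hrA hlam d hX hFS hth hthm hthp hAA q1 (lt_conj q1 hqp).
exists C => // f Phi lf Phi0 H m c p c0.
rewrite -lee_fin EFinM -(Xnorm_ball_sum hA hD hX hth hAA).
exact: HC.
Qed.

Lemma norm_equivalence : lp ^+ d < b `^ (eps * ln lm / ln b) ->
  2 < th * (1 + eps * ln lm / ln b) -> exists C : R, 0 < C /\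
  forall f : 'cV[R]_n.+1 -> R, Lloc q f ->
    ((campanato A D nX q d th f < +oo)%E <-> (star_norm A D nX d th eps lm f < +oo)%E) /\
    (campanato A D nX q d th f <= C%:E * star_norm A D nX d th eps lm f)%E /\
    (star_norm A D nX d th eps lm f <= C%:E * campanato A D nX q d th f)%E.
Proof.
move=> hbe1 hbe2.
have hbe0 : 0 <= 1 + eps * ln lm / ln b.
  by rewrite -(pmulr_rge0 _ hth) ltW// (lt_trans _ hbe2).
have [C1 C10 HC1] := aq_bound_ge1.
have [C2 C20 HC2] := star_bound hA hD hDvol hr hrA hlam hX hFS hth hthm hbe1 hbe2.
have C0 : 0 < C1 * 2 + C2 * 2 by rewrite addr_gt0// mulr_gt0.
exists (C1 * 2 + C2 * 2); split => // f [[g [bg [N [[mN N0] HN]]]] hfq].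
(* The Borel representative is extended-real valued; since f is finite, [fine] does not alter it off
   the null set. *)
pose f0 (x : V) := fine (g x).
have mf0 : measurable_fun setT f0.
  apply: (@measurableT_comp _ _ _ _ _ _ fine) => //; exact: borel_fun_measurable.
have {}N0 : mu N = 0%E by rewrite -RvolE.
have ff0 x : ~ N x -> f x = f0 x by move=> /HN fg; rewrite /f0 -fg.
have lfq : locintq A D d q f0 := locintq_Borel hA hD hDvol hr hrA d mN N0 mf0 ff0 hq hfq.
have lf : locint A D f0 := lfq.1.
set P := campanato A D nX q d th f; set S := star_norm A D nX d th eps lm f.
have P0 : (0 <= P)%E by exact: (campanato_ge0 hA hD hDvol hr hrA d hX hth hAA mN N0 mf0 ff0 hq hfq).
have S0 : (0 <= S)%E by exact: (star_norm_ge0 hA hD hDvol hr hrA lm d hX hth hAA mN N0 ff0 lf).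
have PS : (S < +oo)%E -> (P <= (C1 * 2)%:E * S)%E.
  move=> Sfin; have SE : S = (fine S)%:E by rewrite fineK// ge0_fin_numE.
  have camp := star_norm_camp_le hA hD hDvol hr hrA hX hth hAA mN N0 ff0 lf hbe0 Sfin.
  have S2 : 0 <= 2 * fine S by rewrite mulr_ge0// fine_ge0.
  rewrite SE -EFinM -mulrA; apply: (campanato_le hA hD hDvol hr hrA hX hth hAA mN N0 mf0 ff0 hq hfq).
    by rewrite mulr_ge0// ltW.
  exact: HC1.
have SP : (P < +oo)%E -> (S <= (C2 * 2)%:E * P)%E.
  move=> Pfin; have PE : P = (fine P)%:E by rewrite fineK// ge0_fin_numE.
  have camp := campanato_camp_le hA hD hDvol hr hrA hX hth hAA mN N0 mf0 ff0 hq hfq Pfin.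
  have P2 : 0 <= 2 * fine P by rewrite mulr_ge0// fine_ge0.
  rewrite PE -EFinM -mulrA; apply: (star_norm_le hA hD hDvol hr hrA hX hth hAA mN N0 ff0 lf).
    by rewrite mulr_ge0// ltW.
  move=> m c p c0; rewrite EFinM -(Xnorm_ball_sum hA hD hX hth hAA).
  exact: (HC2 f0 _ lf P2 camp _ _ c p c0).
(* When the right-hand functional is infinite, so is its positive multiple, and only the finite case
   has content. *)
have le_scale (x y : \bar R) (c : R) : 0 < c -> c <= C1 * 2 + C2 * 2 -> (0 <= y)%E ->
    ((y < +oo)%E -> (x <= c%:E * y)%E) -> (x <= (C1 * 2 + C2 * 2)%:E * y)%E.
  move=> c0 cC y0 H; have [yfin|] := boolP (y < +oo)%E.
    by apply: le_trans (H yfin) _; apply: lee_wpmul2r => //; rewrite lee_fin.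
  by rewrite -leNgt leye_eq => /eqP ->; rewrite gt0_muley ?lte_fin// leey.
split; last by split; [apply: le_scale PS|apply: le_scale SP] => //;
  rewrite ?mulr_gt0// ?lerDl ?lerDr mulr_ge0// ltW.
split=> [Pfin|Sfin].
  by apply: le_lt_trans (SP Pfin) _; apply: lte_mul_pinfty => //; rewrite lee_fin mulr_ge0// ltW.
by apply: le_lt_trans (PS Sfin) _; apply: lte_mul_pinfty => //; rewrite lee_fin mulr_ge0// ltW.
Qed.

End Assembly.

Unset Implicit Arguments.
Set Strict Implicit.
Set Printing Implicit Defensive.

Theorem theorem4p3 (R : realType) (n : nat) (hn : (0 < n)%N)
  (A : 'M[R]_n) (hA : dilation A)
  (lm lp : R) (hlam : eig_bounds A lm lp)
  (D : set 'cV[R]_n) (hD : ellipsoid0 D) (hDvol : Rvol D = 1%E)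
  (r : R) (hr : 1 < r)
  (hDr : D `<=` [set r *: x | x in D]) (hrA : [set r *: x | x in D] `<=` [set A *m x | x in D])
  (nX : ('cV[R]_n -> \bar R) -> \bar R) (hX : ball_QBFS A D nX) (hac : abs_cont nX)
  (pm : R) (hpm : 0 < pm) (hFS : assumption_FS A D nX pm)
  (th p0 : R) (hth : 0 < th) (hth1 : th < Num.min pm 1) (hp0 : th < p0)
  (hAA : assumption_A A D nX th p0)
  (d : nat)
  (hd : Num.floor ((th^-1 - 1) * ln `|\det A| / ln lm) <= d%:Z)
  (q : R) (hq : 1 <= q /\
     (p0 < 1 \/ (p0 = 1) \/ (1 < p0 /\ q < conjR p0)))
  (eps : R)
  (heps : exists s : R, 0 < s /\ s < th /\
     ln `|\det A| / ln lm * (2 / s + d%:R * ln lp / ln `|\det A|) < eps) :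
  exists C : R, 0 < C /\
  forall f : 'cV[R]_n -> R, Lloc q f ->
    ((campanato A D nX q d th f < +oo)%E <-> (star_norm A D nX d th eps lm f < +oo)%E) /\
    (campanato A D nX q d th f <= C%:E * star_norm A D nX d th eps lm f)%E /\
    (star_norm A D nX d th eps lm f <= C%:E * campanato A D nX q d th f)%E.
Proof.
(* Positive dimension is put in successor form, in which square matrices form a nontrivial ring. *)
case: n hn A hA lm lp hlam D hD hDvol r hr hDr hrA nX hX hac hpm hFS hth hth1 hp0 hAA hd hq heps => // n' _.
move=> A hA lm lp hlam D hD hDvol r hr _ hrA nX hX _ hpm hFS hth hth1 hp0 hAA _ [hq hqp] [s [s0 [sth heps]]].
have b1 := det_gt1 hA hD hDvol hr hrA.
have [hbe1 hbe2] := star_exponent b1 hlam.1 (eig_bounds_gt1 hlam) s0 sth heps.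
apply: (norm_equivalence hA hD hDvol hr hrA hlam hX hFS hth _ hp0 hAA hq hqp hbe1 hbe2).
by move: hth1; rewrite lt_min => /andP[].
Qed.
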